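(* Let $\xi$ be a $k$-differential ($k\ge1$) and let $z_0$ be a singularity of $\xi$ of order $a_0>-k$. Let $(\alpha_1,\dots,\alpha_t)$ be nonzero integers with $\alpha_i>-k$ and $a_0=\sum_i\alpha_i$. It is not possible to split $z_0$ locally into $t$ singularities of orders $(\alpha_1,\dots,\alpha_t)$ if and only if $k\ge2$, $t=2$, $k\mid a_0$ and $k\nmid\gcd(\alpha_1,\alpha_2)$.
   Context: A $k$-differential on a Riemann surface $X$ is a nonzero meromorphic section $\xi$ of $K_X^{\otimes k}$; it defines a flat metric for which a singularity of order $a>-k$ is a conical point of angle $(a+k)\frac{2\pi}{k}$. The singularity $z_0$ can be split locally into singularities of orders $(\alpha_1,\dots,\alpha_t)$ if $\xi$ can be modified only inside arbitrarily small neighbourhoods of $z_0$ so as to replace $z_0$ by $t$ singularities of these orders: for every neighbourhood $V$ of $z_0$ there are a closed disc $D\subset V$ containing $z_0$ and no other singularity of $\xi$, and a $k$-differential $\xi'$ on a Riemann surface $X'$, together with a closed disc $D'\subset X'$, such that $(X'\setminus D',\xi')$ is isomorphic to $(X\setminus D,\xi)$ (compatibly with the boundaries) and the singularities of $\xi'$ in $D'$ are exactly $t$ points, of orders $\alpha_1,\dots,\alpha_t$. *)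

(* Defs.v *)
From HB Require Import structures.
From mathcomp Require Import all_boot all_order all_algebra.
From mathcomp Require Import all_classical all_reals all_analysis.
From mathcomp Require Import complex.

Set Implicit Arguments.
Unset Strict Implicit.
Unset Printing Implicit Defensive.

Import Order.TTheory GRing.Theory Num.Theory.
Import numFieldNormedType.Exports.

Local Open Scope classical_set_scope.
Local Open Scope ring_scope.

(* The complex numbers, with the topology and the complex differentiability
   that MathComp-Analysis attaches to a numFieldType. *)
Definition Cplx (R : realType) : numClosedFieldType := R[i].

Definition holomorphic_at (R : realType) (f : Cplx R -> Cplx R) (z : Cplx R) :
    Prop :=
  \forall w \near z, derivable f w 1.

(* A meromorphic function is represented by a total function whose values at
   the points of a discrete set are irrelevant; hence the deleted
   neighbourhoods z^' here and below. *)
Definition meromorphic_at (R : realType) (f : Cplx R -> Cplx R) (z : Cplx R) :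
    Prop :=
  exists (n : nat) (g : Cplx R -> Cplx R),
    holomorphic_at g z /\ \forall w \near z^', (w - z) ^+ n * f w = g w.

Definition order_at (R : realType) (f : Cplx R -> Cplx R) (z : Cplx R)
    (n : int) : Prop :=
  exists g : Cplx R -> Cplx R,
    [/\ holomorphic_at g z, g z != 0
      & \forall w \near z^', f w = (w - z) ^ n * g w].

(* Connected Hausdorff space with a holomorphic atlas.  The chart of index i
   is the homeomorphism rs_chart i from the open set rs_dom i onto an open
   subset of the plane, with inverse rs_inv i; the values of these total
   functions elsewhere are irrelevant. *)
Record riemannSurface (R : realType) := RiemannSurface {
  rs_space :> topologicalType;
  rs_index : Type;
  rs_dom : rs_index -> set rs_space;
  rs_chart : rs_index -> rs_space -> Cplx R;
  rs_inv : rs_index -> Cplx R -> rs_space;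
  rs_hausdorff : hausdorff_space rs_space;
  rs_connected : connected [set: rs_space];
  rs_cover : forall p, exists i, rs_dom i p;
  rs_dom_open : forall i, open (rs_dom i);
  rs_im_open : forall i, open (rs_chart i @` rs_dom i);
  rs_chartK : forall i p, rs_dom i p -> rs_inv i (rs_chart i p) = p;
  rs_chart_cont : forall i, {within rs_dom i, continuous (rs_chart i)};
  rs_inv_cont : forall i,
    {within rs_chart i @` rs_dom i, continuous (rs_inv i)};
  rs_transition : forall i j p, rs_dom i p -> rs_dom j p ->
    holomorphic_at (rs_chart j \o rs_inv i) (rs_chart i p)
}.

(* In the chart of index i the section is kd_coef i (z) dz^k. *)
Record kDifferential (R : realType) (k : nat) (X : riemannSurface R) :=
    KDifferential {
  kd_coef : rs_index X -> Cplx R -> Cplx R;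
  kd_mero : forall i p, rs_dom i p ->
    meromorphic_at (kd_coef i) (rs_chart i p);
  kd_transition : forall i j p, rs_dom i p -> rs_dom j p ->
    \forall w \near (rs_chart i p)^',
      kd_coef i w =
        kd_coef j ((rs_chart j \o rs_inv i) w)
          * (derive1 (rs_chart j \o rs_inv i) w) ^+ k;
  kd_nonzero : exists i p, rs_dom i p /\
    ~ (\forall w \near (rs_chart i p)^', kd_coef i w = 0)
}.

Section Surfaces.
Context {R : realType} {k : nat}.

Definition has_order (X : riemannSurface R) (xi : kDifferential k X) (p : X)
    (n : int) : Prop :=
  forall i, rs_dom i p -> order_at (kd_coef xi i) (rs_chart i p) n.

(* The singularities are the zeros and the poles. *)
Definition singularity (X : riemannSurface R) (xi : kDifferential k X) (p : X) :
    Prop :=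
  exists n : int, n != 0 /\ has_order xi p n.

(* A continuous injection of the compact unit disc into a Hausdorff space is a
   homeomorphism onto its image. *)
Definition closed_disc (X : riemannSurface R) (D : set X) : Prop :=
  exists h : Cplx R -> X,
    [/\ {within [set z | `|z| <= 1], continuous h},
        set_inj [set z | `|z| <= 1] h
      & D = h @` [set z | `|z| <= 1]].

Definition local_expr (X X' : riemannSurface R) (F : X -> X')
    (i : rs_index X) (j : rs_index X') : Cplx R -> Cplx R :=
  rs_chart j \o F \o rs_inv i.

(* Only meant for an open set A on which F is continuous. *)
Definition holomorphic_on (X X' : riemannSurface R) (A : set X) (F : X -> X') :
    Prop :=
  forall p i j, A p -> rs_dom i p -> rs_dom j (F p) ->
    holomorphic_at (local_expr F i j) (rs_chart i p).

(* xi = F^* xi' on A *)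
Definition pullback_on (X X' : riemannSurface R) (A : set X) (F : X -> X')
    (xi : kDifferential k X) (xi' : kDifferential k X') : Prop :=
  forall p i j, A p -> rs_dom i p -> rs_dom j (F p) ->
    \forall w \near (rs_chart i p)^',
      kd_coef xi i w =
        kd_coef xi' j (local_expr F i j w) * (derive1 (local_expr F i j) w) ^+ k.

(* An isomorphism from (X \ D, xi) to (X' \ D', xi') which extends to a
   homeomorphism from X minus the interior of D to X' minus the interior of D',
   and so maps the boundary of D onto the boundary of D'. *)
Definition isomorphic_outside (X X' : riemannSurface R)
    (D : set X) (D' : set X')
    (xi : kDifferential k X) (xi' : kDifferential k X') : Prop :=
  exists (F : X -> X') (G : X' -> X),
    [/\ [/\ {within ~` D°, continuous F}, {within ~` D'°, continuous G},
            forall p, (~` D°) p -> (~` D'°) (F p) /\ G (F p) = p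
          & forall q, (~` D'°) q -> (~` D°) (G q) /\ F (G q) = q],
        F @` (~` D) = ~` D',
        holomorphic_on (~` D) F, holomorphic_on (~` D') G
      & pullback_on (~` D) F xi xi'].

Definition splits_locally (X : riemannSurface R) (xi : kDifferential k X)
    (z0 : X) (t : nat) (alpha : t.-tuple int) : Prop :=
  forall V : set X, nbhs z0 V ->
  exists D : set X,
    [/\ closed_disc D, D `<=` V, D z0,
        forall p, D p -> singularity xi p -> p = z0
      & exists (X' : riemannSurface R) (xi' : kDifferential k X')
               (D' : set X'),
          [/\ closed_disc D', isomorphic_outside D D' xi xi'
            & exists z : 'I_t -> X',
                [/\ injective z,
                    forall i, D' (z i) /\ has_order xi' (z i) (tnth alpha i)
                  & forall q, D' q -> singularity xi' q ->
                      exists i, q = z i]]].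

End Surfaces.

(* Main.v *)
(* Near z0 write xi = w^a0 dw^k; replacing z0 by singularities of orders alpha_i amounts to replacing a disc by one
   that carries prod (z - y_i)^alpha_i dz^k, glued along the collar by a holomorphic map.

   Existence.  Such a gluing map w(z) ~ z with w^a0 (w')^k = prod (z - y_i)^alpha_i near infinity is obtained by taking
   k-th roots and integrating termwise in u = 1/z.  The only obstruction is a logarithm: when m = a0/k + 1 is an
   integer, the coefficient of u^m in prod (1 - y_i u)^(alpha_i/k) must vanish.  If k divides every alpha_i this product is
   a polynomial of degree a0/k < m; otherwise, with at least three singularities, nodes y_i making it vanish exist because
   the coefficient is a nonconstant polynomial in each of several y_i.

   Obstruction.  Suppose that k divides a0 but not alpha_1, with t = 2, and glue the disc D' into the plane.  The k-th
   root of xi' integrates to flat coordinates f on D' minus two points, defined up to w |-> zeta w + c, which on the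
   boundary are affine in w^m.  The monodromies around the two points are inverse to each other with zeta <> 1, hence
   have the same fixed point, so (f + c)^k is a single valued function h on the disc, equal to (w^m + c)^k outside.
   It has zeros of orders alpha_1 + k and alpha_2 + k, in total k (m + 1), but takes no value near infinity more than
   k m times. *)
From HB Require Import structures.
From mathcomp Require Import all_boot all_order all_algebra.
From mathcomp Require Import all_classical all_reals all_analysis.
From mathcomp Require Import complex ring lra zify separable.
Require Import Defs.

Set Implicit Arguments.
Unset Strict Implicit.
Unset Printing Implicit Defensive.

Import Order.TTheory GRing.Theory Num.Theory.
Import numFieldNormedType.Exports.

Local Open Scope classical_set_scope.
Local Open Scope ring_scope.

(** * Complex derivatives *)


(** The disc [D] of the definition is bounded by an arbitrary Jordan curve, so [D'] is glued into
    the plane by a homeomorphism only ([coning]), and no complex structure survives across the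
    boundary. The obstruction is therefore proved for continuous flat coordinates, with topological
    tools: openness comes from invariance of domain, which comes from winding numbers modulo 2; the
    maximum principle and the count of preimages come from openness and local injectivity. Simple
    connectedness is replaced by gluing germs over rectangles that are bisected. The ratio of radii
    that the obstruction requires depends on [k] and the orders alone, so that the neighbourhood [V]
    can be fixed before [D] is given. In the other direction no quotient space is built: the model
    map is interpolated with the identity to a homeomorphism of the whole plane, and the new surface
    is the old topological space with another chart over the disc. *)

Definition md (R : realType) (z : Cplx R) : R := ComplexField.Normc.normc z.

Section Modulus.
Context {R : realType}.
Local Notation C := (Cplx R).
Implicit Types (x y z w : C).

(** The norm of [C] takes its values in [C], whose order is partial; [md] takes them in [R], where
    [lra] and [nra] decide the estimates. *)
Lemma norm_md z : `|z| = (md z)%:C%C :> C.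
Proof. by []. Qed.

Lemma md_ge0 z : 0 <= md z.
Proof. by case: z => a b; rewrite /md /= sqrtr_ge0. Qed.

Lemma md0 : md (0 : C) = 0.
Proof. exact: ComplexField.Normc.normc0. Qed.

Lemma md1 : md (1 : C) = 1.
Proof. exact: ComplexField.Normc.normc1. Qed.

Lemma mdM z w : md (z * w) = md z * md w.
Proof. exact: ComplexField.Normc.normcM. Qed.

Lemma mdV z : md z^-1 = (md z)^-1.
Proof. exact: ComplexField.Normc.normcV. Qed.

Lemma mdN z : md (- z) = md z.
Proof. by apply: complexI; rewrite -!norm_md normrN. Qed.

Lemma mdB z w : md (z - w) = md (w - z).
Proof. by rewrite -mdN opprB. Qed.

Lemma mdD z w : md (z + w) <= md z + md w.
Proof. by rewrite -lecR rmorphD /= -!norm_md ler_normD. Qed.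

Lemma md_tri z y w : md (z - w) <= md (z - y) + md (y - w).
Proof. by rewrite (_ : z - w = (z - y) + (y - w)) ?mdD//; ring. Qed.

Lemma md_lt_ball (a w : Cplx R) r : md (w - a) < r - md a -> md w < r.
Proof. by have := md_tri w a 0; rewrite !subr0; lra. Qed.

Lemma md_subD z w : md (z - w) <= md z + md w.
Proof. by rewrite -(mdN w) mdD. Qed.

Lemma md_sub z w : md z - md w <= md (z - w).
Proof. by have := mdD (z - w) w; rewrite subrK; lra. Qed.

Lemma md_subr z w : md z - md w <= md (z + w).
Proof. by have := md_sub z (- w); rewrite opprK mdN. Qed.

Lemma md_eq0 z : (md z == 0) = (z == 0).
Proof.
apply/eqP/eqP => [|->]; last exact: md0.
exact: ComplexField.Normc.eq0_normc.
Qed.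

Lemma md_gt0 z : (0 < md z) = (z != 0).
Proof. by rewrite lt_neqAle md_ge0 andbT eq_sym md_eq0. Qed.

Lemma mdX z n : md (z ^+ n) = md z ^+ n.
Proof. by elim: n => [|n ih]; rewrite ?expr0 ?md1// !exprS mdM ih. Qed.

Lemma md_real (a : R) : md (a%:C%C : C) = `|a|.
Proof. by rewrite /md /= expr0n addr0 sqrtr_sqr. Qed.

Lemma md_nat n : md (n%:R : C) = n%:R.
Proof. by rewrite -(rmorph_nat (real_complex R)) md_real normr_nat. Qed.

Lemma md_Re z : `|complex.Re z| <= md z.
Proof.
case: z => a b; rewrite /md /= -sqrtr_sqr; apply: ler_wsqrtr.
by rewrite lerDl sqr_ge0.
Qed.

Lemma md_Im z : `|complex.Im z| <= md z.
Proof.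
case: z => a b; rewrite /md /= -sqrtr_sqr; apply: ler_wsqrtr.
by rewrite lerDr sqr_ge0.
Qed.

Lemma md_ReIm (a b : R) : md ((a +i* b)%C : C) <= `|a| + `|b|.
Proof.
rewrite /md /= -[leRHS]ger0_norm ?addr_ge0// -sqrtr_sqr; apply: ler_wsqrtr.
rewrite sqrrD -!normrX (ger0_norm (sqr_ge0 a)) (ger0_norm (sqr_ge0 b)).
by rewrite -addrA lerD2l lerDr mulrn_wge0// mulr_ge0.
Qed.

Lemma md_small_eq0 z : (forall e : R, 0 < e -> md z <= e) -> z = 0.
Proof.
move=> h; apply/eqP; rewrite -md_eq0 eq_le md_ge0 andbT leNgt; apply/negP => p.
by have := h (md z / 2) ltac:(lra); lra.
Qed.

Lemma md_sum I (r : seq I) (P : pred I) (F : I -> C) :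
  md (\sum_(i <- r | P i) F i) <= \sum_(i <- r | P i) md (F i).
Proof.
elim/big_ind2 : _ => //; first by rewrite md0.
by move=> x1 x2 y1 y2 h1 h2; apply: le_trans (mdD _ _) _; rewrite lerD.
Qed.

Lemma ball_md z (e : R) w : ball z (e%:C%C : C) w <-> md (w - z) < e.
Proof. by rewrite -ball_normE /= norm_md mdB ltcR. Qed.

Lemma near_md z (P : C -> Prop) :
  (\forall w \near z, P w) <->
  exists2 e : R, 0 < e & forall w, md (w - z) < e -> P w.
Proof.
split=> [/nbhs_ballP[e /= e0 h]|[e e0 h]].
  have /complex_realP[r er] : e \is Num.real by rewrite realE (ltW e0).
  exists r; first by move: e0; rewrite er ltcR.
  by move=> w hw; apply: h; rewrite er; apply/ball_md.
by apply/nbhs_ballP; exists (e%:C%C : C); [rewrite /= ltcR|move=> w /ball_md; exact: h].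
Qed.

Lemma dnear_md z (P : C -> Prop) :
  (\forall w \near z^', P w) <->
  exists2 e : R, 0 < e & forall w, md (w - z) < e -> w != z -> P w.
Proof. exact: near_md. Qed.

(** Stated without a quotient, so that [w = z] is no exception and the estimates can be added and
    composed. *)
Definition cder (f : C -> C) z (c : C) := forall e : R, 0 < e ->
  exists2 d : R, 0 < d &
    forall w, md (w - z) < d -> md (f w - f z - c * (w - z)) <= e * md (w - z).

Lemma cder_is_derive f z c : cder f z c <-> is_derive z (1 : C) f c.
Proof.
have E : (fun h : C => h^-1 *: ((f \o shift z) (h *: 1) - f z)) @ 0^' --> c <->
    cder f z c.
  split.
    move=> /cvgrPdist_le h e e0.
    have /h/dnear_md[d d0 {}h] : 0 < e%:C%C :> C by rewrite ltcR.
    exists d => // w hw; have [->|wz] := eqVneq w z.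
      by rewrite !subrr mulr0 subr0 md0 mulr0.
    have := h (w - z); rewrite subr0 => /(_ hw); rewrite subr_eq0 => /(_ wz).
    rewrite norm_md lecR /= /shift scaler1 subrK => h1.
    have -> : f w - f z - c * (w - z) = - ((c - (w - z)^-1 *: (f w - f z)) * (w - z)).
      by rewrite mulrBl /GRing.scale /=; field; rewrite subr_eq0.
    by rewrite mdN mdM ler_wpM2r// md_ge0.
  move=> h; apply/cvgrPdist_le => e e0.
  have /complex_realP[r er] : e \is Num.real by rewrite realE (ltW e0).
  move: e0; rewrite er ltcR => /h[d d0 {}h].
  apply/dnear_md; exists d => // w; rewrite subr0 => wd w0.
  rewrite norm_md lecR /= /shift scaler1.
  have := h (w + z); rewrite addrK => /(_ wd) h1.
  have -> : c - w^-1 *: (f (w + z) - f z) = - (f (w + z) - f z - c * w) * w^-1.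
    by rewrite /GRing.scale /=; field.
  by rewrite mdM mdN mdV ler_pdivrMr// md_gt0.
split=> [/E h|[h1 h2]].
  by apply: DeriveDef; [apply/cvg_ex; exists c|exact: cvg_lim].
by apply/E; rewrite -h2; exact: h1.
Qed.

Lemma derivable_cder f z : derivable f z (1 : C) <-> exists c, cder f z c.
Proof.
split=> [h|[c /cder_is_derive[]//]].
by exists ('D_1 f z); apply/cder_is_derive; split.
Qed.

Lemma cder_derive1 f z c : cder f z c -> derive1 f z = c.
Proof. by move=> /cder_is_derive[_ <-]; rewrite derive1E. Qed.

Lemma cder_uniq f z c d : cder f z c -> cder f z d -> c = d.
Proof. by move=> /cder_derive1 <- /cder_derive1 <-. Qed.

Definition hol (f : C -> C) z := exists2 e : R, 0 < e &
  forall w, md (w - z) < e -> exists c, cder f w c.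

Lemma holP f z : holomorphic_at f z <-> hol f z.
Proof.
rewrite /holomorphic_at; split=> [/near_md|] [e e0 h].
  by exists e => // w /h /derivable_cder.
by apply/near_md; exists e => // w /h /derivable_cder.
Qed.

Lemma cder_cst c z : cder (fun=> c) z 0.
Proof.
move=> e e0; exists 1 => // w _.
by rewrite subrr mul0r subr0 md0 mulr_ge0 ?md_ge0 ?ltW.
Qed.

Lemma cder_id z : cder id z 1.
Proof.
move=> e e0; exists 1 => // w _.
by rewrite mul1r subrr md0 mulr_ge0 ?md_ge0 ?ltW.
Qed.

Lemma cder_cont f z c : cder f z c -> forall e : R, 0 < e -> exists2 d : R, 0 < d &
  forall w, md (w - z) < d -> md (f w - f z) < e.
Proof.
move=> h e e0; have [d d0 {}h] := h 1 ltr01.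
have c0 := md_ge0 c.
exists (Num.min d (e / (md c + 2))).
  by rewrite lt_min d0/= divr_gt0//; lra.
move=> w; rewrite lt_min => /andP[/h h1]; rewrite ltr_pdivlMr; last lra.
have := mdD (f w - f z - c * (w - z)) (c * (w - z)); rewrite subrK mdM.
have := md_ge0 (w - z); nra.
Qed.

Lemma cder_eq f g z c : (exists2 e : R, 0 < e & forall w, md (w - z) < e -> f w = g w) ->
  cder f z c -> cder g z c.
Proof.
move=> [r r0 E] h e e0; have [d d0 {}h] := h e e0.
exists (Num.min d r); first by rewrite lt_min d0.
move=> w; rewrite lt_min => /andP[/h h1 /E <-]; rewrite -E//.
by rewrite subrr md0.
Qed.

Lemma cderD f g z c d : cder f z c -> cder g z d ->
  cder (fun w => f w + g w) z (c + d).
Proof. by move=> /cder_is_derive h /cder_is_derive k; apply/cder_is_derive; exact: is_deriveD. Qed.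

Lemma cderN f z c : cder f z c -> cder (fun w => - f w) z (- c).
Proof. by move=> /cder_is_derive h; apply/cder_is_derive; exact: is_deriveN. Qed.

Lemma cderB f g z c d : cder f z c -> cder g z d ->
  cder (fun w => f w - g w) z (c - d).
Proof. by move=> h k; apply: cderD => //; exact: cderN. Qed.

Lemma cder_eqd f z c d : cder f z c -> c = d -> cder f z d.
Proof. by move=> h <-. Qed.

Lemma cderM f g z c d : cder f z c -> cder g z d ->
  cder (fun w => f w * g w) z (c * g z + f z * d).
Proof.
move=> /cder_is_derive h /cder_is_derive k; apply/cder_is_derive.
have := is_deriveM h k.
by rewrite (_ : _ + _ = c * g z + f z * d) // /GRing.scale /=; ring.
Qed.

Lemma cderZ (a : C) f z c : cder f z c -> cder (fun w => a * f w) z (a * c).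
Proof.
move=> h; have := cderM (cder_cst a z) h; by rewrite mul0r add0r.
Qed.

Lemma cderX f z c n : cder f z c ->
  cder (fun w => f w ^+ n) z (n%:R * f z ^+ n.-1 * c).
Proof.
move=> h; elim: n => [|n ih]; first by rewrite !mul0r; exact: cder_cst.
under eq_fun do rewrite exprS; apply: cder_eqd (cderM h ih) _.
case: n {ih} => [|n] /=; first by rewrite expr0; ring.
by rewrite exprS -[in n.+2%:R]natr1; ring.
Qed.

Lemma cder_comp f g z c d : cder f z c -> cder g (f z) d -> cder (g \o f) z (d * c).
Proof.
move=> hf hg e e0.
have c0 := md_ge0 c; have dd0 := md_ge0 d.
pose e1 := Num.min 1 (e / (md d + md c + 2)).
have e10 : 0 < e1 by rewrite lt_min ltr01/= divr_gt0//; lra.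
have [r1 r10 h1] := hf _ e10; have [r2 r20 h2] := hg _ e10.
have [r3 r30 h3] := cder_cont hf r20.
exists (Num.min r1 r3); first by rewrite lt_min r10.
move=> w; rewrite lt_min => /andP[/h1 A /h3/h2 B] /=.
have e1l : e1 <= 1 by rewrite ge_min lexx.
have e1r : e1 * (md d + md c + 2) <= e by rewrite -ler_pdivlMr ?ge_min ?lexx ?orbT//; lra.
have -> : g (f w) - g (f z) - d * c * (w - z) =
   (g (f w) - g (f z) - d * (f w - f z)) + d * (f w - f z - c * (w - z)) by ring.
have := mdD (g (f w) - g (f z) - d * (f w - f z)) (d * (f w - f z - c * (w - z))).
rewrite mdM => T.
have := mdD (f w - f z - c * (w - z)) (c * (w - z)); rewrite subrK mdM => U.
have w0 := md_ge0 (w - z).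
have B' : md (g (f w) - g (f z) - d * (f w - f z)) <= e1 * (md c + 1) * md (w - z).
  apply: le_trans B _; rewrite -mulrA ler_pM2l//; nra.
have A' : md d * md (f w - f z - c * (w - z)) <= md d * e1 * md (w - z).
  by rewrite -mulrA ler_wpM2l.
have V : e1 * (md d + md c + 2) * md (w - z) <= e * md (w - z) by rewrite ler_wpM2r.
nra.
Qed.

Lemma cder_inv z : z != 0 -> cder (fun w => w^-1) z (- z ^- 2).
Proof.
move=> z0 e e0; have z0' : 0 < md z by rewrite md_gt0.
exists (Num.min (md z / 2) (e * md z ^+ 3 / 2)).
  by rewrite lt_min !divr_gt0// mulr_gt0// exprn_gt0.
move=> w; rewrite lt_min => /andP[h1 h2].
have wz : md z / 2 < md w by have := md_sub z w; rewrite mdB; lra.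
have w0 : w != 0 by rewrite -md_gt0; lra.
rewrite (_ : _ - _ - _ = (w - z) * (w - z) / (w * z ^+ 2)); last by field; apply/andP.
rewrite !mdM mdV !mdM ler_pdivrMr ?mulr_gt0//; last lra.
rewrite [e * _]mulrC -mulrA ler_wpM2l ?md_ge0//.
apply: le_trans (ltW h2) _; rewrite -mulrA ler_pM2l// !exprS expr0.
have : 0 < md z * md z by rewrite mulr_gt0.
nra.
Qed.

Lemma cderV f z c : f z != 0 -> cder f z c ->
  cder (fun w => (f w)^-1) z (- c * f z ^- 2).
Proof.
move=> fz h; apply: cder_eqd (cder_comp h (cder_inv fz)) _.
by rewrite mulrC mulrN mulNr.
Qed.

End Modulus.

(** * Induction by bisection of rectangles *)

Section QuadInduction.
Context {R : realType}.

Lemma pow2_small (x d : R) : 0 < d -> exists n, x / 2 ^+ n < d.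
Proof.
move=> d0; have [x0|x0] := leP x 0.
  by exists 0%N; rewrite expr0 divr1; exact: le_lt_trans d0.
exists (Num.Def.archi_bound (x / d)); rewrite ltr_pdivrMr ?exprn_gt0// mulrC -ltr_pdivrMr//.
exact: upper_nthrootP.
Qed.

Lemma quad_ind (P : R -> R -> R -> R -> Prop) (X0 X1 Y0 Y1 : R) :
  X0 <= X1 -> Y0 <= Y1 ->
  (forall x0 x1 y0 y1, X0 <= x0 -> x0 <= x1 -> x1 <= X1 ->
     Y0 <= y0 -> y0 <= y1 -> y1 <= Y1 ->
     let x := (x0 + x1) / 2 in let y := (y0 + y1) / 2 in
     P x0 x y0 y -> P x x1 y0 y -> P x0 x y y1 -> P x x1 y y1 ->
     P x0 x1 y0 y1) ->
  (forall x y, X0 <= x <= X1 -> Y0 <= y <= Y1 -> exists2 d, 0 < d &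
     forall x0 x1 y0 y1, X0 <= x0 -> x0 <= x <= x1 -> x1 <= X1 ->
       Y0 <= y0 -> y0 <= y <= y1 -> y1 <= Y1 ->
       (x0 = X0 /\ x1 = X1 \/ x0 < x1) -> (y0 = Y0 /\ y1 = Y1 \/ y0 < y1) ->
       x1 - x0 < d -> y1 - y0 < d -> P x0 x1 y0 y1) ->
  P X0 X1 Y0 Y1.
Proof.
move=> X01 Y01 glue loc; apply: contrapT => nP.
pose T := (R * R * R * R)%type.
pose bad (q : T) := let: (x0, x1, y0, y1) := q in
  [/\ X0 <= x0 /\ x0 <= x1, x1 <= X1, Y0 <= y0 /\ y0 <= y1, y1 <= Y1 & ~ P x0 x1 y0 y1].
pose half (q q' : T) := let: (x0, x1, y0, y1) := q in let: (u0, u1, v0, v1) := q' in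
  [/\ x0 <= u0 /\ u1 <= x1, y0 <= v0 /\ v1 <= y1,
     u1 - u0 = (x1 - x0) / 2 & v1 - v0 = (y1 - y0) / 2].
have step (q : {q | bad q}) : {q' : {q | bad q} | half (sval q) (sval q')}.
  apply: cid; case: q => -[[[x0 x1] y0] y1] /= [[a1 a2] a3 [a4 a5] a6 a7].
  pose x := (x0 + x1) / 2; pose y := (y0 + y1) / 2.
  have [b1|/not_andP[b1|/not_andP[b1|/not_andP[b1|b1]]]] :=
    pselect (P x0 x y0 y /\ P x x1 y0 y /\ P x0 x y y1 /\ P x x1 y y1).
  - exfalso; apply: a7; case: b1 => b1 [b2 [b3 b4]]; exact: glue.
  - have B : bad (x0, x, y0, y) by rewrite /x /y in b1 *; repeat split => //; lra.
    by exists (exist _ _ B); rewrite /= /x /y; repeat split; lra.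
  - have B : bad (x, x1, y0, y) by rewrite /x /y in b1 *; repeat split => //; lra.
    by exists (exist _ _ B); rewrite /= /x /y; repeat split; lra.
  - have B : bad (x0, x, y, y1) by rewrite /x /y in b1 *; repeat split => //; lra.
    by exists (exist _ _ B); rewrite /= /x /y; repeat split; lra.
  - have B : bad (x, x1, y, y1) by rewrite /x /y in b1 *; repeat split => //; lra.
    by exists (exist _ _ B); rewrite /= /x /y; repeat split; lra.
have B0 : bad (X0, X1, Y0, Y1) by repeat split.
have [f [f0 fS]] := dependent_choice step (exist _ _ B0).
pose x0 n := (sval (f n)).1.1.1; pose x1 n := (sval (f n)).1.1.2.
pose y0 n := (sval (f n)).1.2; pose y1 n := (sval (f n)).2.
have fE n : sval (f n) = (x0 n, x1 n, y0 n, y1 n).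
  by rewrite /x0 /x1 /y0 /y1; case: (sval (f n)) => -[[]].
have fB n : bad (x0 n, x1 n, y0 n, y1 n) by rewrite -fE; exact: svalP.
have fH n : half (x0 n, x1 n, y0 n, y1 n) (x0 n.+1, x1 n.+1, y0 n.+1, y1 n.+1).
  by rewrite -!fE; exact: fS.
have dimx n : x1 n - x0 n = (X1 - X0) / 2 ^+ n.
  elim: n => [|n ih]; first by rewrite expr0 divr1 /x1 /x0 f0.
  by have [_ _ -> _] := fH n; rewrite ih exprS; field; rewrite expf_neq0.
have dimy n : y1 n - y0 n = (Y1 - Y0) / 2 ^+ n.
  elim: n => [|n ih]; first by rewrite expr0 divr1 /y1 /y0 f0.
  by have [_ _ _ ->] := fH n; rewrite ih exprS; field; rewrite expf_neq0.
have mono m n : (m <= n)%N -> [/\ x0 m <= x0 n, x1 n <= x1 m, y0 m <= y0 n & y1 n <= y1 m].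
  move=> /subnK <-; elim: (n - m)%N => [|j ih]; first by split.
  rewrite addSn; have [[a1 a2] [a3 a4] _ _] := fH (j + m)%N.
  by case: ih => *; split; [apply: le_trans a1|apply: le_trans a2 _|apply: le_trans a3|apply: le_trans a4 _].
have ub m n : x0 m <= x1 n /\ y0 m <= y1 n.
  have [a1 a2 a3 a4] := mono _ _ (leq_maxl m n).
  have [b1 b2 b3 b4] := mono _ _ (leq_maxr m n).
  have [[_ c1] _ [_ c2] _ _] := fB (maxn m n).
  by split; [exact: le_trans a1 (le_trans c1 b2)|exact: le_trans a3 (le_trans c2 b4)].
pose x := sup (range x0); pose y := sup (range y0).
have hx n : x0 n <= x <= x1 n.
  apply/andP; split.
    by apply: ub_le_sup; [exists (x1 n) => _ [m _ <-]; have [] := ub m n|exists n].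
  by apply: ge_sup; [exists (x0 0%N), 0%N|move=> _ [m _ <-]; have [] := ub m n].
have hy n : y0 n <= y <= y1 n.
  apply/andP; split.
    by apply: ub_le_sup; [exists (y1 n) => _ [m _ <-]; have [] := ub m n|exists n].
  by apply: ge_sup; [exists (y0 0%N), 0%N|move=> _ [m _ <-]; have [] := ub m n].
have [|//|d d0 hd] := loc x y.
- by have := hx 0%N; rewrite /x0 /x1 f0.
- by have := hy 0%N; rewrite /y0 /y1 f0.
have [n hn] := pow2_small ((X1 - X0) + (Y1 - Y0)) d0.
have [[a1 a2] a3 [a4 a5] a6 []] := fB n.
have p2 : 0 < (2 ^+ n : R) by rewrite exprn_gt0.
have q0 : (X1 - X0) / 2 ^+ n + (Y1 - Y0) / 2 ^+ n < d by rewrite -mulrDl.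
have q1 : 0 <= (X1 - X0) / 2 ^+ n by rewrite divr_ge0 ?(ltW p2)// subr_ge0.
have q2 : 0 <= (Y1 - Y0) / 2 ^+ n by rewrite divr_ge0 ?(ltW p2)// subr_ge0.
apply: hd => //.
- have [XX|XX] := eqVneq X0 X1; first by left; move: XX a1 a2 a3; clear; split; lra.
  right; rewrite -subr_gt0 dimx divr_gt0// subr_gt0 lt_neqAle XX//.
- have [XX|XX] := eqVneq Y0 Y1; first by left; move: XX a4 a5 a6; clear; split; lra.
  right; rewrite -subr_gt0 dimy divr_gt0// subr_gt0 lt_neqAle XX//.
- by rewrite dimx; lra.
- by rewrite dimy; lra.
Qed.

End QuadInduction.

(** * Integrals of continuous complex functions of a real variable *)

Section Integral.
Context {R : realType}.
Local Notation C := (Cplx R).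

Definition rcont (phi : R -> C) := forall (x e : R), 0 < e -> exists2 d, 0 < d &
  forall t, `|t - x| < d -> md (phi t - phi x) < e.

(** Componentwise, because the fundamental theorem and the mean value theorem are applied to real
    functions; [rderP] gives the usual form. *)
Definition rder (Phi : R -> C) (x : R) (c : C) :=
  is_derive x (1 : R) (fun t => complex.Re (Phi t)) (complex.Re c) /\
  is_derive x (1 : R) (fun t => complex.Im (Phi t)) (complex.Im c).

Lemma ReB (z w : C) : complex.Re (z - w) = complex.Re z - complex.Re w.
Proof. by case: z w => ? ? []. Qed.

Lemma ImB (z w : C) : complex.Im (z - w) = complex.Im z - complex.Im w.
Proof. by case: z w => ? ? []. Qed.

Lemma md_le_ReIm (z : C) : md z <= `|complex.Re z| + `|complex.Im z|.
Proof. by case: z => a b; exact: md_ReIm. Qed.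

Lemma rcont_Re phi : rcont phi -> continuous (fun t => complex.Re (phi t)).
Proof.
move=> h x; apply/cvgrPdist_lt => e e0; have [d d0 k] := h x e e0.
apply/nbhs_ballP; exists d => // t; rewrite /ball /= => /= xt.
rewrite -ReB; apply: le_lt_trans (md_Re _) _; rewrite mdB; apply: k.
by rewrite distrC.
Qed.

Lemma rcont_Im phi : rcont phi -> continuous (fun t => complex.Im (phi t)).
Proof.
move=> h x; apply/cvgrPdist_lt => e e0; have [d d0 k] := h x e e0.
apply/nbhs_ballP; exists d => // t; rewrite /ball /= => /= xt.
rewrite -ImB; apply: le_lt_trans (md_Im _) _; rewrite mdB; apply: k.
by rewrite distrC.
Qed.

Lemma real_prim (f : R -> R) (L : R) : continuous f -> exists F : R -> R,
  forall x, - L < x < L -> is_derive x (1 : R) F (f x).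
Proof.
move=> cf; exists (fun x => \int[lebesgue_measure]_(t in [set` Interval (BLeft (- L)) (BRight x)]) f t).
move=> x /andP[x1 x2].
have I : lebesgue_measure.-integrable [set` Interval (BLeft (- L)) (BRight L)] (EFin \o f).
  apply: continuous_compact_integrable; first exact: segment_compact.
  exact: continuous_subspaceT.
have [||h1 h2] := continuous_FTC1 x2 I.
- by rewrite lte_fin.
- exact: cf.
- by apply: (DeriveDef h1); move: h2; rewrite derive1E.
Qed.

Lemma rder_prim phi L : rcont phi -> exists Phi : R -> C,
  forall x, - L < x < L -> rder Phi x (phi x).
Proof.
move=> h; have [F hF] := real_prim L (rcont_Re h); have [G hG] := real_prim L (rcont_Im h).
by exists (fun x => (F x +i* G x)%C) => x hx; split; [exact: hF|exact: hG].
Qed.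

Lemma real_mvt (f df : R -> R) (a b M : R) : a <= b ->
  (forall x, a <= x <= b -> is_derive x (1 : R) f (df x)) ->
  (forall x, a <= x <= b -> `|df x| <= M) -> `|f b - f a| <= M * (b - a).
Proof.
move=> ab hd hM.
have [||c] := @MVT_segment _ f df a b ab.
- by move=> x; rewrite in_itv /= => /andP[x1 x2]; apply: hd; rewrite !ltW.
- apply: derivable_within_continuous => x; rewrite in_itv /= => hx.
  by have [] := hd x hx.
rewrite in_itv /= => hc ->; rewrite normrM (ger0_norm (_ : 0 <= b - a)) ?subr_ge0//.
by rewrite ler_wpM2r ?subr_ge0// hM.
Qed.

(** The mean value theorem holds for the real and the imaginary part separately, hence the factor
    2. *)
Lemma rder_bound Phi phi (a b M : R) : a <= b ->
  (forall x, a <= x <= b -> rder Phi x (phi x)) ->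
  (forall x, a <= x <= b -> md (phi x) <= M) -> md (Phi b - Phi a) <= 2 * M * (b - a).
Proof.
move=> ab hd hM.
have h1 := @real_mvt (fun t => complex.Re (Phi t)) (fun t => complex.Re (phi t)) a b M ab
  (fun x hx => (hd x hx).1) (fun x hx => le_trans (md_Re _) (hM x hx)).
have h2 := @real_mvt (fun t => complex.Im (Phi t)) (fun t => complex.Im (phi t)) a b M ab
  (fun x hx => (hd x hx).2) (fun x hx => le_trans (md_Im _) (hM x hx)).
have := md_le_ReIm (Phi b - Phi a).
by rewrite ReB ImB; lra.
Qed.

Lemma rderD F G x c d : rder F x c -> rder G x d -> rder (fun t => F t + G t) x (c + d).
Proof.
move=> [a1 a2] [b1 b2]; split.
  rewrite (_ : complex.Re (c + d) = complex.Re c + complex.Re d); last by case: c d {a1 a2 b1 b2} => ? ? [].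
  rewrite (_ : (fun t => complex.Re (F t + G t)) = (fun t => complex.Re (F t)) + (fun t => complex.Re (G t))).
    exact: is_deriveD.
  by apply/funext => t; rewrite fctE; case: (F t) (G t) => ? ? [].
rewrite (_ : complex.Im (c + d) = complex.Im c + complex.Im d); last by case: c d {a1 a2 b1 b2} => ? ? [].
rewrite (_ : (fun t => complex.Im (F t + G t)) = (fun t => complex.Im (F t)) + (fun t => complex.Im (G t))).
  exact: is_deriveD.
by apply/funext => t; rewrite fctE; case: (F t) (G t) => ? ? [].
Qed.

Lemma rderZ (k : C) F x c : rder F x c -> rder (fun t => k * F t) x (k * c).
Proof.
case: k => p q [a1 a2]; split.
  rewrite (_ : complex.Re _ = p *: complex.Re c - q *: complex.Im c); last by case: c {a1 a2}.
  rewrite (_ : (fun t => _) = p *: (fun t => complex.Re (F t)) - q *: (fun t => complex.Im (F t))).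
    by apply: is_deriveB; exact: is_deriveZ.
  by apply/funext => t; rewrite !fctE; case: (F t).
rewrite (_ : complex.Im _ = p *: complex.Im c + q *: complex.Re c); last by case: c {a1 a2}.
rewrite (_ : (fun t => _) = p *: (fun t => complex.Im (F t)) + q *: (fun t => complex.Re (F t))).
  by apply: is_deriveD; exact: is_deriveZ.
by apply/funext => t; rewrite !fctE; case: (F t).
Qed.

Lemma rderP F x c : rder F x c <-> (forall e : R, 0 < e -> exists2 d : R, 0 < d &
  forall t, `|t - x| < d -> md (F t - F x - c * (t - x)%:C%C) <= e * `|t - x|).
Proof.
have E (f : R -> R) (k : R) : is_derive x (1 : R) f k <->
   (forall e : R, 0 < e -> exists2 d : R, 0 < d &
      forall t, `|t - x| < d -> `|f t - f x - k * (t - x)| <= e * `|t - x|).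
  have E : (fun h : R => h^-1 *: ((f \o shift x) (h *: 1) - f x)) @ 0^' --> k <->
   (forall e : R, 0 < e -> exists2 d : R, 0 < d &
      forall t, `|t - x| < d -> `|f t - f x - k * (t - x)| <= e * `|t - x|).
    split.
      move=> /cvgrPdist_le h e e0.
      have /h/nbhs_ballP[d d0 {}h] := e0.
      exists d => // w hw; have [->|wz] := eqVneq w x.
        by rewrite !subrr mulr0 subr0 normr0 mulr0.
      have := h (w - x); rewrite /ball /= sub0r normrN => /(_ hw); rewrite subr_eq0 => /(_ wz).
      rewrite /shift scaler1 subrK => h1.
      have -> : f w - f x - k * (w - x) = - ((k - (w - x)^-1 *: (f w - f x)) * (w - x)).
        by rewrite mulrBl /GRing.scale /=; field; rewrite subr_eq0.
      by rewrite normrN normrM ler_wpM2r.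
    move=> h; apply/cvgrPdist_le => e /h[d d0 {}h].
    apply/nbhs_ballP; exists d => // w; rewrite /ball /= sub0r normrN => wd w0.
    rewrite /= /shift scaler1.
    have := h (w + x); rewrite addrK => /(_ wd) h1.
    have -> : k - w^-1 *: (f (w + x) - f x) = - (f (w + x) - f x - k * w) * w^-1.
      by rewrite /GRing.scale /=; field.
    by rewrite normrM normrN normfV ler_pdivrMr// normr_gt0.
  split=> [h|h].
    by apply/E; case: h => h1 <-; exact: h1.
  have K := h; move/E in h.
  by apply: DeriveDef; [apply/cvg_ex; exists k|exact: cvg_lim].
have Er (t : R) : complex.Re (F t - F x - c * (t - x)%:C%C) =
   complex.Re (F t) - complex.Re (F x) - complex.Re c * (t - x).
  by move: (F t) (F x) (c) => [a b] [a' b'] [a'' b''] /=; ring.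
have Ei (t : R) : complex.Im (F t - F x - c * (t - x)%:C%C) =
   complex.Im (F t) - complex.Im (F x) - complex.Im c * (t - x).
  by move: (F t) (F x) (c) => [a b] [a' b'] [a'' b''] /=; ring.
split=> [[/E h1 /E h2] e e0|h].
  have e20 : 0 < e / 2 by lra.
  have [d1 d10 {}h1] := h1 _ e20; have [d2 d20 {}h2] := h2 _ e20.
  exists (Num.min d1 d2); first by rewrite lt_min d10.
  move=> t; rewrite lt_min => /andP[/h1 A /h2 B].
  have := md_le_ReIm (F t - F x - c * (t - x)%:C%C).
  by rewrite Er Ei; lra.
split; apply/E => e /h[d d0 {}h]; exists d => // t /h {}h.
  by apply: le_trans h; rewrite -Er md_Re.
by apply: le_trans h; rewrite -Ei md_Im.
Qed.

Lemma rder_line f (p v : C) x c : cder f (p + v * x%:C%C) c ->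
  rder (fun t => f (p + v * t%:C%C)) x (v * c).
Proof.
move=> h; apply/rderP => e e0; have v0 := md_ge0 v.
have e10 : 0 < e / (md v + 1) by rewrite divr_gt0//; lra.
have [d d0 {}h] := h _ e10.
exists (d / (md v + 1)); first by rewrite divr_gt0//; lra.
move=> t; rewrite ltr_pdivlMr; last lra.
have := h (p + v * t%:C%C).
rewrite (_ : p + v * t%:C%C - (p + v * x%:C%C) = v * (t - x)%:C%C); last by rewrite rmorphB /=; ring.
rewrite mdM md_real => {}h ht.
have n0 := normr_ge0 (t - x).
have /h {}h : md v * `|t - x| < d by nra.
rewrite (_ : v * c * _ = c * (v * (t - x)%:C%C)); last by ring.
apply: le_trans h _; rewrite mulrA ler_wpM2r//.
rewrite mulrAC ler_pdivrMr; [nra|lra].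
Qed.

(* [xget] picks any primitive of [phi] on a neighbourhood of [a, b]; without one the value is 0. *)
Definition cint (phi : R -> C) (a b : R) : C :=
  let Phi := xget (fun=> 0) [set Phi | forall x, - (`|a| + `|b| + 1) < x < `|a| + `|b| + 1 -> rder Phi x (phi x)] in
  Phi b - Phi a.

(** Two primitives differ by a constant: their difference has derivative 0, and [rder_bound] applies
    with [M = 0]. *)
Lemma cintE phi Psi (a b : R) : rcont phi -> a <= b ->
  (forall x, a <= x <= b -> rder Psi x (phi x)) -> cint phi a b = Psi b - Psi a.
Proof.
move=> h ab hP; rewrite /cint; case: xgetP => [Phi _ hPhi|]; last first.
  by have [Phi hPhi] := rder_prim (`|a| + `|b| + 1) h => /(_ Phi).
apply/eqP; rewrite -subr_eq0 -md_eq0 eq_le md_ge0 andbT.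
have := @rder_bound (fun t => Phi t + (-1) * Psi t) (fun=> 0) a b 0 ab.
rewrite mulr0 mul0r (_ : _ - _ - _ = Phi b + -1 * Psi b - (Phi a + -1 * Psi a)); last by ring.
apply=> [x /[dup] /hP h1 /andP[x1 x2]|x _]; last by rewrite md0.
rewrite (_ : 0 = phi x + (-1) * phi x); last by ring.
apply: rderD; last exact: rderZ.
apply: hPhi; have := ler_norm b; have := ler_norm (- a); rewrite normrN.
have := normr_ge0 a; have := normr_ge0 b; lra.
Qed.

Lemma cint_prim phi (a b : R) : rcont phi -> a <= b -> exists2 Phi : R -> C,
  (forall x, a <= x <= b -> rder Phi x (phi x)) & cint phi a b = Phi b - Phi a.
Proof.
move=> h ab; have [Phi hPhi] := rder_prim (`|a| + `|b| + 1) h.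
have k x : a <= x <= b -> rder Phi x (phi x).
  move=> /andP[x1 x2]; apply: hPhi; have := ler_norm b; have := ler_norm (- a); rewrite normrN.
  by have := normr_ge0 a; have := normr_ge0 b; lra.
by exists Phi => //; exact: cintE.
Qed.

Lemma cint_bound phi (a b M : R) : rcont phi -> a <= b ->
  (forall x, a <= x <= b -> md (phi x) <= M) -> md (cint phi a b) <= 2 * M * (b - a).
Proof. by move=> h ab hM; have [Phi k ->] := cint_prim h ab; exact: rder_bound k hM. Qed.

Lemma cint_cat phi a b c : rcont phi -> a <= b -> b <= c ->
  cint phi a c = cint phi a b + cint phi b c.
Proof.
move=> h ab bc; have [Phi k ->] := cint_prim h (le_trans ab bc).
rewrite !(@cintE _ Phi)//; first by ring.
- by move=> x hx; apply: k; lra.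
- by move=> x hx; apply: k; lra.
Qed.

Lemma rcontD f g : rcont f -> rcont g -> rcont (fun t => f t + g t).
Proof.
move=> hf hg x e e0; have e20 : 0 < e / 2 by lra.
have [d d0 h1] := hf x _ e20; have [d' d'0 h2] := hg x _ e20.
exists (Num.min d d'); first by rewrite lt_min d0.
move=> t; rewrite lt_min => /andP[/h1 A /h2 B].
rewrite (_ : _ - _ = (f t - f x) + (g t - g x)); last by ring.
by have := mdD (f t - f x) (g t - g x); lra.
Qed.

Lemma rcontZ k f : rcont f -> rcont (fun t => k * f t).
Proof.
move=> hf x e e0; have k0 := md_ge0 k.
have e20 : 0 < e / (md k + 1) by rewrite divr_gt0//; lra.
have [d d0 h1] := hf x _ e20; exists d => // t /h1.
rewrite ltr_pdivlMr; last lra.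
by rewrite -mulrBr mdM; have := md_ge0 (f t - f x); nra.
Qed.

Lemma cintD f g a b : rcont f -> rcont g -> a <= b ->
  cint (fun t => f t + g t) a b = cint f a b + cint g a b.
Proof.
move=> hf hg ab; have [F k ->] := cint_prim hf ab; have [G l ->] := cint_prim hg ab.
rewrite (@cintE _ (fun t => F t + G t))//; first by ring.
- exact: rcontD.
- by move=> x hx; apply: rderD; [exact: k|exact: l].
Qed.

Lemma cintZ c f a b : rcont f -> a <= b ->
  cint (fun t => c * f t) a b = c * cint f a b.
Proof.
move=> hf ab; have [F k ->] := cint_prim hf ab.
rewrite (@cintE _ (fun t => c * F t))//; first by ring.
- exact: rcontZ.
- by move=> x hx; apply: rderZ; exact: k.
Qed.

End Integral.

(** * Goursat's theorem on rectangles *)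


Lemma minr_lip (R : realDomainType) (a x y : R) : `|Num.min x a - Num.min y a| <= `|x - y|.
Proof.
have := ler_norm (x - y); have := ler_norm (y - x); rewrite distrC /Num.min => h1 h2.
by case: (ltP x a) => ?; case: (ltP y a) => ?; rewrite ler_norml; apply/andP; split; lra.
Qed.

Lemma maxr_lip (R : realDomainType) (a x y : R) : `|Num.max a x - Num.max a y| <= `|x - y|.
Proof.
have := ler_norm (x - y); have := ler_norm (y - x); rewrite distrC /Num.max => h1 h2.
by case: (ltP a x) => ?; case: (ltP a y) => ?; rewrite ler_norml; apply/andP; split; lra.
Qed.

Section Goursat.
Context {R : realType}.
Local Notation C := (Cplx R).

Definition pt (x y : R) : C := (x +i* y)%C.

Lemma ptE (z : C) : z = pt (complex.Re z) (complex.Im z).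
Proof. by case: z. Qed.

Lemma pt_hor x y : pt x y = pt 0 y + 1 * x%:C%C.
Proof. by rewrite mul1r /pt; apply/eqP; rewrite eq_complex /= add0r addr0 !eqxx. Qed.

Lemma pt_ver x y : pt x y = x%:C%C + 'i%C * y%:C%C.
Proof.
by apply/eqP; rewrite eq_complex /=; apply/andP; split; apply/eqP; ring.
Qed.

Lemma ptB x y x' y' : pt x y - pt x' y' = pt (x - x') (y - y').
Proof. by []. Qed.

Lemma md_pt x y : md (pt x y) <= `|x| + `|y|.
Proof. exact: md_ReIm. Qed.

Lemma md_ptx x y : `|x| <= md (pt x y).
Proof. exact: (md_Re (pt x y)). Qed.

Lemma md_pty x y : `|y| <= md (pt x y).
Proof. exact: (md_Im (pt x y)). Qed.

Lemma md_i : md ('i%C : C) = 1.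
Proof. by rewrite /md /= expr0n add0r expr1n sqrtr1. Qed.

Definition ccont (f : C -> C) := forall (z : C) (e : R), 0 < e ->
  exists2 d : R, 0 < d & forall w, md (w - z) < d -> md (f w - f z) < e.

(** The integral of [f dz] over the boundary, counterclockwise; [dz = i dy] on the vertical
    sides. *)
Definition rectI (f : C -> C) (x0 x1 y0 y1 : R) : C :=
  cint (fun t => f (pt t y0)) x0 x1 - cint (fun t => f (pt t y1)) x0 x1 +
  'i%C * (cint (fun t => f (pt x1 t)) y0 y1 - cint (fun t => f (pt x0 t)) y0 y1).

(** Continuity is required on the whole lines through the sides, because [cint] integrates functions
    that are continuous on [R]. *)
Definition bcont (f : C -> C) (x0 x1 y0 y1 : R) :=
  [/\ rcont (fun t => f (pt t y0)), rcont (fun t => f (pt t y1)),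
      rcont (fun t => f (pt x0 t)) & rcont (fun t => f (pt x1 t))].

Definition onbd (x0 x1 y0 y1 : R) (P : C -> Prop) :=
  (forall x, x0 <= x <= x1 -> P (pt x y0) /\ P (pt x y1)) /\
  (forall y, y0 <= y <= y1 -> P (pt x0 y) /\ P (pt x1 y)).

Lemma rcont_hor f y : ccont f -> rcont (fun t => f (pt t y)).
Proof.
move=> h x e e0; have [d d0 k] := h (pt x y) e e0; exists d => // t ht; apply: k.
by rewrite ptB subrr; apply: le_lt_trans (md_pt _ _) _; rewrite normr0 addr0.
Qed.

Lemma rcont_ver f x : ccont f -> rcont (fun t => f (pt x t)).
Proof.
move=> h y e e0; have [d d0 k] := h (pt x y) e e0; exists d => // t ht; apply: k.
by rewrite ptB subrr; apply: le_lt_trans (md_pt _ _) _; rewrite normr0 add0r.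
Qed.

Lemma bcontW f x0 x1 y0 y1 : ccont f -> bcont f x0 x1 y0 y1.
Proof. by move=> h; split; [exact: rcont_hor|exact: rcont_hor|exact: rcont_ver|exact: rcont_ver]. Qed.

Lemma rder_hor F y x c : cder F (pt x y) c -> rder (fun t => F (pt t y)) x c.
Proof.
rewrite pt_hor => /rder_line; rewrite mul1r.
by under eq_fun do rewrite -pt_hor.
Qed.

Lemma rder_ver F y x c : cder F (pt x y) c -> rder (fun t => F (pt x t)) y ('i%C * c).
Proof.
rewrite pt_ver => /rder_line.
by under eq_fun do rewrite -pt_ver.
Qed.

Lemma rectI_prim f F x0 x1 y0 y1 : x0 <= x1 -> y0 <= y1 -> bcont f x0 x1 y0 y1 ->
  onbd x0 x1 y0 y1 (fun z => cder F z (f z)) -> rectI f x0 x1 y0 y1 = 0.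
Proof.
move=> hx hy [c1 c2 c3 c4] [h1 h2]; rewrite /rectI.
rewrite (cintE c1 hx (fun x hx => rder_hor (h1 x hx).1)).
rewrite (cintE c2 hx (fun x hx => rder_hor (h1 x hx).2)).
rewrite mulrBr -!cintZ//.
rewrite (cintE (rcontZ _ c3) hy (fun x hx => rder_ver (h2 x hx).1)).
rewrite (cintE (rcontZ _ c4) hy (fun x hx => rder_ver (h2 x hx).2)).
ring.
Qed.

Lemma rectI_bound f x0 x1 y0 y1 (M : R) : x0 <= x1 -> y0 <= y1 -> bcont f x0 x1 y0 y1 ->
  onbd x0 x1 y0 y1 (fun z => md (f z) <= M) ->
  md (rectI f x0 x1 y0 y1) <= 4 * M * ((x1 - x0) + (y1 - y0)).
Proof.
move=> hx hy [c1 c2 c3 c4] [h1 h2]; rewrite /rectI.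
have b1 := cint_bound c1 hx (fun x hx => (h1 x hx).1).
have b2 := cint_bound c2 hx (fun x hx => (h1 x hx).2).
have b3 := cint_bound c3 hy (fun x hx => (h2 x hx).1).
have b4 := cint_bound c4 hy (fun x hx => (h2 x hx).2).
apply: le_trans (mdD _ _) _; rewrite mdM md_i mul1r.
have := md_subD (cint (fun t => f (pt t y0)) x0 x1) (cint (fun t => f (pt t y1)) x0 x1).
have := md_subD (cint (fun t => f (pt x1 t)) y0 y1) (cint (fun t => f (pt x0 t)) y0 y1).
lra.
Qed.

Lemma rectID f g x0 x1 y0 y1 : x0 <= x1 -> y0 <= y1 ->
  bcont f x0 x1 y0 y1 -> bcont g x0 x1 y0 y1 ->
  rectI (fun z => f z + g z) x0 x1 y0 y1 = rectI f x0 x1 y0 y1 + rectI g x0 x1 y0 y1.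
Proof.
move=> hx hy [c1 c2 c3 c4] [d1 d2 d3 d4]; rewrite /rectI !cintD//; ring.
Qed.

Lemma rectIZ k f x0 x1 y0 y1 : x0 <= x1 -> y0 <= y1 -> bcont f x0 x1 y0 y1 ->
  rectI (fun z => k * f z) x0 x1 y0 y1 = k * rectI f x0 x1 y0 y1.
Proof. move=> hx hy [c1 c2 c3 c4]; rewrite /rectI !cintZ//; ring. Qed.

Lemma bcontZ k f x0 x1 y0 y1 : bcont f x0 x1 y0 y1 -> bcont (fun z => k * f z) x0 x1 y0 y1.
Proof. by move=> [c1 c2 c3 c4]; split; apply: rcontZ. Qed.

Lemma rectI_catx f x0 x x1 y0 y1 : x0 <= x -> x <= x1 -> ccont f ->
  rectI f x0 x1 y0 y1 = rectI f x0 x y0 y1 + rectI f x x1 y0 y1.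
Proof.
move=> h1 h2 cf; rewrite /rectI !(@cint_cat _ _ x0 x x1)//; last 2 first.
- exact: rcont_hor.
- exact: rcont_hor.
ring.
Qed.

Lemma rectI_caty f x0 x1 y0 y y1 : y0 <= y -> y <= y1 -> ccont f ->
  rectI f x0 x1 y0 y1 = rectI f x0 x1 y0 y + rectI f x0 x1 y y1.
Proof.
move=> h1 h2 cf; rewrite /rectI !(@cint_cat _ _ y0 y y1)//; last 2 first.
- exact: rcont_ver.
- exact: rcont_ver.
ring.
Qed.

Lemma ccontD f g : ccont f -> ccont g -> ccont (fun t => f t + g t).
Proof.
move=> hf hg x e e0; have e20 : 0 < e / 2 by lra.
have [d d0 h1] := hf x _ e20; have [d' d'0 h2] := hg x _ e20.
exists (Num.min d d'); first by rewrite lt_min d0.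
move=> t; rewrite lt_min => /andP[/h1 A /h2 B].
rewrite (_ : _ - _ = (f t - f x) + (g t - g x)); last by ring.
by have := mdD (f t - f x) (g t - g x); lra.
Qed.

Lemma ccont_cder f : (forall z, exists c, cder f z c) -> ccont f.
Proof. by move=> h z e e0; have [c /cder_cont] := h z; apply. Qed.

Lemma cder_affine (a b z : C) : cder (fun w => a + b * w) z b.
Proof.
apply: cder_eqd (cderD (cder_cst a z) (cderZ b (cder_id z))) _.
by rewrite add0r mulr1.
Qed.

Lemma rectI_affine (a b : C) x0 x1 y0 y1 : x0 <= x1 -> y0 <= y1 ->
  rectI (fun w => a + b * w) x0 x1 y0 y1 = 0.
Proof.
move=> hx hy; apply: (@rectI_prim _ (fun w => a * w + (b / 2) * w ^+ 2)) => //.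
  by apply: bcontW; apply: ccont_cder => z; exists b; exact: cder_affine.
have E z : cder (fun w => a * w + b / 2 * w ^+ 2) z (a + b * z).
  apply: cder_eqd (cderD (cderZ a (cder_id z)) (cderZ (b / 2) (cderX 2 (cder_id z)))) _.
  by rewrite /=; field.
by split.
Qed.

(** The bound [e1] times the square of the half perimeter passes from the four quarters to the
    rectangle. It holds for small rectangles around a point because an affine function integrates to
    0 and the rest is [o(|w - z|)]. *)
Lemma goursat f x0 x1 y0 y1 : x0 <= x1 -> y0 <= y1 -> ccont f ->
  (forall x y, x0 <= x <= x1 -> y0 <= y <= y1 -> exists c, cder f (pt x y) c) ->
  rectI f x0 x1 y0 y1 = 0.
Proof.
move=> hx hy cf df; apply: md_small_eq0 => e e0.
pose A := (x1 - x0 + (y1 - y0)) ^+ 2 + 1.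
have A0 : 0 < A by rewrite /A; have := sqr_ge0 (x1 - x0 + (y1 - y0)); lra.
pose e1 := e / A; have e10 : 0 < e1 by rewrite divr_gt0.
suff : md (rectI f x0 x1 y0 y1) <= e1 * (x1 - x0 + (y1 - y0)) ^+ 2.
  move=> h; apply: le_trans h _; rewrite /e1 mulrAC ler_pdivrMr// ler_pM2l//.
  by rewrite /A lerDl.
apply: (quad_ind (P := fun x0 x1 y0 y1 => md (rectI f x0 x1 y0 y1) <= e1 * (x1 - x0 + (y1 - y0)) ^+ 2)) => //.
  move=> u0 u1 v0 v1 _ hu _ _ hv _ /=.
  set u := (u0 + u1) / 2; set v := (v0 + v1) / 2.
  rewrite (@rectI_catx f u0 u u1)//; [|rewrite /u; lra|rewrite /u; lra].
  rewrite !(@rectI_caty f _ _ v0 v v1)//; [|rewrite /v; lra|rewrite /v; lra|rewrite /v; lra|rewrite /v; lra].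
  move=> a1 a2 a3 a4.
  apply: le_trans (mdD _ _) _; apply: le_trans (lerD (mdD _ _) (mdD _ _)) _.
  apply: le_trans (lerD (lerD a1 a3) (lerD a2 a4)) _.
  by rewrite le_eqVlt; apply/orP; left; apply/eqP; rewrite /u /v; field.
move=> x y xx yy; have [c hc] := df x y xx yy.
have e80 : 0 < e1 / 8 by lra.
have [d d0 hd] := hc _ e80.
exists (d / 2); first lra.
move=> u0 u1 v0 v1 _ hu _ _ hv _ _ _ du dv.
have uu : u0 <= u1 by lra. have vv : v0 <= v1 by lra.
pose z := pt x y.
(* Minus the affine part of [f] at [z], which may be added without changing the integral. *)
pose g w := (- (f z - c * z)) + (- c) * w.
have cg : ccont g by apply: ccont_cder => w; exists (- c); exact: cder_affine.
have -> : rectI f u0 u1 v0 v1 = rectI (fun w => f w + g w) u0 u1 v0 v1.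
  rewrite rectID//; [|exact: bcontW|exact: bcontW].
  by rewrite rectI_affine// addr0.
apply: le_trans (@rectI_bound _ _ _ _ _ ((e1 / 8) * (2 * (u1 - u0 + (v1 - v0)))) uu vv _ _) _.
- exact: bcontW (ccontD cf cg).
- have B a b : u0 <= a <= u1 -> v0 <= b <= v1 -> md (f (pt a b) + g (pt a b)) <= (e1 / 8) * (2 * (u1 - u0 + (v1 - v0))).
    move=> ha hb.
    have m : md (pt a b - z) <= (u1 - u0) + (v1 - v0).
      rewrite ptB; apply: le_trans (md_pt _ _) _.
      by rewrite lerD// ler_norml; lra.
    rewrite (_ : f _ + _ = f (pt a b) - f z - c * (pt a b - z)); last by rewrite /g; ring.
    apply: le_trans (hd _ _) _; first by lra.
    by rewrite ler_pM2l//; lra.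
  by split=> t ht; split; apply: B => //; rewrite lexx ?uu ?vv.
- have := sqr_ge0 (u1 - u0 + (v1 - v0)); rewrite expr2; nra.
Qed.

Definition cl (s x : R) : R := Num.max (- s) (Num.min x s).

Lemma cl_lip s x y : 0 <= s -> `|cl s x - cl s y| <= `|x - y|.
Proof.
by move=> s0; apply: le_trans (maxr_lip _ _ _) (minr_lip _ _ _).
Qed.

Lemma cl_id s x : - s <= x <= s -> cl s x = x.
Proof. by move=> /andP[h1 h2]; rewrite /cl (min_idPl h2) (max_idPr h1). Qed.

Lemma cl_in s x : 0 <= s -> - s <= cl s x <= s.
Proof. by move=> s0; rewrite /cl le_max lexx /= ge_max ge_min lexx orbT andbT; lra. Qed.

(** The retraction of the plane onto a square: composed with it, a function given near 0 becomes
    continuous on the whole plane, as [ccont] and [cint] demand. *)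
Definition clC (s : R) (z : C) : C := pt (cl s (complex.Re z)) (cl s (complex.Im z)).

Lemma clC_lip s z w : 0 <= s -> md (clC s z - clC s w) <= 2 * md (z - w).
Proof.
move=> s0; rewrite /clC ptB; apply: le_trans (md_pt _ _) _.
have := md_Re (z - w); have := md_Im (z - w); rewrite ReB ImB.
have := cl_lip (complex.Re z) (complex.Re w) s0.
have := cl_lip (complex.Im z) (complex.Im w) s0; lra.
Qed.

(** The square of half side [r] around the exceptional point has an integral of modulus at most
    [16 * M * r]; [goursat] disposes of the four rectangles around it. *)
Lemma goursat_except f s (a b : R) : 0 < s -> - s < a < s -> - s < b < s -> ccont f ->
  (forall x y, - s <= x <= s -> - s <= y <= s -> pt x y != pt a b -> exists c, cder f (pt x y) c) ->
  rectI f (- s) s (- s) s = 0.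
Proof.
move=> s0 ha hb cf df; apply: md_small_eq0 => e e0.
have [d d0 hd] := cf (pt a b) 1 ltr01.
pose M := md (f (pt a b)) + 1; have M0 : 0 < M by rewrite /M; have := md_ge0 (f (pt a b)); lra.
pose r := Num.min (Num.min (d / 4) (e / (M * 16))) (Num.min (Num.min (s - a) (a + s)) (Num.min (s - b) (b + s))).
have r0 : 0 < r.
  by rewrite /r !lt_min !divr_gt0 ?mulr_gt0//=; lra.
have : [/\ r <= d / 4, r <= e / (M * 16), r <= s - a, r <= a + s & (r <= s - b) /\ (r <= b + s)].
  by rewrite /r !ge_min !lexx ?orbT.
move=> [r1 r2 r3 r4 [r5 r6]].
have [xa1 xa2 xa3 xa4 xa5] : [/\ - s <= a - r, a - r <= a + r, a + r <= s, - s <= a + r & a - r <= s] by split; clear - r0 r3 r4; lra.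
have [yb1 yb2 yb3 yb4 yb5] : [/\ - s <= b - r, b - r <= b + r, b + r <= s, - s <= b + r & b - r <= s] by split; clear - r0 r5 r6; lra.
have ss : - s <= s := le_trans xa1 xa5.
rewrite (@rectI_catx f _ (a - r))// (@rectI_catx f (a - r) (a + r))//.
rewrite (@rectI_caty f (a - r) (a + r) _ (b - r))// (@rectI_caty f (a - r) (a + r) (b - r) (b + r))//.
have G x0 x1 y0 y1 : - s <= x0 -> x0 <= x1 -> x1 <= s -> - s <= y0 -> y0 <= y1 -> y1 <= s ->
  ~ (x0 <= a <= x1 /\ y0 <= b <= y1) -> rectI f x0 x1 y0 y1 = 0.
  move=> *; apply: goursat => // x y hx hy; apply: df; [lra|lra|].
  apply/eqP => -[xa yb]; subst; tauto.
rewrite (G (- s))//; last by clear - r0; lra.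
rewrite (G _ _ (- s) (b - r))//; last by clear - r0; lra.
rewrite (G _ _ (b + r))//; last by clear - r0; lra.
rewrite (G (a + r))//; last by clear - r0; lra.
rewrite addr0 !add0r addr0.
have B : onbd (a - r) (a + r) (b - r) (b + r) (fun z => md (f z) <= M).
  have B x y : a - r <= x <= a + r -> b - r <= y <= b + r -> md (f (pt x y)) <= M.
    move=> hx hy; have := hd (pt x y); rewrite ptB.
    have h : `|x - a| <= r by rewrite ler_norml; lra.
    have h' : `|y - b| <= r by rewrite ler_norml; lra.
    have := md_pt (x - a) (y - b) => h'' h3.
    have := h3 ltac:(lra); have := md_sub (f (pt x y)) (f (pt a b)); rewrite /M; lra.
  by split=> t ht; split; apply: B => //; lra.
apply: le_trans (rectI_bound _ _ _ B) _; [lra|lra|exact: bcontW|].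
move: r2; rewrite ler_pdivlMr ?mulr_gt0//; lra.
Qed.

End Goursat.

(** * Cauchy's formula and power series *)


Section Cauchy.
Context {R : realType}.
Local Notation C := (Cplx R).

(** The way in which identities between analytic functions are proved here: a geometric bound for
    every order of truncation. *)
Lemma geom_le0 (x K q : R) : 0 <= q -> q <= 1 / 2 -> (forall N, x <= K * q ^+ N) -> x <= 0.
Proof.
move=> q0 q1 h; apply/ler_addgt0Pl => e e0; rewrite addr0.
have [n hn] := pow2_small `|K| e0.
apply: le_trans (h n) _; apply: le_trans (ltW hn).
have : q ^+ n <= (1 / 2) ^+ n by apply: lerXn2r; rewrite ?nnegrE.
rewrite expr_div_n expr1n div1r => qn.
apply: le_trans (_ : `|K| * q ^+ n <= _); last by rewrite ler_wpM2l.
by rewrite ler_wpM2r ?ler_norm// exprn_ge0.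
Qed.

Lemma rcontM (f g : R -> C) : rcont f -> rcont g -> rcont (fun t => f t * g t).
Proof.
move=> hf hg x e e0.
have f0 := md_ge0 (f x); have g0 := md_ge0 (g x).
pose e1 := Num.min 1 (e / (md (f x) + md (g x) + 2)).
have e10 : 0 < e1 by rewrite lt_min ltr01/= divr_gt0//; lra.
have [d d0 h1] := hf x _ e10; have [d' d'0 h2] := hg x _ e10.
exists (Num.min d d'); first by rewrite lt_min d0.
move=> t; rewrite lt_min => /andP[/h1 A /h2 B].
have e1l : e1 <= 1 by rewrite ge_min lexx.
have e1r : e1 * (md (f x) + md (g x) + 2) <= e by rewrite -ler_pdivlMr ?ge_min ?lexx ?orbT//; lra.
rewrite (_ : _ - _ = (f t - f x) * (g t - g x) + (f t - f x) * g x + f x * (g t - g x)); last by ring.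
have := mdD ((f t - f x) * (g t - g x) + (f t - f x) * g x) (f x * (g t - g x)).
have := mdD ((f t - f x) * (g t - g x)) ((f t - f x) * g x).
rewrite !mdM => h3 h4; have := md_ge0 (f t - f x); have := md_ge0 (g t - g x); nra.
Qed.

Lemma rcont_hor_cder (f : C -> C) y : (forall x, exists c, cder f (pt x y) c) ->
  rcont (fun t => f (pt t y)).
Proof.
move=> h x e e0; have [c /cder_cont/(_ e e0)[d d0 k]] := h x.
exists d => // t ht; apply: k.
by rewrite ptB subrr; apply: le_lt_trans (md_pt _ _) _; rewrite normr0 addr0.
Qed.

Lemma rcont_ver_cder (f : C -> C) x : (forall y, exists c, cder f (pt x y) c) ->
  rcont (fun t => f (pt x t)).
Proof.
move=> h y e e0; have [c /cder_cont/(_ e e0)[d d0 k]] := h y.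
exists d => // t ht; apply: k.
by rewrite ptB subrr; apply: le_lt_trans (md_pt _ _) _; rewrite normr0 add0r.
Qed.

Definition online (x0 x1 y0 y1 : R) (P : C -> Prop) :=
  (forall t, P (pt t y0) /\ P (pt t y1)) /\ (forall t, P (pt x0 t) /\ P (pt x1 t)).

Lemma bcont_cder (f : C -> C) x0 x1 y0 y1 :
  online x0 x1 y0 y1 (fun z => exists c, cder f z c) -> bcont f x0 x1 y0 y1.
Proof.
move=> [h1 h2]; split.
- by apply: rcont_hor_cder => x; have [] := h1 x.
- by apply: rcont_hor_cder => x; have [] := h1 x.
- by apply: rcont_ver_cder => x; have [] := h2 x.
- by apply: rcont_ver_cder => x; have [] := h2 x.
Qed.

Lemma bcontM (f g : C -> C) x0 x1 y0 y1 : bcont f x0 x1 y0 y1 -> bcont g x0 x1 y0 y1 ->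
  bcont (fun z => f z * g z) x0 x1 y0 y1.
Proof. by move=> [c1 c2 c3 c4] [d1 d2 d3 d4]; split; apply: rcontM. Qed.

Lemma rectI_eq (f g : C -> C) x0 x1 y0 y1 : online x0 x1 y0 y1 (fun z => f z = g z) ->
  rectI f x0 x1 y0 y1 = rectI g x0 x1 y0 y1.
Proof.
move=> [h1 h2]; rewrite /rectI.
under eq_fun do rewrite (h1 _).1; under [in X in _ - X + _]eq_fun do rewrite (h1 _).2.
by under [in X in _ * (X - _)]eq_fun do rewrite (h2 _).2; under [in X in _ * (_ - X)]eq_fun do rewrite (h2 _).1.
Qed.

Lemma bcont_eq (f g : C -> C) x0 x1 y0 y1 : online x0 x1 y0 y1 (fun z => f z = g z) ->
  bcont f x0 x1 y0 y1 -> bcont g x0 x1 y0 y1.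
Proof.
move=> [h1 h2] [c1 c2 c3 c4]; split.
- by under eq_fun do rewrite -(h1 _).1.
- by under eq_fun do rewrite -(h1 _).2.
- by under eq_fun do rewrite -(h2 _).1.
- by under eq_fun do rewrite -(h2 _).2.
Qed.

Lemma cint_Im_ge phi (a b m : R) : rcont phi -> a <= b ->
  (forall x, a <= x <= b -> m <= complex.Im (phi x)) -> m * (b - a) <= complex.Im (cint phi a b).
Proof.
move=> h ab hm; have [Phi k ->] := cint_prim h ab; rewrite ImB.
have [||c] := @MVT_segment _ (fun t => complex.Im (Phi t)) (fun t => complex.Im (phi t)) a b ab.
- by move=> x; rewrite in_itv /= => /andP[x1 x2]; apply: (k x _).2; rewrite !ltW.
- apply: derivable_within_continuous => x; rewrite in_itv /= => hx.
  by have [_ []] := k x hx.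
by rewrite in_itv /= => hc ->; rewrite ler_wpM2r ?subr_ge0// hm.
Qed.

Lemma pt_neq0 (s t : R) : 0 < s -> pt t s != 0 /\ pt t (- s) != 0 /\ pt s t != 0 /\ pt (- s) t != 0.
Proof.
move=> s0; rewrite !eq_complex /=.
by rewrite !oppr_eq0 (gt_eqF s0) !andbF.
Qed.

Lemma ImD (z w : C) : complex.Im (z + w) = complex.Im z + complex.Im w.
Proof. by case: z w => ? ? []. Qed.

(** The value is [2 pi i], but Cauchy's formula only has to divide by it. Each side contributes
    [pi / 2] to the imaginary part, which is bounded below by 1. *)
Lemma kappa_neq0 (s : R) : 0 < s -> rectI (fun w => w^-1) (- s) s (- s) s != 0.
Proof.
move=> s0.
have [c1 c2 c3 c4] : bcont (fun w : C => w^-1) (- s) s (- s) s.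
  apply: bcont_cder; split=> t; have [h1 [h2 [h3 h4]]] := pt_neq0 t s0.
    by split; eexists; apply: cder_inv.
  by split; eexists; apply: cder_inv.
have ss : - s <= s by lra.
suff : 1 <= complex.Im (rectI (fun w => w^-1) (- s) s (- s) s).
  by apply: contraTN => /eqP ->; rewrite /=; lra.
have -> : rectI (fun w => w^-1) (- s) s (- s) s =
    cint (fun t => (pt t (- s))^-1) (- s) s + cint (fun t => -1 * (pt t s)^-1) (- s) s +
    (cint (fun t => 'i%C * (pt s t)^-1) (- s) s + cint (fun t => -1 * 'i%C * (pt (- s) t)^-1) (- s) s).
  by rewrite !cintZ// /rectI; ring.
have ImD4 (a b c d : C) : complex.Im (a + b + (c + d)) =
    complex.Im a + complex.Im b + (complex.Im c + complex.Im d) by rewrite !ImD.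
rewrite ImD4.
have b1 := @cint_Im_ge _ (- s) s (1 / (2 * s)) c1 ss.
have b2 := @cint_Im_ge _ (- s) s (1 / (2 * s)) (rcontZ (-1) c2) ss.
have b3 := @cint_Im_ge _ (- s) s (1 / (2 * s)) (rcontZ 'i%C c4) ss.
have b4 := @cint_Im_ge _ (- s) s (1 / (2 * s)) (rcontZ (-1 * 'i%C) c3) ss.
have E : 1 / (2 * s) * (s - - s) = 1 by field; rewrite gt_eqF.
rewrite E in b1 b2 b3 b4.
have K (x : R) : - s <= x <= s -> 1 / (2 * s) <= s / (x ^+ 2 + s ^+ 2).
  move=> hx; have x2 := sqr_ge0 x; have s2 : 0 < s ^+ 2 by rewrite exprn_gt0.
  rewrite ler_pdivrMr; last by lra.
  rewrite mulrAC ler_pdivlMr; last by lra.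
  rewrite !expr2; nra.
have {}b1 : 1 <= complex.Im (cint (fun t => (pt t (- s))^-1) (- s) s).
  apply: b1 => x /K h; apply: le_trans h _; rewrite /= le_eqVlt; apply/orP; left; apply/eqP.
  by rewrite sqrrN mulNr opprK.
have {}b2 : 1 <= complex.Im (cint (fun t => -1 * (pt t s)^-1) (- s) s).
  apply: b2 => x /K h; apply: le_trans h _; rewrite /= le_eqVlt; apply/orP; left; apply/eqP.
  by rewrite /=; ring.
have {}b3 : 1 <= complex.Im (cint (fun t => 'i%C * (pt s t)^-1) (- s) s).
  apply: b3 => x /K h; apply: le_trans h _; rewrite /= le_eqVlt; apply/orP; left; apply/eqP.
  by rewrite [s ^+ 2 + _]addrC; ring.
have {}b4 : 1 <= complex.Im (cint (fun t => -1 * 'i%C * (pt (- s) t)^-1) (- s) s).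
  apply: b4 => x /K h; apply: le_trans h _; rewrite /= le_eqVlt; apply/orP; left; apply/eqP.
  by rewrite sqrrN [s ^+ 2 + _]addrC; ring.
lra.
Qed.

Definition psum (b : nat -> C) N z := \sum_(i < N) b i * z ^+ i.

(** Analyticity without infinite sums: a remainder bound for every partial sum, which also controls
    the growth of [b] ([expands_coef]). *)
Definition expands (f : C -> C) (b : nat -> C) (M rho : R) :=
  forall z, md z < rho -> forall N, md (f z - psum b N z) <= M * (md z / rho) ^+ N.

Section CauchyFormula.
Variables (F : C -> C) (s : R) (K : R).
Hypotheses (s0 : 0 < s) (cF : ccont F) (K0 : 0 <= K).
Hypothesis FK : forall z, md (F z) <= K.

Let J g := rectI g (- s) s (- s) s.
Let L P := online (- s) s (- s) s P.

Lemma line_away z : md z < s / 2 -> L (fun w => [/\ w != 0, w != z, s <= md w & s / 2 <= md (w - z)]).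
Proof.
move=> zs; have H w : s <= md w -> [/\ w != 0, w != z, s <= md w & s / 2 <= md (w - z)].
  move=> ws; have h : s / 2 <= md (w - z) by have := md_sub w z; lra.
  have s20 : 0 < s / 2 by rewrite divr_gt0.
  split=> //; first by rewrite -md_gt0; exact: lt_le_trans ws.
  by rewrite -subr_eq0 -md_gt0; exact: lt_le_trans h.
split=> t; split; apply: H.
- by have := md_pty t (- s); rewrite normrN (ger0_norm (ltW s0)).
- by have := md_pty t s; rewrite (ger0_norm (ltW s0)).
- by have := md_ptx (- s) t; rewrite normrN (ger0_norm (ltW s0)).
- by have := md_ptx s t; rewrite (ger0_norm (ltW s0)).
Qed.

Lemma onlineW (P Q : C -> Prop) : (forall z, P z -> Q z) -> L P -> L Q.
Proof. by move=> h [h1 h2]; split=> t; [have [] := h1 t|have [] := h2 t]; split; apply: h. Qed.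

Lemma bcont_kern z n : md z < s / 2 ->
  bcont (fun w => F w * ((w - z)^-1 * w ^- n)) (- s) s (- s) s.
Proof.
move=> zs; apply: bcontM; first exact: bcontW.
apply: bcont_cder; apply: onlineW (line_away zs) => w [w0 wz _ _].
rewrite -subr_eq0 in wz; eexists; apply: cderM.
  by apply: cderV => //; apply: cderB; [exact: cder_id|exact: cder_cst].
by apply: cderV; [rewrite expf_neq0|apply: cderX; exact: cder_id].
Qed.

Lemma bcont_kern0 n : bcont (fun w => F w * w ^- n) (- s) s (- s) s.
Proof.
apply: bcontM; first exact: bcontW.
have zs : md (0 : C) < s / 2 by rewrite md0 divr_gt0.
apply: bcont_cder; apply: onlineW (line_away zs) => w [w0 wz _ _].
eexists; by apply: cderV; [rewrite expf_neq0|apply: cderX; exact: cder_id].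
Qed.

(** From [1 / (w - z) = 1 / w + z / (w (w - z))]: the geometric series of the kernel, one term at a
    time. *)
Lemma kern_step z n : md z < s / 2 ->
  J (fun w => F w * ((w - z)^-1 * w ^- n)) =
  J (fun w => F w * w ^- n.+1) + z * J (fun w => F w * ((w - z)^-1 * w ^- n.+1)).
Proof.
have ss : - s <= s by have := s0; lra.
move=> zs; rewrite /J -rectIZ// -?rectID//; last 3 first.
- exact: bcont_kern0.
- by apply: bcontZ; exact: bcont_kern.
- exact: bcont_kern.
apply: rectI_eq; apply: onlineW (line_away zs) => w [w0 wz _ _].
rewrite -subr_eq0 in wz.
by rewrite exprS; field; rewrite expf_neq0// w0 wz.
Qed.

Lemma kern_bound z n : md z < s / 2 ->
  md (J (fun w => F w * ((w - z)^-1 * w ^- n))) <= 32 * K * s ^- n.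
Proof.
have s0' := s0; have K0' := K0; move=> zs; have ss : - s <= s by lra.
have sn : 0 < s ^- n by rewrite invr_gt0 exprn_gt0.
apply: le_trans (rectI_bound ss ss (bcont_kern n zs) (_ : onbd _ _ _ _ (fun w => _ <= K * (2 / s * s ^- n)))) _; last first.
  rewrite le_eqVlt; apply/orP; left; apply/eqP; by field; rewrite expf_neq0 ?gt_eqF.
have : L (fun w => md (F w * ((w - z)^-1 * w ^- n)) <= K * (2 / s * s ^- n)).
  apply: onlineW (line_away zs) => w [w0 wz h1 h2].
  rewrite !mdM !mdV mdX; apply: ler_pM => //; rewrite ?md_ge0//.
    by rewrite mulr_ge0// invr_ge0 ?exprn_ge0 ?md_ge0.
  apply: ler_pM; rewrite ?invr_ge0 ?exprn_ge0 ?md_ge0//.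
    by rewrite -[2 / s]invf_div lef_pV2// posrE; lra.
  rewrite lef_pV2 ?posrE ?exprn_gt0//; last by lra.
  by apply: lerXn2r; rewrite ?nnegrE ?md_ge0 ?(ltW s0').
by move=> [h1 h2]; split=> t _; [exact: h1|exact: h2].
Qed.

Lemma kern_expand z N : md z < s / 2 ->
  J (fun w => F w * (w - z)^-1) = psum (fun n => J (fun w => F w * w ^- n.+1)) N z +
   z ^+ N * J (fun w => F w * ((w - z)^-1 * w ^- N)).
Proof.
move=> zs; elim: N => [|N ih].
  rewrite /psum big_ord0 add0r expr0 mul1r; congr rectI; apply/funext => w.
  by rewrite expr0 invr1 mulr1.
by rewrite ih /psum big_ord_recr /= kern_step// exprS; ring.
Qed.

End CauchyFormula.

Lemma ccont_cst (c : C) : ccont (fun=> c).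
Proof. by move=> z e e0; exists 1 => // w _; rewrite subrr md0. Qed.

(** The expansion of the kernel for [F = 1]: the powers [w ^- i] with [i >= 2] have primitives, so
    the two integrals differ by a remainder that decays geometrically. *)
Lemma kappa_shift (s : R) z : 0 < s -> md z < s / 2 ->
  rectI (fun w => (w - z)^-1) (- s) s (- s) s = rectI (fun w => w^-1) (- s) s (- s) s.
Proof.
move=> s0 zs; have ss : - s <= s by lra.
have one : md (1 : C) <= 1 by rewrite md1.
apply/eqP; rewrite -subr_eq0 -md_eq0 eq_le md_ge0 andbT.
apply: (@geom_le0 _ 32 (md z / s)).
- by rewrite divr_ge0 ?md_ge0 ?ltW.
- by rewrite ler_pdivrMr//; lra.
case=> [|N].
  rewrite expr0 mulr1.
  have := @kern_bound (fun=> 1) s 1 s0 (ccont_cst 1) ltac:(lra) (fun=> one) z 1 zs.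
  have := @kern_step (fun=> 1) s s0 (ccont_cst 1) z 0 zs.
  under eq_fun do rewrite mul1r expr0 invr1 mulr1.
  under [in X in X + _]eq_fun do rewrite mul1r expr1.
  move=> ->; rewrite addrAC subrr add0r mdM mulr1 expr1 => h.
  apply: le_trans (ler_wpM2l (md_ge0 z) h) _; rewrite mulrCA -[leRHS]mulr1 ler_pM2l//.
  by rewrite ler_pdivrMr//; lra.
have := @kern_expand (fun=> 1) s s0 (ccont_cst 1) z N.+1 zs.
under eq_fun do rewrite mul1r.
move=> ->; rewrite /psum big_ord_recl /= expr0 mulr1 big1 ?addr0.
  under [in X in md (X + _ - _)]eq_fun do rewrite mul1r expr1.
  rewrite addrAC subrr add0r mdM mdX.
  have := @kern_bound (fun=> 1) s 1 s0 (ccont_cst 1) ltac:(lra) (fun=> one) z N.+1 zs.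
  rewrite mulr1 => h; apply: le_trans (ler_wpM2l _ h) _; first by rewrite exprn_ge0 ?md_ge0.
  by rewrite mulrCA expr_div_n.
move=> i _; rewrite (@rectI_prim _ _ (fun w => - (i.+1)%:R^-1 * w ^- i.+1)) ?mul0r//.
  exact: (@bcont_kern0 (fun=> 1) s s0 (ccont_cst 1)).
have zs0 : md (0 : C) < s / 2 by rewrite md0; lra.
have := line_away s0 zs0.
have E (w : C) : [/\ w != 0, w != 0, s <= md w & s / 2 <= md (w - 0)] ->
   cder (fun w : C => - (i.+1)%:R^-1 * w ^- i.+1) w (1 * w ^- (bump 0 i).+1).
  move=> [w0 _ _ _]; apply: cder_eqd (cderZ _ (cderV _ (cderX i.+1 (cder_id w)))) _.
    by rewrite expf_neq0.
  have n0 : (i.+1%:R : C) != 0 by rewrite pnatr_eq0.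
  rewrite /bump /= add1n !exprS; move: (i.+1%:R : C) n0 => a n0; field.
  by rewrite n0 w0 expf_neq0.
by move=> [h1 h2]; split=> t _; split; apply: E; [case: (h1 t)|case: (h1 t)|case: (h2 t)|case: (h2 t)].
Qed.

Lemma clC_id (s x y : R) : - s <= x <= s -> - s <= y <= s -> clC s (pt x y) = pt x y.
Proof. by move=> hx hy; rewrite /clC /= !cl_id. Qed.

Lemma clC_md (s : R) z : 0 <= s -> md (clC s z) <= 2 * s.
Proof.
move=> s0; apply: le_trans (md_pt _ _) _.
have h1 := cl_in (complex.Re z) s0; have h2 := cl_in (complex.Im z) s0.
have : `|cl s (complex.Re z)| <= s by rewrite ler_norml.
have : `|cl s (complex.Im z)| <= s by rewrite ler_norml.
lra.
Qed.

(** Cauchy's formula for [F], which is [f] clamped to a square, followed by the expansion of the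
    kernel in powers of [z / w]. *)
Lemma hol_expands0 (f : C -> C) : hol f 0 -> exists b M rho,
  [/\ 0 < rho, 0 <= M & expands f b M rho].
Proof.
move=> [r0 r00 h0].
have [c0 /cder_cont/(_ 1 ltr01)[r1 r10 h1]] : exists c, cder f 0 c by apply: h0; rewrite subr0 md0.
pose r := Num.min r0 r1.
have rr0 : r <= r0 by rewrite ge_min lexx.
have rr1 : r <= r1 by rewrite ge_min lexx orbT.
have r_0 : 0 < r by rewrite lt_min r00.
have df w : md w < r -> exists c, cder f w c by move=> ?; apply: h0; rewrite subr0; lra.
pose K := md (f 0) + 1; have K0 : 0 <= K by have := md_ge0 (f 0); rewrite /K; lra.
have bf w : md w < r -> md (f w) <= K.
  by move=> hw; have := h1 w; rewrite subr0 => /(_ ltac:(lra)); have := md_sub (f w) (f 0); rewrite /K; lra.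
pose u := r / 4; have u0 : 0 < u by rewrite /u; lra.
pose F w := f (clC u w).
have cu w : md (clC u w) < r by have := clC_md w (ltW u0); rewrite /u; lra.
have FK w : md (F w) <= K by apply: bf.
have cF : ccont F.
  move=> z e e0; have [c /cder_cont/(_ e e0)[d d0 h]] := df _ (cu z).
  exists (d / 2); first lra.
  by move=> w hw; apply: h; have := clC_lip z w (ltW u0); rewrite mdB [md (w - z)]mdB in hw *; lra.
have dF x y : - u < x < u -> - u < y < u -> exists c, cder F (pt x y) c.
  move=> hx hy; have [c hc] := df _ (cu (pt x y)); exists c.
  rewrite clC_id in hc; [|lra|lra].
  apply: cder_eq hc; exists (Num.min (Num.min (u - x) (u + x)) (Num.min (u - y) (u + y))).
    by rewrite !lt_min; lra.
  move=> w; rewrite !lt_min => /andP[/andP[a1 a2] /andP[a3 a4]]; rewrite /F [in RHS](ptE w) clC_id -?ptE//.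
    have := md_Re (w - pt x y); rewrite ReB /= ler_norml => /andP[b1 b2]; lra.
  have := md_Im (w - pt x y); rewrite ImB /= ler_norml => /andP[b1 b2]; lra.
pose s := u / 2; have s0 : 0 < s by rewrite /s; lra.
pose J g := rectI g (- s) s (- s) s.
pose kap := J (fun w => w^-1).
have kap0 : kap != 0 := kappa_neq0 s0.
have ss : - s <= s by lra.
have FE z : md z < s / 2 -> F z = f z.
  move=> hz; rewrite /F (ptE z) clC_id//.
    by have := md_Re z; rewrite ler_norml /s in hz *; lra.
  by have := md_Im z; rewrite ler_norml /s in hz *; lra.
have main z : md z < s / 2 -> kap * f z = J (fun w => F w * (w - z)^-1).
  move=> hz.
  have hzx := md_Re z; have hzy := md_Im z.
  rewrite ler_norml in hzx; rewrite ler_norml in hzy.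
  have [c hc] : exists c, cder F z c.
    by rewrite (ptE z); apply: dF; rewrite /s in hz; lra.
  (* The difference quotient is continuous, also at [z], and differentiable elsewhere in the square;
     that its integral vanishes by [goursat_except] is Cauchy's formula. *)
  pose q w := if w == z then c else (F w - F z) * (w - z)^-1.
  have qE w : w != z -> q w = (F w - F z) * (w - z)^-1 by rewrite /q => /negbTE ->.
  have cq : ccont q.
    move=> w e e0; have [->|wz] := eqVneq w z.
      have e20 : 0 < e / 2 by lra.
      have [d d0 h] := hc _ e20; exists d => // v vd; rewrite /q eqxx.
      case: eqVneq => vz; first by rewrite subrr md0.
      rewrite (_ : _ - c = (F v - F z - c * (v - z)) * (v - z)^-1); last first.
        by field; rewrite subr_eq0.
      rewrite mdM mdV ltr_pdivrMr; last by rewrite md_gt0 subr_eq0.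
      apply: le_lt_trans (h v vd) _; rewrite ltr_pM2r; first lra.
      by rewrite md_gt0 subr_eq0.
    have wz' : 0 < md (w - z) by rewrite md_gt0 subr_eq0.
    have [c' /cder_cont hc'] : exists c, cder (fun v => (v - z)^-1) w c.
      by eexists; apply: cderV; [rewrite subr_eq0|apply: cderB; [exact: cder_id|exact: cder_cst]].
    have : rcont (fun t => 0 : C) by move=> *; exists 1 => // *; rewrite subrr md0.
    pose e1 := Num.min 1 (e / (md (F w - F z) + md (w - z)^-1 + 2)).
    have A0 := md_ge0 (F w - F z); have B0 := md_ge0 (w - z)^-1.
    have e10 : 0 < e1 by rewrite lt_min ltr01/= divr_gt0//; lra.
    have e1l : e1 <= 1 by rewrite ge_min lexx.
    have e1r : e1 * (md (F w - F z) + md (w - z)^-1 + 2) <= e by rewrite -ler_pdivlMr ?ge_min ?lexx ?orbT//; lra.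
    have [d1 d10 k1] := cF w _ e10; have [d2 d20 k2] := hc' _ e10 => _.
    exists (Num.min (Num.min d1 d2) (md (w - z))); first by rewrite !lt_min d10 d20.
    move=> v; rewrite !lt_min => /andP[/andP[/k1 E1 /k2 E2] E3].
    rewrite !qE//; last by apply: contraTneq E3 => ->; rewrite mdB ltxx.
    rewrite (_ : _ - _ = (F v - F w) * ((v - z)^-1 - (w - z)^-1) + (F v - F w) * (w - z)^-1 +
      (F w - F z) * ((v - z)^-1 - (w - z)^-1)); last by ring.
    have := mdD ((F v - F w) * ((v - z)^-1 - (w - z)^-1) + (F v - F w) * (w - z)^-1) ((F w - F z) * ((v - z)^-1 - (w - z)^-1)).
    have := mdD ((F v - F w) * ((v - z)^-1 - (w - z)^-1)) ((F v - F w) * (w - z)^-1).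
    rewrite !(mdM, mulrDl) => h3 h4; have := md_ge0 (F v - F w); have := md_ge0 ((v - z)^-1 - (w - z)^-1); nra.
  have q0 : J q = 0.
    apply: (@goursat_except _ q s (complex.Re z) (complex.Im z)) => //; [lra|lra|].
    move=> x y hx hy; rewrite -ptE => wz.
    have [d hd] : exists d, cder F (pt x y) d by apply: dF; rewrite /s in hx hy; lra.
    have wz' : 0 < md (pt x y - z) by rewrite md_gt0 subr_eq0.
    eexists; apply: (@cder_eq _ (fun w => (F w - F z) * (w - z)^-1)).
      exists (md (pt x y - z)) => // v E3; rewrite qE//.
      by apply: contraTneq E3 => ->; rewrite mdB ltxx.
    apply: cderM; first by apply: cderB; [exact: hd|exact: cder_cst].
    by apply: cderV; [rewrite subr_eq0|apply: cderB; [exact: cder_id|exact: cder_cst]].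
  have b0 : bcont (fun w => F w * (w - z)^-1) (- s) s (- s) s.
    have := bcont_kern s0 cF 0 hz; apply: bcont_eq; apply: onlineW (line_away s0 hz) => w _.
    by rewrite expr0 invr1 mulr1.
  have b1 : bcont (fun w => (w - z)^-1) (- s) s (- s) s.
    have := bcont_kern s0 (ccont_cst 1) 0 hz; apply: bcont_eq; apply: onlineW (line_away s0 hz) => w _.
    by rewrite expr0 invr1 mulr1 mul1r.
  have := q0; rewrite /J (@rectI_eq _ (fun w => F w * (w - z)^-1 + (- F z) * (w - z)^-1)).
    rewrite rectID//; last exact: bcontZ.
    rewrite rectIZ// kappa_shift// FE// => /eqP; rewrite mulNr subr_eq0 => /eqP ->.
    by rewrite mulrC.
  by apply: onlineW (line_away s0 hz) => w [_ wz _ _]; rewrite qE//; ring.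
exists (fun n => kap^-1 * J (fun w => F w * w ^- n.+1)), (32 * K / md kap), (s / 2); split.
- lra.
- by rewrite divr_ge0 ?md_ge0//; lra.
move=> z hz N.
have := main z hz; rewrite /J (kern_expand s0 cF N hz) => E.
have -> : f z - psum (fun n => kap^-1 * J (fun w => F w * w ^- n.+1)) N z =
    kap^-1 * (z ^+ N * J (fun w => F w * ((w - z)^-1 * w ^- N))).
  have -> : psum (fun n => kap^-1 * J (fun w => F w * w ^- n.+1)) N z =
      kap^-1 * psum (fun n => J (fun w => F w * w ^- n.+1)) N z.
    by rewrite /psum big_distrr /=; apply: eq_bigr => i _; rewrite mulrA.
  by rewrite -[f z](mulKf kap0) E /J; ring.
rewrite !mdM mdV mdX.
have B := kern_bound s0 cF K0 FK N hz.
have z0 : 0 <= md z ^+ N by rewrite exprn_ge0 ?md_ge0.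
have k1 : 0 < (md kap)^-1 by rewrite invr_gt0 md_gt0.
rewrite (_ : 32 * K / md kap * _ = (md kap)^-1 * (32 * K * (md z / (s / 2)) ^+ N)); last by ring.
rewrite ler_pM2l//; apply: le_trans (ler_wpM2l z0 B) _.
rewrite mulrCA; apply: ler_wpM2l; first lra.
have s20 : 0 < s / 2 by lra.
have m0 := md_ge0 z.
have q1 : 0 <= md z / s by rewrite divr_ge0 ?(ltW s0).
have q2 : md z / s <= md z / (s / 2).
  by apply: ler_wpM2l => //; rewrite lef_pV2 ?posrE//; lra.
by rewrite -expr_div_n; apply: lerXn2r; rewrite ?nnegrE//; exact: le_trans q1 q2.
Qed.

End Cauchy.

(** * Power series, their derivatives and a linear differential equation *)

Section PowerSeries.
Context {R : realType}.
Local Notation C := (Cplx R).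

(** The limit is the supremum of the lower bounds [u n - B n]. The rate [B] is kept because the
    series need explicit remainders. *)
Lemma real_limit (u B : nat -> R) :
  (forall n m, (n <= m)%N -> `|u m - u n| <= B n) ->
  exists l, forall n, `|l - u n| <= B n.
Proof.
move=> h; exists (sup (range (fun n => u n - B n))) => n.
have H m : u m - B m <= u n + B n.
  have [mn|/ltnW nm] := leqP m n.
    have := h _ _ mn; have := h _ _ (leqnn n); rewrite subrr normr0 ler_norml; lra.
  have := h _ _ nm; have := h _ _ (leqnn m); rewrite subrr normr0 ler_norml; lra.
rewrite ler_distl; apply/andP; split.
  by apply: ub_le_sup; [exists (u n + B n) => _ [m _ <-]|exists n].
apply: ge_sup; first by exists (u 0%N - B 0%N), 0%N.
by move=> _ [m _ <-].
Qed.

Lemma cplx_limit (u : nat -> C) (B : nat -> R) :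
  (forall n m, (n <= m)%N -> md (u m - u n) <= B n) ->
  exists l, forall n, md (l - u n) <= 2 * B n.
Proof.
move=> h.
have [a ha] := @real_limit (fun n => complex.Re (u n)) B (fun n m nm =>
  le_trans (eq_ind _ (fun x => `|x| <= _) (md_Re _) _ (ReB _ _)) (h n m nm)).
have [b hb] := @real_limit (fun n => complex.Im (u n)) B (fun n m nm =>
  le_trans (eq_ind _ (fun x => `|x| <= _) (md_Im _) _ (ImB _ _)) (h n m nm)).
exists (pt a b) => n; apply: le_trans (md_le_ReIm _) _; rewrite ReB ImB /=.
by have := ha n; have := hb n; lra.
Qed.

Lemma half_pow (x : R) n : 0 <= x <= 1 / 2 -> x ^+ n <= (1 / 2) ^+ n.
Proof. by move=> /andP[x0 x1]; apply: lerXn2r; rewrite ?nnegrE//; lra. Qed.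

Lemma half_powS (x : R) n : 0 <= x <= 1 / 2 -> x ^+ n.+1 <= (1 / 2) ^+ n.
Proof.
move=> /(half_pow n.+1) h; apply: le_trans h _; rewrite exprS.
have : 0 <= (1 / 2 : R) ^+ n by apply: exprn_ge0; lra.
by move: (_ ^+ n) => y; lra.
Qed.

Lemma psumD (b c : nat -> C) N z : psum (fun n => b n + c n) N z = psum b N z + psum c N z.
Proof. by rewrite /psum -big_split /=; apply: eq_bigr => i _; rewrite mulrDl. Qed.

Lemma psumZ k (b : nat -> C) N z : psum (fun n => k * b n) N z = k * psum b N z.
Proof. by rewrite /psum big_distrr /=; apply: eq_bigr => i _; rewrite mulrA. Qed.

Lemma psumS (b : nat -> C) N z : psum b N.+1 z = psum b N z + b N * z ^+ N.
Proof. by rewrite /psum big_ord_recr. Qed.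

Lemma psum_recl (b : nat -> C) N z : psum b N.+1 z = b 0%N + z * psum (fun n => b n.+1) N z.
Proof.
rewrite /psum big_ord_recl expr0 mulr1 big_distrr /=; congr (_ + _); apply: eq_bigr => i _.
by rewrite exprS mulrCA.
Qed.

Lemma psum_tail (b : nat -> C) (M rho : R) z n m : 0 < rho -> 0 <= M ->
  (forall n, md (b n) <= M * rho ^- n) -> md z <= rho / 2 -> (n <= m)%N ->
  md (psum b m z - psum b n z) <= 2 * M * (md z / rho) ^+ n.
Proof.
move=> r0 M0 hb hz.
have q0 : 0 <= md z / rho by rewrite divr_ge0 ?md_ge0 ?ltW.
have q1 : md z / rho <= 1 / 2 by rewrite ler_pdivrMr//; lra.
set q := md z / rho in q0 q1 *.
suff H j : md (psum b (j + n) z - psum b n z) <= 2 * M * (q ^+ n - q ^+ (j + n)).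
  move=> /subnK <-; apply: le_trans (H _) _.
  apply: ler_wpM2l; first lra.
  by rewrite gerBl exprn_ge0.
elim: j => [|j ih]; first by rewrite !subrr md0 mulr0.
rewrite addSn psumS addrAC; apply: le_trans (mdD _ _) _.
apply: le_trans (lerD ih (_ : _ <= M * q ^+ (j + n))) _.
  rewrite mdM mdX; apply: le_trans (ler_wpM2r _ (hb _)) _; first by rewrite exprn_ge0 ?md_ge0.
  by rewrite expr_div_n mulrAC mulrA.
have qn : 0 <= M * q ^+ (j + n) by rewrite mulr_ge0// exprn_ge0.
rewrite exprS; nra.
Qed.

Lemma pser_sum (b : nat -> C) (M rho : R) : 0 < rho -> 0 <= M ->
  (forall n, md (b n) <= M * rho ^- n) -> exists f, expands f b (4 * M) (rho / 2).
Proof.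
move=> r0 M0 hb.
have H z : {l : C | md z <= rho / 2 -> forall N, md (l - psum b N z) <= 2 * (2 * M * (md z / rho) ^+ N)}.
  apply: cid; have [zr|zr] := pselect (md z <= rho / 2); last by exists 0.
  have [l hl] := cplx_limit (fun n m nm => psum_tail r0 M0 hb zr nm).
  by exists l.
exists (fun z => sval (H z)) => z zr N; apply: le_trans (svalP (H z) (ltW zr) N) _.
have q1 : 0 <= md z / rho by rewrite divr_ge0 ?md_ge0 ?(ltW r0).
have q2 : md z / rho <= md z / (rho / 2).
  by apply: ler_wpM2l; rewrite ?md_ge0// lef_pV2 ?posrE//; lra.
have : (md z / rho) ^+ N <= (md z / (rho / 2)) ^+ N.
  by apply: lerXn2r; rewrite ?nnegrE//; exact: le_trans q1 q2.
by move: (_ ^+ N) (_ ^+ N) => x y; nra.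
Qed.

Lemma expandsW f b (M M' r r' : R) : 0 < r' -> r' <= r -> M <= M' -> 0 <= M ->
  expands f b M r -> expands f b M' r'.
Proof.
move=> r'0 rr MM M0 h z zr N; apply: le_trans (h z (lt_le_trans zr rr) N) _.
have r0 : 0 < r by exact: lt_le_trans rr.
have q1 : 0 <= md z / r by rewrite divr_ge0 ?md_ge0 ?(ltW r0).
have q2 : md z / r <= md z / r'.
  by apply: ler_wpM2l; rewrite ?md_ge0// lef_pV2 ?posrE.
have : (md z / r) ^+ N <= (md z / r') ^+ N.
  by apply: lerXn2r; rewrite ?nnegrE//; exact: le_trans q1 q2.
have : 0 <= (md z / r) ^+ N by rewrite exprn_ge0.
by move: (_ ^+ N) (_ ^+ N) => x y; nra.
Qed.

(** At a point of modulus [rho / 2] two consecutive remainders differ by the term of index [n]. *)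
Lemma expands_coef f b (M rho : R) n : 0 < rho -> expands f b M rho -> md (b n) <= 2 * M * rho ^- n.
Proof.
move=> r0 h.
have M0 : 0 <= M.
  have := h 0; rewrite md0 => /(_ r0 0%N); rewrite expr0 mulr1; apply: le_trans; exact: md_ge0.
apply/ler_addgt0Pl => e e0.
pose z : C := (rho / 2)%:C%C.
have mz : md z = rho / 2 by rewrite md_real ger0_norm//; lra.
have H (t : R) : 0 < t -> t < 1 -> md (b n) * (t * rho) ^+ n <= 2 * M * t ^+ n.
  move=> t0 t1; pose w : C := (t * rho)%:C%C.
  have mw : md w = t * rho by rewrite md_real ger0_norm// mulr_ge0 ?ltW.
  have wr : md w < rho by rewrite mw gtr_pMl.
  have h1 := h w wr n; have h2 := h w wr n.+1.
  have := md_tri (psum b n.+1 w) (f w) (psum b n w).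
  rewrite {1}psumS addrAC subrr add0r mdM mdX mw [md (psum b n.+1 w - _)]mdB.
  move: h1 h2; rewrite mw mulfK ?gt_eqF// => h1 h2 h3.
  have : t ^+ n.+1 <= t ^+ n by rewrite exprS ler_piMl ?exprn_ge0 ?ltW.
  by nra.
have := H (1 / 2) ltac:(lra) ltac:(lra); rewrite exprMn mulrCA [leRHS]mulrC.
rewrite ler_pM2l; last by rewrite exprn_gt0//; lra.
move=> h1; have -> : md (b n) = md (b n) * rho ^+ n * rho ^- n.
  by rewrite mulfK// expf_neq0 ?gt_eqF.
have : md (b n) * rho ^+ n * rho ^- n <= 2 * M * rho ^- n.
  by rewrite ler_wpM2r// invr_ge0 exprn_ge0 ?ltW.
lra.
Qed.

Lemma pow_taylor (z w : C) (r : R) n : md z <= r -> md w <= r ->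
  md (w ^+ n - z ^+ n - n%:R * z ^+ n.-1 * (w - z)) <= (n ^ 2)%:R * r ^+ n.-2 * md (w - z) ^+ 2.
Proof.
move=> zr wr; have r0 : 0 <= r := le_trans (md_ge0 z) zr.
case: n => [|[|n]].
- by rewrite !expr0 subrr !mul0r subr0 md0.
- by rewrite !expr1 /= expr0 !mul1r subrr md0 sqr_ge0.
elim: n => [|n ih].
  rewrite (_ : _ - _ - _ = (w - z) ^+ 2); last by rewrite /=; ring.
  by rewrite mdX /= expr0 mulr1 ler_peMl ?sqr_ge0// ler1n.
rewrite (_ : _ - _ - _ = w * (w ^+ n.+2 - z ^+ n.+2 - n.+2%:R * z ^+ n.+2.-1 * (w - z))
  + n.+2%:R * z ^+ n.+1 * (w - z) ^+ 2); last first.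
  rewrite /= [in n.+3%:R]mulrSr; move: (n.+2%:R : C) => m.
  by rewrite !exprS; ring.
apply: le_trans (mdD _ _) _; rewrite mdM mdM mdM !mdX md_nat.
set d := md (w - z) in ih *.
have d0 : 0 <= d ^+ 2 by rewrite sqr_ge0.
have rn : 0 <= r ^+ n.+1 by rewrite exprn_ge0.
have h1 : md z ^+ n.+1 <= r ^+ n.+1 by apply: lerXn2r; rewrite ?nnegrE ?md_ge0.
have h2 : md w * md (w ^+ n.+2 - z ^+ n.+2 - n.+2%:R * z ^+ n.+2.-1 * (w - z)) <= (n.+2 ^ 2)%:R * r ^+ n.+1 * d ^+ 2.
  apply: le_trans (ler_pM _ _ wr ih) _; rewrite ?md_ge0//.
  by move: ((n.+2 ^ 2)%:R : R) => m; rewrite /= [r ^+ n.+1]exprS le_eqVlt; apply/orP; left; apply/eqP; ring.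
have h3 : n.+2%:R * md z ^+ n.+1 * d ^+ 2 <= n.+2%:R * r ^+ n.+1 * d ^+ 2.
  by rewrite ler_wpM2r// ler_wpM2l.
apply: le_trans (lerD h2 h3) _; rewrite /= -!mulrDl ler_wpM2r// ler_wpM2r// -natrD ler_nat.
by rewrite -!mulnn; lia.
Qed.

Lemma sqn_le_exp4 n : (n ^ 2 <= 4 ^ n)%N.
Proof. by rewrite (_ : 4 = 2 * 2)%N // expnMn mulnn leq_sqr ltnW // ltn_expl. Qed.

Definition dcoef (b : nat -> C) n := n.+1%:R * b n.+1.

(** After [i ^ 2 <= 4 ^ i] the radius [rho / 8] leaves a geometric series of ratio 1/2; the factor
    64 is [8 ^ 2], from the two missing powers in [pow_taylor], and the sum of the series doubles
    it. *)
Lemma psum_taylor (b : nat -> C) (M rho : R) z w N : 0 < rho -> 0 <= M ->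
  (forall n, md (b n) <= M * rho ^- n) -> md z <= rho / 8 -> md w <= rho / 8 ->
  md (psum b N.+1 w - psum b N.+1 z - psum (dcoef b) N z * (w - z)) <=
    128 * M * rho ^- 2 * md (w - z) ^+ 2.
Proof.
move=> r0 M0 hb zr wr.
have -> : psum b N.+1 w - psum b N.+1 z - psum (dcoef b) N z * (w - z) =
   \sum_(i < N.+1) b i * (w ^+ i - z ^+ i - i%:R * z ^+ i.-1 * (w - z)).
  have -> : psum (dcoef b) N z = \sum_(i < N.+1) i%:R * b i * z ^+ i.-1.
    by rewrite big_ord_recl !mul0r add0r.
  rewrite /psum big_distrl /= -!sumrB; apply: eq_bigr => i _.
  by ring.
have d0 : 0 <= md (w - z) ^+ 2 by rewrite sqr_ge0.
apply: le_trans (md_sum _ _ _) _.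
apply: le_trans (_ : _ <= \sum_(i < N.+1) (64 * M * rho ^- 2 * md (w - z) ^+ 2) * (1 / 2) ^+ i) _.
  apply: ler_sum => i _; rewrite mdM.
  have B0 : 0 <= 64 * M * rho ^- 2 * md (w - z) ^+ 2 * (1 / 2) ^+ i.
    have h0 : 0 <= (1 / 2 : R) by lra.
    apply: mulr_ge0; last exact: exprn_ge0.
    by apply: mulr_ge0 => //; apply: mulr_ge0; [lra|rewrite invr_ge0 sqr_ge0].
  have [i0|[i1|[j ij]]] : i = 0%N :> nat \/ i = 1%N :> nat \/ exists j, i = j.+2 :> nat.
    by case: (nat_of_ord i) => [|[|j]]; [left|right; left|right; right; exists j].
  - suff -> : w ^+ i - z ^+ i - i%:R * z ^+ i.-1 * (w - z) = 0 by rewrite md0 mulr0.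
    by rewrite i0; ring.
  - suff -> : w ^+ i - z ^+ i - i%:R * z ^+ i.-1 * (w - z) = 0 by rewrite md0 mulr0.
    by rewrite i1 /=; ring.
  have rn : 0 <= rho ^- i by rewrite invr_ge0 exprn_ge0 ?ltW.
  apply: le_trans (ler_pM _ _ (hb i) (pow_taylor _ zr wr)) _; rewrite ?md_ge0//.
  have /(ler_wpM2l (mulr_ge0 M0 rn)) H : (i ^ 2)%:R * (rho / 8) ^+ i.-2 * md (w - z) ^+ 2 <=
      (4 ^ i)%:R * (rho / 8) ^+ i.-2 * md (w - z) ^+ 2.
    rewrite ler_wpM2r// ler_wpM2r//; last by rewrite ler_nat sqn_le_exp4.
    by rewrite exprn_ge0// divr_ge0 ?(ltW r0).
  apply: le_trans H _; rewrite le_eqVlt; apply/orP; left; apply/eqP.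
  rewrite ij /= natrX -[8]/((2 * 4)%:R) natrM !exprS !expr_div_n !exprMn expr1n; field.
  by rewrite !expf_neq0 ?gt_eqF.
rewrite -big_distrr /= (_ : 128 * M * _ * _ = 64 * M * rho ^- 2 * md (w - z) ^+ 2 * 2); last by ring.
apply: ler_wpM2l.
  by apply: mulr_ge0 => //; apply: mulr_ge0; [lra|rewrite invr_ge0 sqr_ge0].
suff -> : \sum_(i < N.+1) (1 / 2 : R) ^+ i = 2 - (1 / 2) ^+ N.
  by rewrite gerBl exprn_ge0//; lra.
elim: N => [|N ih]; first by rewrite big_ord1 !expr0; ring.
by rewrite big_ord_recr /= ih exprS; field.
Qed.

Lemma dcoef_bound (b : nat -> C) (M rho : R) n : 0 < rho -> 0 <= M ->
  (forall n, md (b n) <= M * rho ^- n) -> md (dcoef b n) <= (2 * M / rho) * (rho / 2) ^- n.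
Proof.
move=> r0 M0 hb; rewrite /dcoef mdM md_nat.
have h : (n.+1%:R : R) <= 2 * 2 ^+ n.
  by rewrite -exprS -natrX ler_nat ltnW // ltn_expl.
apply: le_trans (ler_pM _ _ h (hb _)) _; rewrite ?md_ge0//.
rewrite le_eqVlt; apply/orP; left; apply/eqP.
by rewrite exprS expr_div_n; field; rewrite !expf_neq0 ?gt_eqF.
Qed.

(** The error of the linear approximation is quadratic, uniformly in [z] and [w], and the derivative
    [g] is again given by a power series. Hence derivatives of holomorphic functions are
    holomorphic. *)
Lemma expands_taylor f b (M rho : R) : 0 < rho -> expands f b M rho ->
  exists g (M' rho' K : R), [/\ 0 < rho', 0 <= M', expands g (dcoef b) M' rho', 0 <= K &
    forall z w, md z < rho' -> md w < rho' ->
      md (f w - f z - g z * (w - z)) <= K * md (w - z) ^+ 2].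
Proof.
move=> r0 h.
have M0 : 0 <= M.
  have := h 0; rewrite md0 => /(_ r0 0%N); rewrite expr0 mulr1; apply: le_trans; exact: md_ge0.
have hb n := expands_coef n r0 h.
have M20 : 0 <= 2 * M by lra.
have hd n := dcoef_bound n r0 M20 hb.
have c0 : 0 <= 2 * (2 * M) / rho by rewrite divr_ge0 ?(ltW r0)//; lra.
have r20 : 0 < rho / 2 by lra.
have [g hg] := pser_sum r20 c0 hd.
pose M' := 4 * (2 * (2 * M) / rho).
have M'0 : 0 <= M' by rewrite /M'; lra.
exists g, M', (rho / 16), (128 * (2 * M) * rho ^- 2); split => //; [lra| | |].
- by apply: expandsW hg; rewrite -/M' //; lra.
- by apply: mulr_ge0; [lra|rewrite invr_ge0 sqr_ge0].
move=> z w zr wr; rewrite -subr_le0.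
have hw := h w ltac:(lra); have hz := h z ltac:(lra); have hgz := hg z ltac:(lra).
have ht N := @psum_taylor b (2 * M) rho z w N r0 M20 hb ltac:(lra) ltac:(lra).
pose A := M + M + M' * md (w - z).
have A0 : 0 <= A by rewrite /A; have := mulr_ge0 M'0 (md_ge0 (w - z)); lra.
apply: (@geom_le0 _ _ A (1 / 2)); [lra|lra|] => N.
have pw : (md w / rho) ^+ N.+1 <= (1 / 2) ^+ N.
  by apply: half_powS; rewrite divr_ge0 ?md_ge0 ?(ltW r0)//= ler_pdivrMr//; lra.
have pz : (md z / rho) ^+ N.+1 <= (1 / 2) ^+ N.
  by apply: half_powS; rewrite divr_ge0 ?md_ge0 ?(ltW r0)//= ler_pdivrMr//; lra.
have pz' : (md z / (rho / 2 / 2)) ^+ N <= (1 / 2) ^+ N.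
  have r40 : 0 < rho / 2 / 2 by lra.
  by apply: half_pow; rewrite divr_ge0 ?md_ge0 ?(ltW r40)//= ler_pdivrMr//; lra.
have h1 := hw N.+1; have h2 := hz N.+1; have h4 := ht N.
have h3 := hgz N; rewrite -/M' in h3.
have -> : f w - f z - g z * (w - z) = (f w - psum b N.+1 w) - (f z - psum b N.+1 z)
    - (g z - psum (dcoef b) N z) * (w - z) +
   (psum b N.+1 w - psum b N.+1 z - psum (dcoef b) N z * (w - z)) by ring.
have t1 := mdD (f w - psum b N.+1 w - (f z - psum b N.+1 z) - (g z - psum (dcoef b) N z) * (w - z))
   (psum b N.+1 w - psum b N.+1 z - psum (dcoef b) N z * (w - z)).
have t2 := md_subD (f w - psum b N.+1 w - (f z - psum b N.+1 z)) ((g z - psum (dcoef b) N z) * (w - z)).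
have t3 := md_subD (f w - psum b N.+1 w) (f z - psum b N.+1 z).
rewrite mdM in t2.
have d0 := md_ge0 (w - z).
have := ler_wpM2l M0 pw; have := ler_wpM2l M0 pz => k1 k2.
have := ler_wpM2r d0 (le_trans h3 (ler_wpM2l M'0 pz')) => k3.
rewrite /A; clear - t1 t2 t3 h1 h2 h4 k1 k2 k3; lra.
Qed.

Lemma taylor_cder (f g : C -> C) (rho K : R) z : 0 < rho -> 0 <= K ->
  (forall z w, md z < rho -> md w < rho -> md (f w - f z - g z * (w - z)) <= K * md (w - z) ^+ 2) ->
  md z < rho -> cder f z (g z).
Proof.
move=> r0 K0 h zr e e0; exists (Num.min (rho - md z) (e / (K + 1))).
  by rewrite lt_min subr_gt0 zr divr_gt0//; lra.
move=> w; rewrite lt_min => /andP[h1]; rewrite ltr_pdivlMr; last lra.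
move=> h2; apply: le_trans (h z w zr _) _.
  by have := md_sub w z; lra.
have := md_ge0 (w - z); rewrite expr2; nra.
Qed.

Lemma expands_hol f b (M rho : R) : 0 < rho -> expands f b M rho -> hol f 0.
Proof.
move=> r0 /(expands_taylor r0)[g [M' [r [K [r'0 M'0 hg K0 ht]]]]].
exists r => // w; rewrite subr0 => wr; exists (g w); exact: taylor_cder ht wr.
Qed.

Lemma hol_taylor f : hol f 0 -> exists g (rho K : R), [/\ 0 < rho, 0 <= K, hol g 0 &
    forall z w, md z < rho -> md w < rho ->
      md (f w - f z - g z * (w - z)) <= K * md (w - z) ^+ 2].
Proof.
move=> /hol_expands0[b [M [rho [r0 M0 /(expands_taylor r0)]]]].
move=> [g [M' [r [K [r'0 M'0 hg K0 ht]]]]].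
by exists g, r, K; split => //; exact: expands_hol hg.
Qed.

(** The equation is solved coefficientwise; it is what becomes of integrating a k-th root. [D]
    bounds the inverses of the factors [1 + lam n]; where such a factor is 0, the hypotheses force
    [b n = 0] and [a n = 0]. *)
Lemma expands_ode B b (a : nat -> C) (lam : C) (D M rho : R) : 0 < rho -> 0 <= D ->
  expands B b M rho ->
  (forall n, (1 + lam * n%:R) * a n = b n) -> (forall n, md (a n) <= D * md (b n)) ->
  exists (A A' : C -> C) (r : R), [/\ 0 < r, A 0 = a 0%N,
    forall z, md z < r -> cder A z (A' z) &
    forall z, md z < r -> A z + lam * z * A' z = B z].
Proof.
move=> r0 D0 hB hab hD.
have M0 : 0 <= M.
  have := hB 0; rewrite md0 => /(_ r0 0%N); rewrite expr0 mulr1; apply: le_trans; exact: md_ge0.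
have ha n : md (a n) <= (D * (2 * M)) * rho ^- n.
  apply: le_trans (hD n) _; rewrite -mulrA; apply: ler_wpM2l => //.
  exact: expands_coef hB.
have DM0 : 0 <= D * (2 * M) by rewrite mulr_ge0//; lra.
have [A hA] := pser_sum r0 DM0 ha.
have r20 : 0 < rho / 2 by lra.
have [A' [M' [r [K [r'0 M'0 hA' K0 ht]]]]] := expands_taylor r20 hA.
pose r1 := Num.min (r / 2) (rho / 4).
have r1r : r1 <= r / 2 by rewrite ge_min lexx.
have r1rho : r1 <= rho / 4 by rewrite ge_min lexx orbT.
exists A, A', r1; split.
- by rewrite lt_min; apply/andP; split; lra.
- apply/eqP; rewrite -subr_eq0 -md_eq0 eq_le md_ge0 andbT.
  have := hA 0; rewrite md0 => /(_ r20 1%N); rewrite /psum big_ord1 expr0 mulr1 mul0r expr1 mulr0.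
  by [].
- by move=> z zr; apply: taylor_cder ht _ => //; lra.
move=> z zr; apply/eqP; rewrite -subr_eq0 -md_eq0 eq_le md_ge0 andbT.
pose A1 := 4 * (D * (2 * M)) + M + md lam * md z * M'.
apply: (@geom_le0 _ _ A1 (1 / 2)); [lra|lra|] => N.
have z0 := md_ge0 z.
have h1 := hA z ltac:(lra) N.+1.
have h2 := hA' z ltac:(lra) N.
have h3 := hB z ltac:(lra) N.+1.
have p1 : (md z / (rho / 2)) ^+ N.+1 <= (1 / 2) ^+ N.
  by apply: half_powS; rewrite divr_ge0 ?(ltW r20)//= ler_pdivrMr//; lra.
have p2 : (md z / r) ^+ N <= (1 / 2) ^+ N.
  by apply: half_pow; rewrite divr_ge0 ?(ltW r'0)//= ler_pdivrMr//; lra.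
have p3 : (md z / rho) ^+ N.+1 <= (1 / 2) ^+ N.
  by apply: half_powS; rewrite divr_ge0 ?(ltW r0)//= ler_pdivrMr//; lra.
have E : psum a N.+1 z + lam * z * psum (dcoef a) N z = psum b N.+1 z.
  rewrite !psum_recl -hab mulr0 addr0 mul1r -addrA; congr (_ + _).
  rewrite -mulrA [lam * _]mulrC -mulrA -mulrDr; congr (_ * _).
  rewrite mulrC -psumZ -psumD; rewrite /psum; apply: eq_bigr => i _; congr (_ * _).
  by rewrite -hab /dcoef; ring.
have -> : A z + lam * z * A' z - B z = (A z - psum a N.+1 z) - (B z - psum b N.+1 z) +
   lam * z * (A' z - psum (dcoef a) N z) by rewrite -E; ring.
have t1 := mdD (A z - psum a N.+1 z - (B z - psum b N.+1 z)) (lam * z * (A' z - psum (dcoef a) N z)).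
have t2 := md_subD (A z - psum a N.+1 z) (B z - psum b N.+1 z).
rewrite !mdM in t1.
have l0 : 0 <= md lam * md z by rewrite mulr_ge0 ?md_ge0.
have c40 : 0 <= 4 * (D * (2 * M)) by lra.
have k1 := le_trans h1 (ler_wpM2l c40 p1).
have k2 := ler_wpM2l l0 (le_trans h2 (ler_wpM2l M'0 p2)).
have k3 := le_trans h3 (ler_wpM2l M0 p3).
rewrite /A1; lra.
Qed.

End PowerSeries.

(** * Local inverses and local orders *)

Arguments md : simpl never.



Section Compactness.
Context {R : realType}.
Local Notation C := (Cplx R).

Lemma pt_continuous : continuous (fun p : R * R => pt p.1 p.2 : C).
Proof.
move=> p; apply/cvgrPdist_lt => e e0.
have /complex_realP[r er] : e \is Num.real by rewrite realE (ltW e0).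
move: e0; rewrite er ltcR => r0.
have r20 : 0 < r / 2 by rewrite divr_gt0.
exists (ball p.1 (r / 2), ball p.2 (r / 2)); first by split; exact: nbhsx_ballx.
move=> q [/= h1 h2]; rewrite norm_md ltcR ptB; apply: le_lt_trans (md_pt _ _) _.
by move: h1 h2; rewrite /ball /=; lra.
Qed.

Lemma md_continuous : continuous (@md R).
Proof.
move=> z; have FF : Filter (nbhs z) by exact: nbhs_filter.
apply/cvgrPdist_lt => e e0; apply/near_md; exists e => // w hw.
rewrite ltr_distl; have := md_sub z w; have := md_sub w z; rewrite [md (z - w)]mdB; lra.
Qed.

Lemma compact_disc (r : R) : compact [set z : C | md z <= r].
Proof.
apply: (@subclosed_compact _ _ ((fun p : R * R => pt p.1 p.2 : C) @` (`[- r, r] `*` `[- r, r]))).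
- have -> : [set z : C | md z <= r] = @md R @^-1` [set x | x <= r] by [].
  by apply: closed_comp => [z _|]; [exact: md_continuous|exact: closed_le].
- apply: continuous_compact; first exact: continuous_subspaceT pt_continuous.
  by apply: compact_setX; exact: segment_compact.
- move=> z /= zr; exists (complex.Re z, complex.Im z); last by rewrite -ptE.
  split; rewrite /= in_itv /= -ler_norml.
    exact: le_trans (md_Re z) zr.
  exact: le_trans (md_Im z) zr.
Qed.

Lemma compact_min (A : set C) (phi : C -> R) : compact A -> A !=set0 ->
  (forall z, A z -> forall e : R, 0 < e -> exists2 d : R, 0 < d &
     forall w, A w -> md (w - z) < d -> `|phi w - phi z| < e) ->
  exists2 c, A c & forall z, A z -> phi c <= phi z.
Proof.
move=> cA A0 h; have [|c] := @compact_EVT_min _ R phi A A0 cA.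
  apply/subspace_continuousP => z Az; apply/cvgrPdist_lt => e e0.
  have [d d0 k] := h z Az e e0; apply/near_md; exists d => // w wd Aw.
  by rewrite distrC; exact: k.
by rewrite inE => Ac hc; exists c => // z Az; apply: hc; rewrite inE.
Qed.

End Compactness.

Section LocalAnalysis.
Context {R : realType}.
Local Notation C := (Cplx R).

Lemma cder_shift f (a z c : C) : cder f (a + z) c <-> cder (fun w => f (a + w)) z c.
Proof.
split=> h e e0; have [d d0 k] := h e e0; exists d => // w hw.
  by have := k (a + w); rewrite opprD addrACA subrr add0r; apply.
have := k (w - a); rewrite addrCA subrr addr0 opprD addrA.
rewrite (_ : w - a - z = w - (a + z)); last by ring.
by apply.
Qed.

Lemma hol_shift f (a z : C) : hol f (a + z) <-> hol (fun w => f (a + w)) z.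
Proof.
split=> -[e e0 h]; exists e => // w hw.
  have [|c hc] := h (a + w); first by rewrite opprD addrACA subrr add0r.
  by exists c; apply/cder_shift.
have [|c hc] := h (w - a); first by rewrite -addrA -opprD.
by exists c; rewrite -[w](subrKC a); apply/cder_shift.
Qed.

(** The minimum of [|f z - y|] over the closed disc is attained inside, since [|f z - f 0| >= r / 2]
    on the circle. If it were positive, a step from [z] in the direction [y - f z] would lower
    it. *)
Lemma near_identity_surj (f : C -> C) (r : R) y : 0 < r ->
  (forall z w, md z <= r -> md w <= r -> md (f z - f w - (z - w)) <= 1 / 2 * md (z - w)) ->
  md (y - f 0) < r / 4 -> exists2 z, md z < r & f z = y.
Proof.
move=> r0 h hy.
have lip z w : md z <= r -> md w <= r -> md (f z - f w) <= 3 / 2 * md (z - w).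
  move=> zr wr; have := mdD (f z - f w - (z - w)) (z - w); rewrite subrK.
  by have := h z w zr wr; lra.
have [||z /= zr hz] := @compact_min R _ (fun z => md (f z - y)) (@compact_disc R r).
- by exists (0 : C); rewrite /= md0 ltW.
- move=> z zr e e0; exists (e / 2); first lra.
  move=> w wr wz; have := lip w z wr zr.
  have := md_sub (f w - y) (f z - y); have := md_sub (f z - y) (f w - y).
  have E (a b : C) : a - y - (b - y) = a - b by ring.
  rewrite !E.
  rewrite [md (f z - f w)]mdB ltr_distl; lra.
have m0 : md (0 : C) <= r by rewrite md0 ltW.
have hz0 := hz 0 m0; rewrite [md (f 0 - y)]mdB in hz0.
have zr' : md z < r.
  have := lip z 0 zr m0; have := h z 0 zr m0; rewrite !subr0 => h1 h2.
  have := md_sub z (z - (f z - f 0)).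
  rewrite (_ : z - (z - (f z - f 0)) = (f z - y) + (y - f 0)); last by ring.
  have := mdD (f z - y) (y - f 0); rewrite [md (z - _)]mdB; lra.
exists z => //; apply/eqP; rewrite -subr_eq0 -md_eq0; apply: contraT => fy.
have d0 : 0 < md (f z - y) by rewrite lt_neqAle eq_sym fy md_ge0.
pose d := md (f z - y).
pose s := Num.min 1 ((r - md z) / d).
have s0 : 0 < s by rewrite lt_min ltr01/= divr_gt0// subr_gt0.
have s1 : s <= 1 by rewrite ge_min lexx.
have sd : s * d <= r - md z by rewrite -ler_pdivlMr// ge_min lexx orbT.
pose z' := z + s%:C%C * (y - f z).
have mz' : md (z' - z) = s * d.
  by rewrite /z' addrAC subrr add0r mdM md_real ger0_norm ?ltW// [md (y - _)]mdB.
have z'r : md z' <= r by have := md_sub z' z; lra.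
have := h z' z z'r zr; rewrite mz' => h1.
have := hz z' z'r; rewrite -/d.
have -> : f z' - y = (f z' - f z - (z' - z)) + (1 - s)%:C%C * (f z - y).
  by rewrite rmorphB /= /z'; ring.
have := mdD (f z' - f z - (z' - z)) ((1 - s)%:C%C * (f z - y)).
rewrite [md (_ * (f z - y))]mdM md_real ger0_norm; last lra.
rewrite -/d; have : 0 < s * d by rewrite mulr_gt0.
nra.
Qed.

(** A local coordinate [T] at [z0] with inverse [S]. The image of the [r]-disc under [T] contains
    the [rho]-disc but may be larger, so [S] inverts [T] over the latter only. *)
Definition biholo (T S : C -> C) z0 (r rho : R) :=
  [/\ 0 < r, 0 < rho, T z0 = 0,
     (forall w, md (w - z0) < r -> exists2 c, c != 0 & cder T w c) /\
     (forall w w', md (w - z0) < r -> md (w' - z0) < r -> T w = T w' -> w = w')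
   & forall v, md v < rho -> [/\ md (S v - z0) < r, T (S v) = v & exists2 d, d != 0 & cder S v d]].

(** Near 0 the map [c^-1 f] is the identity up to a map of Lipschitz constant 1/2, which gives
    injectivity, and surjectivity by [near_identity_surj]. *)
Lemma ift (f : C -> C) (c : C) (r0 : R) : 0 < r0 -> hol f 0 -> f 0 = 0 -> cder f 0 c -> c != 0 ->
  exists S r rho, biholo f S 0 r rho /\ r <= r0.
Proof.
move=> r00 hf f0 fc c0; have [g [r1 [K [r10 K0 hg ht]]]] := hol_taylor hf.
have gc : g 0 = c by apply: cder_uniq fc; apply: taylor_cder ht _; rewrite ?md0.
have mc : 0 < md c by rewrite md_gt0.
have [_ /cder_cont/(_ (md c / 4) ltac:(lra))[r2 r20 hg']] : exists c, cder g 0 c.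
  by have [e e0 h] := hg; apply: h; rewrite subr0 md0.
pose r := Num.min (Num.min (r1 / 2) (r2 / 2)) (Num.min r0 (md c / (16 * (K + 1)))).
have [ra rb rc rd] : [/\ r <= r1 / 2, r <= r2 / 2, r <= r0 & r <= md c / (16 * (K + 1))].
  by rewrite /r !ge_min !lexx ?orbT.
have r_0 : 0 < r by rewrite /r !lt_min; rewrite divr_gt0// divr_gt0// divr_gt0 ?r00//; lra.
have Kr : 16 * (K + 1) * r <= md c by rewrite mulrC -ler_pdivlMr//; lra.
have strict z w : md z <= r -> md w <= r -> md (f z - f w - c * (z - w)) <= 1 / 2 * md c * md (z - w).
  move=> zr wr.
  have := ht w z ltac:(lra) ltac:(lra).
  have := hg' w; rewrite subr0 gc => /(_ ltac:(lra)) h1 h2.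
  rewrite (_ : _ - c * _ = (f z - f w - g w * (z - w)) + (g w - c) * (z - w)); last by ring.
  apply: le_trans (mdD _ _) _; rewrite mdM.
  have zw : md (z - w) <= 2 * r by have := md_subD z w; lra.
  have z0 := md_ge0 (z - w).
  have : (md (g w - c)) * md (z - w) <= md c / 4 * md (z - w) by rewrite ler_wpM2r// ltW.
  have : K * md (z - w) ^+ 2 <= md c / 4 * md (z - w).
    rewrite expr2 mulrA ler_wpM2r//; nra.
  lra.
have lower z w : md z <= r -> md w <= r -> 1 / 2 * md c * md (z - w) <= md (f z - f w).
  move=> zr wr; have := strict z w zr wr; have := md_sub (c * (z - w)) (c * (z - w) - (f z - f w)).
  have E : c * (z - w) - (c * (z - w) - (f z - f w)) = f z - f w by ring.
  rewrite E mdM [md (_ - (f z - f w))]mdB; lra.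
pose F z := c^-1 * f z.
have FH z w : md z <= r -> md w <= r -> md (F z - F w - (z - w)) <= 1 / 2 * md (z - w).
  move=> zr wr; rewrite (_ : _ - _ = c^-1 * (f z - f w - c * (z - w))); last by rewrite /F; field.
  rewrite mdM mdV mulrC ler_pdivrMr//; have := strict z w zr wr; lra.
pose rho := md c * r / 4.
have rho0 : 0 < rho by rewrite /rho divr_gt0 ?mulr_gt0.
have H v : {z : C | md v < rho -> md z < r /\ f z = v}.
  apply: cid; have [hv|hv] := pselect (md v < rho); last by exists 0.
  have [|z zr zE] := @near_identity_surj F r (c^-1 * v) r_0 FH.
    rewrite /F f0 mulr0 subr0 mdM mdV mulrC ltr_pdivrMr//; move: hv; rewrite /rho; lra.
  by exists z => _; split => //; exact: (mulfI (invr_neq0 c0) zE).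
pose S v := sval (H v).
have hS v : md v < rho -> md (S v) < r /\ f (S v) = v by exact: svalP (H v).
have fd w : md w < r -> cder f w (g w) by move=> wr; apply: taylor_cder ht _ => //; lra.
have gn0 w : md w < r -> g w != 0.
  move=> wr; have := hg' w; rewrite subr0 gc => /(_ ltac:(lra)) h1.
  by rewrite -md_gt0; have := md_sub c (g w); rewrite mdB; lra.
exists S, r, rho; split => //; split => //.
  split=> [w|w w']; rewrite subr0.
    by move=> wr; exists (g w); [exact: gn0|exact: fd].
  rewrite subr0 => wr wr' E; apply/eqP; rewrite -subr_eq0 -md_eq0 eq_le md_ge0 andbT.
  have := lower w w' (ltW wr) (ltW wr'); rewrite E subrr md0; have := md_ge0 (w - w'); nra.
move=> v vr; have [Sr fS] := hS v vr; rewrite subr0; split => //.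
exists (g (S v))^-1; first by rewrite invr_neq0// gn0.
have gS := gn0 _ Sr; have mg : 0 < md (g (S v)) by rewrite md_gt0.
move=> e e0.
have e10 : 0 < e * md (g (S v)) * md c / 2 by rewrite !divr_gt0 ?mulr_gt0.
have [d d0 hd] := fd _ Sr _ e10.
exists (Num.min (rho - md v) (d * md c / 2)).
  by rewrite lt_min subr_gt0 vr divr_gt0// mulr_gt0.
move=> u; rewrite lt_min => /andP[h1 h2].
have ur : md u < rho by have := md_sub u v; lra.
have [Su fSu] := hS u ur.
have := lower (S u) (S v) (ltW Su) (ltW Sr); rewrite fS fSu => L.
have SS : md (S u - S v) < d.
  have : md c * md (S u - S v) < md c * d by lra.
  by rewrite ltr_pM2l.
have := hd _ SS; rewrite fS fSu => h3.
rewrite (_ : _ - _ - _ = - (g (S v))^-1 * (u - v - g (S v) * (S u - S v))); last by field.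
rewrite mdM mdN mdV mulrC ler_pdivrMr//; apply: le_trans h3 _.
rewrite (_ : _ * _ * _ / 2 * _ = e * md (g (S v)) * (1 / 2 * md c * md (S u - S v))); last by field.
rewrite [e * md (u - v) * _]mulrAC; apply: ler_wpM2l => //.
by rewrite mulr_ge0 ?ltW.
Qed.

(** The root is taken by inverting [x |-> (x0 + x) ^+ n] near 0, for a root [x0] of [A 0], and
    composing with [A]. *)
Lemma hol0_root (A : C -> C) n : (0 < n)%N -> hol A 0 -> A 0 != 0 ->
  exists B, hol B 0 /\ exists2 e : R, 0 < e & forall z, md z < e -> B z ^+ n = A z.
Proof.
move=> n0 hA A0.
have [x0 hx0] : exists x0 : C, x0 ^+ n = A 0.
  by exists (n.-root (A 0)); rewrite rootCK.
have x00 : x0 != 0 by apply: contraNneq A0 => x00; rewrite -hx0 x00 expr0n gtn_eqF.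
pose p x := (x0 + x) ^+ n - A 0.
have dp x : cder p x (n%:R * (x0 + x) ^+ n.-1).
  apply: cder_eqd (cderB (cderX n (cderD (cder_cst x0 x) (cder_id x))) (cder_cst _ _)) _.
  by rewrite add0r mulr1 subr0.
have [||||S [r [rho [[r0 rho0 p0 [dp' inj] hS] _]]]] := @ift p (n%:R * x0 ^+ n.-1) 1 ltr01.
- by exists 1 => // w _; eexists; exact: dp.
- by rewrite /p addr0 hx0 subrr.
- by have := dp 0; rewrite addr0.
- by rewrite mulf_neq0 ?expf_neq0// pnatr_eq0 -lt0n.
have [e e0 hA'] := hA.
have [_ /cder_cont/(_ rho rho0)[d d0 hd]] : exists c, cder A 0 c.
  by apply: hA'; rewrite subr0 md0.
exists (fun z => x0 + S (A z - A 0)); split; last first.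
  exists d => // z zd; have := hd z; rewrite subr0 => /(_ zd)/hS[_ + _].
  by rewrite /p => /eqP; rewrite subr_eq subrK => /eqP.
exists (Num.min e d); first by rewrite lt_min e0.
move=> w; rewrite lt_min => /andP[/hA'[c hc] /hd/hS[_ _ [c' _ hc']]].
exists (0 + c' * (c - 0)); apply: cderD; first exact: cder_cst.
exact: (cder_comp (f := fun z => A z - A 0)) (cderB hc (cder_cst _ _)) hc'.
Qed.

End LocalAnalysis.

Lemma int_lt_diff (n m : int) : n < m -> exists2 j : nat, (0 < j)%N & m = n + j%:Z.
Proof. by move=> nm; exists `|(m - n)%R|%N; lia. Qed.

(** * Orders of zeros and poles, and the normal form of a k-differential *)

Section Orders.
Context {R : realType}.
Local Notation C := (Cplx R).

Implicit Types (f g T A B F : C -> C) (z w : C) (P Q : C -> Prop).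

Definition dC f z : C := derive1 f z.

Lemma cder_dC f z (c : C) : cder f z c -> dC f z = c.
Proof. exact: cder_derive1. Qed.

Definition nearC z0 (P : C -> Prop) := exists2 e : R, 0 < e & forall w, md (w - z0) < e -> P w.
Definition dnearC z0 (P : C -> Prop) := nearC z0 (fun w => w != z0 -> P w).

Lemma nearCI z0 P Q : nearC z0 P -> nearC z0 Q -> nearC z0 (fun w => P w /\ Q w).
Proof.
move=> [e e0 h] [d d0 k]; exists (Num.min e d); first by rewrite lt_min e0.
by move=> w; rewrite lt_min => /andP[/h ? /k].
Qed.

Lemma nearCW z0 (P Q : C -> Prop) : (forall w, P w -> Q w) -> nearC z0 P -> nearC z0 Q.
Proof. by move=> h [e e0 k]; exists e => // w /k/h. Qed.

Lemma nearCT z0 (P : C -> Prop) : (forall w, P w) -> nearC z0 P.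
Proof. by move=> h; exists 1. Qed.

Lemma near_md_lt z0 (r : R) : md z0 < r -> nearC z0 (fun w => md w < r).
Proof. by move=> zr; exists (r - md z0); [rewrite subr_gt0|move=> w; exact: md_lt_ball]. Qed.

Lemma nearC_self z0 (P : C -> Prop) : nearC z0 P -> P z0.
Proof. by move=> [e e0]; apply; rewrite subrr md0. Qed.

Lemma nearC_nearC z0 P : nearC z0 P -> nearC z0 (fun w => nearC w P).
Proof.
move=> [e e0 h]; exists e => // w we; exists (e - md (w - z0)); first by rewrite subr_gt0.
by move=> v hv; apply: h; have := md_tri v w z0; lra.
Qed.

Lemma dnearC_near z0 P : dnearC z0 P <-> \forall w \near z0^', P w.
Proof. by split=> /dnear_md. Qed.

Lemma cder_nearC f z c : cder f z c -> forall e : R, 0 < e -> nearC z (fun w => md (f w - f z) < e).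
Proof. by move=> /cder_cont h e /h. Qed.

Lemma hol_cder f z : hol f z -> exists c, cder f z c.
Proof. exact: nearC_self. Qed.

Lemma hol_near f z : hol f z -> nearC z (hol f).
Proof. exact: nearC_nearC. Qed.

Lemma hol_cst (c z : C) : hol (fun=> c) z.
Proof. by apply: nearCT => w; exists 0; exact: cder_cst. Qed.

Lemma hol_id (z : C) : hol id z.
Proof. by apply: nearCT => w; exists 1; exact: cder_id. Qed.

Lemma holD f g z : hol f z -> hol g z -> hol (fun w => f w + g w) z.
Proof.
move=> hf hg; apply: nearCW (nearCI hf hg) => w [[c hc] [d hd]].
by exists (c + d); exact: cderD.
Qed.

Lemma holB f g z : hol f z -> hol g z -> hol (fun w => f w - g w) z.
Proof.
move=> hf hg; apply: nearCW (nearCI hf hg) => w [[c hc] [d hd]].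
by exists (c - d); exact: cderB.
Qed.

Lemma holM f g z : hol f z -> hol g z -> hol (fun w => f w * g w) z.
Proof.
move=> hf hg; apply: nearCW (nearCI hf hg) => w [[c hc] [d hd]].
by exists (c * g w + f w * d); exact: cderM.
Qed.

Lemma holX f n z : hol f z -> hol (fun w => f w ^+ n) z.
Proof. by move=> hf; apply: nearCW hf => w [c hc]; eexists; exact: cderX hc. Qed.

Lemma hol_neq0 f z : hol f z -> f z != 0 -> nearC z (fun w => f w != 0).
Proof.
move=> /hol_cder[c /cder_nearC h] f0; have m0 : 0 < md (f z) by rewrite md_gt0.
apply: nearCW (h _ m0) => w hw; rewrite -md_gt0.
by have := md_sub (f z) (f w); rewrite mdB; lra.
Qed.

Lemma holV f z : hol f z -> f z != 0 -> hol (fun w => (f w)^-1) z.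
Proof.
move=> hf f0; apply: nearCW (nearCI hf (hol_neq0 hf f0)) => w [[c hc] fw].
by eexists; exact: cderV hc.
Qed.

Lemma holXz f (n : int) z : hol f z -> f z != 0 -> hol (fun w => f w ^ n) z.
Proof.
case: n => n hf f0; first exact: holX.
by rewrite /exprz; apply: holV; [exact: holX|rewrite expf_neq0].
Qed.

Lemma nearC_comp f z P : (exists c, cder f z c) -> nearC (f z) P -> nearC z (fun w => P (f w)).
Proof. by move=> [c /cder_nearC h] [e e0 k]; apply: nearCW (h e e0) => w /k. Qed.

Lemma hol_comp f g z : hol f z -> hol g (f z) -> hol (g \o f) z.
Proof.
move=> hf hg; apply: nearCW (nearCI hf (nearC_comp (hol_cder hf) hg)) => w [[c hc] [d hd]].
by exists (d * c); exact: cder_comp.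
Qed.

Lemma hol_eq f g z : nearC z (fun w => f w = g w) -> hol f z -> hol g z.
Proof.
move=> E hf; apply: nearCW (nearCI (nearC_nearC E) hf) => w [Ew [c hc]].
by exists c; exact: cder_eq hc.
Qed.

Lemma dCP f z : (exists c, cder f z c) -> cder f z (dC f z).
Proof. by move=> [c hc]; rewrite (cder_dC hc). Qed.

Lemma dC_eq f g z : nearC z (fun w => f w = g w) -> (exists c, cder f z c) ->
  dC f z = dC g z.
Proof. by move=> E [c hc]; rewrite (cder_dC hc) (cder_dC (cder_eq E hc)). Qed.

Lemma dC_shift f (a z : C) : (exists c, cder f (a + z) c) ->
  dC (fun w => f (a + w)) z = dC f (a + z).
Proof. by move=> [c hc]; rewrite (cder_dC hc); apply: cder_dC; apply/cder_shift. Qed.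

Lemma nearC_shift z0 P : nearC z0 P <-> nearC 0 (fun w => P (z0 + w)).
Proof.
split=> -[e e0 h]; exists e => // w hw.
  by apply: h; rewrite addrAC subrr add0r -[w]subr0.
by rewrite -[w](subrKC z0); apply: h; rewrite subr0.
Qed.

Lemma hol_shift0 f z : hol f z <-> hol (fun w => f (z + w)) 0.
Proof. by have := hol_shift f z 0; rewrite addr0. Qed.

Lemma hol_derive f z : hol f z -> hol (dC f) z.
Proof.
move=> hf; have := hf; rewrite hol_shift0 => /hol_taylor[g [r [K [r0 K0 hg ht]]]].
apply/hol_shift0; apply: hol_eq hg.
have : nearC 0 (fun w => exists c, cder f (z + w) c) := iffLR (nearC_shift z _) hf.
move=> [e e0 h]; exists (Num.min r e); first by rewrite lt_min r0.
move=> w; rewrite lt_min subr0 => /andP[wr we].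
rewrite -dC_shift; last by apply: h; rewrite subr0.
by rewrite (cder_dC (taylor_cder r0 K0 ht wr)).
Qed.

(** [n] is the index of the first nonzero Taylor coefficient, and [g] the sum of the shifted
    series. *)
Lemma hol_order f z0 : hol f z0 -> nearC z0 (fun w => f w = 0) \/
  exists n g, [/\ hol g z0, g z0 != 0 & nearC z0 (fun w => f w = (w - z0) ^+ n * g w)].
Proof.
move=> /hol_shift0 /hol_expands0[b [M [rho [r0 M0 hb]]]].
have [allz|/existsNP[n0 bn0]] := pselect (forall n, b n = 0).
  left; apply/nearC_shift; exists (rho / 2); first by rewrite divr_gt0.
  move=> w; rewrite subr0 => wr; apply/eqP; rewrite -md_eq0 eq_le md_ge0 andbT.
  apply: (@geom_le0 _ _ M (md w / rho)); first by rewrite divr_ge0 ?md_ge0 ?(ltW r0).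
    by rewrite ler_pdivrMr//; lra.
  move=> N; have := hb w ltac:(lra) N; rewrite /psum big1 ?subr0//.
  by move=> i _; rewrite allz mul0r.
right; have ex : exists n, b n != 0 by exists n0; exact/eqP.
case: (ex_minnP ex) => n bn mn.
pose c j := b (n + j)%N.
have hc j : md (c j) <= (2 * M * rho ^- n) * rho ^- j.
  by apply: le_trans (expands_coef _ r0 hb) _; rewrite exprD invfM mulrA.
have c0 : 0 <= 2 * M * rho ^- n by rewrite mulr_ge0 ?invr_ge0 ?exprn_ge0 ?(ltW r0)//; lra.
have [g hg] := pser_sum r0 c0 hc.
have r20 : 0 < rho / 2 by lra.
have g0 : g 0 = b n.
  apply/eqP; rewrite -subr_eq0 -md_eq0 eq_le md_ge0 andbT.
  have := hg 0; rewrite md0 => /(_ r20 1%N).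
  by rewrite /psum big_ord1 expr0 mulr1 mul0r expr1 mulr0 /c addn0.
exists n, (fun w => g (w - z0)); split.
- apply/hol_shift0; apply: hol_eq (expands_hol r20 hg).
  by apply: nearCT => w; rewrite addrAC subrr add0r.
- by rewrite subrr g0.
apply/nearC_shift; exists (rho / 4); first lra.
move=> w; rewrite subr0 addrAC subrr add0r => wr.
have w0 := md_ge0 w.
apply/eqP; rewrite -subr_eq0 -md_eq0 eq_le md_ge0 andbT.
apply: (@geom_le0 _ _ (M + md w ^+ n * (4 * (2 * M * rho ^- n))) (1 / 2)); [lra|lra|] => N.
have h1 := hb w ltac:(lra) (n + N)%N; have h2 := hg w ltac:(lra) N.
have E : psum b (n + N)%N w = w ^+ n * psum c N w.
  rewrite /psum big_split_ord /= big1 ?add0r.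
    by rewrite big_distrr /=; apply: eq_bigr => i _; rewrite exprD mulrCA.
  move=> i _; suff -> : b i = 0 by rewrite mul0r.
  by apply/eqP; apply: contraT => /mn; rewrite leqNgt ltn_ord.
rewrite E in h1.
have -> : f (z0 + w) - w ^+ n * g w = (f (z0 + w) - w ^+ n * psum c N w) - w ^+ n * (g w - psum c N w).
  by ring.
apply: le_trans (md_subD _ _) _; rewrite mulrDl; apply: lerD.
  apply: le_trans h1 _; apply: ler_wpM2l => //.
  have q0 : 0 <= md w / rho by rewrite divr_ge0 ?(ltW r0).
  have q1 : md w / rho <= 1 / 2 by rewrite ler_pdivrMr//; lra.
  rewrite exprD; apply: le_trans (_ : 1 * (1 / 2) ^+ N <= _); last by rewrite mul1r.
  apply: ler_pM; rewrite ?exprn_ge0//; last by apply: half_pow; rewrite q0.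
  by apply: exprn_ile1 => //; lra.
rewrite mdM mdX -mulrA; apply: ler_wpM2l; first by rewrite exprn_ge0.
apply: le_trans h2 _; apply: ler_wpM2l; first lra.
by apply: half_pow; rewrite divr_ge0 ?(ltW r20)//= ler_pdivrMr//; lra.
Qed.

Lemma order_atP f z (n : int) : order_at f z n <->
  exists g, [/\ hol g z, g z != 0 & dnearC z (fun w => f w = (w - z) ^ n * g w)].
Proof.
split=> -[g [h1 h2 h3]]; exists g; split => //; try exact/holP; exact/dnearC_near.
Qed.

Lemma mero_order f z : meromorphic_at f z ->
  dnearC z (fun w => f w = 0) \/ exists n : int, order_at f z n.
Proof.
move=> [n [g [/holP hg /dnearC_near hn]]].
case: (hol_order hg) => [g0|[m [h [hh h0 hm]]]].
  left; apply: nearCW (nearCI hn g0) => w [E gw] wz.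
  move: (E wz); rewrite gw => /eqP; rewrite mulf_eq0 expf_eq0 subr_eq0 (negbTE wz) andbF.
  by move/eqP.
right; exists (m%:Z - n%:Z); apply/order_atP; exists h; split => //.
apply: nearCW (nearCI hn hm) => w [E Em] wz.
have wz0 : w - z != 0 by rewrite subr_eq0.
apply: (mulfI (expf_neq0 n wz0)); rewrite E// Em mulrA [in RHS]exprnP -expfzDr//.
by rewrite subrKC.
Qed.

Lemma order_at_uniq f z (n m : int) : order_at f z n -> order_at f z m -> n = m.
Proof.
wlog : n m / n < m => [hw|nm].
  by move=> h1 h2; case: (ltgtP n m) => // h; [exact: hw|apply/esym; exact: hw].
move=> /order_atP[g [hg g0 hn]] /order_atP[h [hh h0 hm]]; exfalso.
have [c hc] := hol_cder hg; have [d hd] := hol_cder hh.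
have mg : 0 < md (g z) by rewrite md_gt0.
have [e e0 H] := nearCI (nearCI hn hm) (nearCI (cder_nearC hc (e := md (g z) / 2) ltac:(lra)) (cder_nearC hd ltr01)).
have mh := md_ge0 (h z).
pose t := Num.min (Num.min (e / 2) 1) (md (g z) / (4 * (md (h z) + 1))).
have t0 : 0 < t by rewrite /t !lt_min !divr_gt0 ?ltr01//; lra.
have [te t1 tg] : [/\ t <= e / 2, t <= 1 & t <= md (g z) / (4 * (md (h z) + 1))].
  by rewrite /t !ge_min !lexx ?orbT.
have [] := H (z + t%:C%C); first by rewrite addrAC subrr add0r md_real ger0_norm; lra.
rewrite addrAC subrr add0r => -[E1 E2] [].
have wz : z + t%:C%C != z.
  by rewrite -subr_eq0 addrAC subrr add0r -md_gt0 md_real ger0_norm ?(ltW t0).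
have tC : (t%:C%C : C) != 0 by rewrite -md_gt0 md_real ger0_norm ?(ltW t0).
have := E1 wz; rewrite E2//.
have [j j0 ->] := int_lt_diff nm.
rewrite expfzDr// -mulrA => /(mulfI (expfz_neq0 n tC)) E h3 h4.
have : md (g (z + t%:C%C)) <= t * (md (h z) + 1).
  rewrite -E mdM -exprnP mdX md_real (ger0_norm (ltW t0)).
  apply: ler_pM; rewrite ?exprn_ge0 ?md_ge0 ?(ltW t0)//.
    by case: j j0 {E} => // j _; rewrite exprS ler_piMr ?(ltW t0)// exprn_ile1// ltW.
  by have := md_sub (h (z + t%:C%C)) (h z); lra.
move: tg; rewrite ler_pdivlMr; last lra.
have := md_sub (g z) (g (z + t%:C%C)); rewrite mdB; lra.
Qed.

Lemma hol_simple T z0 : hol T z0 -> dC T z0 != 0 ->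
  exists g, [/\ hol g z0, g z0 != 0 & nearC z0 (fun w => T w - T z0 = (w - z0) * g w)].
Proof.
move=> hT dT; have hT' : hol (fun w => T w - T z0) z0 by apply: holB => //; exact: hol_cst.
have hd : cder (fun w => T w - T z0) z0 (dC T z0).
  by apply: cder_eqd (cderB (dCP (hol_cder hT)) (cder_cst _ _)) _; rewrite subr0.
case: (hol_order hT') => [T0|[n [g [hg g0 hn]]]].
  case/eqP: dT; apply: (cder_uniq hd); apply: cder_eq (cder_cst 0 z0).
  by apply: nearCW T0 => w ->.
case: n hn => [|[|n]] hn.
- by have := nearC_self hn; rewrite subrr expr0 mul1r => /eqP; rewrite eq_sym (negbTE g0).
- by exists g; split => //; apply: nearCW hn => w ->; rewrite expr1.
case/eqP: dT; apply: (cder_uniq hd); have [c hc] := hol_cder hg.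
apply: cder_eqd (cder_eq (nearCW (fun w => @esym _ _ _) hn) (cderM (cderX n.+2 (cderB (cder_id z0) (cder_cst z0 z0))) hc)) _.
by rewrite subrr /= !exprS !mul0r !(mulr0, mul0r) addr0.
Qed.

Lemma order_at_pull f F T z (n : int) k : hol T z -> dC T z != 0 ->
  order_at f (T z) n ->
  dnearC z (fun w => F w = f (T w) * dC T w ^+ k) -> order_at F z n.
Proof.
move=> hT dT /order_atP[g [hg g0 hn]] hF.
have [q [hq q0 hqn]] := hol_simple hT dT.
apply/order_atP; exists (fun w => q w ^ n * (g \o T) w * dC T w ^+ k); split.
- by apply: holM; [apply: holM; [exact: holXz|exact: hol_comp]|apply: holX; exact: hol_derive].
- by rewrite !mulf_neq0 ?expfz_neq0 ?expf_neq0.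
have hn' := nearC_comp (hol_cder hT) hn.
apply: nearCW (nearCI (nearCI hF hn') (nearCI hqn (hol_neq0 hq q0))) => w [[E1 E2] [E3 qw]] wz.
rewrite E1// E2; last first.
  by rewrite -subr_eq0 E3 mulf_neq0// subr_eq0.
by rewrite E3 exprzMl ?unitfE ?subr_eq0// !mulrA.
Qed.

Lemma cder0_const f z0 (r : R) w : (forall w, md (w - z0) < r -> cder f w 0) ->
  md (w - z0) < r -> f w = f z0.
Proof.
move=> h wr; apply/eqP; rewrite -subr_eq0 -md_eq0 eq_le md_ge0 andbT.
have := @rder_bound R (fun t => f (z0 + (w - z0) * t%:C%C)) (fun=> 0) 0 1 0 ltac:(lra).
rewrite mulr0 mulr1 subrKC mulr0 addr0 mul0r; apply=> x; last by rewrite md0.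
move=> hx; have := @rder_line R f z0 (w - z0) x 0; rewrite mulr0; apply.
apply: h; rewrite addrAC subrr add0r mdM md_real ger0_norm; last lra.
by apply: le_lt_trans wr; rewrite ler_piMr ?md_ge0//; lra.
Qed.

Lemma unity_root_sep k (zeta : C) : (0 < k)%N -> zeta ^+ k = 1 ->
  nearC zeta (fun x => x ^+ k = 1 -> x = zeta).
Proof.
move=> k0 zk; have z0 : zeta != 0.
  by apply: contra_eq_neq zk => ->; rewrite expr0n gtn_eqF// eq_sym oner_eq0.
pose c := k%:R * zeta ^+ k.-1 * 1.
have mc : 0 < md c by rewrite md_gt0 /c mulr1 mulf_neq0 ?expf_neq0// pnatr_eq0 -lt0n.
have [d d0 h] := cderX k (cder_id zeta) (e := md c / 2) ltac:(lra).
exists d => // x /h; rewrite -/c => h1 xk; move: h1; rewrite xk zk subrr sub0r mdN mdM => h1.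
apply/eqP; rewrite -subr_eq0 -md_eq0 eq_le md_ge0 andbT.
have : md c * md (x - zeta) <= 0 by lra.
by rewrite pmulr_rle0.
Qed.

(** The quotient of the two derivatives is continuous with k-th power 1; since roots of unity are
    isolated, it is constant. *)
Lemma affine_of_derive s1 s2 z0 k : (0 < k)%N -> hol s1 z0 -> hol s2 z0 -> dC s2 z0 != 0 ->
  dnearC z0 (fun w => dC s1 w ^+ k = dC s2 w ^+ k) ->
  exists zeta c, zeta ^+ k = 1 /\ nearC z0 (fun w => s1 w = zeta * s2 w + c).
Proof.
move=> k0 h1 h2 d2 E.
have hd1 := hol_derive h1; have hd2 := hol_derive h2.
have [q [hq qE]] : exists q, hol q z0 /\ forall w, q w = dC s1 w * (dC s2 w)^-1.
  by exists (fun w => dC s1 w * (dC s2 w)^-1); split => //; apply: holM => //; exact: holV.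
have Eq : dnearC z0 (fun w => q w ^+ k = 1).
  apply: nearCW (nearCI E (hol_neq0 hd2 d2)) => w [Ew dw] wz.
  by rewrite qE exprMn (Ew wz) -exprMn (divff dw) expr1n.
have qk : q z0 ^+ k = 1.
  have hqk : hol (fun w => q w ^+ k) z0 by exact: holX.
  have [c hc] := hol_cder hqk.
  apply/eqP; rewrite -subr_eq0; apply/eqP; apply: md_small_eq0 => e e0.
  have [d d0 H] := nearCI (cder_nearC hc e0) Eq.
  have w0 : z0 + (d / 2)%:C%C != z0.
    by rewrite -subr_eq0 addrAC subrr add0r -md_gt0 md_real ger0_norm; lra.
  have [|h3 h4] := H (z0 + (d / 2)%:C%C).
    by rewrite addrAC subrr add0r md_real ger0_norm; lra.
  by move: h3; rewrite (h4 w0) mdB; exact: ltW.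
have sep := nearC_comp (hol_cder hq) (unity_root_sep k0 qk).
exists (q z0); pose D w := s1 w - q z0 * s2 w.
have hD : nearC z0 (fun w => cder D w 0).
  apply: nearCW (nearCI (nearCI (nearCI h1 h2) (nearCI sep Eq)) (hol_neq0 hd2 d2)).
  move=> w [[[c1 c2] [sw Ew]] dw].
  apply: cder_eqd (cderB (dCP c1) (cderZ (q z0) (dCP c2))) _.
  have -> : q z0 = q w.
    by have [->//|wz] := eqVneq w z0; rewrite sw// Ew.
  by rewrite qE (mulfVK dw) subrr.
have [r r0 hr] := hD.
exists (D z0); split => //; exists r => // w wr.
by rewrite -(cder0_const hr wr) /D subrKC.
Qed.

Lemma hol_root A z0 n : (0 < n)%N -> hol A z0 -> A z0 != 0 ->
  exists B, [/\ hol B z0, B z0 != 0 & nearC z0 (fun z => B z ^+ n = A z)].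
Proof.
move=> n0 /hol_shift0 hA A0; have [|B [hB E]] := hol0_root n0 hA; first by rewrite addr0.
exists (fun w => B (w - z0)).
have hB' : hol (fun w => B (w - z0)) z0.
  apply/hol_shift0; apply: hol_eq hB; apply: nearCT => w; by rewrite addrAC subrr add0r.
have E' : nearC z0 (fun z => B (z - z0) ^+ n = A z).
  by apply/nearC_shift; case: E => e e0 h; exists e => // w; rewrite subr0 addrAC subrr add0r => /h.
split => //; apply: contraNneq A0 => B0; rewrite -(nearC_self E') B0 expr0n gtn_eqF//.
Qed.

(** Write [g = B ^+ k] near 0 and [N = n + k]. A primitive of [z^(n/k) B] is a multiple of
    [z^(N/k) A], where [A + (k/N) z A' = B]. The coordinate is [T = z D] with [D ^+ N = A ^+ k], so
    that [T^(N/k) = z^(N/k) A]. Fractional powers are avoided by working with [A] and [D] alone. *)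
Lemma normal_form0 f (n : int) k (r0 : R) : 0 < r0 -> (0 < k)%N -> - k%:Z < n -> order_at f 0 n ->
  exists T S r rho, [/\ biholo T S 0 r rho, r <= r0 &
    forall w, md w < r -> w != 0 -> f w = T w ^ n * dC T w ^+ k].
Proof.
move=> r00 k0 nk /order_atP[g [hg g0 hn]].
have [B [hB B0 EB]] := hol_root k0 hg g0.
have [N N0 NE] : exists2 N : nat, (0 < N)%N & N%:Z = n + k%:Z.
  by have [N N0 E] := int_lt_diff nk; exists N => //; rewrite E addrAC addNr add0r.
have [b [M [rho [rh0 M0 hb]]]] := hol_expands0 hB.
pose lam : C := (k%:R / N%:R : R)%:C%C.
(* As [lam > 0] there is no resonance, unlike at infinity in [dev_map]. *)
have lj (j : nat) : 1 <= md (1 + lam * j%:R).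
  rewrite /lam -(rmorph_nat (real_complex R) j) -rmorphM -(rmorph1 (real_complex R)) -rmorphD md_real.
  have : 0 <= (k%:R / N%:R * j%:R : R) by rewrite mulr_ge0// divr_ge0.
  by move=> h; rewrite ger0_norm; lra.
have lj0 j : 1 + lam * j%:R != 0 by rewrite -md_gt0; have := lj j; lra.
have [||A [A' [r1 [r10 A0 hA EA]]]] := @expands_ode R B b (fun j => b j / (1 + lam * j%:R)) lam 1 M rho rh0 ler01 hb.
- by move=> j; rewrite mulrC divfK.
- by move=> j; rewrite mul1r mdM mdV ler_pdivrMr ?md_gt0// ler_peMr ?md_ge0.
have b0 : b 0%N = B 0.
  apply/eqP; rewrite -subr_eq0 -md_eq0 eq_le md_ge0 andbT mdB.
  have := hb 0; rewrite md0 => /(_ rh0 1%N).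
  by rewrite /psum big_ord1 expr0 mulr1 mul0r expr1 mulr0.
rewrite mulr0 addr0 divr1 b0 in A0.
have hAh : hol A 0 by exists r1 => // w; rewrite subr0 => wr; exists (A' w); exact: hA.
have A00 : A 0 != 0 by rewrite A0.
have [D [hD D0 ED]] := hol_root N0 (holX k hAh) (expf_neq0 k A00).
pose T z := z * D z.
have hT : hol T 0 by apply: holM => //; exact: hol_id.
have dT : dC T 0 = D 0.
  apply: cder_dC; apply: cder_eqd (cderM (cder_id 0) (dCP (hol_cder hD))) _.
  by rewrite mul0r addr0 mul1r.
have lam0 : lam = k%:R / N%:R by rewrite /lam rmorphM fmorphV !rmorph_nat.
have NC : (N%:R : C) != 0 by rewrite pnatr_eq0 -lt0n.
have key : nearC 0 (fun w => w != 0 -> f w = T w ^ n * dC T w ^+ k).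
  have [rr rr0 hr] := nearCI (nearC_nearC ED) (nearCI (nearCI hD (nearCI (hol_neq0 hD D0) (hol_neq0 hAh A00))) (nearCI hn EB)).
  exists (Num.min rr r1); first by rewrite lt_min rr0.
  move=> w; rewrite lt_min => /andP[/hr]; rewrite subr0.
  move=> [ED' [[cD [Dw Aw]] [Ef EBw]]] wr1 w0.
  have EDw := nearC_self ED'.
  have hDd := dCP cD.
  have := cder_uniq (cder_eq ED' (cderX N hDd)) (cderX k (hA w wr1)).
  have dTw : dC T w = D w + w * dC D w.
    by apply: cder_dC; apply: cder_eqd (cderM (cder_id w) hDd) _; rewrite mul1r.
  have EAw := EA w wr1 => K1.
  (* The differential equation of [A], rewritten in terms of [T]; with [D ^+ N = A ^+ k] it yields
     the formula for [f]. *)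
  have K2 : A w * dC T w = D w * B w.
    have : N%:R * D w ^+ N * (A w * dC D w) = k%:R * A w ^+ k * (D w * A' w).
      case: (N) (k) N0 k0 K1 => // N' [//|k'] _ _ /= K1.
      have -> : N'.+1%:R * D w ^+ N'.+1 * (A w * dC D w) =
         (N'.+1%:R * D w ^+ N' * dC D w) * (D w * A w) by rewrite exprS; ring.
      by rewrite K1 exprS; ring.
    rewrite EDw => K3.
    have K4 : A w * dC D w = lam * D w * A' w.
      apply: (mulfI (_ : N%:R * A w ^+ k != 0)); first by rewrite mulf_neq0// expf_neq0.
      by rewrite K3 lam0; field.
    by rewrite dTw mulrDr mulrCA K4 -EAw; ring.
  rewrite (Ef w0) ?subr0 /T exprzMl ?unitfE//.
  rewrite -EBw -mulrA; congr (_ * _).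
  have -> : dC T w = D w * B w / A w by rewrite -K2 mulrC mulKf.
  rewrite !exprMn exprVn.
  have K5 : D w ^ n * D w ^+ k = A w ^+ k.
    by rewrite -EDw [D w ^+ k]exprnP -expfzDr// -NE exprnP.
  rewrite mulrA mulrA K5 mulrAC divff ?mul1r// expf_neq0//.
have [rk rk0 hk] := key.
have [|||||S [r [rho' [bh rr]]]] := @ift R T (D 0) (Num.min r0 rk).
- by rewrite lt_min r00.
- exact: hT.
- by rewrite /T mul0r.
- by rewrite -dT; apply: dCP; exact: hol_cder.
- exact: D0.
exists T, S, r, rho'; split => //.
  by apply: le_trans rr _; rewrite ge_min lexx.
move=> w wr w0; apply: hk => //; rewrite subr0; apply: lt_le_trans wr _.
by apply: le_trans rr _; rewrite ge_min lexx orbT.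
Qed.

Lemma order_at_shift f z (n : int) : order_at f z n -> order_at (fun w => f (z + w)) 0 n.
Proof.
move=> /order_atP[g [hg g0 hn]]; apply/order_atP; exists (fun w => g (z + w)); split.
- exact: (iffLR (hol_shift0 g z)).
- by rewrite addr0.
apply: nearCW (iffLR (nearC_shift _ _) hn) => w h w0.
rewrite h; first by rewrite addrAC subrr add0r subr0.
by rewrite -subr_eq0 addrAC subrr add0r.
Qed.

Lemma normal_form f z0 (n : int) k (r0 : R) : 0 < r0 -> (0 < k)%N -> - k%:Z < n -> order_at f z0 n ->
  exists T S r rho, [/\ biholo T S z0 r rho, r <= r0 &
    forall w, md (w - z0) < r -> w != z0 -> f w = T w ^ n * dC T w ^+ k].
Proof.
move=> r00 k0 nk /order_at_shift/(normal_form0 r00 k0 nk)[T [S [r [rho [[r_0 rho0 T0 [dT inj] hS] rr hf]]]]].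
exists (fun w => T (w - z0)), (fun v => z0 + S v), r, rho.
have dT' w c : cder T (w - z0) c -> cder (fun w => T (w - z0)) w c.
  have := @cder_shift R T (- z0) w c; rewrite addrC => h /h.
  by under eq_fun do rewrite addrC.
split => //.
- split => //; first by rewrite subrr.
  + split=> [w wr|w w' wr wr' E].
      have [|c c0 hc] := dT (w - z0); first by rewrite subr0.
      by exists c => //; exact: dT'.
    by apply: (addIr (- z0)); apply: inj => //; rewrite subr0.
  move=> v /hS[h1 h2 [d d0 hd]]; rewrite addrAC subrr add0r; rewrite subr0 in h1.
  split => //; exists d => //.
  by apply: cder_eqd (cderD (cder_cst z0 v) hd) _; rewrite add0r.
move=> w wr wz; have [|c c0 hc] := dT (w - z0); first by rewrite subr0.
rewrite (cder_dC (dT' _ _ hc)) -(cder_dC hc) -hf ?subr_eq0//.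
by rewrite subrKC.
Qed.

End Orders.

(** * Winding numbers modulo 2 *)


Lemma unity_roots (F : numClosedFieldType) k : (0 < k)%N ->
  exists r : seq F, [/\ uniq r, size r = k & forall w, w \in r -> w ^+ k = 1].
Proof.
move=> k0; have [r pr] := closed_field_poly_normal ('X^k - 1 : {poly F}).
have lc : lead_coef ('X^k - 1 : {poly F}) = 1 by apply/monicP; exact: monic_Xn_sub_1.
rewrite lc scale1r in pr; exists r; split.
- rewrite -separable_prod_XsubC -pr separable_poly.unlock derivB derivXn -polyC1 derivC subr0.
  apply/coprimepP => p /dvdpP[q1 e1] /dvdpP[q2 e2].
  have kC : (k%:R : F) != 0 by rewrite pnatr_eq0 -lt0n.
  have : (p %| 1)%R.
    have : (p %| (k%:R : F)^-1 *: ('X * ('X^(k.-1) *+ k)) - ('X^k - 1%:P)).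
      apply: dvdp_sub; last by rewrite e1 dvdp_mull.
      by rewrite dvdpZr ?invr_neq0// dvdp_mull// e2 dvdp_mull.
    rewrite mulrnAr -exprS prednK// -scalerMnr scalerMnl -mulr_natr mulVf// scale1r.
    by rewrite opprB addrCA subrr addr0 polyC1.
  by rewrite dvdp1 size_poly_eq1.
- by have := size_prod_XsubC r id; rewrite -pr size_Xn_sub_1// => -[].
- move=> w wr; have : root ('X^k - 1) w by rewrite pr root_prod_XsubC.
  by rewrite /root !hornerE subr_eq0 => /eqP.
Qed.

(** Otherwise all [k] roots of unity of order [k] would be roots of [X^d - 1] with
    [d = gcd(k, n) < k]. *)
Lemma exists_unity_root (F : numClosedFieldType) k n : (0 < k)%N -> ~~ (k %| n)%N ->
  exists w : F, w ^+ k = 1 /\ w ^+ n != 1.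
Proof.
move=> k0 kn; apply: contrapT => H.
have H1 (w : F) : w ^+ k = 1 -> w ^+ n = 1.
  by move=> wk; apply/eqP; apply: contraT => wn; exfalso; apply: H; exists w.
pose d := gcdn k n.
have d0 : (0 < d)%N by rewrite gcdn_gt0 k0.
have dk : (d < k)%N.
  rewrite ltn_neqAle dvdn_leq ?dvdn_gcdl// andbT; apply: contraNneq kn => dk.
  by rewrite -dk dvdn_gcdr.
have H2 (w : F) : w ^+ k = 1 -> w ^+ d = 1.
  move=> wk; have wn := H1 w wk.
  have [km kn' e _] := egcdnP n k0.
  have : w ^+ (km * k) = w ^+ (kn' * n + gcdn k n) by rewrite e.
  by rewrite exprD mulnC exprM wk expr1n mulnC exprM wn expr1n mul1r => <-.
have [r [ur sr hr]] := unity_roots F k0.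
have : (size r < size ('X^d - 1 : {poly F})%R)%N.
  apply: max_poly_roots => //.
    by rewrite -size_poly_eq0 size_Xn_sub_1.
  apply/allP => x /hr xr; rewrite /root !hornerE subr_eq0; apply/eqP; exact: H2.
by rewrite size_Xn_sub_1// sr ltnS leqNgt dk.
Qed.

Section PlaneTopology.
Context {R : realType}.
Local Notation C := (Cplx R).
Implicit Types (f g : C -> C) (z w : C) (A : set C).

Definition cat A f z := forall e : R, 0 < e -> exists2 d : R, 0 < d &
  forall w, A w -> md (w - z) < d -> md (f w - f z) < e.

Lemma cat_cder A f z : (exists c, cder f z c) -> cat A f z.
Proof. by move=> [c /cder_cont h] e /h[d d0 k]; exists d => // w _; exact: k. Qed.

Lemma catD A f g z : cat A f z -> cat A g z -> cat A (fun w => f w + g w) z.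
Proof.
move=> hf hg e e0; have e20 : 0 < e / 2 by lra.
have [d d0 h1] := hf _ e20; have [d' d'0 h2] := hg _ e20.
exists (Num.min d d'); first by rewrite lt_min d0.
move=> t At; rewrite lt_min => /andP[/(h1 t At) a1 /(h2 t At) a2].
rewrite (_ : _ - _ = (f t - f z) + (g t - g z)); last by ring.
by have := mdD (f t - f z) (g t - g z); lra.
Qed.

Lemma catM A f g z : cat A f z -> cat A g z -> cat A (fun w => f w * g w) z.
Proof.
move=> hf hg e e0.
have f0 := md_ge0 (f z); have g0 := md_ge0 (g z).
pose e1 := Num.min 1 (e / (md (f z) + md (g z) + 2)).
have e10 : 0 < e1 by rewrite lt_min ltr01/= divr_gt0//; lra.
have [d d0 h1] := hf _ e10; have [d' d'0 h2] := hg _ e10.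
exists (Num.min d d'); first by rewrite lt_min d0.
move=> t At; rewrite lt_min => /andP[/(h1 t At) a1 /(h2 t At) a2].
have e1l : e1 <= 1 by rewrite ge_min lexx.
have e1r : e1 * (md (f z) + md (g z) + 2) <= e by rewrite -ler_pdivlMr ?ge_min ?lexx ?orbT//; lra.
rewrite (_ : _ - _ = (f t - f z) * (g t - g z) + (f t - f z) * g z + f z * (g t - g z)); last by ring.
have := mdD ((f t - f z) * (g t - g z) + (f t - f z) * g z) (f z * (g t - g z)).
have := mdD ((f t - f z) * (g t - g z)) ((f t - f z) * g z).
rewrite !mdM => h3 h4; have := md_ge0 (f t - f z); have := md_ge0 (g t - g z); nra.
Qed.

Lemma cat_comp A B f g z : cat A f z -> cat B g (f z) -> (forall w, A w -> B (f w)) ->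
  cat A (fun w => g (f w)) z.
Proof.
move=> hf hg AB e /hg[d d0 h1]; have [d' d'0 h2] := hf _ d0.
by exists d' => // w Aw wd; apply: h1; [exact: AB|exact: h2].
Qed.

Lemma cat_comp_cder A f g z : cat A f z -> (exists c, cder g (f z) c) -> cat A (fun w => g (f w)) z.
Proof. by move=> hf hg; apply: (cat_comp hf (cat_cder setT hg)). Qed.

Lemma catV A f z : f z != 0 -> cat A f z -> cat A (fun w => (f w)^-1) z.
Proof. by move=> f0 hf; apply: (cat_comp_cder (g := fun x => x^-1) hf); eexists; exact: cder_inv. Qed.

Lemma catX A f n z : cat A f z -> cat A (fun w => f w ^+ n) z.
Proof.
move=> hf; apply: (cat_comp_cder (g := fun x => x ^+ n) hf).
by eexists; exact: (cderX n (cder_id (f z))).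
Qed.

Lemma catS A B f z : A `<=` B -> cat B f z -> cat A f z.
Proof. by move=> AB h e /h[d d0 k]; exists d => // w /AB; exact: k. Qed.

Lemma cat_cst A c z : cat A (fun=> c) z.
Proof. by move=> e e0; exists 1 => // w _ _; rewrite subrr md0. Qed.

Lemma cat_id A z : cat A id z.
Proof. by move=> e e0; exists e. Qed.

Lemma catB A f g z : cat A f z -> cat A g z -> cat A (fun w => f w - g w) z.
Proof.
move=> hf hg; have := catD hf (catM (cat_cst A (-1) z) hg).
by under eq_fun do rewrite mulN1r.
Qed.

Lemma compact_min2 A (phi : C -> C -> R) : compact A -> A !=set0 ->
  (forall z w, A z -> A w -> forall e : R, 0 < e -> exists2 d : R, 0 < d &
     forall z' w', A z' -> A w' -> md (z' - z) < d -> md (w' - w) < d -> `|phi z' w' - phi z w| < e) ->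
  exists z w, [/\ A z, A w & forall z' w', A z' -> A w' -> phi z w <= phi z' w'].
Proof.
move=> cA [a Aa] h.
have [||[z w]] := @compact_EVT_min _ R (fun p : C * C => phi p.1 p.2) (A `*` A) _ (compact_setX cA cA).
- by exists (a, a).
- apply/subspace_continuousP => -[z w] [/= Az Aw]; apply/cvgrPdist_lt => e e0.
  have [d d0 k] := h z w Az Aw e e0.
  exists (ball z (d%:C%C : C), ball w (d%:C%C : C)).
    by split; apply: nbhsx_ballx; rewrite ltcR.
  move=> [z' w'] [/= /ball_md h1 /ball_md h2] [/= Az' Aw'].
  by rewrite distrC; exact: k.
rewrite inE => -[/= Az Aw] hz; exists z, w; split => // z' w' Az' Aw'.
by apply: (hz (z', w')); rewrite inE.
Qed.

Lemma md_dist2 (z w z' w' : C) : `|md (z - w) - md (z' - w')| <= md (z - z') + md (w - w').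
Proof.
have h1 := md_sub (z - w) (z' - w'); have h2 := md_sub (z' - w') (z - w).
rewrite [md (z' - w' - _)]mdB in h2.
have := md_subD (z - z') (w - w').
rewrite (_ : z - z' - (w - w') = z - w - (z' - w')); last by ring.
rewrite ler_norml; lra.
Qed.

(** [phi] is continuous and positive, because its two summands never vanish together; its minimum
    over the pairs of points of [A] is the modulus sought. [compact_sep] exchanges the roles of
    points and values. *)
Lemma compact_unif A f (e : R) : compact A -> (forall z, A z -> cat A f z) -> 0 < e ->
  exists2 d : R, 0 < d & forall z w, A z -> A w -> md (z - w) < d -> md (f z - f w) < e.
Proof.
move=> cA cf e0; have [A0|A0] := pselect (A !=set0); last first.
  by exists 1 => // z w Az; exfalso; apply: A0; exists z.
pose phi z w := md (z - w) + Num.max 0 (e - md (f z - f w)).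
have [z [w [Az Aw hm]]] : exists z w, [/\ A z, A w & forall z' w', A z' -> A w' -> phi z w <= phi z' w'].
  apply: compact_min2 => // z w Az Aw e1 e10; have e40 : 0 < e1 / 4 by lra.
  have [d d0 h1] := cf z Az _ e40; have [d' d'0 h2] := cf w Aw _ e40.
  exists (Num.min (e1 / 4) (Num.min d d')); first by rewrite !lt_min e40 d0.
  move=> z' w' Az' Aw'; rewrite !lt_min => /andP[z1 /andP[z2 _]] /andP[w1 /andP[_ w2]].
  have a1 := h1 z' Az' z2; have a2 := h2 w' Aw' w2.
  have b1 := md_dist2 z' w' z w; have b2 := md_dist2 (f z') (f w') (f z) (f w).
  have b3 := maxr_lip 0 (e - md (f z' - f w')) (e - md (f z - f w)).
  rewrite (_ : e - _ - _ = - (md (f z' - f w') - md (f z - f w))) in b3; last by ring.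
  rewrite normrN in b3.
  have := ler_normD (md (z' - w') - md (z - w)) (Num.max 0 (e - md (f z' - f w')) - Num.max 0 (e - md (f z - f w))).
  rewrite (_ : _ - _ + (_ - _) = phi z' w' - phi z w); last by rewrite /phi; ring.
  lra.
have p0 : 0 < phi z w.
  rewrite /phi; have [->|zw] := eqVneq z w.
    by rewrite !subrr !md0 subr0 add0r lt_max e0 orbT.
  have : 0 < md (z - w) by rewrite md_gt0 subr_eq0.
  have : 0 <= Num.max 0 (e - md (f z - f w)) by rewrite le_max lexx.
  lra.
exists (phi z w) => // z' w' Az' Aw' lt; have := hm z' w' Az' Aw'; rewrite {2}/phi => h.
have : 0 < Num.max 0 (e - md (f z' - f w')) by lra.
by rewrite lt_max ltxx subr_gt0.
Qed.

Lemma compact_sep A f (d : R) : compact A -> (forall z, A z -> cat A f z) ->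
  (forall z w, A z -> A w -> f z = f w -> z = w) -> 0 < d ->
  exists2 m : R, 0 < m & forall z w, A z -> A w -> d <= md (z - w) -> m <= md (f z - f w).
Proof.
move=> cA cf inj d0; have [A0|A0] := pselect (A !=set0); last first.
  by exists 1 => // z w Az; exfalso; apply: A0; exists z.
pose phi z w := md (f z - f w) + Num.max 0 (d - md (z - w)).
have [z [w [Az Aw hm]]] : exists z w, [/\ A z, A w & forall z' w', A z' -> A w' -> phi z w <= phi z' w'].
  apply: compact_min2 => // z w Az Aw e1 e10; have e40 : 0 < e1 / 4 by lra.
  have [d1 d10 h1] := cf z Az _ e40; have [d' d'0 h2] := cf w Aw _ e40.
  exists (Num.min (e1 / 4) (Num.min d1 d')); first by rewrite !lt_min e40 d10.
  move=> z' w' Az' Aw'; rewrite !lt_min => /andP[z1 /andP[z2 _]] /andP[w1 /andP[_ w2]].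
  have a1 := h1 z' Az' z2; have a2 := h2 w' Aw' w2.
  have b1 := md_dist2 z' w' z w; have b2 := md_dist2 (f z') (f w') (f z) (f w).
  have b3 := maxr_lip 0 (d - md (z' - w')) (d - md (z - w)).
  rewrite (_ : d - _ - _ = - (md (z' - w') - md (z - w))) in b3; last by ring.
  rewrite normrN in b3.
  have := ler_normD (md (f z' - f w') - md (f z - f w)) (Num.max 0 (d - md (z' - w')) - Num.max 0 (d - md (z - w))).
  rewrite (_ : _ - _ + (_ - _) = phi z' w' - phi z w); last by rewrite /phi; ring.
  lra.
have p0 : 0 < phi z w.
  rewrite /phi; have [->|zw] := eqVneq z w.
    by rewrite !subrr !md0 subr0 add0r lt_max d0 orbT.
  have : 0 < md (f z - f w).
    by rewrite md_gt0 subr_eq0; apply: contra_neq zw; exact: inj.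
  have : 0 <= Num.max 0 (d - md (z - w)) by rewrite le_max lexx.
  lra.
exists (phi z w) => // z' w' Az' Aw' lt; have := hm z' w' Az' Aw'; rewrite {2}/phi => h.
suff E : Num.max 0 (d - md (z' - w')) = 0 by rewrite E addr0 in h.
by apply/max_idPl; rewrite subr_le0.
Qed.

(** [quad_ind] with a second side of length 0. *)
Lemma loc_const_itv (T : Type) (phi : R -> T) (a b : R) : a <= b ->
  (forall x, a <= x <= b -> exists2 d : R, 0 < d &
     forall t, a <= t <= b -> `|t - x| < d -> phi t = phi x) ->
  forall t, a <= t <= b -> phi t = phi a.
Proof.
move=> ab h.
have := @quad_ind R (fun x0 x1 _ _ => forall t, x0 <= t <= x1 -> phi t = phi x0) a b 0 0 ab (lexx 0).
apply.
  move=> x0 x1 y0 y1 _ hx _ _ _ _ x y h1 h2 _ _ t ht; rewrite /x in h1 h2.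
  have [tx|tx] := leP t ((x0 + x1) / 2); first by apply: h1; lra.
  by rewrite h2; [apply: h1; lra|lra].
move=> x y hx hy; have [d d0 k] := h x hx; exists d => // x0 x1 y0 y1 a0 hx01 b1 _ _ _ _ _ dx _ t ht.
by rewrite (k t) ?(k x0)//; [lra|rewrite ltr_norml; lra|lra|rewrite ltr_norml; lra].
Qed.

Definition S1 : set C := [set u | md u = 1].
Definition E1 (t : R) : C := pt (cos t) (sin t).

Lemma E1_S1 t : S1 (E1 t).
Proof. by rewrite /S1 /= /md /= cos2Dsin2 sqrtr1. Qed.

Lemma E1_surj u : S1 u -> exists2 t, - pi <= t <= pi & u = E1 t.
Proof.
case: u => a b hu.
have hab : a ^+ 2 + b ^+ 2 = 1.
  have h0 : 0 <= a ^+ 2 + b ^+ 2 by rewrite addr_ge0 ?sqr_ge0.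
  by move: hu; rewrite /S1 /= /md /= => h; rewrite -(sqr_sqrtr h0) h expr1n.
have a1 : -1 <= a <= 1.
  have : a ^+ 2 <= 1 by have := sqr_ge0 b; lra.
  by rewrite expr2 => h; apply/andP; split; nra.
have /andP[t0 tpi] : 0 <= acos a <= pi by rewrite acos_ge0 ?acos_lepi.
have ca : cos (acos a) = a by rewrite acosK// in_itv.
have sa : sin (acos a) = `|b|.
  by rewrite sin_acos// -sqrtr_sqr; congr Num.sqrt; lra.
have p0 := pi_ge0 R.
have [b0|b0] := leP 0 b.
  by exists (acos a); [lra|rewrite /E1 /pt ca sa ger0_norm].
exists (- acos a); first lra.
by rewrite /E1 /pt cosN sinN ca sa ltr0_norm// opprK.
Qed.

Lemma E1_lip s t : md (E1 s - E1 t) <= 2 * `|s - t|.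
Proof.
wlog st : s t / t <= s.
  by move=> h; have [/h//|/ltW/h] := leP t s; rewrite mdB distrC.
rewrite /E1 ptB; apply: le_trans (md_pt _ _) _.
have h1 : `|cos s - cos t| <= 1 * (s - t).
  apply: (@real_mvt _ _ (fun x => - sin x)) => // x _.
  by rewrite normrN sin_max.
have h2 : `|sin s - sin t| <= 1 * (s - t).
  apply: (@real_mvt _ _ cos) => // x _.
  exact: cos_max.
rewrite (ger0_norm (_ : 0 <= s - t)); lra.
Qed.

Lemma root_sep k (v x : C) : (0 < k)%N -> v != 0 -> x ^+ k = v -> nearC x (fun y => y ^+ k = v -> y = x).
Proof.
move=> k0 v0 xv; have x0 : x != 0 by apply: contraNneq v0 => x0; rewrite -xv x0 expr0n gtn_eqF.
have mx : 0 < md x by rewrite md_gt0.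
have one : (1 : C) ^+ k = 1 by rewrite expr1n.
have [d d0 h] := unity_root_sep k0 one.
exists (d * md x); first by rewrite mulr_gt0.
move=> y hy yv; have E : (y / x) ^+ k = 1 by rewrite expr_div_n yv xv (divff v0).
have := h (y / x); rewrite (_ : y / x - 1 = (y - x) / x); last by field.
rewrite mdM mdV ltr_pdivrMr// => /(_ hy E) /divr1_eq.
by [].
Qed.

Lemma circle_const k (v : C) f : (0 < k)%N -> v != 0 -> (forall u, S1 u -> cat S1 f u) ->
  (forall u, S1 u -> f u ^+ k = v) -> forall u w, S1 u -> S1 w -> f u = f w.
Proof.
move=> k0 v0 cf fv.
have p0 : - pi <= (pi : R) by have := pi_ge0 R; lra.
have H : forall t, - pi <= t <= pi -> f (E1 t) = f (E1 (- pi)).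
  apply: (@loc_const_itv _ (fun t => f (E1 t))) => // x _.
  have [e e0 he] := root_sep k0 v0 (fv _ (E1_S1 x)).
  have [d d0 hd] := cf _ (E1_S1 x) e e0.
  exists (d / 2); first lra.
  move=> t _ ht; apply: he; last by apply: fv; exact: E1_S1.
  by apply: hd; [exact: E1_S1|have := E1_lip t x; lra].
by move=> u w /E1_surj[t /H ht ->] /E1_surj[s /H hs ->]; rewrite ht hs.
Qed.

Lemma S1X u n : S1 u -> S1 (u ^+ n).
Proof. by rewrite /S1 /= mdX => ->; rewrite expr1n. Qed.

Lemma S1_neq0 u : S1 u -> u != 0.
Proof. by rewrite /S1 /= => h; rewrite -md_gt0 h. Qed.

(** The function [v |-> f (v^k) / v^n] has k-th power 1, hence is constant on the circle; but its
    values differ at 1 and at a k-th root of unity [w] with [w^n <> 1]. *)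
Lemma no_root_pow k n f : (0 < k)%N -> ~~ (k %| n)%N -> (forall u, S1 u -> cat S1 f u) ->
  (forall u, S1 u -> f u ^+ k = u ^+ n) -> False.
Proof.
move=> k0 kn cf fE; have [w [wk wn]] := exists_unity_root (Cplx R) k0 kn.
have w1 : S1 w.
  rewrite /S1 /=; apply/eqP; rewrite -(@pexpr_eq1 _ (md w) k) ?md_ge0//.
  by rewrite -mdX wk md1.
have o1 : S1 1 by rewrite /S1 /= md1.
have n0 : (1 : C) != 0 by rewrite oner_eq0.
have := @circle_const k 1 (fun v => f (v ^+ k) * (v ^+ n)^-1) k0 n0 _ _ w 1 w1 o1.
rewrite wk !expr1n invr1 mulr1 => H.
have : f 1 / w ^+ n = f 1.
  apply: H => u Su.
    apply: catM.
      apply: (@cat_comp S1 S1 (fun v => v ^+ k) f); [exact: catX (cat_id _ _)|exact: cf (S1X k Su)|].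
      by move=> v; exact: S1X.
    by apply: catV; [rewrite expf_neq0 ?S1_neq0|apply: catX (cat_id _ _)].
  by rewrite exprMn (fE _ (S1X k Su)) exprVn -!exprM mulnC (divff (expf_neq0 _ (S1_neq0 Su))).
have f1 : f 1 != 0.
  by apply: contra_eq_neq (fE 1 o1) => ->; rewrite expr0n gtn_eqF// expr1n eq_sym.
move=> E; move: wn; rewrite -(inj_eq (mulfI f1)) mulr1 => /eqP; apply.
by rewrite -{1}E mulfVK// expf_neq0// S1_neq0.
Qed.

(* [SQ g]: the loop g on the unit circle has a continuous square root, i.e. an
   even winding number; this is the only homotopy invariant that is needed. *)
Definition SQ f := exists2 q : C -> C, (forall u, S1 u -> cat S1 q u) &
  forall u, S1 u -> q u ^+ 2 = f u.

Lemma sqrt_near1 : exists (e : R) (s : C -> C), [/\ 0 < e, e <= 1 / 2,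
  forall z, md z < e -> exists c, cder s z c & forall z, md z < e -> s z ^+ 2 = 1 + z].
Proof.
have hh : hol (fun z : C => 1 + z) 0 by apply: holD; [exact: hol_cst|exact: hol_id].
have [|s [hs _ E]] := hol_root (isT : (0 < 2)%N) hh; first by rewrite addr0 oner_eq0.
have [e e0 h] := nearCI hs E.
exists (Num.min e (1 / 2)), s; split; first by rewrite lt_min e0; lra.
- by rewrite ge_min lexx orbT.
- by move=> z; rewrite lt_min => /andP[]; rewrite -[z in md z]subr0 => /h[].
- by move=> z; rewrite lt_min => /andP[]; rewrite -[z in md z]subr0 => /h[].
Qed.

(** A change of relative size less than [e] multiplies the loop by [1 + z] with [|z| < e], where a
    square root is at hand. *)
Lemma SQ_step (e : R) (s : C -> C) f g : 
  (forall z, md z < e -> exists c, cder s z c) -> (forall z, md z < e -> s z ^+ 2 = 1 + z) ->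
  (forall u, S1 u -> cat S1 f u) -> (forall u, S1 u -> cat S1 g u) ->
  (forall u, S1 u -> f u != 0) -> (forall u, S1 u -> md (g u - f u) < e * md (f u)) ->
  SQ f -> SQ g.
Proof.
move=> ds sE cf cg f0 fg [q cq qE].
have small u : S1 u -> md (g u / f u - 1) < e.
  move=> Su; have := fg u Su; have fu := f0 u Su.
  by rewrite (_ : _ / _ - 1 = (g u - f u) / f u); [rewrite mdM mdV ltr_pdivrMr// md_gt0|field].
exists (fun u => q u * s (g u / f u - 1)) => u Su.
  apply: catM; first exact: cq.
  apply: (cat_comp_cder (g := s)); last by apply: ds; exact: small.
  apply: catB; last exact: cat_cst.
  by apply: catM; [exact: cg|apply: catV; [exact: f0|exact: cf]].
rewrite exprMn (qE _ Su) (sE _ (small _ Su)).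
by rewrite addrCA subrr addr0 mulrC divfK// f0.
Qed.

Lemma SQ_cst (c : C) : SQ (fun=> c).
Proof. by exists (fun=> sqrtC c) => u _; [exact: cat_cst|rewrite sqrtCK]. Qed.

(** Uniform continuity cuts the homotopy into finitely many steps to which [SQ_step] applies. *)
Lemma SQ_homotopy (H : R -> C -> C) :
  (forall t, 0 <= t <= 1 -> forall u, S1 u -> cat S1 (H t) u /\ H t u != 0) ->
  (forall e : R, 0 < e -> exists2 d : R, 0 < d & forall t t', 0 <= t <= 1 -> 0 <= t' <= 1 -> `|t - t'| < d ->
     forall u, S1 u -> md (H t' u - H t u) < e * md (H t u)) ->
  SQ (H 0) -> SQ (H 1).
Proof.
move=> hH hu hS; have [e [s [e0 _ ds sE]]] := sqrt_near1.
have [d d0 hd] := hu e e0.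
pose N := (Num.Def.archi_bound (1 / d)).+1.
have N0 : 0 < (N%:R : R) by rewrite ltr0n.
have Nd : 1 / N%:R < d.
  rewrite ltr_pdivrMr// mulrC -ltr_pdivrMr//.
  have := @archi_boundP _ (1 / d) (divr_ge0 ler01 (ltW d0)) => h.
  by apply: lt_trans h _; rewrite ltr_nat.
suff K j : (j <= N)%N -> SQ (H (j%:R / N%:R)).
  by have := K N (leqnn _); rewrite divff// gt_eqF.
elim: j => [|j ih] jN; first by rewrite mul0r.
have inI i : (i <= N)%N -> 0 <= (i%:R / N%:R : R) <= 1.
  by move=> iN; rewrite divr_ge0//= ler_pdivrMr// mul1r ler_nat.
have i1 := inI j (ltnW jN); have i2 := inI j.+1 jN.
apply: (SQ_step ds sE _ _ _ _ (ih (ltnW jN))) => u Su.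
- by have [] := hH _ i1 u Su.
- by have [] := hH _ i2 u Su.
- by have [] := hH _ i1 u Su.
- apply: hd => //; rewrite distrC -mulrBl -natrB// subSnn.
  by rewrite ger0_norm// divr_ge0.
Qed.

(** The quotient [q (- u) / q u] squares to -1, hence is a constant [c]; exchanging [u] and [- u]
    gives [c = 1 / c], so [c^2 = 1]. *)
Lemma odd_not_SQ f : (forall u, S1 u -> f u != 0) -> (forall u, S1 u -> f (- u) = - f u) -> ~ SQ f.
Proof.
move=> f0 fodd [q cq qE].
have q0 u : S1 u -> q u != 0.
  by move=> Su; apply: contraNneq (f0 u Su) => qu; rewrite -qE// qu expr0n.
have SN u : S1 u -> S1 (- u) by rewrite /S1 /= mdN.
have N1 : (-1 : C) != 0 by rewrite oppr_eq0 oner_eq0.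
have H := @circle_const 2 (-1) (fun u => q (- u) / q u) isT N1.
have o1 : S1 1 by rewrite /S1 /= md1.
have {}H : q (- 1) / q 1 = q (- - 1) / q (- 1).
  apply: H; [move=> u Su|move=> u Su|exact: o1|exact: SN].
    apply: catM; last by apply: catV; [exact: q0|exact: cq].
    apply: (@cat_comp S1 S1 (fun v => - v) q); [|exact: cq (SN _ Su)|exact: SN].
    by have := catB (cat_cst S1 0 u) (cat_id S1 u); under eq_fun do rewrite sub0r.
  by rewrite expr_div_n (qE _ (SN _ Su)) (qE _ Su) (fodd _ Su) mulNr (divff (f0 _ Su)).
rewrite opprK in H.
have a0 := q0 _ o1; have b0 := q0 _ (SN _ o1).
have : q (- 1) ^+ 2 = q 1 ^+ 2.
  move: H; move: (q 1) (q (- 1)) a0 b0 => a b a0 b0 H.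
  by rewrite expr2 -[b in b * _](divfK a0) H mulrAC divfK// expr2.
rewrite (qE _ o1) (qE _ (SN _ o1)) (fodd _ o1) => /eqP.
rewrite -subr_eq0 -opprD oppr_eq0 -mulr2n mulrn_eq0 /= => /eqP E.
by have := f0 _ o1; rewrite E eqxx.
Qed.

(** If a [w] near [f 0] were not a value, the loop [f (r u) - w] would contract to a constant
    without meeting 0, so it would have a square root, and so would the nearby loop [f (r u) - f 0].
    The homotopy [f (a r u) - f (- b r u)] with [a + b = 1] never meets 0, by injectivity, and ends
    in an odd loop, which has no square root. *)
Lemma invariance_of_domain f (r : R) : 0 < r ->
  (forall z, md z <= r -> cat [set z | md z <= r] f z) ->
  (forall z w, md z <= r -> md w <= r -> f z = f w -> z = w) ->
  exists2 e : R, 0 < e & forall w, md (w - f 0) < e -> exists2 z, md z <= r & f z = w.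
Proof.
move=> r0 cf inj; pose D := [set z : C | md z <= r].
have cD : compact D by exact: compact_disc.
have [m m0 hm] := compact_sep cD cf inj r0.
have [e [s [e0 e1 ds sE]]] := sqrt_near1.
have rC u (t : R) : 0 <= t -> md ((t * r)%:C%C * u) = t * r * md u.
  by move=> t0; rewrite mdM md_real ger0_norm// mulr_ge0// ltW.
exists (e * m / 2); first by rewrite divr_gt0 ?mulr_gt0.
move=> w hw; apply: contrapT => hno.
have fw0 z : D z -> f z - w != 0.
  by move=> Dz; rewrite subr_eq0; apply/eqP => fz; apply: hno; exists z.
have [z0 Dz0 hz0] := @compact_min R D (fun z => md (f z - w)) cD (ex_intro _ 0 (eq_ind_r (fun x => x <= r) (ltW r0) (@md0 R)))
  (fun z Dz e' e'0 => let: ex_intro2 d d0 h := cf z Dz e' e'0 in ex_intro2 _ _ d d0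
    (fun v Dv hv => le_lt_trans (le_trans (eq_ind _ (fun x => _ <= x) (md_dist2 (f v) w (f z) w) _
       (eq_ind_r (fun x => _ + x = _) (addr0 _) (eq_ind_r (fun x => md x = 0) (@md0 R) (subrr w)))) (lexx _)) (h v Dv hv))).
pose p := md (f z0 - w); have p0 : 0 < p by rewrite md_gt0 fw0.
have DS (t : R) u : 0 <= t <= 1 -> S1 u -> D ((t * r)%:C%C * u).
  move=> /andP[t0 t1] Su; rewrite /D /= rC// Su mulr1.
  by rewrite -[leRHS]mul1r ler_pM2r.
have cmul (c u : C) : cat S1 (fun v => c * v) u by apply: catM; [exact: cat_cst|exact: cat_id].
have sq1 : SQ (fun u => f (r%:C%C * u) - w).
  have -> : (fun u => f (r%:C%C * u) - w) = (fun u => f ((1 * r)%:C%C * u) - w) by rewrite mul1r.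
  apply: (@SQ_homotopy (fun t u => f ((t * r)%:C%C * u) - w)).
  - move=> t ht u Su; split; last by apply: fw0; exact: DS.
    apply: catB; last exact: cat_cst.
    apply: (@cat_comp S1 D (fun v => (t * r)%:C%C * v) f); [exact: cmul|exact: cf (DS _ _ ht Su)|].
    by move=> v Sv; exact: DS.
  - move=> e' e'0; have ep : 0 < e' * p by rewrite mulr_gt0.
    have [d d0 hd] := compact_unif cD cf ep.
    exists (d / r); first by rewrite divr_gt0.
    move=> t t' ht ht' tt u Su; have D1 := DS _ _ ht Su; have D2 := DS _ _ ht' Su.
    rewrite (_ : _ - w - _ = f ((t' * r)%:C%C * u) - f ((t * r)%:C%C * u)); last by ring.
    apply: lt_le_trans (_ : _ < e' * p) _; last by rewrite ler_pM2l// hz0.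
    apply: hd => //; rewrite -mulrBl mdM Su mulr1 -rmorphB /= -mulrBl md_real normrM.
    by rewrite (gtr0_norm r0) distrC -ltr_pdivlMr.
  - by rewrite mul0r; under eq_fun do rewrite mul0r; exact: SQ_cst.
(* [a + b = 1] keeps the two arguments at distance [r], so that [m] bounds the homotopy from below;
   and [a = b] at [t = 1]. *)
pose a (t : R) : R := (1 + t)^-1; pose b (t : R) : R := t / (1 + t).
have aI t : 0 <= t <= 1 -> 0 <= a t <= 1.
  by move=> ht; rewrite invr_ge0 invf_le1; lra.
have bI t : 0 <= t <= 1 -> 0 <= b t <= 1.
  by move=> ht; rewrite divr_ge0 ?ler_pdivrMr; lra.
have ab t : 0 <= t <= 1 -> a t + b t = 1 by move=> ht; rewrite /a /b; field; lra.
have aL t t' : 0 <= t <= 1 -> 0 <= t' <= 1 -> `|a t - a t'| <= `|t - t'|.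
  move=> ht ht'; have p1 : 1 <= (1 + t) * (1 + t') by nra.
  rewrite (_ : a t - a t' = (t' - t) / ((1 + t) * (1 + t'))); last by rewrite /a; field; lra.
  by rewrite normrM distrC normfV (ger0_norm (_ : 0 <= (1 + t) * (1 + t'))) ?ler_pdivrMr ?ler_peMr//; lra.
have bL t t' : 0 <= t <= 1 -> 0 <= t' <= 1 -> `|b t - b t'| <= `|t - t'|.
  move=> ht ht'; apply: le_trans (aL _ _ ht ht').
  rewrite (_ : b t - b t' = - (a t - a t')) ?normrN//.
  by have := ab _ ht; have := ab _ ht'; lra.
pose H t u := f ((a t * r)%:C%C * u) - f ((b t * r)%:C%C * - u).
have SN u : S1 u -> S1 (- u) by rewrite /S1 /= mdN.
have Hm t u : 0 <= t <= 1 -> S1 u -> m <= md (H t u).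
  move=> ht Su; apply: hm; [exact: DS (aI _ ht) Su|exact: DS (bI _ ht) (SN _ Su)|].
  rewrite mulrN opprK -mulrDl -rmorphD /= -mulrDl ab// mul1r mdM Su mulr1 md_real.
  by rewrite ger0_norm ?(ltW r0).
have Hc t u : 0 <= t <= 1 -> S1 u -> cat S1 (H t) u.
  move=> ht Su; apply: catB.
    apply: (@cat_comp S1 D (fun v => (a t * r)%:C%C * v) f); [exact: cmul|exact: cf (DS _ _ (aI _ ht) Su)|].
    by move=> v Sv; exact: DS (aI _ ht) Sv.
  apply: (@cat_comp S1 D (fun v => (b t * r)%:C%C * - v) f); [|exact: cf (DS _ _ (bI _ ht) (SN _ Su))|].
    by have := cmul (- (b t * r)%:C%C) u; under eq_fun do rewrite mulNr -mulrN.
  by move=> v Sv; exact: DS (bI _ ht) (SN _ Sv).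
have o01 : 0 <= (0 : R) <= 1 by rewrite lexx ler01.
have o11 : 0 <= (1 : R) <= 1 by rewrite lexx ler01.
have sqH0 : SQ (H 0).
  have H0E u : H 0 u = f (r%:C%C * u) - f 0.
    by rewrite /H /a /b addr0 invr1 !mul1r mul0r mul0r mul0r.
  apply: (SQ_step ds sE _ _ _ _ sq1) => u Su.
  - apply: catB; last exact: cat_cst.
    have E1 : forall v, S1 v -> D (r%:C%C * v) by move=> v Sv; rewrite -[r]mul1r; exact: DS.
    by apply: (@cat_comp S1 D (fun v => r%:C%C * v) f); [exact: cmul|exact: cf (E1 _ Su)|exact: E1].
  - exact: Hc.
  - by apply: fw0; rewrite -[r]mul1r; exact: DS.
  - have := Hm 0 u o01 Su; rewrite H0E => h1.
    rewrite (_ : f _ - f 0 - _ = w - f 0); last by ring.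
    have := md_sub (f (r%:C%C * u) - f 0) (w - f 0).
    rewrite (_ : _ - (w - f 0) = f (r%:C%C * u) - w); last by ring.
    move: (md (f _ - w)) (md (f _ - f 0)) (md (w - f 0)) h1 hw => v x y h1 hw h2.
    have em0 : 0 <= e * m by rewrite mulr_ge0 ?ltW.
    have := ler_wpM2l (ltW e0) (_ : m - e * m / 2 <= v); have := ler_wpM2l em0 e1.
    by clear -hw h1 h2 em0; lra.
have sqH1 : SQ (H 1).
  apply: SQ_homotopy sqH0.
  - move=> t ht u Su; split; first exact: Hc.
    by rewrite -md_gt0; apply: lt_le_trans (Hm _ _ ht Su).
  - move=> e' e'0; have ep : 0 < e' * m / 2 by rewrite divr_gt0// mulr_gt0.
    have [d d0 hd] := compact_unif cD cf ep.
    exists (d / r); first by rewrite divr_gt0.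
    move=> t t' ht ht' tt u Su.
    apply: lt_le_trans (_ : _ < e' * m) _; last by rewrite ler_pM2l// Hm.
    have h1 : md (f ((a t' * r)%:C%C * u) - f ((a t * r)%:C%C * u)) < e' * m / 2.
      apply: hd; [exact: DS (aI _ ht') Su|exact: DS (aI _ ht) Su|].
      rewrite -mulrBl mdM Su mulr1 -rmorphB /= -mulrBl md_real normrM.
      by rewrite (gtr0_norm r0) distrC -ltr_pdivlMr//; apply: le_lt_trans (aL _ _ ht ht') tt.
    have h2 : md (f ((b t' * r)%:C%C * - u) - f ((b t * r)%:C%C * - u)) < e' * m / 2.
      apply: hd; [exact: DS (bI _ ht') (SN _ Su)|exact: DS (bI _ ht) (SN _ Su)|].
      rewrite -mulrBl mdM (SN _ Su) mulr1 -rmorphB /= -mulrBl md_real normrM.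
      by rewrite (gtr0_norm r0) distrC -ltr_pdivlMr//; apply: le_lt_trans (bL _ _ ht ht') tt.
    rewrite /H (_ : _ - _ - _ = (f ((a t' * r)%:C%C * u) - f ((a t * r)%:C%C * u)) -
       (f ((b t' * r)%:C%C * - u) - f ((b t * r)%:C%C * - u))); last by ring.
    by have := md_subD (f ((a t' * r)%:C%C * u) - f ((a t * r)%:C%C * u)) (f ((b t' * r)%:C%C * - u) - f ((b t * r)%:C%C * - u)); lra.
apply: (odd_not_SQ _ _ sqH1) => u Su.
  by rewrite -md_gt0; apply: lt_le_trans (Hm _ _ o11 Su).
have E : b 1 = a 1 by rewrite /a /b mul1r.
by rewrite /H E opprK opprB.
Qed.

End PlaneTopology.

(** * Counting preimages *)


Lemma root_count (F : fieldType) k mu (c w : F) (s : seq F) : (0 < k)%N -> (0 < mu)%N -> uniq s ->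
  (forall z, z \in s -> (z ^+ mu + c) ^+ k = w) -> (size s <= k * mu)%N.
Proof.
move=> k0 mu0 us hs; pose p : {poly F} := ('X^mu + c%:P) ^+ k.
have pm : p \is monic by rewrite monic_exp// monicXnaddC.
have sp : size p = (k * mu).+1.
  have := size_exp ('X^mu + c%:P) k; rewrite size_XnaddC//= -/p mulnC => <-.
  by rewrite prednK// lt0n size_poly_eq0 monic_neq0.
have sq : size (p - w%:P) = (k * mu).+1.
  rewrite size_polyDl ?sp// size_polyN; apply: leq_ltn_trans (size_polyC_leq1 w) _.
  by rewrite ltnS muln_gt0 k0.
rewrite -ltnS -sq; apply: max_poly_roots => //.
  by rewrite -size_poly_eq0 sq.
by apply/allP => z /hs zE; rewrite /root !hornerE subr_eq0 zE.
Qed.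

Section Counting.
Context {R : realType}.
Local Notation C := (Cplx R).
Implicit Types (f g h : C -> C) (z w a b : C) (A : set C).

Definition lopen h a := forall e : R, 0 < e -> exists2 d : R, 0 < d &
  forall w, md (w - h a) < d -> exists2 z, md (z - a) < e & h z = w.

Definition linj h a := exists2 d : R, 0 < d &
  forall z z', md (z - a) < d -> md (z' - a) < d -> h z = h z' -> z = z'.

(** A lower bound for a multiplicity, expressed by preimages of nearby nonzero values so that it
    makes sense for continuous [h]. *)
Definition lmult h a n := forall e : R, 0 < e -> exists2 d : R, 0 < d &
  forall w, w != 0 -> md w < d -> exists s : seq C, [/\ uniq s, size s = n &
     forall z, z \in s -> md (z - a) < e /\ h z = w].

Lemma inj_lopen g a (d : R) : 0 < d -> (forall b, md (b - a) < d -> cat setT g b) ->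
  (forall z z', md (z - a) < d -> md (z' - a) < d -> g z = g z' -> z = z') -> lopen g a.
Proof.
move=> d0 cg inj e e0; pose r := Num.min (d / 2) (e / 2).
have r0 : 0 < r by rewrite lt_min !divr_gt0.
have rd : r <= d / 2 by rewrite ge_min lexx.
have re : r <= e / 2 by rewrite ge_min lexx orbT.
have E z : a + z - a = z by rewrite addrAC subrr add0r.
have [||m m0 hm] := @invariance_of_domain R (fun z => g (a + z)) r r0.
- move=> z zr; have /cg h : md (a + z - a) < d by rewrite E; lra.
  have ca : cat [set z | md z <= r] (fun z => a + z) z by apply: catD; [exact: cat_cst|exact: cat_id].
  exact: (cat_comp ca h).
- move=> z w zr wr gz; have : a + z = a + w by apply: inj => //; rewrite E; lra.
  exact: addrI.
exists m => // w; have := hm w; rewrite addr0 => H /H[z zr gz].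
by exists (a + z) => //; rewrite E; lra.
Qed.

Lemma pow_lopen k x : (0 < k)%N -> lopen (fun y => y ^+ k) x.
Proof.
move=> k0 e e0; have [->|x0] := eqVneq x 0.
  exists (e ^+ k); first by rewrite exprn_gt0.
  move=> w; rewrite expr0n gtn_eqF// subr0 => we.
  exists (k.-root w); last by rewrite rootCK.
  rewrite subr0 ltNge; apply/negP => le.
  have : e ^+ k <= md (k.-root w) ^+ k by apply: lerXn2r; rewrite ?nnegrE ?md_ge0 ?(ltW e0).
  by rewrite -mdX rootCK//; lra.
pose p y := (x + y) ^+ k - x ^+ k.
have dp y : cder p y (k%:R * (x + y) ^+ k.-1).
  apply: cder_eqd (cderB (cderX k (cderD (cder_cst x y) (cder_id y))) (cder_cst _ _)) _.
  by rewrite add0r mulr1 subr0.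
have [||||S [r [rho [[r0 rho0 p0 [dp' inj] hS] re]]]] := @ift R p (k%:R * x ^+ k.-1) e e0.
- by exists 1 => // w _; eexists; exact: dp.
- by rewrite /p addr0 subrr.
- by have := dp 0; rewrite addr0.
- by rewrite mulf_neq0 ?expf_neq0// pnatr_eq0 -lt0n.
exists rho => // w /hS[h1 h2 _]; exists (x + S (w - x ^+ k)).
  by rewrite addrAC subrr add0r; apply: lt_le_trans re; rewrite -[S _]subr0.
by move: h2; rewrite /p => /addIr.
Qed.

Lemma lopen_comp g f a : cat setT f a -> lopen f a -> lopen g (f a) -> lopen (fun z => g (f z)) a.
Proof.
move=> cf hf hg e /hf[d d0 h1]; have [d' d'0 h2] := hg d d0.
exists d' => // w /h2[y yd <-]; have [z ze <-] := h1 y yd; by exists z.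
Qed.

Lemma lopen_eq f g a : nearC a (fun w => f w = g w) -> lopen f a -> lopen g a.
Proof.
move=> [d d0 E] hf e e0; have m0 : 0 < Num.min d e by rewrite lt_min d0.
have [d' d'0 h] := hf _ m0; exists d' => // w; rewrite -E ?subrr ?md0// => /h[z].
by rewrite lt_min => /andP[zd ze] <-; exists z => //; rewrite E.
Qed.

Lemma linj_eq f g a : nearC a (fun w => f w = g w) -> linj f a -> linj g a.
Proof.
move=> [d d0 E] [d' d'0 h]; exists (Num.min d d'); first by rewrite lt_min d0.
move=> z z'; rewrite !lt_min => /andP[z1 z2] /andP[z3 z4]; rewrite -E// -E//; exact: h.
Qed.

(** For two points with the same power, the quotient of the values of [f] is a k-th root of unity
    close to 1, hence 1. *)
Lemma pow_linj f a (d : R) k : (0 < k)%N -> 0 < d -> cat setT f a ->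
  (forall z z', md (z - a) < d -> md (z' - a) < d -> f z = f z' -> z = z') ->
  f a != 0 -> linj (fun z => f z ^+ k) a.
Proof.
move=> k0 d0 cf inj fa.
have one : (1 : C) ^+ k = 1 by rewrite expr1n.
have [s s0 hs] := unity_root_sep k0 one.
have m0 : 0 < md (f a) by rewrite md_gt0.
pose e := Num.min (1 / 4) (s / 8) * md (f a).
have q0 : 0 < Num.min (1 / 4) (s / 8) by rewrite lt_min; lra.
have e0 : 0 < e by rewrite mulr_gt0.
have e1 : e <= 1 / 4 * md (f a) by rewrite ler_pM2r// ge_min lexx.
have e2 : e <= s / 8 * md (f a) by rewrite ler_pM2r// ge_min lexx orbT.
have [d' d'0 h] := cf e e0.
exists (Num.min d d'); first by rewrite lt_min d0.
move=> z z'; rewrite !lt_min => /andP[z1 z2] /andP[z3 z4] E.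
have a1 := h z I z2; have a2 := h z' I z4.
have b1 : md (f a) / 2 < md (f z') by have := md_sub (f a) (f z'); rewrite mdB; lra.
have fz' : f z' != 0 by rewrite -md_gt0; lra.
have b2 : md (f z - f z') < s / 4 * md (f a) by have := md_tri (f z) (f a) (f z'); rewrite [md (f a - f z')]mdB; lra.
apply: inj => //; apply: (@divr1_eq _ (f z)) => //; apply: hs; last by rewrite expr_div_n E divff ?expf_neq0.
rewrite (_ : f z / f z' - 1 = (f z - f z') / f z'); last by field.
rewrite mdM mdV ltr_pdivrMr; last by rewrite md_gt0.
nra.
Qed.

Lemma nth_roots n w : (0 < n)%N -> w != 0 ->
  exists s : seq C, [/\ uniq s, size s = n & forall x, x \in s -> x ^+ n = w].
Proof.
move=> n0 w0; have [r [ur sr hr]] := unity_roots C n0.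
have x0 : n.-root w != 0 by rewrite rootC_eq0.
exists (map (fun y => n.-root w * y) r); split.
- by rewrite map_inj_uniq//; exact: mulfI.
- by rewrite size_map.
- by move=> x /mapP[y /hr yn ->]; rewrite exprMn yn mulr1 rootCK.
Qed.

Lemma pow_lmult f a n : (0 < n)%N -> lopen f a -> f a = 0 -> lmult (fun z => f z ^+ n) a n.
Proof.
move=> n0 hf fa e e0; have [d d0 h] := hf e e0.
exists (d ^+ n); first by rewrite exprn_gt0.
move=> w w0 wd; have [s [us ss hs]] := nth_roots n0 w0.
have H (x : C) : {z : C | x \in s -> md (z - a) < e /\ f z = x}.
  apply: cid; have [xs|xs] := boolP (x \in s); last by exists 0.
  have [|z z1 z2] := h x; last by exists z.
  rewrite fa subr0 ltNge; apply/negP => le.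
  have : d ^+ n <= md x ^+ n by apply: lerXn2r; rewrite ?nnegrE ?md_ge0 ?(ltW d0).
  by rewrite -mdX (hs x xs); lra.
exists (map (fun x => sval (H x)) s); split.
- rewrite map_inj_in_uniq// => x y xs ys E.
  by rewrite -(svalP (H x) xs).2 -(svalP (H y) ys).2 E.
- by rewrite size_map.
- move=> z /mapP[x xs ->]; have [h1 h2] := svalP (H x) xs; split => //.
  by rewrite h2; exact: hs.
Qed.

Lemma lmult_eq f g a n : nearC a (fun w => f w = g w) -> lmult f a n -> lmult g a n.
Proof.
move=> [d d0 E] hf e e0; have m0 : 0 < Num.min d e by rewrite lt_min d0.
have [d' d'0 h] := hf _ m0; exists d' => // w w0 /(h w w0)[s [us ss hs]].
exists s; split => // z /hs[]; rewrite lt_min => /andP[zd ze] <-.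
by rewrite E.
Qed.

(** At an interior maximum of [|h - b|] an open map would also take the value [h z0 + s (h z0 - b)]
    for a small [s > 0], which is farther from [b]. *)
Lemma max_principle h (r : R) b (B : R) : 0 < r ->
  (forall z, md z <= r -> cat setT h z) -> (forall z, md z < r -> lopen h z) ->
  (forall z, md z = r -> md (h z - b) <= B) -> forall z, md z <= r -> md (h z - b) <= B.
Proof.
move=> r0 ch oh hB.
have [||z0 /= z0r hz0] := @compact_min R [set z | md z <= r] (fun z => - md (h z - b)) (@compact_disc R r).
- by exists (0 : C); rewrite /= md0 ltW.
- move=> z zr e e0; have [d d0 k] := ch z zr e e0; exists d => // w _ wd.
  have := md_dist2 (h w) b (h z) b; rewrite subrr md0 addr0 => k1.
  rewrite (_ : - _ - - _ = - (md (h w - b) - md (h z - b))); last by ring.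
  by rewrite normrN; exact: le_lt_trans k1 (k w I wd).
move=> z zr; have := hz0 z zr; rewrite lerN2 => h1; apply: le_trans h1 _.
have [z0r'|] := ltP (md z0) r; last first.
  by move=> ge; apply: hB; apply/eqP; rewrite eq_le z0r ge.
have B0 : 0 <= B.
  have := hB (r%:C%C); rewrite md_real ger0_norm ?(ltW r0)// => /(_ erefl).
  exact: le_trans (md_ge0 _).
have [E|ne] := eqVneq (h z0 - b) 0; first by rewrite E md0.
have mv : 0 < md (h z0 - b) by rewrite md_gt0.
have rz : 0 < r - md z0 by lra.
have [d d0 hd] := oh z0 z0r' _ rz.
pose s := d / 2 / md (h z0 - b).
have s0 : 0 < s by rewrite !divr_gt0.
have [|z' z'r hz'] := hd (h z0 + s%:C%C * (h z0 - b)).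
  rewrite addrAC subrr add0r mdM md_real (ger0_norm (ltW s0)) /s divfK ?gt_eqF//; lra.
have /hz0 : md z' <= r by have := md_sub z' z0; lra.
rewrite lerN2 hz' (_ : _ - b = (1 + s)%:C%C * (h z0 - b)); last by rewrite rmorphD rmorph1; ring.
rewrite mdM md_real ger0_norm; [nra|lra].
Qed.

Definition atleast h (r : R) n w := exists s : seq C, [/\ uniq s, size s = n &
  forall z, z \in s -> md z < r /\ h z = w].

Lemma seq_min_dist (s : seq C) : exists2 e : R, 0 < e & forall x y, x \in s -> y \in s -> md (x - y) < e -> x = y.
Proof.
elim: s => [|x s [e e0 ih]]; first by exists 1.
have [d d0 hd] : exists2 d : R, 0 < d & forall y, y \in s -> md (x - y) < d -> x = y.
  elim: s {ih} => [|y s [d d0 hd]]; first by exists 1.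
  have [xy|xy] := eqVneq x y.
    by exists d => // z; rewrite inE => /orP[/eqP-> _ //|]; exact: hd.
  have m0 : 0 < md (x - y) by rewrite md_gt0 subr_eq0.
  exists (Num.min d (md (x - y))); first by rewrite lt_min d0.
  move=> z; rewrite inE lt_min => /orP[/eqP-> /andP[_]|zs /andP[zd _]]; first by rewrite ltxx.
  exact: hd.
exists (Num.min e d); first by rewrite lt_min e0.
move=> y z; rewrite !inE lt_min => /orP[/eqP->|ys] /orP[/eqP->|zs] /andP[h1 h2] //.
- exact: hd.
- by apply/esym/hd; rewrite // mdB.
- exact: ih.
Qed.

Lemma seq_common (s : seq C) (P : C -> R -> Prop) :
  (forall z (d d' : R), d' <= d -> P z d -> P z d') ->
  (forall z, z \in s -> exists2 d : R, 0 < d & P z d) ->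
  exists2 d : R, 0 < d & forall z, z \in s -> P z d.
Proof.
move=> mono; elim: s => [|x s ih] H; first by exists 1.
have [d d0 hd] : exists2 d : R, 0 < d & forall z, z \in s -> P z d.
  by apply: ih => z zs; apply: H; rewrite inE zs orbT.
have [d' d'0 hd'] := H x (mem_head _ _).
exists (Num.min d d'); first by rewrite lt_min d0.
move=> z; rewrite inE => /orP[/eqP->|zs].
  by apply: mono hd'; rewrite ge_min lexx orbT.
by apply: mono (hd z zs); rewrite ge_min lexx.
Qed.

(** By openness each preimage moves a little with the value; preimages that are separated stay
    distinct and inside the disc. *)
Lemma atleast_open h r n w : (forall z, md z < r -> lopen h z) -> atleast h r n w ->
  nearC w (atleast h r n).
Proof.
move=> oh [s [us ss hs]]; have [e e0 he] := seq_min_dist s.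
have [e1 e10 he1] : exists2 e1 : R, 0 < e1 & forall z, z \in s -> e1 <= r - md z.
  apply: (@seq_common s (fun z d => d <= r - md z)) => [z d d' dd h1|z /hs[zr _]].
    exact: le_trans dd h1.
  by exists (r - md z); [rewrite subr_gt0|].
pose e2 := Num.min (e / 2) e1.
have e20 : 0 < e2 by rewrite lt_min e10 divr_gt0.
have e2e : e2 <= e / 2 by rewrite ge_min lexx.
have e2e1 : e2 <= e1 by rewrite ge_min lexx orbT.
have [d d0 hd] : exists2 d : R, 0 < d & forall z, z \in s -> forall v, md (v - w) < d -> exists2 y, md (y - z) < e2 & h y = v.
  apply: (@seq_common s (fun z d => forall v, md (v - w) < d -> exists2 y, md (y - z) < e2 & h y = v)).
    by move=> z d d' dd h1 v vd; apply: h1; exact: lt_le_trans dd.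
  by move=> z /hs[zr hz]; have := oh z zr e2 e20; rewrite hz.
exists d => // v vd.
have H (z : C) : {y : C | z \in s -> md (y - z) < e2 /\ h y = v}.
  apply: cid; have [zs|zs] := boolP (z \in s); last by exists 0.
  by have [y y1 y2] := hd z zs v vd; exists y.
exists (map (fun z => sval (H z)) s); split.
- rewrite map_inj_in_uniq// => x y xs ys E; apply: he => //.
  have [h1 _] := svalP (H x) xs; have [h2 _] := svalP (H y) ys; rewrite -E in h2.
  rewrite mdB in h1; have := md_tri x (sval (H x)) y; lra.
- by rewrite size_map.
- move=> y /mapP[z zs ->]; have [h1 h2] := svalP (H z) zs; split => //.
  by have := md_sub (sval (H z)) z; have := he1 z zs; lra.
Qed.

(** The function [phi] is positive on the compact disc, so the preimages of a value near [w] lie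
    close to preimages of [w], and local injectivity allows only one near each of them. *)
Lemma atleast_closed h r n w : 0 < r -> (forall z, md z <= r -> cat setT h z) ->
  (forall z, md z < r -> h z = w -> linj h z) -> (forall z, md z = r -> h z != w) ->
  ~ atleast h r n w -> nearC w (fun v => ~ atleast h r n v).
Proof.
move=> r0 ch ih hb na.
(* [m] is the exact number of preimages of [w], so that [s] lists all of them. *)
have [m [mn am nam]] : exists m, [/\ (m < n)%N, atleast h r m w & ~ atleast h r m.+1 w].
  elim: n na => [|n IH] na; first by exfalso; apply: na; exists [::].
  have [an|nan] := pselect (atleast h r n w); first by exists n.
  by have [m [mn am nam]] := IH nan; exists m; split => //; exact: ltnW.
have {am} [s [us ss hs]] := am.
have allin z : md z < r -> h z = w -> z \in s.
  move=> zr hz; apply: contraT => zs; exfalso; apply: nam; exists (z :: s); split.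
  - by rewrite /= zs.
  - by rewrite /= ss.
  - by move=> y; rewrite inE => /orP[/eqP->//|/hs].
have [e e0 he] : exists2 e : R, 0 < e & forall z, z \in s ->
    forall y y', md (y - z) < e -> md (y' - z) < e -> h y = h y' -> y = y'.
  apply: (@seq_common s (fun z e => forall y y', md (y - z) < e -> md (y' - z) < e -> h y = h y' -> y = y')).
    by move=> z d d' dd h1 y y' yd y'd; apply: h1; [exact: lt_le_trans dd|exact: lt_le_trans dd].
  by move=> z /hs[zr hz]; exact: ih.
pose phi y := md (h y - w) + \sum_(z <- s) Num.max 0 (e - md (y - z)).
have phi_term y z : z \in s -> Num.max 0 (e - md (y - z)) <= phi y.
  move=> zs; rewrite /phi (big_rem z zs) /= addrA [_ + Num.max _ _]addrC -addrA lerDl.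
  by rewrite addr_ge0 ?md_ge0// sumr_ge0// => x _; rewrite le_max lexx.
have [||y0 /= y0r hy0] := @compact_min R [set z | md z <= r] phi (@compact_disc R r).
- by exists (0 : C); rewrite /= md0 ltW.
- move=> y yr e1 e10.
  pose q := e1 / ((size s).+2)%:R.
  have q0 : 0 < q by rewrite divr_gt0// ltr0n.
  have [d d0 hd] := ch y yr q q0.
  exists (Num.min d q); first by rewrite lt_min d0.
  move=> v _; rewrite lt_min => /andP[/(hd v I) v1 v2].
  have b1 := md_dist2 (h v) w (h y) w; rewrite subrr md0 addr0 in b1.
  have b2 : `|\sum_(z <- s) Num.max 0 (e - md (v - z)) - \sum_(z <- s) Num.max 0 (e - md (y - z))| <= (size s)%:R * q.
    rewrite -sumrB; apply: le_trans (ler_norm_sum _ _ _) _.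
    apply: le_trans (_ : _ <= \sum_(z <- s) q) _; last by rewrite big_const_seq count_predT iter_addr_0 mulr_natl.
    apply: ler_sum => z _; apply: le_trans (maxr_lip _ _ _) _.
    rewrite (_ : e - _ - _ = - (md (v - z) - md (y - z))); last by ring.
    rewrite normrN; have := md_dist2 v z y z; rewrite subrr md0 addr0 => b; apply: le_trans b _; exact: ltW.
  have := ler_normD (md (h v - w) - md (h y - w)) (\sum_(z <- s) Num.max 0 (e - md (v - z)) - \sum_(z <- s) Num.max 0 (e - md (y - z))).
  rewrite (_ : _ - _ + (_ - _) = phi v - phi y); last by rewrite /phi; ring.
  have qE : (size s).+2%:R * q = e1 by rewrite mulrC divfK// pnatr_eq0.
  rewrite -natr1 -natr1 !mulrDl !mul1r in qE.
  lra.
have p0 : 0 < phi y0.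
  have [y0r'|y0r'] := ltP (md y0) r; last first.
    have y0E : md y0 = r by apply/eqP; rewrite eq_le y0r y0r'.
    rewrite /phi; apply: ltr_pwDl; first by rewrite md_gt0 subr_eq0 hb.
    by apply: sumr_ge0 => x _; rewrite le_max lexx.
  have [hw|hw] := eqVneq (h y0) w.
    apply: lt_le_trans (phi_term _ _ (allin _ y0r' hw)).
    by rewrite subrr md0 subr0 lt_max e0 orbT.
  rewrite /phi; apply: ltr_pwDl; first by rewrite md_gt0 subr_eq0.
  by apply: sumr_ge0 => x _; rewrite le_max lexx.
exists (phi y0) => // v vw [s' [us' ss' hs']].
have near_s y : y \in s' -> exists2 z, z \in s & md (y - z) < e.
  move=> /hs'[yr hy]; apply: contrapT => H.
  have := hy0 y (ltW yr); rewrite {2}/phi big1_seq ?addr0 ?hy; first lra.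
  move=> z /= zs; apply/max_idPl; rewrite subr_le0 leNgt; apply/negP => lt; apply: H.
  by exists z.
have H (y : C) : {z : C | y \in s' -> z \in s /\ md (y - z) < e}.
  apply: cid; have [ys|ys] := boolP (y \in s'); last by exists 0.
  by have [z z1 z2] := near_s y ys; exists z.
have : (size (map (fun y => sval (H y)) s') <= size s)%N.
  apply: uniq_leq_size.
    rewrite map_inj_in_uniq// => x y xs ys E.
    have [h1 h2] := svalP (H x) xs; have [_ h3] := svalP (H y) ys; rewrite -E in h3.
    by apply: (he _ h1) => //; rewrite (hs' x xs).2 (hs' y ys).2.
  by move=> _ /mapP[y ys ->]; have [] := svalP (H y) ys.
by rewrite size_map ss' ss leqNgt mn.
Qed.

(* Follow the preimages of a value moving along a segment: near 0 there are at least [n1 + n2] of them, they persist,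
   and at the end, beyond all values of [h] on the inner disc, there are at most [k mu]. *)
Lemma counting_contradiction (k mu n1 n2 : nat) h (c p1 p2 : C) (r0 r1 L : R) :
  (0 < k)%N -> (0 < mu)%N -> 0 < r0 -> r0 < r1 -> 0 < L ->
  (forall x : C, md x <= 1 / L -> md ((1 + x) ^+ k - 1) <= 1 / 2) ->
  (1 + 2 * L) * r0 ^+ mu < r1 ^+ mu ->
  (forall z, md z <= r1 -> cat setT h z) -> (forall z, md z < r1 -> lopen h z) ->
  (forall z, md z < r1 -> h z != 0 -> linj h z) ->
  lmult h p1 n1 -> lmult h p2 n2 -> p1 != p2 -> md p1 < r0 -> md p2 < r0 -> h p1 = 0 ->
  (forall z, r0 <= md z <= r1 -> h z = (z ^+ mu + c) ^+ k) -> (k * mu < n1 + n2)%N -> False.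
Proof.
move=> k0 mu0 r00 r01 L0 hL hr ch oh ih m1 m2 p12 p1r p2r hp1 hout kn.
pose rho := r0 ^+ mu; have rho0 : 0 < rho by rewrite exprn_gt0.
have ch0 z : md z <= r0 -> cat setT h z by move=> zr; apply: ch; lra.
have oh0 z : md z < r0 -> lopen h z by move=> zr; apply: oh; lra.
have hcirc z : md z = r0 -> h z = (z ^+ mu + c) ^+ k.
  by move=> zr; apply: hout; rewrite zr lexx ltW.
(* Otherwise [h] would differ from [c^k] by at most [|c^k| / 2] on the circle of radius [r0], hence
   inside it, and could not vanish at [p1]. *)
have cL : md c <= L * rho.
  rewrite leNgt; apply/negP => lt.
  have mc : 0 < md c by apply: lt_trans lt; rewrite mulr_gt0.
  have c0 : c != 0 by rewrite -md_gt0.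
  have mck : 0 < md (c ^+ k) by rewrite mdX exprn_gt0.
  have := @max_principle h r0 (c ^+ k) (md (c ^+ k) / 2) r00 ch0 oh0 _ p1 (ltW p1r).
  rewrite hp1 sub0r mdN => H; suff : md (c ^+ k) <= md (c ^+ k) / 2 by lra.
  apply: H => z zr; rewrite hcirc//.
  have -> : (z ^+ mu + c) ^+ k - c ^+ k = c ^+ k * ((1 + z ^+ mu / c) ^+ k - 1).
    rewrite mulrBr mulr1 -exprMn; congr (_ ^+ k - _); by field.
  rewrite mdM ler_pM2l// mul1r in hL *.
  by have := hL (z ^+ mu / c); rewrite mul1r; apply; rewrite mdM mdV mdX zr -/rho ler_pdivrMr// mulrC ler_pdivlMr// mulrC ltW.
(* [H0] bounds [h] above on the inner disc and [W] bounds it below on the outer circle; the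
   preimages of a value between them lie in the ring, where [h] is explicit. *)
pose H0 := ((1 + L) * rho) ^+ k; pose W := (r1 ^+ mu - L * rho) ^+ k.
have hin z : md z <= r0 -> md (h z) <= H0.
  move=> zr; rewrite -[h z]subr0; apply: (@max_principle h r0 0 H0 r00 ch0 oh0) => // y yr.
  rewrite subr0 hcirc// mdX; apply: lerXn2r; rewrite ?nnegrE ?md_ge0//.
    by rewrite mulr_ge0// ?(ltW rho0)//; lra.
  by apply: le_trans (mdD _ _) _; rewrite mdX yr -/rho; lra.
have base : (1 + L) * rho < r1 ^+ mu - L * rho by rewrite -/rho in hr; lra.
have b0 : 0 <= (1 + L) * rho by rewrite mulr_ge0 ?(ltW rho0)//; lra.
have HW : H0 < W by rewrite /H0 /W ltr_pXn2r// nnegrE; lra.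
have hbd z : md z = r1 -> W <= md (h z).
  move=> zr; rewrite hout ?zr ?lexx ?(ltW r01)// mdX; apply: lerXn2r; rewrite ?nnegrE ?md_ge0//; first lra.
  by have := md_subr (z ^+ mu) c; rewrite mdX zr; lra.
have H00 : 0 <= H0 by rewrite exprn_ge0.
pose v := (H0 + W) / 2; have v0 : 0 < v by rewrite /v; lra.
have vW : v < W by rewrite /v; lra.
have Hv : H0 < v by rewrite /v; lra.
have r10 : 0 < r1 by lra.
have mv (t : R) : 0 <= t -> md ((t * v)%:C%C : C) = t * v.
  by move=> t0; rewrite md_real ger0_norm// mulr_ge0// ltW.
have vn (t : R) : 0 < t -> ((t * v)%:C%C : C) != 0.
  by move=> t0; rewrite -md_gt0 mv ?(ltW t0)// mulr_gt0.
have p12' : 0 < md (p1 - p2) by rewrite md_gt0 subr_eq0.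
pose e := Num.min (md (p1 - p2) / 2) (r1 - r0).
have e0 : 0 < e by rewrite lt_min divr_gt0// subr_gt0.
have e1 : e <= md (p1 - p2) / 2 by rewrite ge_min lexx.
have e2 : e <= r1 - r0 by rewrite ge_min lexx orbT.
have [d1 d10 hd1] := m1 e e0; have [d2 d20 hd2] := m2 e e0.
pose t0 := Num.min 1 (Num.min (d1 / v / 2) (d2 / v / 2)).
have q1 : 0 < d1 / v by rewrite divr_gt0.
have q2 : 0 < d2 / v by rewrite divr_gt0.
have t00 : 0 < t0 by rewrite !lt_min ltr01 /=; apply/andP; split; rewrite divr_gt0.
have t01 : t0 <= 1 by rewrite ge_min lexx.
have td1 : t0 * v < d1.
  rewrite -ltr_pdivlMr//; apply: le_lt_trans (_ : d1 / v / 2 < _); first by rewrite !ge_min lexx !orbT.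
  lra.
have td2 : t0 * v < d2.
  rewrite -ltr_pdivlMr//; apply: le_lt_trans (_ : d2 / v / 2 < _); first by rewrite !ge_min lexx !orbT.
  lra.
have start : atleast h r1 (n1 + n2) ((t0 * v)%:C%C).
  have [|s1 [u1 ss1 hs1]] := hd1 _ (vn _ t00); first by rewrite mv// ltW.
  have [|s2 [u2 ss2 hs2]] := hd2 _ (vn _ t00); first by rewrite mv// ltW.
  exists (s1 ++ s2); split.
  - rewrite cat_uniq u1 u2 andbT /=; apply/hasPn => z /hs2[z2 _]; apply/negP => /hs1[z1 _].
    by have := md_tri p1 z p2; rewrite mdB in z1; lra.
  - by rewrite size_cat ss1 ss2.
  - move=> z; rewrite mem_cat => /orP[/hs1|/hs2] [z1 z2]; split => //.
      by have := md_sub z p1; lra.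
    by have := md_sub z p2; lra.
(* Having at least [n1 + n2] preimages is an open and closed condition along the segment from
   [t0 * v] to [v]. *)
have : `[< atleast h r1 (n1 + n2) ((1 * v)%:C%C) >] = `[< atleast h r1 (n1 + n2) ((t0 * v)%:C%C) >].
  apply: (@loc_const_itv R _ (fun t => `[< atleast h r1 (n1 + n2) ((t * v)%:C%C) >])); [exact: t01| |by rewrite t01 lexx].
  move=> x /andP[x0 x1]; have xp : 0 < x by lra.
  have dist (t : R) : md ((t * v)%:C%C - (x * v)%:C%C : C) = `|t - x| * v.
    by rewrite -rmorphB /= -mulrBl md_real normrM (gtr0_norm v0).
  have [al|nal] := pselect (atleast h r1 (n1 + n2) ((x * v)%:C%C)).
    have [d d0 hd] := atleast_open oh al.
    exists (d / v); first by rewrite divr_gt0.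
    move=> t _ tx; rewrite !asboolT//; apply: hd.
    by rewrite dist -ltr_pdivlMr.
  have [||d d0 hd] := atleast_closed r10 ch _ _ nal.
  - by move=> z zr hz; apply: ih => //; rewrite hz vn.
  - move=> z zr; apply: contraTneq (hbd z zr) => ->; rewrite (mv _ (ltW xp)) -ltNge.
    by apply: le_lt_trans vW; rewrite ler_piMl ?(ltW v0).
  exists (d / v); first by rewrite divr_gt0.
  move=> t _ tx; rewrite !asboolF//; apply: hd.
  by rewrite dist -ltr_pdivlMr.
rewrite [RHS]asboolT// => /asboolP[s [us ss hs]].
have := @root_count C k mu c ((1 * v)%:C%C) s k0 mu0 us; rewrite ss => H.
have : (n1 + n2 <= k * mu)%N; last by rewrite leqNgt kn.
apply: H => z /hs[zr hz]; rewrite -hout//; apply/andP; split; last exact: ltW.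
rewrite leNgt; apply/negP => /ltW /hin; rewrite hz mv// mul1r; lra.
Qed.

End Counting.

(** * Germs on rectangles *)


Section Germs.
Context {R : realType}.
Local Notation C := (Cplx R).
Implicit Types (f g s : C -> C) (z w a b : C) (A B D S : set C) (G : C -> (C -> C) -> Prop).

Definition thick S := forall b, S b -> forall e : R, 0 < e ->
  exists w, [/\ S w, w != b & md (w - b) < e].

Definition convexC A := forall z w (t : R), A z -> A w -> 0 <= t <= 1 -> A (z + t%:C%C * (w - z)).

Definition closedC A := forall a, ~ A a -> nearC a (fun w => ~ A w).

Definition agree g1 g2 A a := nearC a (fun w => A w -> g1 w = g2 w).

(* [G a s] means that the function [s] is an admissible germ at [a]; [good G g A] makes [g] a section over [A]. *)
Definition unique_cont G D := forall a, D a -> exists2 e : R, 0 < e &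
  forall s1 s2, G a s1 -> G a s2 -> forall S b, thick S -> S b -> md (b - a) < e ->
    agree s1 s2 S b -> forall w, md (w - a) < e -> s1 w = s2 w.

Definition good G g A := forall a, A a -> exists2 s, G a s & agree g s A a.

Lemma agree_sub g1 g2 A B a : B `<=` A -> agree g1 g2 A a -> agree g1 g2 B a.
Proof. by move=> BA; apply: nearCW => w h /BA. Qed.

Lemma good_sub G g A B : B `<=` A -> good G g A -> good G g B.
Proof. by move=> BA h a Ba; have [s Gs h'] := h a (BA _ Ba); exists s => //; exact: agree_sub h'. Qed.

Lemma agree_sym g1 g2 A a : agree g1 g2 A a -> agree g2 g1 A a.
Proof. by apply: nearCW => w h /h. Qed.

Lemma agree_trans g2 g1 g3 A a : agree g1 g2 A a -> agree g2 g3 A a -> agree g1 g3 A a.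
Proof. by move=> h1 h2; apply: nearCW (nearCI h1 h2) => w [k1 k2] Aw; rewrite k1// k2. Qed.

(** The points of the segment from [a0] to [w] near which the two sections agree form an open and
    closed subset; closedness is where unique continuation from a thick set enters. *)
Lemma good_ident G D A g1 g2 a0 : unique_cont G D -> A `<=` D -> convexC A -> thick A ->
  good G g1 A -> good G g2 A -> A a0 -> agree g1 g2 A a0 -> forall w, A w -> g1 w = g2 w.
Proof.
move=> uc AD cA tA h1 h2 Aa0 ag w Aw.
pose gam (t : R) : C := a0 + t%:C%C * (w - a0).
have Ag t : 0 <= t <= 1 -> A (gam t) by move=> ht; exact: cA.
have gd t x : md (gam t - gam x) = `|t - x| * md (w - a0).
  by rewrite /gam opprD addrACA subrr add0r -mulrBl mdM -rmorphB /= md_real.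
have m0 := md_ge0 (w - a0).
have near_gam x r : 0 < r -> exists2 d : R, 0 < d & forall t, `|t - x| < d -> md (gam t - gam x) < r.
  move=> r0; exists (r / (md (w - a0) + 1)); first by rewrite divr_gt0//; lra.
  move=> t; rewrite ltr_pdivlMr ?gd; last lra.
  by have := normr_ge0 (t - x); nra.
have E : `[< agree g1 g2 A (gam 1) >] = `[< agree g1 g2 A (gam 0) >].
  apply: (@loc_const_itv R _ (fun t => `[< agree g1 g2 A (gam t) >]) 0 1); [lra| |lra].
  move=> x hx; have [e e0 he] := uc _ (AD _ (Ag _ hx)).
  have [s1 G1 [r1 r10 k1]] := h1 _ (Ag _ hx); have [s2 G2 [r2 r20 k2]] := h2 _ (Ag _ hx).
  have [agx|nagx] := pselect (agree g1 g2 A (gam x)).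
    have [r r0 hr] := nearC_nearC agx; have [d d0 hd] := near_gam x r r0.
    by exists d => // t _ /hd/hr agt; rewrite !asboolT.
  pose m := Num.min e (Num.min r1 r2).
  have m_0 : 0 < m by rewrite !lt_min e0 r10.
  have [d d0 hd] := near_gam x m m_0.
  exists d => // t ht /hd; rewrite !lt_min => /andP[te /andP[t1 t2]]; rewrite !asboolF//.
  move=> [r r0 hr]; apply: nagx.
  have sE : forall v, md (v - gam x) < e -> s1 v = s2 v.
    apply: (he s1 s2 G1 G2 A (gam t) tA (Ag _ ht) te).
    have [q q0 hq] : nearC (gam t) (fun v => md (v - gam x) < Num.min r1 r2).
      exists (Num.min r1 r2 - md (gam t - gam x)); first by rewrite subr_gt0 lt_min t1.
      by move=> v hv; have := md_tri v (gam t) (gam x); lra.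
    exists (Num.min r q); first by rewrite lt_min r0.
    move=> v; rewrite lt_min => /andP[vr /hq]; rewrite lt_min => /andP[v1 v2] Av.
    by rewrite -k1// -k2// hr.
  exists m => // v; rewrite !lt_min => /andP[ve /andP[v1 v2]] Av.
  by rewrite k1// k2// sE.
have g0 : gam 0 = a0 by rewrite /gam mul0r addr0.
have g1E : gam 1 = w by rewrite /gam mul1r subrKC.
move: E; rewrite g0 g1E [RHS]asboolT// => /asboolP agw.
by have := nearC_self agw Aw.
Qed.

Definition pick2 A g1 g2 : C -> C := fun z => if `[< A z >] then g1 z else g2 z.

Lemma pick2_in A g1 g2 z : A z -> pick2 A g1 g2 z = g1 z.
Proof. by move=> Az; rewrite /pick2 asboolT. Qed.

Lemma pick2_out A g1 g2 z : ~ A z -> pick2 A g1 g2 z = g2 z.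
Proof. by move=> Az; rewrite /pick2 asboolF. Qed.

(** At a common point the two germs agree on the thick intersection, hence on a full neighbourhood,
    so that either of them serves for the union. *)
Lemma good_glue G D A B g1 g2 : unique_cont G D -> A `|` B `<=` D -> closedC A -> closedC B ->
  thick (A `&` B) -> good G g1 A -> good G g2 B -> (forall w, A w -> B w -> g1 w = g2 w) ->
  good G (pick2 A g1 g2) (A `|` B).
Proof.
move=> uc AD cA cB tS h1 h2 E a ABa.
have [Aa|nAa] := pselect (A a); have [Ba|nBa] := pselect (B a).
- have [s1 G1 k1] := h1 a Aa; have [s2 G2 k2] := h2 a Ba.
  have [e e0 he] := uc a (AD _ ABa).
  have sE : nearC a (fun v => s1 v = s2 v).
    exists e => //; apply: (he s1 s2 G1 G2 (A `&` B) a tS); [by []|by rewrite subrr md0|].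
    apply: nearCW (nearCI k1 k2) => w [w1 w2] [Aw Bw].
    by rewrite -w1// -w2// E.
  exists s1 => //; apply: nearCW (nearCI sE (nearCI k1 k2)) => w [ws [w1 w2]] ABw.
  have [Aw|nAw] := pselect (A w); first by rewrite pick2_in// w1.
  by rewrite pick2_out// w2 ?ws//; case: ABw.
- have [s1 G1 k1] := h1 a Aa; exists s1 => //.
  apply: nearCW (nearCI k1 (cB a nBa)) => w [w1 nBw] [Aw|//].
  by rewrite pick2_in// w1.
- have [s2 G2 k2] := h2 a Ba; exists s2 => //.
  apply: nearCW (nearCI k2 (cA a nAa)) => w [w1 nAw] [//|Bw].
  by rewrite pick2_out// w1.
- by case: ABa.
Qed.

Lemma cat_glue A B g1 g2 a : closedC A -> closedC B -> (A `|` B) a ->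
  (A a -> cat A g1 a) -> (B a -> cat B g2 a) -> (forall w, A w -> B w -> g1 w = g2 w) ->
  cat (A `|` B) (pick2 A g1 g2) a.
Proof.
move=> cA cB ABa h1 h2 E e e0.
have [Aa|nAa] := pselect (A a); have [Ba|nBa] := pselect (B a).
- have [d d0 k1] := h1 Aa e e0; have [d' d'0 k2] := h2 Ba e e0.
  exists (Num.min d d'); first by rewrite lt_min d0.
  move=> w ABw; rewrite lt_min => /andP[w1 w2]; rewrite (pick2_in _ _ Aa).
  have [Aw|nAw] := pselect (A w); first by rewrite pick2_in//; exact: k1.
  by rewrite pick2_out// E//; apply: k2 => //; case: ABw.
- have [d d0 k1] := h1 Aa e e0; have [d' d'0 k2] := cB a nBa.
  exists (Num.min d d'); first by rewrite lt_min d0.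
  move=> w ABw; rewrite lt_min => /andP[w1 /k2 nB]; rewrite (pick2_in _ _ Aa).
  by case: ABw => // Aw; rewrite pick2_in//; exact: k1.
- have [d d0 k1] := h2 Ba e e0; have [d' d'0 k2] := cA a nAa.
  exists (Num.min d d'); first by rewrite lt_min d0.
  move=> w ABw; rewrite lt_min => /andP[w1 /k2 nA]; rewrite (pick2_out _ _ nAa).
  by case: ABw => // Bw; rewrite pick2_out//; exact: k1.
- by case: ABa.
Qed.

Lemma closedCU A B : closedC A -> closedC B -> closedC (A `|` B).
Proof.
move=> cA cB a /not_orP[nA nB]; apply: nearCW (nearCI (cA a nA) (cB a nB)) => w [h1 h2] [].
  exact: h1.
exact: h2.
Qed.

Definition rc (x0 x1 y0 y1 : R) : set C :=
  [set z | x0 <= complex.Re z <= x1 /\ y0 <= complex.Im z <= y1].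

Lemma rc_pt x0 x1 y0 y1 x y : x0 <= x <= x1 -> y0 <= y <= y1 -> rc x0 x1 y0 y1 (pt x y).
Proof. by []. Qed.

Lemma ReD (z w : C) : complex.Re (z + w) = complex.Re z + complex.Re w.
Proof. by case: z w => ? ? []. Qed.

Lemma ReZ (t : R) (z : C) : complex.Re (t%:C%C * z) = t * complex.Re z.
Proof. by case: z => a b /=; rewrite mul0r subr0. Qed.

Lemma ImZ (t : R) (z : C) : complex.Im (t%:C%C * z) = t * complex.Im z.
Proof. by case: z => a b /=; rewrite mul0r addr0. Qed.

Lemma itv_convex (a b x y t : R) : a <= x <= b -> a <= y <= b -> 0 <= t <= 1 -> a <= x + t * (y - x) <= b.
Proof. by move=> /andP[x0 x1] /andP[y0 y1] /andP[t0 t1]; apply/andP; split; nra. Qed.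

Lemma rc_convex x0 x1 y0 y1 : convexC (rc x0 x1 y0 y1).
Proof.
move=> z w t [z1 z2] [w1 w2] ht; split; rewrite ?ReD ?ImD ?ReZ ?ImZ ?ReB ?ImB; exact: itv_convex.
Qed.

Lemma near_Re a (P : R -> Prop) (e : R) : 0 < e -> (forall x, `|x - complex.Re a| < e -> P x) ->
  nearC a (fun w => P (complex.Re w)).
Proof.
move=> e0 h; exists e => // w we; apply: h; rewrite -ReB; exact: le_lt_trans (md_Re _) we.
Qed.

Lemma near_Im a (P : R -> Prop) (e : R) : 0 < e -> (forall x, `|x - complex.Im a| < e -> P x) ->
  nearC a (fun w => P (complex.Im w)).
Proof.
move=> e0 h; exists e => // w we; apply: h; rewrite -ImB; exact: le_lt_trans (md_Im _) we.
Qed.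

Lemma near_Re_lt a (x : R) : complex.Re a < x -> nearC a (fun w => complex.Re w < x).
Proof.
move=> h; apply: (@near_Re a (fun y => y < x) (x - complex.Re a)); first by rewrite subr_gt0.
by move=> y; rewrite ltr_norml => /andP[_]; lra.
Qed.

Lemma near_Re_gt a (x : R) : x < complex.Re a -> nearC a (fun w => x < complex.Re w).
Proof.
move=> h; apply: (@near_Re a (fun y => x < y) (complex.Re a - x)); first by rewrite subr_gt0.
by move=> y; rewrite ltr_norml => /andP[+ _]; lra.
Qed.

Lemma near_Im_lt a (x : R) : complex.Im a < x -> nearC a (fun w => complex.Im w < x).
Proof.
move=> h; apply: (@near_Im a (fun y => y < x) (x - complex.Im a)); first by rewrite subr_gt0.
by move=> y; rewrite ltr_norml => /andP[_]; lra.
Qed.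

Lemma near_Im_gt a (x : R) : x < complex.Im a -> nearC a (fun w => x < complex.Im w).
Proof.
move=> h; apply: (@near_Im a (fun y => x < y) (complex.Im a - x)); first by rewrite subr_gt0.
by move=> y; rewrite ltr_norml => /andP[+ _]; lra.
Qed.

Lemma rc_closed x0 x1 y0 y1 : closedC (rc x0 x1 y0 y1).
Proof.
move=> a na.
have [h|h1] := ltP (complex.Re a) x0.
  by apply: nearCW (near_Re_lt h) => w hw [/andP[]]; lra.
have [h|h2] := ltP x1 (complex.Re a).
  by apply: nearCW (near_Re_gt h) => w hw [/andP[]]; lra.
have [h|h3] := ltP (complex.Im a) y0.
  by apply: nearCW (near_Im_lt h) => w hw [_ /andP[]]; lra.
have [h|h4] := ltP y1 (complex.Im a).
  by apply: nearCW (near_Im_gt h) => w hw [_ /andP[]]; lra.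
by exfalso; apply: na; split; apply/andP.
Qed.

Lemma convex_thick A z w : convexC A -> A z -> A w -> z != w -> thick A.
Proof.
move=> cA Az Aw zw b Ab e e0.
have [v Av vb] : exists2 v, A v & v != b.
  by have [E|ne] := eqVneq z b; [exists w => //; rewrite -E eq_sym|exists z].
have m0 : 0 < md (v - b) by rewrite md_gt0 subr_eq0.
pose t := Num.min 1 (e / md (v - b) / 2).
have q0 : 0 < e / md (v - b) / 2 by rewrite !divr_gt0.
have t0 : 0 < t by rewrite lt_min ltr01.
have t1 : t <= 1 by rewrite ge_min lexx.
exists (b + t%:C%C * (v - b)); split.
- by apply: cA => //; rewrite t1 ltW.
- rewrite -subr_eq0 addrAC subrr add0r mulf_neq0 ?subr_eq0//.
  by rewrite -md_gt0 md_real ger0_norm// ltW.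
- rewrite addrAC subrr add0r mdM md_real (ger0_norm (ltW t0)) -ltr_pdivlMr//.
  apply: le_lt_trans (_ : e / md (v - b) / 2 < _); first by rewrite ge_min lexx orbT.
  have : 0 < e / md (v - b) by rewrite divr_gt0.
  by move: (e / md (v - b)) => q; lra.
Qed.

Lemma rc_thick x0 x1 y0 y1 : x0 <= x1 -> y0 <= y1 -> x0 < x1 \/ y0 < y1 -> thick (rc x0 x1 y0 y1).
Proof.
move=> hx hy h; apply: (@convex_thick _ (pt x0 y0) (pt x1 y1)); first exact: rc_convex.
- by apply: rc_pt; rewrite lexx.
- by apply: rc_pt; rewrite lexx andbT.
- by apply/eqP => -[e1 e2]; case: h; lra.
Qed.

Lemma rc_catx x x0 x1 y0 y1 : x0 <= x <= x1 -> rc x0 x y0 y1 `|` rc x x1 y0 y1 = rc x0 x1 y0 y1.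
Proof.
move=> hx; apply/seteqP; split=> z.
  by case=> -[h1 h2]; split => //; lra.
move=> [h1 h2]; have [h|h] := leP (complex.Re z) x; [left|right]; split => //; lra.
Qed.

Lemma rc_caty y x0 x1 y0 y1 : y0 <= y <= y1 -> rc x0 x1 y0 y `|` rc x0 x1 y y1 = rc x0 x1 y0 y1.
Proof.
move=> hx; apply/seteqP; split=> z.
  by case=> -[h1 h2]; split => //; lra.
move=> [h1 h2]; have [h|h] := leP (complex.Im z) y; [left|right]; split => //; lra.
Qed.

Lemma rc_capx x x0 x1 y0 y1 : x0 <= x <= x1 -> rc x0 x y0 y1 `&` rc x x1 y0 y1 = rc x x y0 y1.
Proof.
move=> hx; apply/seteqP; split=> z.
  by case=> -[h1 h2] [h3 h4]; split => //; lra.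
by move=> [h1 h2]; split; split => //; lra.
Qed.

Lemma rc_capy y x0 x1 y0 y1 : y0 <= y <= y1 -> rc x0 x1 y0 y `&` rc x0 x1 y y1 = rc x0 x1 y y.
Proof.
move=> hx; apply/seteqP; split=> z.
  by case=> -[h1 h2] [h3 h4]; split => //; lra.
by move=> [h1 h2]; split; split => //; lra.
Qed.

Lemma rc_sub u0 u1 v0 v1 x0 x1 y0 y1 : x0 <= u0 -> u1 <= x1 -> y0 <= v0 -> v1 <= y1 ->
  rc u0 u1 v0 v1 `<=` rc x0 x1 y0 y1.
Proof. by move=> ? ? ? ? z [h1 h2]; split; lra. Qed.

(** The quartering of [quad_ind] is done by halvings in the two directions, so that only two
    rectangles with a common side are glued at a time. *)
Lemma rc_ind (P : set C -> Prop) (x0 x1 y0 y1 : R) : x0 < x1 -> y0 < y1 ->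
  (forall u0 u u1 v0 v1, x0 <= u0 -> u0 < u -> u < u1 -> u1 <= x1 -> y0 <= v0 -> v0 < v1 -> v1 <= y1 ->
    P (rc u0 u v0 v1) -> P (rc u u1 v0 v1) -> P (rc u0 u1 v0 v1)) ->
  (forall u0 u1 v0 v v1, x0 <= u0 -> u0 < u1 -> u1 <= x1 -> y0 <= v0 -> v0 < v -> v < v1 -> v1 <= y1 ->
    P (rc u0 u1 v0 v) -> P (rc u0 u1 v v1) -> P (rc u0 u1 v0 v1)) ->
  (forall a, rc x0 x1 y0 y1 a -> exists2 d : R, 0 < d & forall u0 u1 v0 v1,
    u0 < u1 -> v0 < v1 -> rc u0 u1 v0 v1 `<=` rc x0 x1 y0 y1 ->
    (forall w, rc u0 u1 v0 v1 w -> md (w - a) < d) -> P (rc u0 u1 v0 v1)) ->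
  P (rc x0 x1 y0 y1).
Proof.
move=> hx hy gx gy loc.
have := @quad_ind R (fun u0 u1 v0 v1 => u0 < u1 -> v0 < v1 -> P (rc u0 u1 v0 v1)) x0 x1 y0 y1 (ltW hx) (ltW hy).
apply => //.
  move=> u0 u1 v0 v1 a1 a2 a3 b1 b2 b3 u v h1 h2 h3 h4 hu hv; rewrite /u /v in h1 h2 h3 h4.
  have [u1' u2] := midf_lt hu; have [v1' v2] := midf_lt hv.
  have [u3 u4] := (ltW (lt_le_trans u2 a3), ltW (le_lt_trans a1 u1')).
  have [v3 v4] := (ltW (lt_le_trans v2 b3), ltW (le_lt_trans b1 v1')).
  by apply: (gy _ _ _ ((v0 + v1) / 2)) => //; apply: (gx _ ((u0 + u1) / 2)) => //; auto.
move=> x y hxx hyy; have [d d0 hd] := loc (pt x y) (rc_pt hxx hyy).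
exists (d / 2); first lra.
move=> u0 u1 v0 v1 a1 a2 a3 b1 b2 b3 _ _ du dv hu hv; apply: hd => //.
  by move=> z [h1 h2]; split; lra.
move=> w [h1 h2]; rewrite (ptE w) ptB; apply: le_lt_trans (md_pt _ _) _.
have : `|complex.Re w - x| < d / 2 by rewrite ltr_norml; lra.
have : `|complex.Im w - y| < d / 2 by rewrite ltr_norml; lra.
lra.
Qed.

End Germs.

(** * Flat structures with cone points *)


Section PowConst.
Context {R : realType}.
Local Notation C := (Cplx R).

(** The derivatives of order [k - 1] of the two powers are [k!] times [X + c1] and [X + c2]. *)
Lemma pow_shift_poly (F : numClosedFieldType) k (c1 c2 : F) : (0 < k)%N -> c1 != c2 ->
  ('X + c1%:P) ^+ k - ('X + c2%:P) ^+ k != 0 :> {poly F}.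
Proof.
move=> k0 c12; apply/eqP => /eqP; rewrite subr_eq0 => /eqP E.
have := congr1 (fun p : {poly F} => p^`(k.-1).[- c1]) E.
have D n j (c : F) : (j <= n)%N -> (('X + c%:P) ^+ n)^`(j) = ('X + c%:P) ^+ (n - j) *+ (n ^_ j).
  elim: j => [|j IH] jn; first by rewrite subn0 ffactn0.
  rewrite derivnS IH 1?ltnW// derivMn deriv_exp derivD derivX derivC addr0 mul1r -mulrnA.
  by rewrite -subnS; congr (_ *+ _); rewrite ffactnSr mulnC.
rewrite !(D k k.-1 _ (leq_pred k)); have -> : (k - k.-1 = 1)%N by rewrite -{1}(prednK k0) subSnn.
rewrite !expr1 !hornerMn !hornerE addNr mul0rn => /esym/eqP.
rewrite mulrn_eq0 eqn0Ngt ffact_gt0 leq_pred /= addrC subr_eq0 => /eqP e.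
by move: c12; rewrite e eqxx.
Qed.

(** Where the two powers agree, [F] takes its values among the finitely many roots of a nonzero
    polynomial; near [b] only the value [F b] is left, against injectivity on a set without isolated
    points. So the constant in [(f a w + c)^k] is determined by the function. *)
Lemma pow_const (k : nat) (F : C -> C) (c1 c2 b : C) (S : set C) (d : R) : (0 < k)%N -> thick S -> S b ->
  cat setT F b -> 0 < d -> (forall w, md (w - b) < d -> F w = F b -> w = b) ->
  nearC b (fun w => S w -> (F w + c1) ^+ k = (F w + c2) ^+ k) -> c1 = c2.
Proof.
move=> k0 tS Sb cF d0 inj ne; apply/eqP/contraT => c12.
pose P : {poly C} := ('X + c1%:P) ^+ k - ('X + c2%:P) ^+ k.
have P0 : P != 0 by exact: pow_shift_poly.
have [r rE] := closed_field_poly_normal P.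
have inr x : (x + c1) ^+ k = (x + c2) ^+ k -> x \in r.
  move=> e; have : root P x by rewrite /root /P !hornerE e subrr.
  by rewrite rE rootZ ?lead_coef_eq0// root_prod_XsubC.
have [e e0 he] := seq_min_dist r.
have [d1 d10 h1] := cF e e0; have [d2 d20 h2] := ne.
have m0 : 0 < Num.min d (Num.min d1 d2) by rewrite !lt_min d0 d10.
have [w [Sw wb]] := tS b Sb _ m0; rewrite !lt_min => /andP[wd /andP[w1 w2]].
case/negP: wb; apply/eqP; apply: inj => //; apply: he; last exact: h1.
  by apply: inr; exact: h2.
by apply: inr; apply: h2 => //; rewrite subrr md0.
Qed.

End PowConst.

Section FlatPlane.
Context {R : realType}.
Local Notation C := (Cplx R).
Variables (k : nat) (Reg : set C) (f : C -> C -> C).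
Hypothesis k0 : (0 < k)%N.

(* [f a] is a flat coordinate near [a]; as [(df a)^k] is the given k-differential, two of them differ by
   [w |-> zeta w + c] with [zeta^k = 1]. *)
Definition flat_atlas := forall a, Reg a -> exists2 d : R, 0 < d &
  (forall b, md (b - a) < d -> [/\ Reg b, cat setT (f a) b &
     exists zeta c, zeta ^+ k = 1 /\ nearC b (fun w => f a w = zeta * f b w + c)]) /\
  (forall b b', md (b - a) < d -> md (b' - a) < d -> f a b = f a b' -> b = b').

(* At a singularity of order [n - k] the flat coordinate is [t^(n/k)] up to constants. *)
Definition cone_chart (p : C) (t : C -> C) (n : nat) := exists2 d : R, 0 < d &
  [/\ forall b, md (b - p) < d -> cat setT t b,
      forall b b', md (b - p) < d -> md (b' - p) < d -> t b = t b' -> b = b',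
      t p = 0
    & forall b, md (b - p) < d -> b != p -> Reg b /\
        exists c, nearC b (fun w => t w ^+ n = (f b w + c) ^+ k)].

Hypothesis fl : flat_atlas.

Definition Gf (a : C) (s : C -> C) := exists zeta c, zeta ^+ k = 1 /\ forall w, s w = zeta * f a w + c.

Lemma unity_neq0 (z : C) : z ^+ k = 1 -> z != 0.
Proof. by move=> h; apply/eqP => z0; move: h; rewrite z0 expr0n gtn_eqF// => /eqP; rewrite eq_sym oner_eq0. Qed.

(** Two values determine an affine function, and [f a] takes two values on any thick set. *)
Lemma Gf_uc : unique_cont Gf Reg.
Proof.
move=> a /fl[d d0 [_ inj]]; exists d => // s1 s2 [z1 [c1 [_ E1]]] [z2 [c2 [_ E2]]] S b tS Sb ba [e e0 he].
have e0' : 0 < Num.min e (d - md (b - a)) by rewrite lt_min e0 subr_gt0.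
have [w [Sw wb]] := tS b Sb _ e0'; rewrite lt_min => /andP[we wd].
have h1 := he w we Sw; have h2 : s1 b = s2 b by apply: he => //; rewrite subrr md0.
rewrite !E1 !E2 in h1 h2.
have fw : f a w != f a b.
  apply: contraNneq wb => /inj -> //; have := md_tri w b a; move: wd; lra.
have zz : z1 = z2.
  apply/eqP; rewrite -subr_eq0; have : (z1 - z2) * (f a w - f a b) = 0.
    transitivity ((z1 * f a w + c1) - (z1 * f a b + c1) - ((z2 * f a w + c2) - (z2 * f a b + c2))); first by ring.
    by rewrite h1 h2 subrr.
  by move/eqP; rewrite mulf_eq0 [X in _ || X]subr_eq0 (negPf fw) orbF.
move=> v _; rewrite E1 E2 zz; congr (_ + _).
by move: h2; rewrite zz => /addrI.
Qed.

Lemma good_affine g A th c : good Gf g A -> th ^+ k = 1 -> good Gf (fun w => th * g w + c) A.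
Proof.
move=> h th1 a Aa; have [s [z [c' [z1 E]]] ag] := h a Aa.
exists (fun w => th * s w + c).
  exists (th * z), (th * c' + c); split; first by rewrite exprMn th1 z1 mulr1.
  by move=> w; rewrite E; ring.
by apply: nearCW ag => w k1 /k1 ->.
Qed.

Lemma Gf_norm a s1 s2 : Gf a s1 -> Gf a s2 -> exists th c, th ^+ k = 1 /\ forall w, s1 w = th * s2 w + c.
Proof.
move=> [z1 [c1 [h1 E1]]] [z2 [c2 [h2 E2]]]; have n2 := unity_neq0 h2.
exists (z1 / z2), (c1 - z1 / z2 * c2); split; first by rewrite expr_div_n h1 h2 divr1.
by move=> w; rewrite E1 E2; field.
Qed.

Lemma F_renorm A g b s : A b -> good Gf g A -> Gf b s -> exists th c,
  th ^+ k = 1 /\ agree (fun w => th * g w + c) s A b.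
Proof.
move=> Ab h Gs; have [s' Gs' ag] := h b Ab.
have [th [c [th1 E]]] := Gf_norm Gs Gs'.
by exists th, c; split => //; apply: nearCW ag => w k1 /k1 ->; rewrite E.
Qed.

Lemma F_glue A B g1 g2 a0 : A `|` B `<=` Reg -> closedC A -> closedC B -> convexC (A `&` B) ->
  thick (A `&` B) -> (A `&` B) a0 -> good Gf g1 A -> good Gf g2 B -> exists g, good Gf g (A `|` B).
Proof.
move=> AR cA cB cS tS Sa h1 h2.
have [s1 G1 ag1] := h1 a0 Sa.1.
have [th [c [th1 ag2]]] := F_renorm Sa.2 h2 G1.
have h2' := good_affine c h2 th1.
exists (pick2 A g1 (fun w => th * g2 w + c)); apply: (good_glue Gf_uc AR cA cB tS h1 h2').
move=> w Aw Bw; apply: (good_ident Gf_uc _ cS tS (good_sub _ h1) (good_sub _ h2') Sa) => //.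
- by move=> v [Av _]; apply: AR; left.
- apply: agree_trans (agree_sub _ ag1) (agree_sub _ (agree_sym ag2)) => v [] //.
Qed.

(** The developing map of a rectangle of regular points. The pieces can be glued because one of them
    may be renormalised by [w |-> zeta w + c] to match the other. *)
Lemma F_exists x0 x1 y0 y1 : x0 < x1 -> y0 < y1 -> rc x0 x1 y0 y1 `<=` Reg ->
  exists g, good Gf g (rc x0 x1 y0 y1).
Proof.
move=> hx hy AR.
apply: (@rc_ind _ (fun A => exists g, good Gf g A)) => //.
- move=> u0 u u1 v0 v1 a1 a2 a3 a4 a5 a6 a7 [g1 h1] [g2 h2].
  have hu : u0 <= u <= u1 by rewrite !ltW.
  rewrite -(rc_catx v0 v1 hu); apply: (F_glue (a0 := pt u v0)) h1 h2.
  + by rewrite rc_catx// => z zz; apply: AR; apply: rc_sub zz.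
  + exact: rc_closed.
  + exact: rc_closed.
  + by rewrite rc_capx//; exact: rc_convex.
  + by rewrite rc_capx//; apply: rc_thick; [|exact: ltW|right].
  + by rewrite rc_capx//; apply: rc_pt; rewrite lexx//= ltW.
- move=> u0 u1 v0 v v1 a1 a2 a3 a4 a5 a6 a7 [g1 h1] [g2 h2].
  have hv : v0 <= v <= v1 by rewrite !ltW.
  rewrite -(rc_caty u0 u1 hv); apply: (F_glue (a0 := pt u0 v)) h1 h2.
  + by rewrite rc_caty// => z zz; apply: AR; apply: rc_sub zz.
  + exact: rc_closed.
  + exact: rc_closed.
  + by rewrite rc_capy//; exact: rc_convex.
  + by rewrite rc_capy//; apply: rc_thick; [exact: ltW| |left].
  + by rewrite rc_capy//; apply: rc_pt; rewrite lexx//= ltW.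
- move=> a /AR/fl[d d0 [h _]]; exists d => // u0 u1 v0 v1 hu hv sub hd.
  exists (f a) => b /hd/h[_ _ [z [c [z1 ne]]]].
  exists (fun w => z * f b w + c); first by exists z, c.
  by apply: nearCW ne => w ->.
Qed.

Section Cone.
Variables (p : C) (t : C -> C) (n : nat).
Hypotheses (nRp : ~ Reg p) (ct : cone_chart p t n).

(* The k-th power forgets the root of unity, so that the germs [(f a w + c)^k] extend over the cone point [p]. *)
Definition Gh (a : C) (s : C -> C) := (a = p /\ forall w, s w = t w ^+ n) \/
  (a != p /\ exists c, forall w, s w = (f a w + c) ^+ k).

Lemma Gh_uc : unique_cont Gh [set a | Reg a \/ a = p].
Proof.
move=> a Ra; have [ap|ap] := eqVneq a p.
  exists 1; first lra.
  move=> s1 s2 [[_ E1]|[/eqP//]] [[_ E2]|[/eqP//]] S b _ _ _ _ w _; by rewrite E1 E2.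
have {}Ra : Reg a by case: Ra => // e; rewrite e eqxx in ap.
have [d d0 [h inj]] := fl Ra.
exists d => // s1 s2 [[/eqP e]|[_ [c1 E1]]]; first by rewrite (negPf ap) in e.
case=> [[/eqP e]|[_ [c2 E2]]]; first by rewrite (negPf ap) in e.
move=> S b tS Sb ba ag w _; have [_ cb _] := h b ba.
rewrite E1 E2; congr ((_ + _) ^+ _).
apply: (pow_const (d := d - md (b - a)) k0 tS Sb cb); first by rewrite subr_gt0.
  move=> v hv; apply: inj => //; have := md_tri v b a; move: hv; lra.
by apply: nearCW ag => v hv /hv; rewrite E1 E2.
Qed.

Lemma good_pow g A c : A `<=` Reg -> good Gf g A -> good Gh (fun w => (g w + c) ^+ k) A.
Proof.
move=> AR h a Aa; have [s [z [c' [z1 E]]] ag] := h a Aa; have zn := unity_neq0 z1.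
exists (fun w => (f a w + (c' + c) / z) ^+ k).
  right; split; last by exists ((c' + c) / z).
  by apply/eqP => ap; apply: nRp; rewrite -ap; exact: AR.
apply: nearCW ag => w kw /kw ->; rewrite E.
by rewrite (_ : z * f a w + c' + c = z * (f a w + (c' + c) / z)) ?exprMn ?z1 ?mul1r//; field.
Qed.

Lemma Gh_renorm b g s A B : Reg b -> A b -> B b -> good Gf g A -> good Gh s B -> exists c,
  agree (fun w => (g w + c) ^+ k) s (A `&` B) b.
Proof.
move=> Rb Ab Bb hg hs; have [g' [z [c' [z1 E]]] ag] := hg b Ab; have [s' Gs ag'] := hs b Bb.
have {Gs} [c Es] : exists c, forall w, s' w = (f b w + c) ^+ k.
  by case: Gs => [[bp]|[_ //]]; exfalso; apply: nRp; rewrite -bp.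
exists (z * c - c'); apply: nearCW (nearCI ag ag') => w [h1 h2] [Aw Bw].
rewrite h1// h2// E Es (_ : _ + _ + _ = z * (f b w + c)); last by ring.
by rewrite exprMn z1 mul1r.
Qed.

(** The germs of [Gh] leave no freedom at [p], where only [t ^+ n] is allowed. The section over a
    rectangle that avoids [p] is therefore made anew: a developing map exists there, and the
    constant under its k-th power is adjusted to the section over [A]. *)
Lemma H_glue1 A B h1 h2 x0 x1 y0 y1 : B = rc x0 x1 y0 y1 -> x0 < x1 -> y0 < y1 -> ~ B p ->
  A `|` B `<=` [set a | Reg a \/ a = p] -> closedC A -> convexC (A `&` B) ->
  thick (A `&` B) -> A `&` B !=set0 -> good Gh h1 A -> good Gh h2 B -> exists g, good Gh g (A `|` B).
Proof.
move=> BE hx hy nBp AR cA cS tS [a0 Sa] g1 g2.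
have BR : B `<=` Reg by move=> b Bb; case: (AR b (or_intror Bb)) => // e; rewrite e in Bb.
have cB : closedC B by rewrite BE; exact: rc_closed.
have [g hg] : exists g, good Gf g B by rewrite BE; apply: F_exists => //; rewrite -BE.
have [c ag] := Gh_renorm (BR _ Sa.2) Sa.2 Sa.1 hg g1.
have hg' := good_pow c BR hg.
exists (pick2 A h1 (fun w => (g w + c) ^+ k)); apply: (good_glue Gh_uc AR cA cB tS g1 hg').
move=> w Aw Bw; apply: (good_ident Gh_uc _ cS tS (good_sub _ g1) (good_sub _ hg') Sa) => //.
- by move=> v [Av _]; apply: AR; left.
- by apply: agree_sym; apply: agree_sub ag => v [].
Qed.

(** If both rectangles contain [p], both sections are [t ^+ n] near it and agree by continuation;
    otherwise [H_glue1] applies to the one that avoids [p]. *)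
Lemma H_glue h1 h2 u0 u1 v0 v1 x0 x1 y0 y1 : u0 < u1 -> v0 < v1 -> x0 < x1 -> y0 < y1 ->
  let A := rc u0 u1 v0 v1 in let B := rc x0 x1 y0 y1 in
  A `|` B `<=` [set a | Reg a \/ a = p] -> convexC (A `&` B) ->
  thick (A `&` B) -> A `&` B !=set0 -> good Gh h1 A -> good Gh h2 B -> exists g, good Gh g (A `|` B).
Proof.
move=> hu hv hx hy A B AR cS tS nS g1 g2.
have cA : closedC A by exact: rc_closed.
have cB : closedC B by exact: rc_closed.
have [Bp|nBp] := pselect (B p); last exact: (H_glue1 (erefl B)) nBp _ _ _ _ _ g1 g2.
have [Ap|nAp] := pselect (A p); last first.
  by rewrite setUC; apply: (H_glue1 (erefl A)) nAp _ _ _ _ _ g2 g1; rewrite // 1?setUC// 1?setIC.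
have at_p h D : D p -> good Gh h D -> agree h (fun w => t w ^+ n) D p.
  move=> Dp gh; have [s [[_ E]|[/eqP//]] ag] := gh p Dp.
  by apply: nearCW ag => w k1 /k1 ->; rewrite E.
exists (pick2 A h1 h2); apply: (good_glue Gh_uc AR cA cB tS g1 g2).
move=> w Aw Bw; apply: (good_ident (a0 := p) Gh_uc _ cS tS (good_sub _ g1) (good_sub _ g2)) => //.
- by move=> v [Av _]; apply: AR; left.
- apply: agree_trans (agree_sub _ (at_p _ _ Ap g1)) (agree_sub _ (agree_sym (at_p _ _ Bp g2))) => v [] //.
Qed.

Lemma H_exists x0 x1 y0 y1 : x0 < x1 -> y0 < y1 -> rc x0 x1 y0 y1 `<=` [set a | Reg a \/ a = p] ->
  exists g, good Gh g (rc x0 x1 y0 y1).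
Proof.
move=> hx hy AR.
apply: (@rc_ind _ (fun A => exists g, good Gh g A)) => //.
- move=> u0 u u1 v0 v1 a1 a2 a3 a4 a5 a6 a7 [g1 h1] [g2 h2].
  have hu : u0 <= u <= u1 by rewrite !ltW.
  rewrite -(rc_catx v0 v1 hu); apply: H_glue h1 h2 => //.
  + by rewrite rc_catx// => z zz; apply: AR; apply: rc_sub zz.
  + by rewrite rc_capx//; exact: rc_convex.
  + by rewrite rc_capx//; apply: rc_thick; [|exact: ltW|right].
  + by rewrite rc_capx//; exists (pt u v0); apply: rc_pt; rewrite lexx//= ltW.
- move=> u0 u1 v0 v v1 a1 a2 a3 a4 a5 a6 a7 [g1 h1] [g2 h2].
  have hv : v0 <= v <= v1 by rewrite !ltW.
  rewrite -(rc_caty u0 u1 hv); apply: H_glue h1 h2 => //.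
  + by rewrite rc_caty// => z zz; apply: AR; apply: rc_sub zz.
  + by rewrite rc_capy//; exact: rc_convex.
  + by rewrite rc_capy//; apply: rc_thick; [exact: ltW| |left].
  + by rewrite rc_capy//; exists (pt u0 v); apply: rc_pt; rewrite lexx//= ltW.
- move=> a Aa; have [ap|ap] := eqVneq a p.
    have [d d0 [_ _ _ h]] := ct; exists d => // u0 u1 v0 v1 hu hv sub hd.
    exists (fun w => t w ^+ n) => b Bb; have [bp|bp] := eqVneq b p.
      by exists (fun w => t w ^+ n); [left|exists 1 => //; lra].
    have [_ [c ne]] : Reg b /\ exists c, nearC b (fun w => t w ^+ n = (f b w + c) ^+ k).
      by apply: h => //; rewrite -ap; exact: hd.
    exists (fun w => (f b w + c) ^+ k); first by right; split => //; exists c.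
    by apply: nearCW ne => w ->.
  have Ra : Reg a by case: (AR a Aa) => // e; rewrite e eqxx in ap.
  have [d d0 [h _]] := fl Ra; exists d => // u0 u1 v0 v1 hu hv sub hd.
  pose g b := (f a b + 0) ^+ k; exists g.
  apply: good_pow; first by move=> b /hd/h[].
  move=> b /hd/h[_ _ [z [c [z1 ne]]]].
  exists (fun w => z * f b w + c); first by exists z, c.
  by apply: nearCW ne => w ->.
Qed.

End Cone.
End FlatPlane.

Section Rect.
Context {R : realType}.
Local Notation C := (Cplx R).

Lemma rc_ident (G : C -> (C -> C) -> Prop) D (x0 x1 y0 y1 : R) g1 g2 b : unique_cont G D ->
  x0 < x1 -> y0 < y1 -> rc x0 x1 y0 y1 `<=` D -> good G g1 (rc x0 x1 y0 y1) ->
  good G g2 (rc x0 x1 y0 y1) -> rc x0 x1 y0 y1 b -> nearC b (fun w => g1 w = g2 w) ->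
  forall w, rc x0 x1 y0 y1 w -> g1 w = g2 w.
Proof.
move=> uc hx hy AD h1 h2 Ab ne; apply: (good_ident uc AD) Ab _ => //.
- exact: rc_convex.
- by apply: rc_thick; [exact: ltW|exact: ltW|left].
- by apply: nearCW ne.
Qed.

Lemma rc_near (x0 x1 y0 y1 : R) b : x0 < complex.Re b < x1 -> y0 < complex.Im b < y1 ->
  nearC b (rc x0 x1 y0 y1).
Proof.
move=> /andP[a1 a2] /andP[a3 a4].
apply: nearCW (nearCI (nearCI (near_Re_gt a1) (near_Re_lt a2)) (nearCI (near_Im_gt a3) (near_Im_lt a4))) => w.
by move=> [[? ?] [? ?]]; split; rewrite !ltW.
Qed.

Lemma agree_near (g1 g2 : C -> C) A b : agree g1 g2 A b -> nearC b A -> nearC b (fun w => g1 w = g2 w).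
Proof. by move=> h1 h2; apply: nearCW (nearCI h1 h2) => w [h /h]. Qed.

Lemma near_of_eq (g1 g2 : C -> C) A b : (forall w, A w -> g1 w = g2 w) -> nearC b A ->
  nearC b (fun w => g1 w = g2 w).
Proof. by move=> h; apply: nearCW. Qed.

Lemma near_trans (g2 g1 g3 : C -> C) b : nearC b (fun w => g1 w = g2 w) -> nearC b (fun w => g2 w = g3 w) ->
  nearC b (fun w => g1 w = g3 w).
Proof. by move=> h1 h2; apply: nearCW (nearCI h1 h2) => w [-> ->]. Qed.

Lemma near_sym (g1 g2 : C -> C) b : nearC b (fun w => g1 w = g2 w) -> nearC b (fun w => g2 w = g1 w).
Proof. by apply: nearCW => w ->. Qed.

Lemma near_pow (g1 g2 : C -> C) c k b : nearC b (fun w => g1 w = g2 w) ->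
  nearC b (fun w => (g1 w + c) ^+ k = (g2 w + c) ^+ k).
Proof. by apply: nearCW => w ->. Qed.

Lemma thickT : thick [set: C].
Proof.
move=> b _ e e0; exists (b + (e / 2)%:C%C); split => //.
  rewrite -subr_eq0 addrAC subrr add0r -md_eq0 md_real normr_eq0; lra.
rewrite addrAC subrr add0r md_real gtr0_norm; lra.
Qed.

End Rect.

(** * Monodromy around one cone point *)

Section Halves.
Context {R : realType}.
Local Notation C := (Cplx R).
Variables (k : nat) (Reg : set C) (f : C -> C -> C) (out : C -> C).
Hypothesis k0 : (0 < k)%N.
Hypothesis fl : flat_atlas k Reg f.
Local Notation Gf := (Gf k f).

(** In the application [out] is [w ^+ mu], the coordinate of the outside, which is single valued on
    the whole plane; here it is required to be a flat coordinate near [a]. *)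
Definition outok a := Reg a /\ exists2 s, Gf a s & nearC a (fun w => out w = s w).

Lemma out_good A : (forall a, A a -> outok a) -> good Gf out A.
Proof. by move=> h a /h[_ [s Gs ne]]; exists s => //; apply: nearCW ne. Qed.

Lemma F_out x0 x1 y0 y1 b : x0 < x1 -> y0 < y1 -> rc x0 x1 y0 y1 `<=` Reg ->
  rc x0 x1 y0 y1 b -> outok b ->
  exists2 g, good Gf g (rc x0 x1 y0 y1) & agree g out (rc x0 x1 y0 y1) b.
Proof.
move=> hx hy AR Ab [_ [s Gs ne]].
have [g hg] := F_exists k0 fl hx hy AR.
have [th [c [th1 ag]]] := F_renorm k0 Ab hg Gs.
exists (fun w => th * g w + c); first exact: good_affine.
by apply: agree_trans ag _; apply: nearCW ne => w ->.
Qed.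

(** [pow_const] for the coordinate [f b], of which [out] is an affine function near [b]. *)
Lemma out_const b c1 c2 zeta : outok b -> zeta ^+ k = 1 ->
  nearC b (fun w => (zeta * out w + c1) ^+ k = (out w + c2) ^+ k) -> c1 = zeta * c2.
Proof.
move=> [Rb [s [z [c [z1 E]]] ne]] th1 ag; have zn := unity_neq0 k0 z1; have tn := unity_neq0 k0 th1.
have [d d0 [h inj]] := fl Rb.
have bb : md (b - b) < d by rewrite subrr md0.
have [_ cb _] := h b bb.
have H : (zeta * c + c1) / (zeta * z) = (c + c2) / z.
  apply: (pow_const (d := d) k0 (@thickT R) (I : setT b) cb d0).
    by move=> w wd; exact: inj.
  apply: nearCW (nearCI ag ne) => w [e e'] _.
  have z1k : (zeta * z) ^+ k = 1 by rewrite exprMn th1 z1 mulr1.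
  rewrite -[LHS]mul1r -[RHS]mul1r -{1}z1k -z1 -!exprMn.
  move: e; rewrite e' E (_ : zeta * (z * f b w + c) + c1 = zeta * z * (f b w + (zeta * c + c1) / (zeta * z))); last first.
    by field; rewrite zn tn.
  by rewrite (_ : z * f b w + c + c2 = z * (f b w + (c + c2) / z)); last by field.
have : zeta * c + c1 = zeta * (c + c2).
  transitivity ((zeta * c + c1) / (zeta * z) * (zeta * z)); first by field; rewrite zn tn.
  by rewrite H; field.
by rewrite mulrDr => /addrI.
Qed.

Variables (p : C) (t : C -> C) (n : nat).
Hypotheses (nRp : ~ Reg p) (ct : cone_chart k Reg f p t n).
Local Notation Gh := (Gh k f p t n).
Variables (sg r0 s : R).
Hypotheses (r00 : 0 < r0) (r0s : r0 < s) (ssg : s < sg).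

(* Around [p] the flat coordinate changes by [w |-> zeta w + kappa]; the apex of the cone is a fixed point of it. *)
Lemma half_apex q0 q1 xl xr xo xm o0 o1 h gN zeta kappa :
  q0 <= o0 -> o0 < xo -> xo < o1 -> o1 <= q1 -> q0 <= xl -> xl < xm -> xm < xr -> xr <= q1 ->
  rc q0 q1 (- sg) sg `<=` [set a | Reg a \/ a = p] ->
  (forall a, rc q0 q1 (- sg) sg a ->
     [\/ r0 <= complex.Im a, complex.Im a <= - r0 | o0 <= complex.Re a <= o1] -> outok a) ->
  good Gh h (rc q0 q1 (- sg) sg) -> rc xl xr (- sg) sg `<=` Reg -> good Gf gN (rc xl xr (- sg) sg) ->
  (forall w, rc xl xr r0 sg w -> gN w = out w) ->
  (forall w, rc xl xr (- sg) (- r0) w -> gN w = zeta * out w + kappa) -> zeta ^+ k = 1 ->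
  exists c, [/\ forall w, rc xl xr (- sg) sg w -> h w = (gN w + c) ^+ k,
     forall a, rc q0 q1 (- sg) sg a ->
     [\/ r0 <= complex.Im a, complex.Im a <= - r0 | o0 <= complex.Re a <= o1] -> h a = (out a + c) ^+ k
     & kappa + c = zeta * c].
Proof.
have r00' := r00; have r0s' := r0s; have ssg' := ssg.
move=> a1 a2 a3 a4 a5 a6 a7 a8.
have [u1 u2 u3 u4 u5] : [/\ - sg < - s, - s < - r0, - r0 < sg, - sg < r0 & - sg < s] by split; lra.
have [u6 u7 u8 u9] : [/\ - s < sg, r0 < sg, - sg < - r0 & - sg < sg] by split; lra.
have [v1 v2 v3 v4 v5] : [/\ q0 < xm, xm < q1, q0 < xo, xo < q1 & q0 < q1] by split; lra.
have [v6 v7 v8 v9] : [/\ o0 < o1, xl < xr, q0 <= xl & xr <= q1] by split; lra.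
move=> QR ok gh NR gN1 Ntop Nbot z1.
have uc : unique_cont Gh [set a | Reg a \/ a = p] by exact: Gh_uc.
have NQ : rc xl xr (- sg) sg `<=` rc q0 q1 (- sg) sg by apply: rc_sub.
pose b := pt xm s.
have Nb : rc xl xr (- sg) sg b by apply: rc_pt; rewrite !ltW.
have nNb : nearC b (rc xl xr (- sg) sg) by apply: rc_near; exact/andP.
have [c agb] := Gh_renorm nRp (NR _ Nb) Nb (NQ _ Nb) gN1 gh.
have hN : forall w, rc xl xr (- sg) sg w -> h w = (gN w + c) ^+ k.
  apply: (rc_ident (b := b) uc) => //; [| | |].
  - by move=> w Nw; left; exact: NR.
  - exact: good_sub gh.
  - by apply: (good_pow k0 t n nRp c NR gN1).
  - apply: near_sym; apply: agree_near agb _.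
    by apply: nearCW nNb => w Nw; split => //; exact: NQ.
(* The identity [h = (out + c)^k] is carried around [p]: along the top strip, down the side strip
   from [o0] to [o1], and along the bottom strip, where it meets [gN = zeta out + kappa]. *)
have okT : forall a, rc q0 q1 r0 sg a -> outok a.
  move=> a Ta; apply: ok; first by apply: rc_sub Ta; rewrite ?lexx// ltW.
  by apply: Or31; case: Ta => _ /andP[].
have okB : forall a, rc q0 q1 (- sg) (- r0) a -> outok a.
  move=> a Ta; apply: ok; first by apply: rc_sub Ta; rewrite ?lexx// ltW.
  by apply: Or32; case: Ta => _ /andP[].
have okO : forall a, rc o0 o1 (- sg) sg a -> outok a.
  move=> a Ta; apply: ok; first by apply: rc_sub Ta.
  by apply: Or33; case: Ta.
have hT : forall w, rc q0 q1 r0 sg w -> h w = (out w + c) ^+ k.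
  apply: (rc_ident (b := b) uc) => //; [| | | |].
  - by move=> w /okT[Rw _]; left.
  - by apply: good_sub gh; apply: rc_sub; rewrite ?lexx// ltW.
  - by apply: (good_pow k0 t n nRp c (fun w Tw => (okT w Tw).1) (out_good okT)).
  - by apply: rc_pt; rewrite !ltW.
  - apply: near_trans (near_of_eq hN nNb) _.
    by apply: near_pow; apply: near_of_eq Ntop _; apply: rc_near; exact/andP.
have hO : forall w, rc o0 o1 (- sg) sg w -> h w = (out w + c) ^+ k.
  apply: (rc_ident (b := pt xo s) uc) => //; [| | | |].
  - by move=> w /okO[Rw _]; left.
  - by apply: good_sub gh; apply: rc_sub; rewrite ?lexx// ltW.
  - by apply: (good_pow k0 t n nRp c (fun w Tw => (okO w Tw).1) (out_good okO)).
  - by apply: rc_pt; rewrite !ltW.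
  - by apply: near_of_eq hT _; apply: rc_near; exact/andP.
have hB : forall w, rc q0 q1 (- sg) (- r0) w -> h w = (out w + c) ^+ k.
  apply: (rc_ident (b := pt xo (- s)) uc) => //; [| | | |].
  - by move=> w /okB[Rw _]; left.
  - by apply: good_sub gh; apply: rc_sub; rewrite ?lexx// ltW.
  - by apply: (good_pow k0 t n nRp c (fun w Tw => (okB w Tw).1) (out_good okB)).
  - by apply: rc_pt; rewrite !ltW.
  - by apply: near_of_eq hO _; apply: rc_near; exact/andP.
exists c; split => //.
  move=> a [Qx /andP[Qy Qy']]; case=> hh.
  - by apply: hT; split => //; rewrite hh.
  - by apply: hB; split => //; rewrite hh Qy.
  - by apply: hO; split => //; rewrite Qy.
apply: (@out_const (pt xm (- s)) _ _ zeta) => //.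
  by apply: okB; apply: rc_pt; rewrite !ltW.
have n1 : nearC (pt xm (- s)) (rc xl xr (- sg) (- r0)) by apply: rc_near; exact/andP.
apply: nearCW n1 => w Bw; rewrite addrA -Nbot// -hN; last by apply: rc_sub Bw; rewrite ?lexx// ltW.
by apply: hB; apply: rc_sub Bw; rewrite ?lexx// ltW.
Qed.

End Halves.

(** * Continuous k-th roots on a ring around a cone point *)

Section Ring.
Context {R : realType}.
Local Notation C := (Cplx R).
Variables (k : nat) (Reg : set C) (f : C -> C -> C) (out : C -> C).
Hypothesis k0 : (0 < k)%N.
Hypothesis fl : flat_atlas k Reg f.
Local Notation Gf := (Gf k f).

Lemma good_cat g A a : A `<=` Reg -> good Gf g A -> A a -> cat A g a.
Proof.
move=> AR hg Aa; have [s [z [c [_ E]]] [d d0 ag]] := hg a Aa.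
have [r r0 [h _]] := fl (AR a Aa).
have [_ ca _] : [/\ Reg a, cat setT (f a) a & exists z c, z ^+ k = 1 /\ nearC a (fun w => f a w = z * f a w + c)].
  by apply: h; rewrite subrr md0.
have cs : cat A (fun w => z * f a w + c) a.
  apply: catD; last exact: cat_cst.
  by apply: catM; [exact: cat_cst|exact: catS ca].
move=> e /cs[d' d'0 h']; exists (Num.min d d'); first by rewrite lt_min d0.
move=> w Aw; rewrite lt_min => /andP[w1 w2]; rewrite !ag ?subrr ?md0// !E; exact: h'.
Qed.

Variables (p : C) (t : C -> C) (n : nat).
Hypotheses (nRp : ~ Reg p) (ct : cone_chart k Reg f p t n).
Local Notation Gh := (Gh k f p t n).

(** [tau] lifts a small circle through [t], so that [t ^+ n] winds [n] times along it. The radius is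
    [e ^+ k] to make the factor in front of [u ^+ n] a k-th power. *)
Lemma cone_circle (del0 : R) (h : C -> C) A : 0 < del0 -> nearC p A -> good Gh h A ->
  exists (e del : R) (tau : C -> C), [/\ 0 < e, 0 < del, del <= del0,
    (forall u, S1 u -> cat S1 tau u) &
    forall u, S1 u -> [/\ A (tau u), del < md (tau u - p) & h (tau u) = ((e ^+ n)%:C%C) ^+ k * u ^+ n]].
Proof.
move=> del00 nA gh; have [d d0 [cT inj tp _]] := ct.
have Ap := nearC_self nA.
have [s' [[_ E]|[/eqP//]] ag] := gh p Ap.
have [d3 d30 h3] := nearCI nA ag.
pose dm := Num.min d d3.
have dm0 : 0 < dm by rewrite lt_min d0.
have dmd z : md (z - p) < dm -> md (z - p) < d /\ md (z - p) < d3 by rewrite lt_min => /andP[].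
have lo b : md (b - p) < d -> lopen t b.
  move=> bd; apply: (@inj_lopen _ t b (d - md (b - p))); first by rewrite subr_gt0.
    move=> z zb; apply: cT; have := md_tri z b p; move: zb; lra.
  move=> z z' zb zb'; apply: inj; [have := md_tri z b p; move: zb; lra|have := md_tri z' b p; move: zb'; lra].
have pd : md (p - p) < d by rewrite subrr md0.
have [d' d'0 h'] := lo p pd dm dm0; rewrite tp in h'.
pose e := Num.min (1 / 2) (d' / 2).
have e0 : 0 < e by rewrite lt_min !divr_gt0.
have e1 : e <= 1 / 2 by rewrite ge_min lexx.
have ed : e < d' by apply: le_lt_trans (_ : e <= d' / 2) _; [rewrite ge_min lexx orbT|move: d'0; lra].
have ek : e ^+ k <= e by rewrite -[leRHS]expr1 ler_wiXn2l// ?ltW//; move: e1; lra.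
have ek0 : 0 < e ^+ k by rewrite exprn_gt0.
have /choice[sig hsig] : forall w, exists z, md w < d' -> md (z - p) < dm /\ t z = w.
  move=> w; have [wd|wd] := boolP (md w < d'); last by exists 0.
  by have [|z z1 z2] := h' w; [rewrite subr0|exists z].
have mS u : S1 u -> md ((e ^+ k)%:C%C * u) = e ^+ k.
  by rewrite /S1 /= mdM md_real => ->; rewrite mulr1 gtr0_norm.
have hS u : S1 u -> md (sig ((e ^+ k)%:C%C * u) - p) < dm /\ t (sig ((e ^+ k)%:C%C * u)) = (e ^+ k)%:C%C * u.
  by move=> Su; apply: hsig; rewrite mS//; apply: le_lt_trans ek ed.
have [del1 del10 hdel] := cT p pd _ ek0.
exists e, (Num.min (del1 / 2) del0), (fun u => sig ((e ^+ k)%:C%C * u)); split => //.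
- by rewrite lt_min divr_gt0.
- by rewrite ge_min lexx orbT.
- move=> u Su r r0; have [ud _] := hS u Su; have [ud1 _] := dmd _ ud.
  have m0 : 0 < Num.min r (dm - md (sig ((e ^+ k)%:C%C * u) - p)) by rewrite lt_min r0 subr_gt0.
  have [q q0 hq] := lo _ ud1 _ m0.
  exists q => // w Sw wu; have [wd wE] := hS w Sw; have [uE uE'] := hS u Su.
  have [|z] := hq ((e ^+ k)%:C%C * w).
    rewrite uE' -mulrBr mdM md_real gtr0_norm//.
    have : e ^+ k <= 1 by apply: le_trans ek _; move: e1; lra.
    have := md_ge0 (w - u); move: wu ek0; nra.
  rewrite lt_min => /andP[zr zd] tz.
  suff -> : sig ((e ^+ k)%:C%C * w) = z by [].
  apply: inj; [by have [] := dmd _ wd| |by rewrite wE tz].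
  have := md_tri z (sig ((e ^+ k)%:C%C * u)) p; have dd : dm <= d by rewrite ge_min lexx.
  move: zd dd; lra.
- move=> u Su; have [ud uE] := hS u Su; have [ud1 ud3] := dmd _ ud; have [Au hu] := h3 _ ud3.
  split => //.
    suff : del1 <= md (sig ((e ^+ k)%:C%C * u) - p).
      by move=> hh; apply: lt_le_trans hh; rewrite gt_min; apply/orP; left; move: del10; lra.
    by rewrite leNgt; apply/negP => /(hdel _ I); rewrite tp subr0 uE mS// ltxx.
  rewrite hu// E uE exprMn; congr (_ * _).
  by rewrite -!rmorphXn /= -!exprM mulnC.
Qed.

End Ring.


Section RingGlue.
Context {R : realType}.
Local Notation C := (Cplx R).

Lemma sub_ident (G : C -> (C -> C) -> Prop) D (x0 x1 y0 y1 : R) A B g1 g2 g3 b : unique_cont G D ->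
  x0 < x1 -> y0 < y1 -> A `<=` D -> good G g1 A -> good G g2 B ->
  rc x0 x1 y0 y1 `<=` A -> rc x0 x1 y0 y1 `<=` B -> nearC b (rc x0 x1 y0 y1) ->
  nearC b (fun w => g1 w = g3 w) -> nearC b (fun w => g2 w = g3 w) ->
  forall w, rc x0 x1 y0 y1 w -> g1 w = g2 w.
Proof.
move=> uc hx hy AD h1 h2 sA sB nb n1 n2; apply: (rc_ident (b := b) uc hx hy) => //.
- by move=> w /sA/AD.
- exact: good_sub h1.
- exact: good_sub h2.
- exact: nearC_self nb.
- by apply: near_trans n1 _; exact: near_sym.
Qed.

(** Left and right, and likewise top and bottom, are disjoint, so the four pieces only have to agree
    on the corners. *)
Lemma ring_glue (x0 xa xb x1 y0 ya yb y1 : R) gl gr gt gb (k : nat) (c : C) h :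
  xa < xb -> ya < yb -> 
  let Rl := rc x0 xa y0 y1 in let Rr := rc xb x1 y0 y1 in
  let Rt := rc x0 x1 yb y1 in let Rb := rc x0 x1 y0 ya in
  (forall a, Rl a -> cat Rl gl a) -> (forall a, Rr a -> cat Rr gr a) ->
  (forall a, Rt a -> cat Rt gt a) -> (forall a, Rb a -> cat Rb gb a) ->
  (forall w, rc x0 xa yb y1 w -> gl w = gt w) -> (forall w, rc x0 xa y0 ya w -> gl w = gb w) ->
  (forall w, rc xb x1 yb y1 w -> gr w = gt w) -> (forall w, rc xb x1 y0 ya w -> gr w = gb w) ->
  (forall w, Rl w -> (gl w + c) ^+ k = h w) -> (forall w, Rr w -> (gr w + c) ^+ k = h w) ->
  (forall w, Rt w -> (gt w + c) ^+ k = h w) -> (forall w, Rb w -> (gb w + c) ^+ k = h w) ->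
  exists G, forall a, ((Rl `|` Rr) `|` (Rt `|` Rb)) a ->
    cat ((Rl `|` Rr) `|` (Rt `|` Rb)) G a /\ (G a + c) ^+ k = h a.
Proof.
move=> hx hy Rl Rr Rt Rb cl_ cr ct cb Elt Elb Ert Erb hl hr ht hb.
have cRl : closedC Rl by exact: rc_closed.
have cRr : closedC Rr by exact: rc_closed.
have cRt : closedC Rt by exact: rc_closed.
have cRb : closedC Rb by exact: rc_closed.
pose G1 := pick2 Rl gl gr; pose G2 := pick2 Rt gt gb.
have nlr w : Rl w -> Rr w -> False.
  by move=> [/andP[_ h1] _] [/andP[h2 _] _]; have := lt_le_trans hx (le_trans h2 h1); rewrite ltxx.
have ntb w : Rt w -> Rb w -> False.
  by move=> [_ /andP[h1 _]] [_ /andP[_ h2]]; have := lt_le_trans hy (le_trans h1 h2); rewrite ltxx.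
have c1 a : (Rl `|` Rr) a -> cat (Rl `|` Rr) G1 a.
  by move=> Ha; apply: (cat_glue cRl cRr Ha (cl_ a) (cr a)) => w /nlr h1 /h1.
have c2 a : (Rt `|` Rb) a -> cat (Rt `|` Rb) G2 a.
  by move=> Ha; apply: (cat_glue cRt cRb Ha (ct a) (cb a)) => w /ntb h1 /h1.
have G1r w : Rr w -> G1 w = gr w by move=> Rw; rewrite /G1 pick2_out// => /nlr; exact.
have G2b w : Rb w -> G2 w = gb w by move=> Rw; rewrite /G2 pick2_out// => /ntb; exact.
exists (pick2 (Rl `|` Rr) G1 G2) => a Ha; split.
  apply: (cat_glue (closedCU cRl cRr) (closedCU cRt cRb) Ha (c1 a) (c2 a)).
  move=> w [Lw|Rw] [Tw|Bw].
  - by rewrite /G1 /G2 !pick2_in//; apply: Elt; case: Lw; case: Tw; split.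
  - by rewrite /G1 pick2_in// G2b//; apply: Elb; case: Lw; case: Bw; split.
  - by rewrite G1r// /G2 pick2_in//; apply: Ert; case: Rw; case: Tw; split.
  - by rewrite G1r// G2b//; apply: Erb; case: Rw; case: Bw; split.
have [h1|h1] := pselect ((Rl `|` Rr) a).
  rewrite pick2_in//; case: h1 => h1; first by rewrite /G1 pick2_in//; exact: hl.
  by rewrite G1r//; exact: hr.
case: Ha => // h2; rewrite pick2_out//; case: h2 => h2; first by rewrite /G2 pick2_in//; exact: ht.
by rewrite G2b//; exact: hb.
Qed.

Lemma ring_cover (x0 x1 y0 y1 del : R) (p a : C) : rc x0 x1 y0 y1 a -> 2 * del < md (a - p) ->
  ((rc x0 (complex.Re p - del) y0 y1 `|` rc (complex.Re p + del) x1 y0 y1) `|`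
   (rc x0 x1 (complex.Im p + del) y1 `|` rc x0 x1 y0 (complex.Im p - del))) a.
Proof.
move=> [/andP[q1 q2] /andP[q3 q4]] ad; have hm := md_le_ReIm (a - p); rewrite ReB ImB in hm.
have [h1|h1] := leP (complex.Re a) (complex.Re p - del); first by left; left; split; rewrite ?q1 ?q3.
have [h2|h2] := leP (complex.Re p + del) (complex.Re a); first by left; right; split; rewrite ?q2 ?q3 ?h2.
have [h3|h3] := leP (complex.Im a) (complex.Im p - del); first by right; right; split; rewrite ?q1 ?q3.
have [h4|h4] := leP (complex.Im p + del) (complex.Im a); first by right; left; split; rewrite ?q1 ?h4.
have : `|complex.Re a - complex.Re p| < del by rewrite ltr_norml; lra.
have : `|complex.Im a - complex.Im p| < del by rewrite ltr_norml; lra.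
lra.
Qed.

(** Each of the four rectangles has a developing map, normalised by [out]. Above and below [p] the
    right one is compared with [out] through [gN], which equals [out] on both sides: this is the
    absence of monodromy. *)
Lemma ring_root (k : nat) (Reg : set C) (f : C -> C -> C) (out : C -> C) (p : C) (t : C -> C) (n : nat)
    (sg r0 s xl xm xr xa xb ya yb : R) (c : C) h gN :
  (0 < k)%N -> flat_atlas k Reg f -> ~ Reg p ->
  [&& - sg < - s, - s < - r0, - r0 <= xa, xa < xb, xb <= xl, xl < xm, xm < xr & xr <= sg] ->
  [&& - r0 <= ya, ya < yb, yb <= r0, r0 < s & s < sg] ->
  let Rl := rc (- sg) xa (- sg) sg in let Rr := rc xb xr (- sg) sg in
  let Rt := rc (- sg) xr yb sg in let Rb := rc (- sg) xr (- sg) ya in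
  Rl `<=` Reg -> Rr `<=` Reg -> Rt `<=` Reg -> Rb `<=` Reg ->
  (forall a, rc (- sg) xr r0 sg a -> outok k Reg f out a) ->
  (forall a, rc (- sg) xr (- sg) (- r0) a -> outok k Reg f out a) ->
  (forall a, rc (- sg) (- r0) (- sg) sg a -> outok k Reg f out a) ->
  good (Gh k f p t n) h (rc (- sg) xr (- sg) sg) -> good (Gf k f) gN (rc xl xr (- sg) sg) ->
  (forall w, rc xl xr r0 sg w -> gN w = out w) ->
  (forall w, rc xl xr (- sg) (- r0) w -> gN w = out w) ->
  (forall a, rc (- sg) xr r0 sg a -> h a = (out a + c) ^+ k) ->
  (forall a, rc (- sg) xr (- sg) (- r0) a -> h a = (out a + c) ^+ k) ->
  exists G, forall a, ((Rl `|` Rr) `|` (Rt `|` Rb)) a ->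
    cat ((Rl `|` Rr) `|` (Rt `|` Rb)) G a /\ (G a + c) ^+ k = h a.
Proof.
move=> k0 fl nRp ex ey Rl Rr Rt Rb RRl RRr RRt RRb okT okB okO gh gN1 Ntop Nbot hT hB.
have uc := Gf_uc fl.
have uh : unique_cont (Gh k f p t n) [set a | Reg a \/ a = p] by exact: Gh_uc.
have [e1 e2 e3 e4] : [/\ - sg < xa, xb < xr, yb < sg & - sg < ya] by move: ex ey; clear; move=> *; split; lra.
have [nsg nx eT eB] : [/\ - sg < sg, - sg < xr, r0 < sg & - sg < - r0] by move: ex ey; clear; move=> *; split; lra.
have [i1 i2 i3 i4] : [/\ xl < xr, xa <= xr, - sg <= xb & ya <= sg] by move: ex ey; clear; move=> *; split; lra.
have [i5 i6 i7 i8] : [/\ - sg <= yb, yb <= r0, - r0 <= ya & - r0 <= xa] by move: ex ey; clear; move=> *; split; lra.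
have [i9 i10 i11 i12] : [/\ xb <= xl, - sg <= xl, - r0 <= sg & - sg <= r0] by move: ex ey; clear; move=> *; split; lra.
pose TL := pt (- s) s; pose BL := pt (- s) (- s); pose TR := pt xm s; pose BR := pt xm (- s).
have nTL : nearC TL (rc (- sg) xa yb sg).
  by apply: rc_near; move: ex ey; clear; move=> *; apply/andP; split; rewrite /=; lra.
have nBL : nearC BL (rc (- sg) xa (- sg) ya).
  by apply: rc_near; move: ex ey; clear; move=> *; apply/andP; split; rewrite /=; lra.
have nTR : nearC TR (rc xb xr yb sg).
  by apply: rc_near; move: ex ey; clear; move=> *; apply/andP; split; rewrite /=; lra.
have nBR : nearC BR (rc xb xr (- sg) ya).
  by apply: rc_near; move: ex ey; clear; move=> *; apply/andP; split; rewrite /=; lra.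
have TLT : nearC TL (rc (- sg) xr r0 sg).
  by apply: rc_near; move: ex ey; clear; move=> *; apply/andP; split; rewrite /=; lra.
have TLO : nearC TL (rc (- sg) (- r0) (- sg) sg).
  by apply: rc_near; move: ex ey; clear; move=> *; apply/andP; split; rewrite /=; lra.
have BLB : nearC BL (rc (- sg) xr (- sg) (- r0)).
  by apply: rc_near; move: ex ey; clear; move=> *; apply/andP; split; rewrite /=; lra.
have BLO : nearC BL (rc (- sg) (- r0) (- sg) sg).
  by apply: rc_near; move: ex ey; clear; move=> *; apply/andP; split; rewrite /=; lra.
have TRN : nearC TR (rc xl xr r0 sg).
  by apply: rc_near; move: ex ey; clear; move=> *; apply/andP; split; rewrite /=; lra.
have BRN : nearC BR (rc xl xr (- sg) (- r0)).
  by apply: rc_near; move: ex ey; clear; move=> *; apply/andP; split; rewrite /=; lra.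
have sTr : rc xl xr r0 sg `<=` rc (- sg) xr r0 sg by exact: rc_sub.
have sBr : rc xl xr (- sg) (- r0) `<=` rc (- sg) xr (- sg) (- r0) by exact: rc_sub.
have sNr : rc xl xr (- sg) sg `<=` Rr by exact: rc_sub.
have sTt : rc (- sg) xr r0 sg `<=` Rt by exact: rc_sub.
have sBb : rc (- sg) xr (- sg) (- r0) `<=` Rb by exact: rc_sub.
have sOl : rc (- sg) (- r0) (- sg) sg `<=` Rl by exact: rc_sub.
have lt1 : rc (- sg) xa yb sg `<=` Rl by exact: rc_sub.
have lt2 : rc (- sg) xa yb sg `<=` Rt by exact: rc_sub.
have lb1 : rc (- sg) xa (- sg) ya `<=` Rl by exact: rc_sub.
have lb2 : rc (- sg) xa (- sg) ya `<=` Rb by exact: rc_sub.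
have rt1 : rc xb xr yb sg `<=` Rr by exact: rc_sub.
have rt2 : rc xb xr yb sg `<=` Rt by exact: rc_sub.
have rb1 : rc xb xr (- sg) ya `<=` Rr by exact: rc_sub.
have rb2 : rc xb xr (- sg) ya `<=` Rb by exact: rc_sub.
have TRT := nearCW sTr TRN; have BRB := nearCW sBr BRN.
have [gl gl1 al] := F_out k0 fl e1 nsg RRl (nearC_self (nearCW lt1 nTL)) (okT _ (nearC_self TLT)).
have [gt gt1 at_] := F_out k0 fl nx e3 RRt (nearC_self (nearCW lt2 nTL)) (okT _ (nearC_self TLT)).
have [gb gb1 ab] := F_out k0 fl nx e4 RRb (nearC_self (nearCW lb2 nBL)) (okB _ (nearC_self BLB)).
have [gr gr1 ar] := F_out k0 fl e2 nsg RRr (nearC_self (nearCW rt1 nTR)) (okT _ (nearC_self TRT)).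
have {}al := agree_near al (nearCW lt1 nTL); have {}at_ := agree_near at_ (nearCW lt2 nTL).
have {}ab := agree_near ab (nearCW lb2 nBL); have {}ar := agree_near ar (nearCW rt1 nTR).
have oo b : nearC b (fun w => out w = out w) by exact: nearCT.
have gtT := sub_ident uc nx eT RRt gt1 (out_good okT) sTt (@subset_refl _ _) TLT at_ (oo _).
have glO := sub_ident uc eB nsg RRl gl1 (out_good okO) sOl (@subset_refl _ _) TLO al (oo _).
have nTRN : nearC TR (rc xl xr (- sg) sg) by apply: nearCW TRN; exact: rc_sub.
have grN := sub_ident uc i1 nsg RRr gr1 gN1 sNr (@subset_refl _ _) nTRN ar (near_of_eq Ntop TRN).
have grB : nearC BR (fun w => gr w = out w).
  by apply: nearCW BRN => w Bw; rewrite grN ?Nbot//; apply: rc_sub Bw.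
have Elt := sub_ident uc e1 e3 RRl gl1 gt1 lt1 lt2 nTL al at_.
have Elb := sub_ident uc e1 e4 RRl gl1 gb1 lb1 lb2 nBL (near_of_eq glO BLO) ab.
have Ert := sub_ident uc e2 e3 RRr gr1 gt1 rt1 rt2 nTR ar (near_of_eq gtT TRT).
have gbB := sub_ident uc nx eB RRb gb1 (out_good okB) sBb (@subset_refl _ _) BLB ab (oo _).
have Erb := sub_ident uc e2 e4 RRr gr1 gb1 rb1 rb2 nBR grB (near_of_eq gbB BRB).
have hg x0 x1 y0 y1 g b : x0 < x1 -> y0 < y1 -> rc x0 x1 y0 y1 `<=` rc (- sg) xr (- sg) sg ->
    rc x0 x1 y0 y1 `<=` Reg ->
    good (Gf k f) g (rc x0 x1 y0 y1) -> nearC b (rc x0 x1 y0 y1) -> nearC b (fun w => g w = out w) ->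
    nearC b (fun w => h w = (out w + c) ^+ k) ->
    forall w, rc x0 x1 y0 y1 w -> (g w + c) ^+ k = h w.
  move=> hx hy AQ AR g1 Ab n1 n2.
  apply: (sub_ident uh hx hy _ (good_pow k0 t n nRp c AR g1) gh (@subset_refl _ _) AQ Ab (near_pow c k n1) n2).
  by move=> w /AR; left.
have sl : Rl `<=` rc (- sg) xr (- sg) sg by exact: rc_sub.
have sr : Rr `<=` rc (- sg) xr (- sg) sg by exact: rc_sub.
have st : Rt `<=` rc (- sg) xr (- sg) sg by exact: rc_sub.
have sb : Rb `<=` rc (- sg) xr (- sg) sg by exact: rc_sub.
have hl := hg _ _ _ _ gl TL e1 nsg sl RRl gl1 (nearCW lt1 nTL) al (near_of_eq hT TLT).
have ht := hg _ _ _ _ gt TL nx e3 st RRt gt1 (nearCW lt2 nTL) at_ (near_of_eq hT TLT).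
have hb := hg _ _ _ _ gb BL nx e4 sb RRb gb1 (nearCW lb2 nBL) ab (near_of_eq hB BLB).
have hr := hg _ _ _ _ gr TR e2 nsg sr RRr gr1 (nearCW rt1 nTR) ar (near_of_eq hT TRT).
have xab : xa < xb by move: ex; clear; move=> *; lra.
have yab : ya < yb by move: ey; clear; move=> *; lra.
exact: (ring_glue xab yab (fun a => good_cat fl RRl gl1) (fun a => good_cat fl RRr gr1)
  (fun a => good_cat fl RRt gt1) (fun a => good_cat fl RRb gb1) Elt Elb Ert Erb hl hr ht hb).
Qed.

(* Without monodromy around [p] the function [t^n] has a continuous k-th root near [p], so [k] divides [n]. *)
Lemma ring_excl (k : nat) (Reg : set C) (f : C -> C -> C) (out : C -> C) (p : C) (t : C -> C) (n : nat)
    (sg r0 s xl xm xr : R) (c : C) h gN :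
  (0 < k)%N -> flat_atlas k Reg f -> ~ Reg p -> cone_chart k Reg f p t n -> ~~ (k %| n)%N ->
  0 < r0 -> r0 < s -> s < sg -> `|complex.Re p| < r0 -> `|complex.Im p| < r0 ->
  complex.Re p < xl -> xl < xm -> xm < xr -> xr <= sg ->
  let Q := rc (- sg) xr (- sg) sg in
  (forall a, Q a -> a != p -> Reg a) ->
  (forall a, Q a ->
     [\/ r0 <= complex.Im a, complex.Im a <= - r0 | - sg <= complex.Re a <= - r0] -> outok k Reg f out a) ->
  good (Gh k f p t n) h Q -> good (Gf k f) gN (rc xl xr (- sg) sg) ->
  (forall w, rc xl xr r0 sg w -> gN w = out w) ->
  (forall w, rc xl xr (- sg) (- r0) w -> gN w = out w) ->
  (forall a, Q a ->
     [\/ r0 <= complex.Im a, complex.Im a <= - r0 | - sg <= complex.Re a <= - r0] -> h a = (out a + c) ^+ k) ->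
  False.
Proof.
move=> k0 fl nRp ct kn r00 r0s ssg; rewrite !ltr_norml => /andP[pR1 pR2] /andP[pI1 pI2] a1 a2 a3 a4 Q QReg ok gh gN1 Ntop Nbot hout.
(* The hole around [p] must stay to the left of [xl] and within the square of half side [r0], so
   that the four rectangles contain the strips on which [out] and [gN] are known. *)
pose del0 := Num.min (xl - complex.Re p) (Num.min (r0 + complex.Re p) (Num.min (r0 - complex.Im p) (r0 + complex.Im p))).
have del00 : 0 < del0 by rewrite !lt_min; apply/and4P; split; clear - pR1 pR2 pI1 pI2 a1; lra.
have nQ : nearC p Q by apply: rc_near; apply/andP; split; clear - pR1 pR2 pI1 pI2 a1 a2 a3 a4 r0s ssg; lra.
have [e [del' [tau [e0 del'0 del'1 ctau htau]]]] := cone_circle k0 ct del00 nQ gh.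
have : del' <= del0 by [].
rewrite !le_min => /and4P[d1 d2 d3 d4].
pose del := del' / 2; have E2 : 2 * del = del' by rewrite /del mulrCA divff ?mulr1// pnatr_eq0.
move: (E2) del'0 => <-; rewrite pmulr_rgt0// => del_0; rewrite -E2 in d1 d2 d3 d4.
have ex : [&& - sg < - s, - s < - r0, - r0 <= complex.Re p - del, complex.Re p - del < complex.Re p + del,
  complex.Re p + del <= xl, xl < xm, xm < xr & xr <= sg].
  by rewrite !ltrN2 r0s ssg a2 a3 a4; apply/and5P; split => //; move: d1 d2 del_0; clear; lra.
have ey : [&& - r0 <= complex.Im p - del, complex.Im p - del < complex.Im p + del, complex.Im p + del <= r0, r0 < s & s < sg].
  by rewrite r0s ssg !andbT; apply/and3P; split => //; move: d3 d4 del_0; clear; lra.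
have sub_reg A : A `<=` Q -> ~ A p -> A `<=` Reg.
  by move=> AQ nA w Aw; apply: QReg; [exact: AQ|apply: contra_notN nA => /eqP <-].
have le1 : complex.Re p - del <= xr by move: ex; clear; lra.
have le2 : - sg <= complex.Re p + del by move: ex ey; clear; lra.
have le3 : - sg <= complex.Im p + del by move: ex ey; clear; lra.
have le4 : complex.Im p - del <= sg by move: ex ey; clear; lra.
have [le5 le6] : - sg <= xr /\ - r0 <= sg by move: ex ey; clear; lra.
have le7 : - r0 <= xr by move: ex ey; clear; lra.
have le8 : - sg <= r0 by move: ex ey; clear; lra.
have [] := ring_root (c := c) (out := out) (t := t) (n := n) (h := h) (gN := gN) k0 fl nRp ex ey => //.
- by apply: sub_reg; [exact: rc_sub|move=> [/andP[_ h1] _]; move: h1 del_0; clear; lra].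
- by apply: sub_reg; [exact: rc_sub|move=> [/andP[h1 _] _]; move: h1 del_0; clear; lra].
- by apply: sub_reg; [exact: rc_sub|move=> [_ /andP[h1 _]]; move: h1 del_0; clear; lra].
- by apply: sub_reg; [exact: rc_sub|move=> [_ /andP[_ h1]]; move: h1 del_0; clear; lra].
- by move=> a Ta; apply: ok; [exact: rc_sub Ta|apply: Or31; case: Ta => _ /andP[]].
- by move=> a Ta; apply: ok; [exact: rc_sub Ta|apply: Or32; case: Ta => _ /andP[]].
- by move=> a Ta; apply: ok; [exact: rc_sub Ta|apply: Or33; case: Ta].
- by move=> a Ta; apply: hout; [exact: rc_sub Ta|apply: Or31; case: Ta => _ /andP[]].
- by move=> a Ta; apply: hout; [exact: rc_sub Ta|apply: Or32; case: Ta => _ /andP[]].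
move=> G hG.
pose Ring := ((rc (- sg) (complex.Re p - del) (- sg) sg `|` rc (complex.Re p + del) xr (- sg) sg) `|`
   (rc (- sg) xr (complex.Im p + del) sg `|` rc (- sg) xr (- sg) (complex.Im p - del))).
have Rtau u : S1 u -> Ring (tau u).
  by move=> /htau[h1 h2 _]; apply: ring_cover => //; rewrite E2.
have en0 : ((e ^+ n)%:C%C : C) != 0 by rewrite -md_eq0 md_real normr_eq0 expf_neq0// gt_eqF.
apply: (@no_root_pow _ k n (fun u => (G (tau u) + c) * ((e ^+ n)%:C%C)^-1) k0 kn).
  move=> u Su; apply: catM; last exact: cat_cst.
  apply: catD; last exact: cat_cst.
  by apply: (cat_comp (ctau u Su) (hG _ (Rtau u Su)).1) => w; exact: Rtau.
move=> u Su; rewrite exprMn (hG _ (Rtau u Su)).2.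
have [_ _ ->] := htau u Su; rewrite exprVn mulrAC divff ?mul1r//; exact: expf_neq0.
Qed.

End RingGlue.

(** * Two cone points in the plane *)

Section Plane.
Context {R : realType}.
Local Notation C := (Cplx R).

Lemma cat_near A (g1 g2 : C -> C) a : nearC a (fun w => g1 w = g2 w) -> cat A g1 a -> cat A g2 a.
Proof.
move=> [d d0 E] c e /c[d' d'0 h]; exists (Num.min d d'); first by rewrite lt_min d0.
by move=> w Aw; rewrite lt_min => /andP[w1 w2]; rewrite -!E ?subrr ?md0//; exact: h.
Qed.

Definition punctured (R0 : R) (p1 p2 : C) : set C := [set a | [/\ md a < R0, a != p1 & a != p2]].

(* As [out] is single valued, both apexes are fixed by the same monodromy [w |-> zeta w + kappa], and [zeta <> 1]
   because [k] does not divide [n1]; hence they coincide, and the two k-th powers glue. *)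
Lemma glued_power (k mu n1 n2 : nat) (R0 r0 : R) (p1 p2 : C) f (t1 t2 : C -> C) :
  (0 < k)%N -> (0 < mu)%N -> ~~ (k %| n1)%N ->
  0 < r0 -> r0 * 6 < R0 -> md p1 < r0 -> md p2 < r0 -> complex.Re p1 < complex.Re p2 ->
  let Reg := punctured R0 p1 p2 in
  flat_atlas k Reg f -> cone_chart k Reg f p1 t1 n1 -> cone_chart k Reg f p2 t2 n2 ->
  (forall a, r0 <= md a -> md a < R0 -> exists zeta c, zeta ^+ k = 1 /\
     nearC a (fun w => w ^+ mu = zeta * f a w + c)) ->
  exists h c, [/\ forall a, Reg a -> md a <= R0 / 3 -> exists c, nearC a (fun w => h w = (f a w + c) ^+ k),
    nearC p1 (fun w => h w = t1 w ^+ n1), nearC p2 (fun w => h w = t2 w ^+ n2)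
    & forall a, 2 * r0 <= md a -> md a <= R0 / 3 -> h a = (a ^+ mu + c) ^+ k].
Proof.
move=> k0 mu0 kn r00 rR m1 m2 Re12 Reg fl ct1 ct2 H3.
(* The square of half side [sg] lies in the disc of radius [R0], because [2 * sg < R0], and contains
   the disc of radius [R0 / 3]. *)
pose out (w : C) := w ^+ mu; pose sg := R0 * (2 / 5); pose s := (r0 + sg) / 2.
pose xm := (complex.Re p1 + complex.Re p2) / 2.
pose xl := (complex.Re p1 + xm) / 2; pose xr := (xm + complex.Re p2) / 2.
have [R1 I1] : `|complex.Re p1| < r0 /\ `|complex.Im p1| < r0 by split; apply: le_lt_trans m1; [exact: md_Re|exact: md_Im].
have [R2 I2] : `|complex.Re p2| < r0 /\ `|complex.Im p2| < r0 by split; apply: le_lt_trans m2; [exact: md_Re|exact: md_Im].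
have [u1 u2] : - r0 < complex.Re p1 /\ complex.Re p2 < r0 by move: R1 R2; rewrite !ltr_norml => /andP[? ?] /andP[].
have [v1 v2 v3 v4] : [/\ complex.Re p1 < xl, xl < xm, xm < xr & xr < complex.Re p2].
  by rewrite /xl /xr /xm; move: Re12; clear; move=> *; split; lra.
have [r0s ssg] : r0 < s /\ s < sg by rewrite /s /sg; move: r00 rR; clear; lra.
have xrs : xr <= sg by move: v4 u2 r0s ssg; clear; lra.
have xls : - sg <= xl by move: v1 u1 r0s ssg; clear; lra.
have nRp1 : ~ Reg p1 by case; rewrite eqxx.
have nRp2 : ~ Reg p2 by case; rewrite eqxx.
have box a : rc (- sg) sg (- sg) sg a -> md a < R0.
  move=> [/andP[q1 q2] /andP[q3 q4]]; apply: le_lt_trans (md_le_ReIm a) _.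
  have : `|complex.Re a| <= sg by rewrite ler_norml q1.
  have : `|complex.Im a| <= sg by rewrite ler_norml q3.
  by rewrite /sg; move: r00 rR; clear; lra.
have okb a : rc (- sg) sg (- sg) sg a -> r0 <= md a -> outok k Reg f out a.
  move=> /box aR ra; split.
    by split => //; apply: contraTneq ra => ->; rewrite -ltNge.
  have [z [c [z1 ne]]] := H3 a ra aR; exists (fun w => z * f a w + c) => //.
  by exists z, c.
have ok a : rc (- sg) sg (- sg) sg a ->
   [\/ r0 <= complex.Im a, complex.Im a <= - r0, complex.Re a <= - r0 | r0 <= complex.Re a] -> outok k Reg f out a.
  move=> /okb h hh; apply: h; case: hh => hh.
  - by apply: le_trans hh (le_trans (ler_norm _) (md_Im _)).
  - by apply: le_trans (md_Im _); rewrite -normrN; apply: le_trans (ler_norm _); rewrite lerNr.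
  - by apply: le_trans (md_Re _); rewrite -normrN; apply: le_trans (ler_norm _); rewrite lerNr.
  - by apply: le_trans hh (le_trans (ler_norm _) (md_Re _)).
have [i1 i2 i3 i4] : [/\ - sg < sg, r0 < sg, - sg < - r0 & - s < - r0] by move: r00 r0s ssg; clear; move=> *; split; lra.
have [i5 i6 i7 i8] : [/\ xl < xr, - sg < xr, xl < sg & - sg < - s] by move: v1 v2 v3 v4 u1 u2 r0s ssg; clear; move=> *; split; lra.
have [i9 i10 i11 i12] : [/\ - r0 <= sg, - sg <= r0, - r0 <= xr & xl <= r0] by move: v1 v2 v3 v4 u1 u2 r00 r0s ssg; clear; move=> *; split; lra.
(* [Q1] contains [p1] but not [p2], [Q2] contains [p2] but not [p1], and they overlap in the strip
   between [xl] and [xr], which is free of cone points. *)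
pose Q1 := rc (- sg) xr (- sg) sg; pose Q2 := rc xl sg (- sg) sg.
have sQ1 : Q1 `<=` rc (- sg) sg (- sg) sg by exact: rc_sub.
have sQ2 : Q2 `<=` rc (- sg) sg (- sg) sg by exact: rc_sub.
have Q1R a : Q1 a -> a != p1 -> Reg a.
  move=> Qa ap; split => //; first by apply: box; apply: sQ1.
  by apply: contraTneq v4 => <-; rewrite -leNgt; case: Qa => /andP[].
have Q2R a : Q2 a -> a != p2 -> Reg a.
  move=> Qa ap; split => //; first by apply: box; apply: sQ2.
  by apply: contraTneq v1 => <-; rewrite -leNgt; case: Qa => /andP[].
have Q1p : Q1 `<=` [set a | Reg a \/ a = p1].
  by move=> a Qa; have [->|/Q1R h] := eqVneq a p1; [right|left; exact: h].
have Q2p : Q2 `<=` [set a | Reg a \/ a = p2].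
  by move=> a Qa; have [->|/Q2R h] := eqVneq a p2; [right|left; exact: h].
have NQ1 : rc xl xr (- sg) sg `<=` Q1 by exact: rc_sub.
have NQ2 : rc xl xr (- sg) sg `<=` Q2 by exact: rc_sub.
have NR : rc xl xr (- sg) sg `<=` Reg.
  move=> a Na; apply: Q1R; first exact: NQ1.
  by apply: contraTneq v1 => <-; rewrite -leNgt; case: Na => /andP[].
have [h1 gh1] := H_exists k0 fl nRp1 ct1 i6 i1 Q1p.
have [h2 gh2] := H_exists k0 fl nRp2 ct2 i7 i1 Q2p.
have uc := Gf_uc fl.
have okT a : rc xl xr r0 sg a -> outok k Reg f out a.
  by move=> Ta; apply: ok; [exact: rc_sub Ta|apply: Or41; case: Ta => _ /andP[]].
have okB a : rc xl xr (- sg) (- r0) a -> outok k Reg f out a.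
  by move=> Ta; apply: ok; [exact: rc_sub Ta|apply: Or42; case: Ta => _ /andP[]].
pose TR := pt xm s; pose BR := pt xm (- s).
have TRN : nearC TR (rc xl xr r0 sg) by apply: rc_near; rewrite /= ?v2 ?r0s.
have BRN : nearC BR (rc xl xr (- sg) (- r0)) by apply: rc_near; rewrite /= ?v2 ?i8.
have TN : rc xl xr r0 sg `<=` rc xl xr (- sg) sg by exact: rc_sub.
have BN : rc xl xr (- sg) (- r0) `<=` rc xl xr (- sg) sg by exact: rc_sub.
have [gN gN1 aT] := F_out k0 fl i5 i1 NR (nearC_self (nearCW TN TRN)) (okT _ (nearC_self TRN)).
have {}aT := agree_near aT (nearCW TN TRN).
have oo b : nearC b (fun w => out w = out w) by exact: nearCT.
have Ntop := sub_ident uc i5 i2 NR gN1 (out_good okT) TN (@subset_refl _ _) TRN aT (oo _).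
(* The developing map of the strip, normalised to be [out] above the two points, is an affine
   function of [out] below them: the monodromy around either point. *)
have [zeta [kappa [z1 Nbot]]] : exists zeta kappa, zeta ^+ k = 1 /\
    forall w, rc xl xr (- sg) (- r0) w -> gN w = zeta * out w + kappa.
  have bN := nearC_self (nearCW BN BRN).
  have [s1 G1 ag1] := gN1 _ bN.
  have [_ [s2 G2 ag2]] := okB _ (nearC_self BRN).
  have [th [c [th1 E]]] := Gf_norm k0 G1 G2.
  exists th, c; split => //.
  have og := good_affine c (out_good okB) th1.
  apply: (sub_ident uc i5 i3 NR gN1 og BN (@subset_refl _ _) BRN (agree_near ag1 (nearCW BN BRN))).
  by apply: nearCW ag2 => w ->.
have ok1 a : Q1 a -> [\/ r0 <= complex.Im a, complex.Im a <= - r0 | - sg <= complex.Re a <= - r0] -> outok k Reg f out a.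
  by move=> /sQ1/ok h [hh|hh|/andP[_ hh]]; apply: h; [apply: Or41|apply: Or42|apply: Or43].
have ok2 a : Q2 a -> [\/ r0 <= complex.Im a, complex.Im a <= - r0 | r0 <= complex.Re a <= sg] -> outok k Reg f out a.
  by move=> /sQ2/ok h [hh|hh|/andP[hh _]]; apply: h; [apply: Or41|apply: Or42|apply: Or44].
have [c1 [h1N h1o e1]] := half_apex k0 fl nRp1 r00 r0s ssg (lexx _) i8 i4 i11 xls v2 v3 (lexx _) Q1p ok1 gh1 NR gN1 Ntop Nbot z1.
have [c2 [h2N h2o e2]] := half_apex k0 fl nRp2 r00 r0s ssg i12 r0s ssg (lexx _) (lexx _) v2 v3 xrs Q2p ok2 gh2 NR gN1 Ntop Nbot z1.
have zn : zeta != 1.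
  apply/eqP => zE; apply: (ring_excl k0 fl nRp1 ct1 kn r00 r0s ssg R1 I1 v1 v2 v3 xrs Q1R ok1 gh1 gN1 Ntop _ h1o).
  move=> w /Nbot ->; rewrite zE mul1r.
  by move/eqP: e1; rewrite zE mul1r -subr_eq0 addrK => /eqP ->; rewrite addr0.
have c12 : c2 = c1.
  apply/eqP; rewrite -subr_eq0; have : (1 - zeta) * (c2 - c1) = 0.
    transitivity ((kappa + c2) - zeta * c2 - ((kappa + c1) - zeta * c1)); first by ring.
    by rewrite e1 e2 !subrr.
  by move/eqP; rewrite mulf_eq0 [X in X || _]subr_eq0 (eq_sym 1 zeta) (negPf zn).
rewrite {}c12 {c2 e2} in h2N h2o.
pose h (z : C) := if complex.Re z <= xm then h1 z else h2 z.
have hl a : complex.Re a < xm -> nearC a (fun w => h w = h1 w).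
  by move=> /near_Re_lt; apply: nearCW => w hw; rewrite /h (ltW hw).
have hr a : xm < complex.Re a -> nearC a (fun w => h w = h2 w).
  by move=> /near_Re_gt; apply: nearCW => w hw; rewrite /h leNgt hw.
have hN a : rc xl xr (- sg) sg a -> h a = (gN a + c1) ^+ k.
  by move=> Na; rewrite /h; case: ifP => _; [rewrite h1N|rewrite h2N].
have rsg : R0 / 3 < sg by rewrite /sg; move: r00 rR; clear; lra.
have mdb a : md a <= R0 / 3 -> [/\ - sg < complex.Re a, complex.Re a < sg, - sg < complex.Im a & complex.Im a < sg].
  move=> /le_lt_trans/(_ rsg) aR.
  have := le_lt_trans (md_Re a) aR; rewrite ltr_norml => /andP[? ?].
  by have := le_lt_trans (md_Im a) aR; rewrite ltr_norml => /andP[? ?].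
have rr3 : r0 <= R0 / 3 by move: r00 rR; clear; lra.
have at1 : nearC p1 (fun w => h w = t1 w ^+ n1).
  have [b1 b2 b3 b4] := mdb _ (ltW (lt_le_trans m1 rr3)).
  have n1Q : nearC p1 Q1 by apply: rc_near; rewrite ?b1 ?b3 ?b4 //= (lt_trans v1) ?(lt_trans v2).
  have [s' [[_ E]|[/eqP//]] ag] := gh1 p1 (nearC_self n1Q).
  have l1 := hl p1 (lt_trans v1 v2).
  by apply: nearCW (nearCI l1 (agree_near ag n1Q)) => w [-> ->].
have at2 : nearC p2 (fun w => h w = t2 w ^+ n2).
  have [b1 b2 b3 b4] := mdb _ (ltW (lt_le_trans m2 rr3)).
  have n1Q : nearC p2 Q2 by apply: rc_near; rewrite ?b2 ?b3 ?b4 ?andbT //= (lt_trans i5).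
  have [s' [[_ E]|[/eqP//]] ag] := gh2 p2 (nearC_self n1Q).
  have l1 := hr p2 (lt_trans v3 v4).
  by apply: nearCW (nearCI l1 (agree_near ag n1Q)) => w [-> ->].
exists h, c1; split => //.
- move=> a Ra /mdb[b1 b2 b3 b4].
  have [l|l|l] := ltgtP (complex.Re a) xm.
  + have n1Q : nearC a Q1 by apply: rc_near; rewrite ?b1 ?b3 ?b4 //= (lt_trans l).
    have [s' [[E _]|[_ [c E]]] ag] := gh1 a (nearC_self n1Q); first by rewrite E in Ra.
    by exists c; apply: nearCW (nearCI (hl a l) (agree_near ag n1Q)) => w [-> ->].
  + have n1Q : nearC a Q2 by apply: rc_near; rewrite ?b2 ?b3 ?b4 ?andbT //= (lt_trans v2).
    have [s' [[E _]|[_ [c E]]] ag] := gh2 a (nearC_self n1Q); first by rewrite E in Ra.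
    by exists c; apply: nearCW (nearCI (hr a l) (agree_near ag n1Q)) => w [-> ->].
  + have nN : nearC a (rc xl xr (- sg) sg) by apply: rc_near; rewrite ?l ?v2 ?b3.
    have gp := good_pow k0 t1 n1 nRp1 c1 NR gN1.
    have [s' [[E _]|[_ [c E]]] ag] := gp a (nearC_self nN); first by rewrite E in Ra.
    by exists c; apply: nearCW (nearCI nN (agree_near ag nN)) => w [/hN -> ->].
- move=> a ra /mdb[b1 b2 b3 b4].
  have big : [\/ r0 <= complex.Im a, complex.Im a <= - r0, complex.Re a <= - r0 | r0 <= complex.Re a].
    have [A1|A1] := leP r0 (complex.Im a); first exact: Or41.
    have [A2|A2] := leP (complex.Im a) (- r0); first exact: Or42.
    have [A3|A3] := leP (complex.Re a) (- r0); first exact: Or43.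
    have [A4|A4] := leP r0 (complex.Re a); first exact: Or44.
    have := md_le_ReIm a; have : `|complex.Re a| < r0 by rewrite ltr_norml A3.
    have : `|complex.Im a| < r0 by rewrite ltr_norml A2.
    by move=> hIm hRe hmd; exfalso; clear - ra hIm hRe hmd; lra.
  rewrite /h; case: (leP (complex.Re a) xm) => hx.
    have Qa : Q1 a by split; rewrite ?b3 ?b4 ?(ltW b1) ?(ltW b3) ?(ltW b4) //= (le_trans hx) ?ltW.
    apply: h1o => //; case: big => hh; [exact: Or31|exact: Or32|by apply: Or33; rewrite hh ltW|].
    by exfalso; move: hh hx v3 v4 u2; clear; lra.
  have Qa : Q2 a by split; rewrite ?(ltW b2) ?(ltW b3) ?(ltW b4) ?andbT //= (le_trans (ltW v2)) ?ltW.
  apply: h2o => //; case: big => hh; [exact: Or31|exact: Or32| |by apply: Or33; rewrite hh ltW].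
  by exfalso; move: hh hx v1 v2 u1; clear; lra.
Qed.

(** [Lam] comes before the radii and the flat structure, since it has to be known when the
    neighbourhood in the definition of a local splitting is chosen. *)
Lemma plane_no (k mu n1 n2 : nat) : (0 < k)%N -> (0 < mu)%N -> ~~ (k %| n1)%N -> (0 < n2)%N ->
  (n1 + n2 = k * mu + k)%N -> exists2 Lam : R, 6 <= Lam &
  forall (R0 r0 : R) (p1 p2 : C) f (t1 t2 : C -> C),
  0 < r0 -> r0 * Lam < R0 -> md p1 < r0 -> md p2 < r0 -> complex.Re p1 < complex.Re p2 ->
  let Reg := punctured R0 p1 p2 in
  flat_atlas k Reg f -> cone_chart k Reg f p1 t1 n1 -> cone_chart k Reg f p2 t2 n2 ->
  (forall a, r0 <= md a -> md a < R0 -> exists zeta c, zeta ^+ k = 1 /\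
     nearC a (fun w => w ^+ mu = zeta * f a w + c)) -> False.
Proof.
move=> k0 mu0 kn n20 nE.
have n10 : (0 < n1)%N by rewrite lt0n; apply: contraNneq kn => ->; rewrite dvdn0.
have [d d0 hd] : exists2 d : R, 0 < d & forall x : C, md x < d -> md ((1 + x) ^+ k - 1) < 1 / 2.
  have [c hc] : exists c, cder (fun x : C => (1 + x) ^+ k) 0 c.
    by eexists; exact: (cderX k (cderD (cder_cst 1 0) (cder_id 0))).
  have half0 : (0 : R) < 1 / 2 by rewrite divr_gt0.
  have [d d0 h] := cder_cont hc half0.
  by exists d => // x; have := h x; rewrite subr0 addr0 expr1n.
pose L := 2 / d; have L0 : 0 < L by rewrite divr_gt0.
(* The preimages are counted between the radii [2 * r0] and [R0 / 3], whence the factor 6;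
   [1 + 2 * L] is the ratio that [counting_contradiction] asks for. *)
exists (6 * (1 + 2 * L)); first by move: L0; clear; lra.
move=> R0 r0 p1 p2 f t1 t2 r00 rR m1 m2 Re12 Reg fl ct1 ct2 H3.
have rR6 : r0 * 6 < R0.
  by apply: le_lt_trans rR; rewrite ler_pM2l//; move: L0; clear; lra.
have [h [c [hloc hp1 hp2 hout]]] := glued_power k0 mu0 kn r00 rR6 m1 m2 Re12 fl ct1 ct2 H3.
have R13 : R0 / 3 < R0 by move: rR6 r00; clear; lra.
have cone_at p t n : nearC p (fun w => h w = t w ^+ n) -> cone_chart k Reg f p t n -> (0 < n)%N ->
    [/\ cat setT h p, lopen h p, lmult h p n & h p = 0].
  move=> hp [e e0 [cT inj tp _]] n0; have pe : md (p - p) < e by rewrite subrr md0.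
  have lo : lopen t p := inj_lopen e0 cT inj.
  have E : nearC p (fun w => t w ^+ n = h w) by apply: nearCW hp.
  have ct : cat setT t p := cT p pe.
  split.
  - exact: cat_near E (catX n ct).
  - by apply: lopen_eq E _; exact: (lopen_comp ct lo (@pow_lopen R n (t p) n0)).
  - by apply: lmult_eq E _; exact: pow_lmult.
  - by rewrite (nearC_self hp) tp expr0n gtn_eqF.
have [cp1 op1 mp1 hp10] := cone_at _ _ _ hp1 ct1 n10.
have [cp2 op2 mp2 hp20] := cone_at _ _ _ hp2 ct2 n20.
have reg_at a : Reg a -> md a <= R0 / 3 -> [/\ cat setT h a, lopen h a & h a != 0 -> linj h a].
  move=> Ra aR; have [c' ne] := hloc a Ra aR; have [e e0 [hb inj]] := fl a Ra.
  have ae : md (a - a) < e by rewrite subrr md0.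
  have cfa : cat setT (fun w => f a w + c') a.
    by apply: catD; [have [] := hb a ae|exact: cat_cst].
  have inj' z z' : md (z - a) < e -> md (z' - a) < e -> f a z + c' = f a z' + c' -> z = z'.
    by move=> z1 z2 /addIr; exact: inj.
  have lo : lopen (fun w => f a w + c') a.
    apply: (@inj_lopen _ _ _ e) => // b be; apply: catD; last exact: cat_cst.
    by have [] := hb b be.
  have E : nearC a (fun w => (f a w + c') ^+ k = h w) by apply: nearCW ne.
  split.
  - exact: cat_near E (catX k cfa).
  - by apply: lopen_eq E _; exact: (lopen_comp cfa lo (@pow_lopen R k (f a a + c') k0)).
  - rewrite (nearC_self ne) => h0; apply: linj_eq E _; apply: (pow_linj k0 e0 cfa inj').
    by apply: contraNneq h0 => ->; rewrite expr0n gtn_eqF.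
have dich a : md a <= R0 / 3 -> [\/ a = p1, a = p2 | Reg a].
  move=> aR; have [->|a1] := eqVneq a p1; first exact: Or31.
  have [->|a2] := eqVneq a p2; first exact: Or32.
  by apply: Or33; split => //; apply: le_lt_trans R13.
have p12 : p1 != p2 by apply: contraTneq Re12 => ->; rewrite ltxx.
have bnd : (1 + 2 * L) * (2 * r0) ^+ mu < (R0 / 3) ^+ mu.
  have b1 : 1 <= 1 + 2 * L by move: L0; clear; lra.
  apply: le_lt_trans (_ : ((1 + 2 * L) * (2 * r0)) ^+ mu < _).
    rewrite [leRHS]exprMn; apply: ler_wpM2r; first by rewrite exprn_ge0// mulr_ge0// ltW.
    by rewrite -[leLHS]expr1 ler_weXn2l.
  have R00 : 0 < R0 / 3 by move: rR6 r00; clear; lra.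
  rewrite ltr_pXn2r// ?nnegrE ?(ltW R00)//; first by move: rR; clear; lra.
  by rewrite !mulr_ge0// ?ltW//; move: b1; clear; lra.
apply: (@counting_contradiction R k mu n1 n2 h c p1 p2 (2 * r0) (R0 / 3) L) => //.
- by rewrite mulr_gt0.
- by move: rR6 r00; clear; lra.
- move=> x; rewrite /L invf_div mul1r => hx; apply/ltW/hd; apply: le_lt_trans hx _.
  by move: d0; clear; lra.
- by move=> z zR; have [->|->|Ra] // := dich z zR; have [] := reg_at _ Ra zR.
- by move=> z zR; have [->|->|Ra] // := dich z (ltW zR); have [] := reg_at _ Ra (ltW zR).
- by move=> z zR h0; have [e|e|Ra] := dich z (ltW zR); [by rewrite e hp10 eqxx in h0|by rewrite e hp20 eqxx in h0|have [_ _] := reg_at _ Ra (ltW zR); exact].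
- by apply: lt_trans m1 _; move: r00; clear; lra.
- by apply: lt_trans m2 _; move: r00; clear; lra.
- by move=> z /andP[z1 z2]; exact: hout.
- by rewrite nE -[ltnLHS]addn0 ltn_add2l.
Qed.

End Plane.

(** * Discs in surfaces *)


Section Cone.
Context {R : realType}.
Local Notation C := (Cplx R).

Definition E2 : set C := [set z | md z <= 1].

Lemma E2E : E2 = [set z : C | `|z| <= 1].
Proof. by apply/seteqP; split=> z; rewrite /E2 /= norm_md -(rmorph1 (real_complex R)) lecR. Qed.

(** Alexander's trick: under this radial extension a homeomorphism of the circle becomes one of the
    plane. *)
Definition cone (phi : C -> C) (v : C) : C := (md v)%:C%C * phi (v / (md v)%:C%C).

Lemma md_dir (v : C) : v != 0 -> S1 (v / (md v)%:C%C).
Proof.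
move=> v0; have m0 : 0 < md v by rewrite md_gt0.
by rewrite /S1 /= mdM mdV md_real ger0_norm ?md_ge0// divff// gt_eqF.
Qed.

Lemma mdC_neq0 (v : C) : v != 0 -> ((md v)%:C%C : C) != 0.
Proof. by rewrite -!md_gt0 md_real ger0_norm ?md_ge0. Qed.

Lemma cat_md A v : cat A (fun w : C => (md w)%:C%C) v.
Proof.
move=> e e0; exists e => // w _ hw; rewrite -rmorphB /= md_real.
by apply: le_lt_trans hw; rewrite ler_norml; have := md_sub w v; have := md_sub v w; rewrite (mdB v w); lra.
Qed.

Section Phi.
Variable phi : C -> C.
Hypothesis phiS : forall u, S1 u -> S1 (phi u).

Lemma md_cone v : md (cone phi v) = md v.
Proof.
have [->|v0] := eqVneq v 0; first by rewrite /cone md0 rmorph0 mul0r md0.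
by rewrite /cone mdM (phiS (md_dir v0)) mulr1 md_real ger0_norm ?md_ge0.
Qed.

Lemma cone_S1 u : S1 u -> cone phi u = phi u.
Proof. by rewrite /cone /S1 /= => ->; rewrite rmorph1 mul1r divr1. Qed.

Lemma cone_cat v : (forall u, S1 u -> cat S1 phi u) -> cat setT (cone phi) v.
Proof.
move=> cphi; have [->|v0] := eqVneq v 0.
  move=> e e0; exists e => // w _; rewrite subr0 => we.
  have -> : cone phi 0 = 0 by rewrite /cone md0 rmorph0 mul0r.
  by rewrite subr0 md_cone.
have h : cat [set w : C | w != 0] (cone phi) v.
  apply: catM; first exact: cat_md.
  apply: (cat_comp (B := S1) (f := fun w : C => w / (md w)%:C%C)).
  - by apply: catM; [exact: cat_id|apply: catV; [exact: mdC_neq0|exact: cat_md]].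
  - by apply: cphi; exact: md_dir.
  - by move=> w; exact: md_dir.
move=> e /h[d d0 hd]; have m0 : 0 < md v by rewrite md_gt0.
exists (Num.min d (md v)); first by rewrite lt_min d0.
move=> w _; rewrite lt_min => /andP[w1 w2]; apply: hd => //=.
by apply: contraTneq w2 => ->; rewrite sub0r mdN ltxx.
Qed.

Lemma cone_inj : (forall u w, S1 u -> S1 w -> phi u = phi w -> u = w) -> injective (cone phi).
Proof.
move=> inj v w E; have mE : md v = md w by rewrite -(md_cone v) E md_cone.
have [v0|v0] := eqVneq v 0.
  by move: mE; rewrite v0 md0 => /esym/eqP; rewrite md_eq0 => /eqP.
have w0 : w != 0 by rewrite -md_gt0 -mE md_gt0.
have := mulfI (mdC_neq0 v0); move: E; rewrite /cone -mE => E /(_ _ _ E) /inj H.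
have : v / (md v)%:C%C = w / (md v)%:C%C by apply: H; [exact: md_dir|rewrite mE; exact: md_dir].
by move=> /(mulIf (invr_neq0 (mdC_neq0 v0))).
Qed.

Lemma cone_surj : (forall u, S1 u -> exists2 w, S1 w & phi w = u) -> forall v, exists2 w, md w = md v & cone phi w = v.
Proof.
move=> sur v; have [->|v0] := eqVneq v 0.
  by exists 0 => //; rewrite /cone md0 rmorph0 mul0r.
have [w Sw wE] := sur _ (md_dir v0); have m0 := mdC_neq0 v0.
have mw : md ((md v)%:C%C * w) = md v by rewrite mdM Sw mulr1 md_real ger0_norm ?md_ge0.
exists ((md v)%:C%C * w) => //; rewrite /cone mw mulrAC divff// mul1r wE.
by rewrite mulrCA divff// mulr1.
Qed.
End Phi.
End Cone.

Section Topo.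
Context {X Y : topologicalType}.

Definition wc (A : set X) (F : X -> Y) p := forall U, nbhs (F p) U -> nbhs p [set q | A q -> U (F q)].

Lemma wcP A (F : X -> Y) : {within A, continuous F} <-> forall p, A p -> wc A F p.
Proof.
split=> [/subspace_continuousP h p Ap U /(h p Ap)|h] //.
by apply/subspace_continuousP => p Ap U /(h p Ap).
Qed.
End Topo.

Section Disc.
Context {R : realType} (X : riemannSurface R).
Local Notation C := (Cplx R).
Implicit Types (p q : X) (i j : rs_index X).

Lemma nbhsC (z : C) (U : set C) : nbhs z U <-> nearC z U.
Proof. exact: near_md. Qed.

Lemma chart_near i p P : rs_dom i p -> nearC (rs_chart i p) P ->
  nbhs p [set q | rs_dom i q /\ P (rs_chart i q)].
Proof.
move=> ip /nbhsC hP; have /wcP h := @rs_chart_cont _ X i.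
have ho : nbhs p (rs_dom i) by apply: open_nbhs_nbhs; split => //; exact: rs_dom_open.
by apply: filterS (filterI ho (h p ip _ hP)) => q [iq /(_ iq)].
Qed.

Lemma inv_near i p U : rs_dom i p -> nbhs p U ->
  nearC (rs_chart i p) (fun w => [/\ rs_dom i (rs_inv i w), rs_chart i (rs_inv i w) = w & U (rs_inv i w)]).
Proof.
move=> ip nU; have im : (rs_chart i @` rs_dom i) (rs_chart i p) by exists p.
have /wcP h := @rs_inv_cont _ X i.
have hU : nbhs (rs_inv i (rs_chart i p)) U by rewrite rs_chartK.
have ho : nbhs (rs_chart i p) (rs_chart i @` rs_dom i).
  by apply: open_nbhs_nbhs; split => //; exact: rs_im_open.
apply/nbhsC; apply: filterS (filterI ho (h _ im _ hU)) => w [[q iq <-]] /= hh.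
by rewrite rs_chartK//; split => //; move: hh; rewrite rs_chartK//; apply; exists q.
Qed.

Lemma chart_nbhs i p U : rs_dom i p -> (nbhs p U <-> nearC (rs_chart i p) (fun w => U (rs_inv i w))).
Proof.
move=> ip; split=> [/(inv_near ip)|/(chart_near ip)]; first by apply: nearCW => w [].
by apply: filterS => q [iq]; rewrite rs_chartK.
Qed.

Variables (h : C -> X).
Hypotheses (ch : {within [set z : C | `|z| <= 1], continuous h})
           (ih : set_inj [set z : C | `|z| <= 1] h).
Local Notation D := (h @` [set z : C | `|z| <= 1]).

Lemma disc_inj z w : md z <= 1 -> md w <= 1 -> h z = h w -> z = w.
Proof. by move: ih; rewrite -E2E => ih' z1 w1; apply: ih'; rewrite inE. Qed.

Lemma disc_in z : md z <= 1 -> D (h z).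
Proof. by rewrite -E2E => z1; exists z. Qed.

Lemma disc_out q : D q -> exists2 z, md z <= 1 & h z = q.
Proof. by rewrite -E2E => -[z z1 <-]; exists z. Qed.

Lemma disc_cont z U : md z <= 1 -> nbhs (h z) U -> nearC z (fun w => md w <= 1 -> U (h w)).
Proof.
move=> z1 nU; move: ch => /wcP c; rewrite -E2E in c.
by have := c z z1 U nU; apply: (iffLR (nbhsC _ _)).
Qed.

Lemma disc_compact : compact D.
Proof. by apply: continuous_compact => //; rewrite -E2E; exact: compact_disc. Qed.

Lemma disc_closed : closed D.
Proof. by apply: compact_closed disc_compact; exact: rs_hausdorff. Qed.

Definition disc_inv (q : X) : C := get [set z | md z <= 1 /\ h z = q].

Lemma disc_invP q : D q -> md (disc_inv q) <= 1 /\ h (disc_inv q) = q.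
Proof.
move=> /disc_out[z z1 zq]; have := @getPex C (fun z => md z <= 1 /\ h z = q); apply.
by exists z.
Qed.

Lemma disc_invK z : md z <= 1 -> disc_inv (h z) = z.
Proof. by move=> z1; have [a b] := disc_invP (disc_in z1); exact: disc_inj. Qed.

(** The points of the unit disc at distance at least [e] from the preimage of [q] form a compact
    set, whose image is closed and misses [q]. *)
Lemma disc_inv_cont q (e : R) : D q -> 0 < e -> nbhs q [set q' | D q' -> md (disc_inv q' - disc_inv q) < e].
Proof.
move=> Dq e0; set u := disc_inv q; have [u1 uq] := disc_invP Dq; rewrite -/u in u1 uq.
pose K := [set z : C | md z <= 1] `&` [set z | e <= md (z - u)].
have cmu : continuous (fun z : C => md (z - u)).
  move=> z; have FF : Filter (nbhs z) by exact: nbhs_filter.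
  apply/cvgrPdist_lt => r r0; apply/near_md; exists r => // w hw.
  apply: le_lt_trans (md_dist2 z u w u) _; rewrite subrr md0 addr0 mdB//.
have cK : compact K.
  apply: (@subclosed_compact _ K [set z : C | md z <= 1]); [|exact: compact_disc|by move=> z []].
  apply: closedI; first exact: (compact_closed (@norm_hausdorff _ _) (@compact_disc R 1)).
  have -> : [set z : C | e <= md (z - u)] = (fun z : C => md (z - u)) @^-1` [set x | e <= x] by [].
  by apply: closed_comp => [z _|]; [exact: cmu|exact: closed_ge].
have cK' : closed (h @` K).
  apply: compact_closed; first exact: rs_hausdorff.
  apply: continuous_compact cK; apply: continuous_subspaceW ch.
  by rewrite -E2E => z [].
have nq : nbhs q (~` (h @` K)).
  apply: open_nbhs_nbhs; split; first by rewrite openC.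
  move=> [z [z1 ze] zq]; move: ze; rewrite (_ : z = u); last by apply: disc_inj => //; rewrite zq.
  by rewrite /= subrr md0 leNgt e0.
apply: filterS nq => q' nK Dq'; rewrite ltNge; apply/negP => he.
have [q1 q2] := disc_invP Dq'; apply: nK; exists (disc_inv q') => //.
Qed.

(** Invariance of domain in a chart, twice. If [h z] with [|z| = 1] were interior, [disc_inv] would
    be open there and take values of modulus greater than 1; for [|z| < 1] the map [h] itself is
    open at [z]. *)
Lemma disc_interior z : md z <= 1 -> D° (h z) <-> md z < 1.
Proof.
move=> z1; have [i ip] := rs_cover (h z).
have nd := chart_near ip (@nearCT R _ (fun=> True) (fun=> I)).
split=> [Dz|zl].
- rewrite ltNge; apply/negP => z2.
  have mz : md z = 1 by apply/eqP; rewrite eq_le z1.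
  have [e e0 he] := inv_near ip Dz.
  pose g := fun v => disc_inv (rs_inv i v).
  have gc : g (rs_chart i (h z)) = z by rewrite /g rs_chartK// disc_invK.
  have lo : lopen g (rs_chart i (h z)).
    apply: (@inj_lopen _ _ _ e) => //.
    - move=> b be r r0; have [b1 b2 b3] := he b be.
      have := inv_near b1 (disc_inv_cont b3 r0); rewrite b2 => /(nearCI (P := fun w => md (w - rs_chart i (h z)) < e)).
      case; first by exists (e - md (b - rs_chart i (h z))); [rewrite subr_gt0|move=> w hw; have := md_tri w b (rs_chart i (h z)); lra].
      move=> r' r'0 hr; exists r' => // w _ /hr[we [_ _ hw]]; apply: hw.
      by have [] := he w we.
    - move=> v w /he[v1 v2 v3] /he[w1 w2 w3] E.
      have : rs_inv i v = rs_inv i w.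
        by have [_ <-] := disc_invP v3; have [_ <-] := disc_invP w3; rewrite -/(g v) E.
      by move=> /(congr1 (rs_chart i)); rewrite v2 w2.
  have [d d0 hd] := lo e e0; rewrite gc in hd.
  have [|v ve gv] := hd ((1 + d / 2)%:C%C * z).
    rewrite -[X in _ - X]mul1r -(rmorph1 (real_complex R)) -mulrBl -rmorphB mdM mz mulr1 md_real addrAC subrr add0r gtr0_norm; lra.
  have [_ _ v3] := he v ve; have [+ _] := disc_invP v3.
  by rewrite -/(g v) gv mdM mz mulr1 md_real gtr0_norm; lra.
- apply/(chart_nbhs _ ip).
  have [e1 e10 he1] := disc_cont z1 nd.
  pose e := Num.min e1 (1 - md z); have e0 : 0 < e by rewrite lt_min e10 subr_gt0.
  have inE2 w : md (w - z) < e -> md w <= 1 /\ rs_dom i (h w).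
    rewrite lt_min => /andP[w1 w2]; have mw : md w <= 1 by have := md_tri w z 0; rewrite !subr0; lra.
    by split => //; have [] := he1 w w1 mw.
  pose g := fun w => rs_chart i (h w).
  have lo : lopen g z.
    apply: (@inj_lopen _ _ _ e) => //.
    - move=> b be r r0; have [b1 b2] := inE2 b be.
      have nb : nearC (rs_chart i (h b)) (fun v => md (v - rs_chart i (h b)) < r) by exists r.
      have [d d0 hd] := disc_cont b1 (chart_near b2 nb).
      exists (Num.min d (e - md (b - z))); first by rewrite lt_min d0 subr_gt0.
      move=> w _; rewrite lt_min => /andP[w1 w2]; apply: (hd w w1 _).2.
      by apply: (inE2 w _).1; have := md_tri w b z; lra.
    - move=> v w /inE2[v1 v2] /inE2[w1 w2] /(congr1 (rs_inv i)); rewrite !rs_chartK//; exact: disc_inj.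
  have [d d0 hd] := lo e e0; exists d => // v /hd[w /inE2[w1 w2] <-].
  by rewrite /g rs_chartK//; exact: disc_in.
Qed.

End Disc.

(* The boundary homeomorphism extends radially to the discs, which turns the
   isomorphism outside the discs into an embedding of the whole surface. *)
Lemma coning (R : realType) (X X' : riemannSurface R) (D : set X) (D' : set X') F G :
  closed_disc D -> closed_disc D' ->
  {within ~` D°, continuous F} -> {within ~` D'°, continuous G} ->
  (forall p, (~` D°) p -> (~` D'°) (F p) /\ G (F p) = p) ->
  (forall q, (~` D'°) q -> (~` D°) (G q) /\ F (G q) = q) ->
  F @` (~` D) = ~` D' ->
  exists Phi : X -> X', [/\ forall p, wc setT Phi p, injective Phi,
    forall p, ~ D p -> Phi p = F p, forall p, D p -> D' (Phi p) & forall q, D' q -> exists2 p, D p & Phi p = q].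
Proof.
move=> [h [ch ih DE]] [h' [ch' ih' DE']] /wcP cF /wcP cG FG GF FD.
have intD z : md z <= 1 -> D° (h z) <-> md z < 1 by rewrite DE; exact: disc_interior.
have intD' z : md z <= 1 -> D'° (h' z) <-> md z < 1 by rewrite DE'; exact: disc_interior.
have inD z : md z <= 1 -> D (h z) by rewrite DE; exact: disc_in.
have inD' z : md z <= 1 -> D' (h' z) by rewrite DE'; exact: disc_in.
have cD : closed D by rewrite DE; exact: disc_closed.
pose s := disc_inv h; pose s' := disc_inv h'.
have sP q : D q -> md (s q) <= 1 /\ h (s q) = q by rewrite DE; exact: disc_invP.
have sP' q : D' q -> md (s' q) <= 1 /\ h' (s' q) = q by rewrite DE'; exact: disc_invP.
have sK z : md z <= 1 -> s (h z) = z by exact: disc_invK.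
have sK' z : md z <= 1 -> s' (h' z) = z by exact: disc_invK.
have S1le (u : Cplx R) : S1 u -> md u <= 1 by rewrite /S1 /= => ->.
have bd u : S1 u -> (~` D°) (h u) by move=> Su /(intD u (S1le u Su)); rewrite Su ltxx.
have bd' u : S1 u -> (~` D'°) (h' u) by move=> Su /(intD' u (S1le u Su)); rewrite Su ltxx.
(* Boundary points go to [D']: if [F p] were outside it, it would be the image of a point outside
   [D], which is [p] itself by injectivity. *)
have FDD p : D p -> (~` D°) p -> D' (F p).
  move=> Dp np; apply: contrapT => nD'; have : (F @` (~` D)) (F p) by rewrite FD.
  move=> [q nDq E]; have nq : (~` D°) q by move=> /(@interior_subset _ D).
  by have := (FG q nq).2; rewrite E (FG p np).2 => pq; apply: nDq; rewrite -pq.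
have GDD q : D' q -> (~` D'°) q -> D (G q).
  move=> Dq nq; apply: contrapT => nD; have : (F @` (~` D)) (F (G q)) by exists (G q).
  by rewrite (GF q nq).2 FD; apply.
have bdS q : D q -> (~` D°) q -> S1 (s q).
  move=> Dq nq; have [q1 q2] := sP q Dq; apply/eqP; rewrite eq_le q1 leNgt; apply/negP => lt.
  by apply: nq; rewrite -q2; apply/(intD _ q1).
have bdS' q : D' q -> (~` D'°) q -> S1 (s' q).
  move=> Dq nq; have [q1 q2] := sP' q Dq; apply/eqP; rewrite eq_le q1 leNgt; apply/negP => lt.
  by apply: nq; rewrite -q2; apply/(intD' _ q1).
pose phi u := s' (F (h u)).
have phiD u : S1 u -> D' (F (h u)) by move=> Su; apply: FDD; [exact: inD (S1le _ Su)|exact: bd].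
have phiS u : S1 u -> S1 (phi u).
  by move=> Su; apply: bdS'; [exact: phiD|exact: (FG _ (bd u Su)).1].
have phiE u : S1 u -> h' (phi u) = F (h u) by move=> Su; have [] := sP' _ (phiD u Su).
have phi_inj u w : S1 u -> S1 w -> phi u = phi w -> u = w.
  move=> Su Sw E; rewrite -(sK u (S1le u Su)) -(sK w (S1le w Sw)).
  by rewrite -(FG _ (bd u Su)).2 -(FG _ (bd w Sw)).2 -phiE// -phiE// E.
have phi_surj u : S1 u -> exists2 w, S1 w & phi w = u.
  move=> Su; have Du := GDD _ (inD' u (S1le u Su)) (bd' u Su); have [nu Fu] := GF _ (bd' u Su).
  exists (s (G (h' u))); first exact: bdS.
  by rewrite /phi; have [_ ->] := sP _ Du; rewrite Fu sK'//; exact: S1le.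
have phi_cat u : S1 u -> cat S1 phi u.
  move=> Su e e0.
  have n1 : nbhs (F (h u)) [set q' | D' q' -> md (s' q' - phi u) < e].
    by move: (phiD u Su); rewrite /phi /s' DE' => Du; exact: disc_inv_cont.
  have n2 := cF _ (bd u Su) _ n1.
  have [d d0 hd] := disc_cont ch (S1le u Su) n2.
  by exists d => // w Sw wd; apply: (hd w wd (S1le _ Sw) (bd w Sw)); exact: phiD.
have mc v : md (cone phi v) = md v by exact: md_cone.
have csurj := cone_surj phi_surj; have cinj := cone_inj phiS phi_inj.
pose Phi p := if `[< D p >] then h' (cone phi (s p)) else F p.
have PhiD p : D p -> Phi p = h' (cone phi (s p)) by move=> Dp; rewrite /Phi asboolT.
have PhiN p : (~` D°) p -> Phi p = F p.
  move=> np; have [Dp|nDp] := pselect (D p); last by rewrite /Phi asboolF.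
  have Sp := bdS p Dp np; rewrite PhiD// cone_S1// phiE//.
  by have [_ ->] := sP p Dp.
have wcD p : D p -> wc D Phi p.
  move=> Dp U; rewrite PhiD// => nU; have [p1 p2] := sP p Dp.
  have c1 : md (cone phi (s p)) <= 1 by rewrite mc.
  have [d d0 hd] := disc_cont ch' c1 nU.
  have [d' d'0 hd'] := cone_cat phiS (s p) phi_cat d0.
  have n1 : nbhs p [set q' | D q' -> md (s q' - s p) < d'] by move: Dp; rewrite /s DE => Dp; exact: disc_inv_cont.
  apply: filterS n1 => q hq Dq; rewrite PhiD//; apply: hd; first by apply: hd' => //; exact: hq.
  by rewrite mc; have [] := sP q Dq.
have wcN p : (~` D°) p -> wc (~` D°) Phi p.
  move=> np U; rewrite PhiN// => nU; apply: filterS (cF p np U nU) => q hq nq.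
  by rewrite PhiN//; exact: hq.
exists Phi; split.
- move=> p U nU; have [Dp|nDp] := pselect (D p).
    have [ip|np] := pselect (D° p).
      by apply: filterS (filterI ip (wcD p Dp U nU)) => q [Dq hq] _; exact: hq.
    apply: filterS (filterI (wcN p np U nU) (wcD p Dp U nU)) => q [h1 h2] _.
    have [Dq|nDq] := pselect (D q); first exact: h2.
    by apply: h1 => /(@interior_subset _ D).
  have np : (~` D°) p by move=> /(@interior_subset _ D).
  have oD : nbhs p (~` D) by apply: open_nbhs_nbhs; split => //; rewrite openC.
  apply: filterS (filterI oD (wcN p np U nU)) => q [nDq hq] _; apply: hq.
  by move=> /(@interior_subset _ D).
- have NN p : ~ D p -> (~` D°) p by move=> nDp /(@interior_subset _ D).
  have ND p : ~ D p -> ~ D' (F p).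
    by move=> nDp; have : (~` D') (F p) by rewrite -FD; exists p.
  have DD p : D p -> D' (Phi p).
    by move=> Dp; rewrite PhiD//; apply: inD'; rewrite mc; have [] := sP p Dp.
  move=> p q E; have [Dp|nDp] := pselect (D p); have [Dq|nDq] := pselect (D q).
  + have [p1 p2] := sP p Dp; have [q1 q2] := sP q Dq.
    rewrite -p2 -q2; congr (h _); apply: cinj; move: E; rewrite !PhiD// => /(congr1 s').
    by rewrite !sK' ?mc.
  + by have := DD p Dp; rewrite E PhiN; [move/ND|exact: NN].
  + by have := DD q Dq; rewrite -E PhiN; [move/ND|exact: NN].
  + have := (FG p (NN p nDp)).2; rewrite -PhiN; last exact: NN.
    by rewrite E PhiN; [rewrite (FG q (NN q nDq)).2|exact: NN].
- by move=> p nDp; rewrite /Phi asboolF.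
- by move=> p Dp; rewrite PhiD//; apply: inD'; rewrite mc; have [] := sP p Dp.
- move=> q Dq; have [q1 q2] := sP' q Dq; have [w w1 w2] := csurj (s' q).
  have w1' : md w <= 1 by rewrite w1.
  exists (h w); first exact: inD.
  by rewrite PhiD ?sK ?w2//; exact: inD.
Qed.

(** * Primitives of k-th roots of a k-differential *)


Lemma pow_chain (F : fieldType) (a x y m c : F) k : a = x * y -> x ^+ k = m * c -> a ^+ k = m * (c * y ^+ k).
Proof. by move=> -> h; rewrite exprMn h mulrA. Qed.

Lemma pow_scale (F : fieldType) (a m x y c : F) k : a = m * x -> c = y ^ 0%Z * x ^+ k -> a ^+ k = m ^+ k * c.
Proof. by move=> -> ->; rewrite exprMn expr0z mul1r. Qed.

(* Differentiating [s ^ k = (l T) ^ N] *)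
Lemma pow_root_deriv (F : fieldType) (k N : nat) (n : int) (mu l s T ds dT c : F) :
  (0 < k)%N -> (0 < N)%N -> k%:R != 0 :> F -> N%:R != 0 :> F -> l != 0 -> s != 0 ->
  N%:Z = n + k%:Z -> l ^+ N = (mu * k%:R / N%:R) ^+ k -> s ^+ k = (l * T) ^+ N ->
  k%:R * s ^+ k.-1 * ds = N%:R * (l * T) ^+ N.-1 * (l * dT) ->
  c = T ^ n * dT ^+ k -> ds ^+ k = mu ^+ k * c.
Proof.
move=> k0 N0 k0C N0C l0 s0 NE lN sk d12 ->.
have T0 : T != 0.
  apply: contraNneq s0 => T0; move: sk; rewrite T0 mulr0 expr0n gtn_eqF// => /eqP.
  by rewrite expf_eq0 k0.
have d13 : (k%:R * ds) * (l * T) ^+ N = N%:R * (l * T) ^+ N.-1 * (l * dT) * s.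
  rewrite -sk -d12; have -> : s ^+ k = s * s ^+ k.-1 by rewrite -exprS prednK.
  ring.
have d14 : k%:R * ds * T = N%:R * dT * s.
  apply: (mulIf (expf_neq0 N.-1 (mulf_neq0 l0 T0))); apply: (mulIf l0).
  rewrite (_ : _ * l = (k%:R * ds) * (l * T) ^+ N); last first.
    have -> : (l * T) ^+ N = l * T * (l * T) ^+ N.-1 by rewrite -exprS prednK.
    ring.
  by rewrite d13; ring.
have d15 : (k%:R * ds * T) ^+ k = (N%:R * dT) ^+ k * ((mu * k%:R / N%:R) ^+ k * T ^+ N).
  by rewrite d14 [LHS]exprMn sk [(l * T) ^+ N]exprMn lN.
have Tn : T ^+ N = T ^ n * T ^+ k by rewrite -[T ^+ N]/(T ^ N%:Z) NE expfzDr.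
apply: (mulIf (expf_neq0 k T0)); apply: (mulIf (expf_neq0 k k0C)).
transitivity ((k%:R * ds * T) ^+ k); first by rewrite -!exprMn; congr (_ ^+ k); ring.
rewrite d15 Tn !exprMn exprVn.
have NkC : (N%:R : F) ^+ k != 0 by exact: expf_neq0.
by field.
Qed.

Section Comp.
Context {R : realType}.
Local Notation C := (Cplx R).

Lemma dC_comp (f g : C -> C) (z : C) : (exists c, cder f z c) -> (exists c, cder g (f z) c) ->
  dC (g \o f) z = dC g (f z) * dC f z.
Proof. by move=> hf hg; apply: cder_dC; apply: cder_comp; exact: dCP. Qed.

Lemma dnear_comp (f : C -> C) (z : C) P : (exists c, cder f z c) -> dnearC z (fun w => f w != f z) ->
  dnearC (f z) P -> dnearC z (fun w => P (f w)).
Proof.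
move=> hf hne hP; apply: nearCW (nearCI hne (nearC_comp hf hP)) => w [h1 h2] wz.
by apply: h2; exact: h1.
Qed.

Lemma dnearC_near' (z : C) P : nearC z P -> dnearC z P.
Proof. by apply: nearCW. Qed.

Lemma dnear_at (z b : C) P (r : R) : (forall w, md (w - z) < r -> w != z -> P w) -> md (b - z) < r -> dnearC b P.
Proof.
move=> h br; have [->|bz] := eqVneq b z.
  exists r; first exact: le_lt_trans (md_ge0 _) br.
  by move=> w wr wz; exact: h.
exists (Num.min (r - md (b - z)) (md (b - z))).
  by rewrite lt_min subr_gt0 br md_gt0 subr_eq0.
move=> w; rewrite lt_min => /andP[w1 w2] _; apply: h; first by have := md_tri w b z; lra.
by apply: contraTneq w2 => ->; rewrite mdB ltxx.
Qed.

Lemma prim_pull (T g h c c' : C -> C) (z m : C) k : hol T z -> dnearC z (fun w => T w != T z) ->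
  hol g (T z) -> dnearC (T z) (fun v => dC g v ^+ k = m * c v) ->
  nearC z (fun w => (g \o T) w = h w) -> dnearC z (fun w => c' w = c (T w) * dC T w ^+ k) ->
  hol h z /\ dnearC z (fun w => dC h w ^+ k = m * c' w).
Proof.
move=> hT hne hg hd E hc; split; first exact: hol_eq E (hol_comp hT hg).
have hd' := dnear_comp (P := fun v => dC g v ^+ k = m * c v) (hol_cder hT) hne hd.
have hg1 := nearC_comp (hol_cder hT) (hol_near hg).
apply: nearCW (nearCI (nearCI hd' hc) (nearCI (nearC_nearC E) (nearCI hg1 (hol_near hT)))).
move=> w [[h1 h2] [h3 [h4 h5]]] wz; have h4' := hol_cder h4; have h5' := hol_cder h5.
rewrite (h2 wz) -(dC_eq h3); last by have [a ha] := h4'; have [b hb] := h5'; exists (a * b); exact: cder_comp.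
exact: pow_chain (dC_comp h5' h4') (h1 wz).
Qed.
End Comp.

Section Surf.
Context {R : realType} {k : nat} {X : riemannSurface R} (xi : kDifferential k X).
Local Notation C := (Cplx R).
Implicit Types (p q : X) (i j : rs_index X) (f g : X -> C).

Definition trans i j : C -> C := rs_chart j \o rs_inv i.

Lemma trans_hol i j p : rs_dom i p -> rs_dom j p -> hol (trans i j) (rs_chart i p).
Proof. by move=> ip jp; apply/holP; exact: rs_transition. Qed.

Lemma trans_at i j p : rs_dom i p -> trans i j (rs_chart i p) = rs_chart j p.
Proof. by move=> ip; rewrite /trans /= rs_chartK. Qed.

Lemma dom_near i p : rs_dom i p -> nbhs p (rs_dom i).
Proof. by move=> ip; apply: open_nbhs_nbhs; split => //; exact: rs_dom_open. Qed.

Lemma trans_inv i j p : rs_dom i p -> rs_dom j p ->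
  nearC (rs_chart i p) (fun w => trans j i (trans i j w) = w).
Proof.
move=> ip jp; apply: nearCW (inv_near ip (dom_near jp)) => w [w1 w2 w3].
by rewrite /trans /= rs_chartK.
Qed.

Lemma trans_dC i j p : rs_dom i p -> rs_dom j p -> dC (trans i j) (rs_chart i p) != 0.
Proof.
move=> ip jp; have h1 := hol_cder (trans_hol ip jp).
have h2 := hol_cder (trans_hol jp ip); rewrite -(trans_at j ip) in h2.
have E : dC (trans j i \o trans i j) (rs_chart i p) = 1.
  rewrite (dC_eq (trans_inv ip jp)); first exact: (cder_dC (cder_id _)).
  have [c1 hc1] := h1; have [c2 hc2] := h2; exists (c2 * c1); exact: cder_comp.
apply: contra_eq_neq E => d0; rewrite dC_comp// d0 mulr0 eq_sym; exact: oner_neq0.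
Qed.

Lemma trans_ne i j p : rs_dom i p -> rs_dom j p ->
  dnearC (rs_chart i p) (fun w => trans i j w != trans i j (rs_chart i p)).
Proof.
move=> ip jp; apply: nearCW (trans_inv ip jp) => w hw; apply: contraNneq => E.
by rewrite -hw E trans_at// trans_at.
Qed.

Lemma kd_trans i j p : rs_dom i p -> rs_dom j p -> dnearC (rs_chart i p) (fun w =>
  kd_coef xi i w = kd_coef xi j (trans i j w) * dC (trans i j) w ^+ k).
Proof. by move=> ip jp; have /dnearC_near := kd_transition xi ip jp. Qed.

Lemma order_indep i j p n : rs_dom i p -> rs_dom j p ->
  order_at (kd_coef xi i) (rs_chart i p) n -> order_at (kd_coef xi j) (rs_chart j p) n.
Proof.
move=> ip jp h; apply: (order_at_pull (trans_hol jp ip) (trans_dC jp ip) _ (kd_trans jp ip)).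
by rewrite trans_at.
Qed.

Lemma has_order_of i p n : rs_dom i p -> order_at (kd_coef xi i) (rs_chart i p) n -> has_order xi p n.
Proof. by move=> ip h j jp; exact: order_indep h. Qed.

Lemma has_order_uniq p n m : has_order xi p n -> has_order xi p m -> n = m.
Proof. by have [i ip] := rs_cover p => h1 h2; exact: order_at_uniq (h1 i ip) (h2 i ip). Qed.

Lemma zero_indep i j p : rs_dom i p -> rs_dom j p ->
  dnearC (rs_chart i p) (fun w => kd_coef xi i w = 0) -> dnearC (rs_chart j p) (fun w => kd_coef xi j w = 0).
Proof.
move=> ip jp h.
have h' : dnearC (rs_chart j p) (fun w => kd_coef xi i (trans j i w) = 0).
  apply: (dnear_comp (P := fun v => kd_coef xi i v = 0) (hol_cder (trans_hol jp ip)) (trans_ne jp ip)).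
  by rewrite trans_at.
apply: nearCW (nearCI h' (kd_trans jp ip)) => w [h1 h2] wz.
by rewrite h2// h1// mul0r.
Qed.

(** The points near which the coefficient vanishes identically form an open and closed set; the
    surface is connected and [xi] is not zero, so there are none. *)
Lemma order_exists p : exists n, has_order xi p n.
Proof.
pose Z := [set q | exists i, rs_dom i q /\ dnearC (rs_chart i q) (fun w => kd_coef xi i w = 0)].
have ZE i q : rs_dom i q -> Z q -> dnearC (rs_chart i q) (fun w => kd_coef xi i w = 0).
  by move=> iq [j [jq h]]; exact: zero_indep h.
have NZ q : ~ Z q -> exists n, has_order xi q n.
  move=> nZ; have [i iq] := rs_cover q.
  have [h0|[n hn]] := mero_order (kd_mero xi iq); first by exfalso; apply: nZ; exists i.
  by exists n; exact: has_order_of hn.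
apply: (NZ p) => Zp.
have oZ : open Z.
  rewrite openE => q [i [iq [e e0 he]]].
  have ne : nearC (rs_chart i q) (fun w => md (w - rs_chart i q) < e) by exists e.
  apply: filterS (chart_near iq ne) => q' [iq' hq']; exists i; split => //.
  exact: dnear_at he hq'.
have cZ : closed Z.
  rewrite -openC openE => q nZq; have [i iq] := rs_cover q.
  have [n hn] := NZ q nZq; have /order_atP[g [hg g0 hgn]] := hn i iq.
  have [e e0 he] := nearCI hgn (hol_neq0 hg g0).
  have ne : nearC (rs_chart i q) (fun w => md (w - rs_chart i q) < e) by exists e.
  apply: filterS (chart_near iq ne) => q' [iq' hq'] Zq'.
  have h1 : dnearC (rs_chart i q') (fun w => kd_coef xi i w != 0).
    apply: (dnear_at (z := rs_chart i q) (r := e)) hq' => w we wz.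
    have [-> // gw] := he w we; rewrite mulf_neq0//.
    by apply: expfz_neq0; rewrite subr_eq0.
  have [r r0 hr] := nearCI h1 (ZE i q' iq' Zq').
  have [w [_ wz wr]] : exists w : C, [/\ True, w != rs_chart i q' & md (w - rs_chart i q') < r].
    exists (rs_chart i q' + (r / 2)%:C%C).
    have md2 : md ((r / 2)%:C%C : C) = r / 2 by rewrite md_real gtr0_norm// divr_gt0.
    split => //; last by rewrite addrAC subrr add0r md2; lra.
    by rewrite -subr_eq0 addrAC subrr add0r -md_gt0 md2 divr_gt0.
  by have [h2 h3] := hr w wr; have := h2 wz; rewrite h3// eqxx.
have ZT : Z = [set: X].
  apply: (rs_connected (r := X)); first by exists p.
    by exists Z => //; rewrite setTI.
  by exists Z => //; rewrite setTI.
have [i [q [iq]]] := kd_nonzero xi; apply; apply/dnearC_near; apply: ZE => //.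
by rewrite ZT.
Qed.

Variable mu : C.

(** The factor [mu] is a normalisation: for a suitable [mu] a pure power of the coordinate at [z0]
    is such a primitive ([coord_prim]). *)
Definition prim_in i f p := hol (f \o rs_inv i) (rs_chart i p) /\
  dnearC (rs_chart i p) (fun w => dC (f \o rs_inv i) w ^+ k = mu ^+ k * kd_coef xi i w).

Definition prim f p := forall i, rs_dom i p -> prim_in i f p.

Lemma prim_of i f p : rs_dom i p -> prim_in i f p -> prim f p.
Proof.
move=> ip [hf hd] j jp.
have hT := trans_hol jp ip.
have hf' : hol (f \o rs_inv i) (trans j i (rs_chart j p)) by rewrite trans_at.
have E : nearC (rs_chart j p) (fun w => ((f \o rs_inv i) \o trans j i) w = (f \o rs_inv j) w).
  apply: nearCW (inv_near jp (dom_near ip)) => w [w1 w2 w3].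
  by rewrite /trans /= rs_chartK.
apply: (prim_pull hT (trans_ne jp ip) hf' _ E (kd_trans jp ip)).
by rewrite trans_at.
Qed.

Lemma prim_uniq i f g p : (0 < k)%N -> rs_dom i p -> prim f p -> prim g p -> dC (g \o rs_inv i) (rs_chart i p) != 0 ->
  exists zeta c, zeta ^+ k = 1 /\ nbhs p [set q | f q = zeta * g q + c].
Proof.
move=> k0 ip /(_ i ip)[hf df] /(_ i ip)[hg dg] d0.
have dfg : dnearC (rs_chart i p) (fun w => dC (f \o rs_inv i) w ^+ k = dC (g \o rs_inv i) w ^+ k).
  by apply: nearCW (nearCI df dg) => w [h1 h2] wz; exact: etrans (h1 wz) (esym (h2 wz)).
have [zeta [c [z1 E]]] := affine_of_derive k0 hf hg d0 dfg.
by exists zeta, c; split => //; apply/(chart_nbhs _ ip).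
Qed.

Lemma hol_cont i f p (e : R) : rs_dom i p -> hol (f \o rs_inv i) (rs_chart i p) -> 0 < e ->
  nbhs p [set q | md (f q - f p) < e].
Proof.
move=> ip /hol_cder[c /cder_nearC h] e0; apply/(chart_nbhs _ ip).
by apply: nearCW (h e e0) => w; rewrite /= rs_chartK.
Qed.

Hypotheses (k0 : (0 < k)%N) (mu0 : mu != 0).

(* A chart in which xi = t^n dt^k. *)
Lemma normal_chart p n U : has_order xi p n -> - k%:Z < n -> nbhs p U -> exists i T S r rho, [/\ rs_dom i p,
  biholo T S (rs_chart i p) r rho,
  forall w, md (w - rs_chart i p) < r ->
    [/\ rs_dom i (rs_inv i w), rs_chart i (rs_inv i w) = w & U (rs_inv i w)]
  & forall w, md (w - rs_chart i p) < r -> w != rs_chart i p -> kd_coef xi i w = T w ^ n * dC T w ^+ k].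
Proof.
move=> hn nk nU; have [i ip] := rs_cover p.
have [e e0 he] := inv_near ip nU.
have [T [S [r [rho [bh re hc]]]]] := normal_form e0 k0 nk (hn i ip).
by exists i, T, S, r, rho; split => // w wr; apply: he; exact: lt_le_trans re.
Qed.

Lemma biholo_hol (T S : C -> C) z (r rho : R) w : biholo T S z r rho -> md (w - z) < r -> hol T w /\ dC T w != 0.
Proof.
move=> [_ _ _ [h _] _] wr; split.
  exists (r - md (w - z)); first by rewrite subr_gt0.
  by move=> v hv; have [|c _ hc] := h v; [have := md_tri v w z; lra|exists c].
by have [c c0 hc] := h w wr; rewrite (cder_dC hc).
Qed.

Definition ndeg f p := exists2 i, rs_dom i p & dC (f \o rs_inv i) (rs_chart i p) != 0.

Lemma prim_chart p : has_order xi p 0 -> exists f, nbhs p [set q | prim f q /\ ndeg f q] /\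
  exists2 U, nbhs p U & forall q q', U q -> U q' -> f q = f q' -> q = q'.
Proof.
move=> h0; have nk : - k%:Z < 0 by rewrite oppr_lt0 ltz_nat.
have [i [T [S [r [rho [ip bh hr hc]]]]]] := normal_chart h0 nk (@filterT _ _ _).
have [r0 _ _ [_ inj] _] := bh.
have nr : nearC (rs_chart i p) (fun w => md (w - rs_chart i p) < r) by exists r.
have ne := chart_near ip nr.
exists (fun q => mu * T (rs_chart i q)); split.
  apply: filterS ne => q [iq qr].
  have E : nearC (rs_chart i q) (fun w => mu * T w = ((fun q' => mu * T (rs_chart i q')) \o rs_inv i) w).
    apply: nearCW (inv_near iq (@filterT _ _ _)) => w [_ + _]; by rewrite /= => ->.
  have [hT dT] := biholo_hol bh qr.
  have hmT w : hol T w -> dC (fun w => mu * T w) w = mu * dC T w.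
    by move=> /hol_cder/dCP h; apply: cder_dC; exact: cderZ.
  have hh : hol (fun w => mu * T w) (rs_chart i q) by apply: holM => //; exact: hol_cst.
  split; last by exists i; [exact: iq|rewrite -(dC_eq E (hol_cder hh)) (hmT _ hT); exact: mulf_neq0].
  apply: (prim_of iq); split; first exact: hol_eq E hh.
  have nhc := dnear_at hc qr.
  apply: nearCW (nearCI nhc (nearCI (nearC_nearC E) (nearCI (hol_near hh) (hol_near hT)))) => w [h1 [h2 [h3 h4]]] wz.
  exact: pow_scale (etrans (esym (dC_eq h2 (hol_cder h3))) (hmT _ h4)) (h1 wz).
exists [set q | rs_dom i q /\ md (rs_chart i q - rs_chart i p) < r]; first exact: ne.
move=> q q' [iq qr] [iq' qr'] /(mulfI mu0)/(inj _ _ qr qr')/(congr1 (rs_inv i)).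
by rewrite !rs_chartK.
Qed.

(* (ds)^k = mu^k t^(N-k) dt^k for s = (mu k / N) t^(N/k). *)
Lemma cone_chart_at p n (N : nat) : has_order xi p n -> - k%:Z < n -> N%:Z = n + k%:Z ->
  exists t, [/\ t p = 0,
    exists2 U, nbhs p U & forall q q', U q -> U q' -> t q = t q' -> q = q',
    nbhs p [set q | exists2 i, rs_dom i q & hol (t \o rs_inv i) (rs_chart i q)]
    & nbhs p [set q | q != p -> forall f, prim f q -> ndeg f q -> exists c, nbhs q [set q' | t q' ^+ N = (f q' + c) ^+ k]]].
Proof.
move=> hn nk NE.
have N0 : (0 < N)%N by rewrite -ltz_nat NE; lia.
have [i [T [S [r [rho [ip bh hr hc]]]]]] := normal_chart hn nk (@filterT _ _ _).
have [r0 _ T0 [_ inj] _] := bh.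
have nr : nearC (rs_chart i p) (fun w => md (w - rs_chart i p) < r) by exists r.
have ne := chart_near ip nr.
have k0C : (k%:R : C) != 0 by rewrite pnatr_eq0 -lt0n.
have N0C : (N%:R : C) != 0 by rewrite pnatr_eq0 -lt0n.
(* Chosen so that [(l T)^N = s^k] for [s = (mu k / N) T^(N/k)], which satisfies
   [(ds)^k = mu^k T^n dT^k]. *)
pose L := (mu * k%:R / N%:R) ^+ k; pose l := N.-root L.
have lN : l ^+ N = L by rewrite rootCK.
have L0 : L != 0 by rewrite expf_neq0// !mulf_neq0// invr_neq0.
have l0 : l != 0 by apply: contraNneq L0 => l0; rewrite -lN l0 expr0n gtn_eqF.
have E q : rs_dom i q -> nearC (rs_chart i q) (fun w => l * T w = ((fun q' => l * T (rs_chart i q')) \o rs_inv i) w).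
  by move=> iq; apply: nearCW (inv_near iq (@filterT _ _ _)) => w [_ + _]; rewrite /= => ->.
exists (fun q => l * T (rs_chart i q)); split.
- by rewrite T0 mulr0.
- exists [set q | rs_dom i q /\ md (rs_chart i q - rs_chart i p) < r]; first exact: ne.
  move=> q q' [iq qr] [iq' qr'] /(mulfI l0)/(inj _ _ qr qr')/(congr1 (rs_inv i)).
  by rewrite !rs_chartK.
- apply: filterS ne => q [iq qr]; exists i => //; apply: hol_eq (E q iq) _.
  by apply: holM; [exact: hol_cst|exact: (biholo_hol bh qr).1].
- apply: filterS ne => q [iq qr] qp f pf [j jq ndf].
  have [hT dT] := biholo_hol bh qr.
  have qz : rs_chart i q != rs_chart i p.
    by apply: contraNneq qp => /(congr1 (rs_inv i)); rewrite !rs_chartK// => ->.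
  have Tq : T (rs_chart i q) != 0.
    by rewrite -T0; apply: contraNneq qz => /inj -> //; rewrite subrr md0.
  have hA : hol (fun w => (l * T w) ^+ N) (rs_chart i q).
    by apply: holX; apply: holM => //; exact: hol_cst.
  have [s [hs s0 sE]] := hol_root k0 hA (expf_neq0 N (mulf_neq0 l0 Tq)).
  have ps : prim (s \o rs_chart i) q.
    apply: (prim_of iq).
    have Es : nearC (rs_chart i q) (fun w => s w = ((s \o rs_chart i) \o rs_inv i) w).
      by apply: nearCW (inv_near iq (@filterT _ _ _)) => w [_ + _]; rewrite /= => ->.
    split; first exact: hol_eq Es hs.
    have nhc := dnear_at hc qr.
    apply: nearCW (nearCI (nearCI nhc (nearC_nearC Es)) (nearCI (nearCI (hol_near hs) (hol_neq0 hs s0)) (nearCI (nearC_nearC sE) (hol_near hT)))).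
    move=> w [[h1 h2] [[h3 h4] [h5 h6]]] wz.
    rewrite -(dC_eq h2 (hol_cder h3)).
    have d1 : dC (fun w => s w ^+ k) w = k%:R * s w ^+ k.-1 * dC s w.
      by apply: cder_dC; apply: cderX; exact: dCP (hol_cder h3).
    have d2 : dC (fun w => (l * T w) ^+ N) w = N%:R * (l * T w) ^+ N.-1 * (l * dC T w).
      by apply: cder_dC; apply: cderX; apply: cderZ; exact: dCP (hol_cder h6).
    have d12 : k%:R * s w ^+ k.-1 * dC s w = N%:R * (l * T w) ^+ N.-1 * (l * dC T w).
      by rewrite -d1 -d2; apply: dC_eq h5 _; exact: hol_cder (holX k h3).
    exact: (pow_root_deriv k0 N0 k0C N0C l0 h4 NE lN (nearC_self h5) d12 (h1 wz)).
  have [z [c [z1 nE]]] := prim_uniq k0 jq ps pf ndf.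
  have zn : z != 0 by apply: contra_eq_neq z1 => ->; rewrite expr0n gtn_eqF// eq_sym oner_neq0.
  exists (c / z).
  have nsE := chart_near iq sE.
  apply: filterS (filterI nE nsE) => q' [h1 [h2 h3]] /=.
  rewrite -h3 -[s _]/((s \o rs_chart i) q') h1.
  by rewrite (_ : z * f q' + c = z * (f q' + c / z)) ?exprMn ?z1 ?mul1r//; field.
Qed.

End Surf.

Section Iso.
Context {R : realType} {k : nat} {X X' : riemannSurface R} (xi : kDifferential k X) (xi' : kDifferential k X').
Local Notation C := (Cplx R).
Variables (A : set X) (A' : set X') (F : X -> X') (G : X' -> X).
Hypotheses (hF : holomorphic_on A F) (hG : holomorphic_on A' G) (pF : pullback_on A F xi xi').
Hypotheses (FA : forall p, A p -> A' (F p) /\ G (F p) = p).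
Hypotheses (oA : open A) (cF : forall p, A p -> wc A F p).

Lemma le_at i j p : rs_dom i p -> local_expr F i j (rs_chart i p) = rs_chart j (F p).
Proof. by move=> ip; rewrite /local_expr /= rs_chartK. Qed.

Lemma le_near i j p : A p -> rs_dom i p -> rs_dom j (F p) ->
  nearC (rs_chart i p) (fun w => [/\ rs_dom i (rs_inv i w), rs_chart i (rs_inv i w) = w, A (rs_inv i w)
     & rs_dom j (F (rs_inv i w))]).
Proof.
move=> Ap ip jp; have nA : nbhs p A by apply: open_nbhs_nbhs; split.
have nj := cF Ap (dom_near jp).
apply: nearCW (inv_near ip (filterI nA nj)) => w [w1 w2 [w3 w4]].
by split => //; exact: w4.
Qed.

Lemma le_hol i j p : A p -> rs_dom i p -> rs_dom j (F p) -> hol (local_expr F i j) (rs_chart i p).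
Proof. by move=> Ap ip jp; apply/holP; exact: hF. Qed.

Lemma le_inv i j p : A p -> rs_dom i p -> rs_dom j (F p) ->
  nearC (rs_chart i p) (fun w => local_expr G j i (local_expr F i j w) = w).
Proof.
move=> Ap ip jp; apply: nearCW (le_near Ap ip jp) => w [w1 w2 w3 w4].
by rewrite /local_expr /= rs_chartK// (FA w3).2 w2.
Qed.

Lemma le_ne i j p : A p -> rs_dom i p -> rs_dom j (F p) ->
  dnearC (rs_chart i p) (fun w => local_expr F i j w != local_expr F i j (rs_chart i p)).
Proof.
move=> Ap ip jp; have h := le_inv Ap ip jp; apply: nearCW h => w hw; apply: contraNneq => E.
by rewrite -hw E (nearC_self (le_inv Ap ip jp)).
Qed.

Lemma le_dC i j p : A p -> rs_dom i p -> rs_dom j (F p) -> dC (local_expr F i j) (rs_chart i p) != 0.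
Proof.
move=> Ap ip jp; have h1 := hol_cder (le_hol Ap ip jp).
have h2 : exists c, cder (local_expr G j i) (local_expr F i j (rs_chart i p)) c.
  rewrite le_at//; apply: hol_cder; apply/holP; apply: hG => //; first exact: (FA Ap).1.
  by rewrite (FA Ap).2.
have E : dC (local_expr G j i \o local_expr F i j) (rs_chart i p) = 1.
  rewrite (dC_eq (le_inv Ap ip jp)); first exact: (cder_dC (cder_id _)).
  have [c1 hc1] := h1; have [c2 hc2] := h2; exists (c2 * c1); exact: cder_comp.
apply: contra_eq_neq E => d0; rewrite (dC_comp h1 h2) d0 mulr0 eq_sym; exact: oner_neq0.
Qed.

Lemma le_pull i j p : A p -> rs_dom i p -> rs_dom j (F p) -> dnearC (rs_chart i p) (fun w =>
  kd_coef xi i w = kd_coef xi' j (local_expr F i j w) * dC (local_expr F i j) w ^+ k).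
Proof. by move=> Ap ip jp; have /dnearC_near := pF Ap ip jp. Qed.

Lemma iso_order p n : A p -> has_order xi' (F p) n -> has_order xi p n.
Proof.
move=> Ap hn; have [i ip] := rs_cover p; have [j jp] := rs_cover (F p).
apply: (has_order_of ip); apply: (order_at_pull (le_hol Ap ip jp) (le_dC Ap ip jp) _ (le_pull Ap ip jp)).
by rewrite le_at//; exact: hn.
Qed.

Lemma iso_prim mu f p : A p -> prim xi' mu f (F p) -> prim xi mu (f \o F) p.
Proof.
move=> Ap pf; have [i ip] := rs_cover p; have [j jp] := rs_cover (F p).
have [hf df] := pf j jp.
apply: (prim_of ip); apply: (prim_pull (le_hol Ap ip jp) (le_ne Ap ip jp) (g := f \o rs_inv j) _ _ _ (le_pull Ap ip jp)).
- by rewrite le_at.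
- by rewrite le_at.
- apply: nearCW (le_near Ap ip jp) => w [w1 w2 w3 w4].
  by rewrite /local_expr /= rs_chartK.
Qed.

End Iso.

Lemma pow_coord (F : fieldType) (a m w x y c : F) (k e : nat) : a = m * (w * x) ^+ e * (w * y) ->
  c = x ^ (k * e)%:Z * y ^+ k -> a ^+ k = (m * w ^+ e.+1) ^+ k * c.
Proof.
move=> -> ->; rewrite -exprnP mulnC exprM exprS -!exprMn; congr (_ ^+ k).
by rewrite exprMn; ring.
Qed.

Section Coord.
Context {R : realType} {k : nat} {X : riemannSurface R} (xi : kDifferential k X).
Local Notation C := (Cplx R).
Variables (c0 : C) (i : rs_index X) (T S : C -> C) (r rho : R) (n : int).
Hypotheses (bh : biholo T S c0 r rho).
Hypothesis (hin : forall w, md (w - c0) < r -> rs_dom i (rs_inv i w) /\ rs_chart i (rs_inv i w) = w).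
Hypothesis (hc : forall w, md (w - c0) < r -> w != c0 -> kd_coef xi i w = T w ^ n * dC T w ^+ k).

Lemma coord_order q : rs_dom i q -> md (rs_chart i q - c0) < r -> T (rs_chart i q) != 0 -> has_order xi q 0.
Proof.
move=> iq qr T0; have [hT dT] := biholo_hol bh qr; apply: (has_order_of iq).
apply/order_atP; exists (fun w => T w ^ n * dC T w ^+ k); split.
- by apply: holM; [exact: holXz|apply: holX; exact: hol_derive].
- by rewrite mulf_neq0// ?expfz_neq0// expf_neq0.
- apply: nearCW (dnear_at hc qr) => w h wz; rewrite (h wz) expr0z mul1r; reflexivity.
Qed.

(** A k-th root of [T^(k e) dT^k] is [T^e dT], whose primitive [T^(e+1) / (e+1)] is single valued
    around the point. The factor [om] leaves room for a rotation of the coordinate. *)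
Lemma coord_prim e om q : n = (k * e)%:Z -> om != 0 -> rs_dom i q -> md (rs_chart i q - c0) < r -> T (rs_chart i q) != 0 ->
  prim xi (e.+1%:R * om ^+ e.+1) (fun q => (om * T (rs_chart i q)) ^+ e.+1) q /\
  dC ((fun q => (om * T (rs_chart i q)) ^+ e.+1) \o rs_inv i) (rs_chart i q) != 0.
Proof.
move=> nE om0 iq qr T0; have [hT dT] := biholo_hol bh qr; have hc' := hc; rewrite nE in hc'.
have E : nearC (rs_chart i q) (fun w => (om * T w) ^+ e.+1 = ((fun q => (om * T (rs_chart i q)) ^+ e.+1) \o rs_inv i) w).
  by apply: nearCW (inv_near iq (@filterT _ _ _)) => w [_ + _]; rewrite /= => ->.
have hh w : hol T w -> hol (fun w => (om * T w) ^+ e.+1) w.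
  by move=> h; apply: holX; apply: holM => //; exact: hol_cst.
have hd w : hol T w -> dC (fun w => (om * T w) ^+ e.+1) w = e.+1%:R * (om * T w) ^+ e * (om * dC T w).
  by move=> /hol_cder/dCP h; apply: cder_dC; apply: cderX; exact: cderZ.
split; last first.
  rewrite -(dC_eq E (hol_cder (hh _ hT))) (hd _ hT).
  apply: mulf_neq0; last exact: mulf_neq0.
  by apply: mulf_neq0; [rewrite pnatr_eq0|apply: expf_neq0; exact: mulf_neq0].
apply: (prim_of iq); split; first exact: hol_eq E (hh _ hT).
apply: nearCW (nearCI (dnear_at hc' qr) (nearCI (nearC_nearC E) (hol_near hT))) => w [h1 [h2 h3]] wz.
exact: pow_coord (etrans (esym (dC_eq h2 (hol_cder (hh _ h3)))) (hd _ h3)) (h1 wz).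
Qed.

End Coord.

(** * The obstruction *)


Lemma int_quotient (k : nat) (a0 : int) : (0 < k)%N -> (k%:Z %| a0)%Z -> - k%:Z < a0 ->
  exists e : nat, a0 = (k * e)%:Z.
Proof.
move=> k0 /dvdzP[q ->] h; have q0 : 0 <= q.
  rewrite leNgt; apply/negP => q0; have : q * k%:Z <= - k%:Z; last by lia.
  by rewrite -mulN1r ler_wpM2r//; lia.
by exists `|q|%N; rewrite PoszM gez0_abs// mulrC.
Qed.

Lemma int_shift (k : nat) (a : int) : - k%:Z < a -> exists2 N : nat, (0 < N)%N & N%:Z = a + k%:Z.
Proof. by move=> h; exists `|(a + k%:Z)%R|%N; lia. Qed.

Section Obstruct.
Context {R : realType}.
Local Notation C := (Cplx R).

(* In the coordinate where xi = w^(k e) dw^k, an embedding Phi of the surface agreeing with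
   the isomorphism F outside D carries the flat structure of xi' to the disc. *)
Lemma flat_contradiction (k e N1 N2 : nat) (X X' : riemannSurface R) (xi : kDifferential k X)
  (xi' : kDifferential k X') (c0 : C) (i : rs_index X) (T S : C -> C) (r rho r0 Lam : R)
  (D : set X) (D' : set X') (F Phi : X -> X') (G : X' -> X) (z1 z2 : X') (a1 a2 : int) (q1 q2 : X) :
  (0 < k)%N ->
  (forall (R0 r0 : R) (p1 p2 : C) f (t1 t2 : C -> C),
    0 < r0 -> r0 * Lam < R0 -> md p1 < r0 -> md p2 < r0 -> complex.Re p1 < complex.Re p2 ->
    let Reg := punctured R0 p1 p2 in
    flat_atlas k Reg f -> cone_chart k Reg f p1 t1 N1 -> cone_chart k Reg f p2 t2 N2 ->
    (forall a, r0 <= md a -> md a < R0 -> exists zeta c, zeta ^+ k = 1 /\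
       nearC a (fun w => w ^+ e.+1 = zeta * f a w + c)) -> False) ->
  biholo T S c0 r rho ->
  (forall w, md (w - c0) < r -> rs_dom i (rs_inv i w) /\ rs_chart i (rs_inv i w) = w) ->
  (forall w, md (w - c0) < r -> w != c0 -> kd_coef xi i w = T w ^ (k * e)%:Z * dC T w ^+ k) ->
  0 < r0 -> r0 * Lam < rho -> r0 < rho ->
  (forall q, D q -> [/\ rs_dom i q, md (rs_chart i q - c0) < r & md (T (rs_chart i q)) < r0]) ->
  D (rs_inv i c0) ->
  open (~` D) -> (forall p, (~` D) p -> wc (~` D) F p) -> holomorphic_on (~` D) F -> holomorphic_on (~` D') G ->
  (forall p, (~` D) p -> (~` D') (F p) /\ G (F p) = p) -> pullback_on (~` D) F xi xi' ->
  (forall p, wc setT Phi p) -> injective Phi -> (forall p, ~ D p -> Phi p = F p) ->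
  D q1 -> D q2 -> Phi q1 = z1 -> Phi q2 = z2 -> z1 != z2 :> X' -> 
  (forall p, D p -> D' (Phi p)) ->
  has_order xi' z1 a1 -> has_order xi' z2 a2 -> - k%:Z < a1 -> - k%:Z < a2 ->
  N1%:Z = a1 + k%:Z -> N2%:Z = a2 + k%:Z ->
  (forall q, D' q -> singularity xi' q -> q = z1 \/ q = z2) -> False.
Proof.
move=> k0 plane bh hin hc r00 rL rrho DV D0 oD cF hF hG FG pF cPhi iPhi PhiF Dq1 Dq2 Pq1 Pq2 z12 DPhi o1 o2 k1 k2 NE1 NE2 sing.
have [r_0 rho0 Tc0 [dT injT] hS] := bh.
pose kap v := rs_inv i (S v); pose vq q := T (rs_chart i q).
have kapP v : md v < rho -> [/\ rs_dom i (kap v), md (rs_chart i (kap v) - c0) < r, rs_chart i (kap v) = S v & vq (kap v) = v].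
  by move=> /hS[h1 h2 _]; have [i1 i2] := hin _ h1; rewrite /vq /kap i2; split.
have kapV q : rs_dom i q -> md (rs_chart i q - c0) < r -> md (vq q) < rho -> kap (vq q) = q.
  move=> iq qr /hS[h1 h2 _]; rewrite /kap (_ : S _ = rs_chart i q) ?rs_chartK//.
  by apply: injT.
have kap_cont v U : md v < rho -> nbhs (kap v) U -> nearC v (fun w => U (kap w)).
  move=> vr nU; have [h1 h2 h3 h4] := kapP v vr; have [_ _ [d d0 hd]] := hS v vr.
  have hn := iffLR (chart_nbhs _ h1) nU; rewrite h3 in hn.
  by apply: nearC_comp hn; exists d.
pose v1 := vq q1; pose v2 := vq q2.
have [v1r v2r] : md v1 < r0 /\ md v2 < r0 by split; [have [] := DV _ Dq1|have [] := DV _ Dq2].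
have kv1 : kap v1 = q1 by have [d1 d2 d3] := DV _ Dq1; apply: kapV => //; exact: lt_trans rrho.
have kv2 : kap v2 = q2 by have [d1 d2 d3] := DV _ Dq2; apply: kapV => //; exact: lt_trans rrho.
have v12 : v2 - v1 != 0.
  rewrite subr_eq0; apply: contraNneq z12 => E; rewrite -Pq1 -Pq2 -kv1 -kv2 E; exact: eqxx.
(* A rotation that makes [p2 - p1] a positive real number: the rectangles behind [plane] need
   distinct real parts. *)
have [om [mom omd]] : exists om : C, md om = 1 /\ om * (v2 - v1) = (md (v2 - v1))%:C%C.
  exists ((md (v2 - v1))%:C%C / (v2 - v1)); split; last by rewrite divfK.
  by rewrite mdM mdV md_real ger0_norm ?md_ge0// divff// gt_eqF// md_gt0.
have om0 : om != 0 by rewrite -md_gt0 mom.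
have mdom a : md (a / om) = md a by rewrite mdM mdV mom invr1 mulr1.
(* [psi] spreads the new surface over a disc of the plane; it is continuous and injective, and over
   [D] nothing more is known of it. *)
pose psi a := Phi (kap (a / om)); pose p1 := om * v1; pose p2 := om * v2.
have [p1r p2r] : md p1 < r0 /\ md p2 < r0 by rewrite /p1 /p2 (mdM om v1) (mdM om v2) mom !mul1r.
have Re12 : complex.Re p1 < complex.Re p2.
  by rewrite -subr_gt0 -ReB -mulrBr omd /= md_gt0.
have psi1 : psi p1 = z1 by rewrite /psi /p1 mulrC mulKf// kv1.
have psi2 : psi p2 = z2 by rewrite /psi /p2 mulrC mulKf// kv2.
have om_cont a : cder (fun w => w / om) a (om^-1).
  by have := cderM (cder_id a) (cder_cst om^-1 a); rewrite mul1r mulr0 addr0.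
have psi_cont a U : md a < rho -> nbhs (psi a) U -> nearC a (fun w => U (psi w)).
  move=> ar nU; have n1 := cPhi _ _ nU.
  have ar' : md (a / om) < rho by rewrite mdom.
  have n2 := kap_cont _ _ ar' n1.
  have := nearC_comp (ex_intro _ _ (om_cont a)) n2; by apply: nearCW => w; exact.
have psi_inj a b : md a < rho -> md b < rho -> psi a = psi b -> a = b.
  rewrite -(mdom a) -(mdom b) => /kapP[_ _ _ ha] /kapP[_ _ _ hb] /iPhi E.
  by apply: (mulIf (invr_neq0 om0)); rewrite -ha -hb E.
pose Reg := punctured rho p1 p2.
pose mu : C := e.+1%:R * om ^+ e.+1.
have mu0 : mu != 0 by rewrite mulf_neq0 ?pnatr_eq0// expf_neq0.
have out_order p : ~ D p -> rs_dom i p -> md (rs_chart i p - c0) < r -> has_order xi p 0.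
  move=> nDp ip pr; apply: (coord_order bh hc ip pr).
  rewrite -Tc0; apply/eqP => /(injT _ _ pr) E; apply: nDp.
  by rewrite -(rs_chartK ip) E// subrr md0.
(* Inside [D'] a singularity would be [z1] or [z2]; outside, the isomorphism carries over the order
   0 that [xi] has away from [D]. *)
have reg_order a : Reg a -> has_order xi' (psi a) 0.
  move=> [ar a1' a2']; have [n hn] := order_exists xi' (psi a).
  have [kd kr _ _] : [/\ rs_dom i (kap (a / om)), md (rs_chart i (kap (a / om)) - c0) < r, True & True].
    by have [] := kapP (a / om); rewrite ?mdom.
  suff n0 : n = 0 by rewrite -n0.
  have [Dk|nDk] := pselect (D (kap (a / om))).
    apply/eqP/contraT => n0; have [|E|E] := sing (psi a) (DPhi _ Dk); first by exists n.
      by case/eqP: a1'; apply: psi_inj => //; [exact: lt_trans rrho|rewrite psi1].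
    by case/eqP: a2'; apply: psi_inj => //; [exact: lt_trans rrho|rewrite psi2].
  have h0 := out_order _ nDk kd kr.
  apply: (has_order_uniq _ h0); apply: (iso_order hF hG pF FG oD cF nDk).
  by rewrite -PhiF.
have /choice[fq hfq] : forall q, exists f : X' -> C, has_order xi' q 0 ->
    nbhs q [set q' | prim xi' mu f q' /\ ndeg f q'] /\
    exists2 U, nbhs q U & forall q' q'', U q' -> U q'' -> f q' = f q'' -> q' = q''.
  move=> q; have [h|nh] := pselect (has_order xi' q 0); last by exists (fun=> 0).
  by have [f hf] := prim_chart k0 mu0 h; exists f.
pose f a w := fq (psi a) (psi w).
have comp_cont (g : X' -> C) b : md b < rho -> (exists2 j, rs_dom j (psi b) & hol (g \o rs_inv j) (rs_chart j (psi b))) ->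
    cat setT (fun w => g (psi w)) b.
  move=> br [j jb hg] d d0; have [d' d'0 h] := psi_cont b _ br (hol_cont jb hg d0).
  by exists d' => // w _ /h.
have prim_hol g q : prim xi' mu g q -> exists2 j, rs_dom j q & hol (g \o rs_inv j) (rs_chart j q).
  by have [j jq] := rs_cover q => /(_ j jq)[h _]; exists j.
have near_reg a : Reg a -> nearC a Reg.
  move=> [ar a1' a2']; have n1 : 0 < Num.min (rho - md a) (Num.min (md (p1 - a)) (md (p2 - a))).
    by rewrite !lt_min subr_gt0 ar !md_gt0 !subr_eq0 eq_sym a1' eq_sym a2'.
  exists (Num.min (rho - md a) (Num.min (md (p1 - a)) (md (p2 - a)))) => // w.
  rewrite !lt_min => /and3P[w1 w2 w3]; split.
  - exact: md_lt_ball w1.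
  - by apply: contraTneq w2 => ->; rewrite ltxx.
  - by apply: contraTneq w3 => ->; rewrite ltxx.
have fl : flat_atlas k Reg f.
  move=> a Ra; have [n1 [U nU injU]] := hfq _ (reg_order a Ra).
  have ar : md a < rho by case: Ra.
  have [d d0 hd] := nearCI (near_reg a Ra) (psi_cont a _ ar (filterI n1 nU)).
  exists d => //; split.
    move=> b /hd[Rb [[pb _] Ub]]; have br : md b < rho by case: Rb.
    split => //; first by apply: comp_cont => //; exact: prim_hol pb.
    have [nb _] := hfq _ (reg_order b Rb); have [pb' [j jb ndb]] := nbhs_singleton nb.
    have [z [c [z1' nE]]] := prim_uniq k0 jb pb pb' ndb.
    exists z, c; split => //; exact: psi_cont nE.
  move=> b b' /hd[Rb [_ Ub]] /hd[Rb' [_ Ub']] E.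
  by apply: psi_inj; [case: Rb|case: Rb'|exact: injU].
have cones p z a (N : nat) q : p = om * q -> md q < r0 -> psi p = z -> has_order xi' z a -> - k%:Z < a -> N%:Z = a + k%:Z ->
    nearC p (fun b => b != p -> Reg b) ->
    exists t, cone_chart k Reg f p t N.
  move=> pq qr pz oz ka NE nR.
  have [t [tz [U nU injU] nh nc]] := cone_chart_at k0 mu0 oz ka NE.
  have pr : md p < rho by rewrite pq mdM mom mul1r; exact: lt_trans rrho.
  exists (t \o psi).
  have [d d0 hd] := nearCI (nearCI (near_md_lt pr) nR) (psi_cont p _ pr ltac:(rewrite pz; exact: (filterI nU (filterI nh nc)))).
  exists d => //; split.
  - by move=> b /hd[[br _] [_ [hb _]]]; exact: comp_cont.
  - move=> b b' /hd[[br _] [Ub _]] /hd[[br' _] [Ub' _]] E; apply: psi_inj => //; exact: injU.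
  - by rewrite /= pz.
  - move=> b /hd[[br Rb] [_ [_ hb]]] bp; have Rb' := Rb bp; split => //.
    have bz : psi b != z by apply: contraNneq bp => E; apply/eqP/psi_inj => //; rewrite pz.
    have [nb _] := hfq _ (reg_order b Rb'); have [pb' ndb] := nbhs_singleton nb.
    have [c nE] := hb bz _ pb' ndb; exists c; exact: psi_cont nE.
have p12 : p1 != p2 by apply: contraTneq Re12 => ->; rewrite ltxx.
have near_ne (p q : C) : p != q -> nearC p (fun b => b != q).
  move=> pq; exists (md (q - p)); first by rewrite md_gt0 subr_eq0 eq_sym.
  by move=> w; apply: contraTneq => ->; rewrite ltxx.
have [t1 ct1] : exists t, cone_chart k Reg f p1 t N1.
  apply: (cones p1 z1 a1 N1 v1) => //.
  by apply: nearCW (nearCI (near_md_lt (lt_trans p1r rrho)) (near_ne _ _ p12)) => b [b1 b2] b3.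
have [t2 ct2] : exists t, cone_chart k Reg f p2 t N2.
  apply: (cones p2 z2 a2 N2 v2) => //.
  have p21 : p2 != p1 by rewrite eq_sym.
  by apply: nearCW (nearCI (near_md_lt (lt_trans p2r rrho)) (near_ne _ _ p21)) => b [b1 b2] b3.
(* Over the ring outside [D] the power [w ^+ e.+1] of the rotated coordinate is a flat coordinate of
   [xi], and [F] identifies it with one of [xi']. *)
apply: (plane rho r0 p1 p2 f t1 t2 r00 rL p1r p2r Re12 fl ct1 ct2) => a ra ar.
have Ra : Reg a by split => //; apply: contraTneq ra => ->; rewrite -ltNge.
have ar' : md (a / om) < rho by rewrite mdom.
have [kd kr ks kv] := kapP _ ar'.
pose p := kap (a / om).
have nDp : (~` D) p.
  by move=> /DV[_ _]; rewrite -/(vq p) kv mdom ltNge ra.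
have nDw : nearC a (fun w => md w < rho /\ (~` D) (kap (w / om))).
  apply: nearCI; first exact: near_md_lt.
  have nn : nbhs p (~` D) by apply: open_nbhs_nbhs; split.
  by have := nearC_comp (ex_intro _ _ (om_cont a)) (kap_cont _ _ ar' nn); apply: nearCW.
have pE : psi a = F p by rewrite /psi PhiF.
have [nb _] := hfq _ (reg_order a Ra); have [pb _] := nbhs_singleton nb.
have pbF : prim xi mu (fq (psi a) \o F) p.
  by apply: (iso_prim hF pF FG oD cF nDp); rewrite -pE.
have Tp : T (rs_chart i p) != 0.
  by rewrite -/(vq p) kv mulf_neq0 ?invr_neq0// -md_gt0; exact: lt_le_trans ra.
have [pc ndc] := coord_prim bh hc (erefl _) om0 kd kr Tp.
have [z [c [z1' nE]]] := prim_uniq k0 kd pbF pc ndc.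
have zn : z != 0 by apply: contra_eq_neq z1' => ->; rewrite expr0n gtn_eqF// eq_sym oner_neq0.
exists z^-1, (- (c / z)); split; first by rewrite exprVn z1' invr1.
have nE' := nearC_comp (ex_intro _ _ (om_cont a)) (kap_cont _ _ ar' nE).
apply: nearCW (nearCI nE' nDw) => w [E [wr nDk]].
have [_ _ _ kvw] : [/\ rs_dom i (kap (w / om)), md (rs_chart i (kap (w / om)) - c0) < r,
    rs_chart i (kap (w / om)) = S (w / om) & vq (kap (w / om)) = w / om] by apply: kapP; rewrite mdom.
move: E; rewrite /= -/(vq _) kvw -(PhiF _ nDk) -/(psi w) -/(f a w) => ->.
rewrite [om * _]mulrC divfK//; move: (w ^+ e.+1) => W.
by field.
Qed.

End Obstruct.

Theorem obstruction (R : realType) (k : nat) (X : riemannSurface R) (xi : kDifferential k X)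
    (z0 : X) (a0 : int) (alpha : 2.-tuple int) : (0 < k)%N -> has_order xi z0 a0 -> - k%:Z < a0 ->
  (forall i, - k%:Z < tnth alpha i) -> a0 = tnth alpha ord0 + tnth alpha (lift ord0 ord0) ->
  (k%:Z %| a0)%Z -> ~~ (k%:Z %| tnth alpha ord0)%Z -> ~ splits_locally xi z0 alpha.
Proof.
move=> k0 ho ka halpha hsum kd nkd hs.
have [e eE] := int_quotient k0 kd ka.
have [N1 N10 NE1] := int_shift (halpha ord0); have [N2 N20 NE2] := int_shift (halpha (lift ord0 ord0)).
have kN : ~~ (k %| N1)%N.
  apply: contra nkd => h; rewrite (_ : tnth alpha ord0 = N1%:Z - k%:Z); last by rewrite NE1 addrK.
  by rewrite rpredB// dvdzE.
have NN : (N1 + N2 = k * e.+1 + k)%N by apply/eqP; rewrite -eqz_nat !PoszD NE1 NE2 mulnS PoszD -eE hsum; lia.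
have [Lam Lam6 plane] := @plane_no R k e.+1 N1 N2 k0 isT kN N20 NN.
have [i [T [S [r [rho [iz bh hin hc]]]]]] := normal_chart k0 ho ka (@filterT _ _ _).
have [r_0 rho0 Tc0 [dT injT] hS] := bh.
have Lam0 : 0 < Lam by apply: lt_le_trans Lam6; rewrite ltr0n.
(* [D] will lie over the disc of radius [r0], while the coordinate reaches as far as
   [rho > r0 * Lam]. *)
pose r0 := rho / (2 * Lam); have r00 : 0 < r0 by rewrite divr_gt0// mulr_gt0.
have rL : r0 * Lam = rho / 2 by rewrite /r0; field; rewrite gt_eqF.
have rL' : r0 * Lam < rho by rewrite rL; move: rho0; lra.
have rr : r0 < rho by apply: le_lt_trans rL'; rewrite ler_peMr ?(ltW r00)//; move: Lam6; lra.
pose V := [set q | rs_dom i q /\ (md (rs_chart i q - rs_chart i z0) < r /\ md (T (rs_chart i q)) < r0)].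
have nV : nbhs z0 V.
  apply: (chart_near iz (P := fun w => md (w - rs_chart i z0) < r /\ md (T w) < r0)).
  apply: nearCI; first by exists r.
  have [|c _ hcd] := dT (rs_chart i z0); first by rewrite subrr md0.
  have [d d0 hd] := cder_cont hcd r00; exists d => // w /hd; by rewrite Tc0 subr0.
have [D [cD DV Dz sD [X' [xi' [D' [cD' [F [G [[cF cG FG GF] FD hF hG pF]]] [z [iz' hz sD']]]]]]]] := hs V nV.
have [Phi [cPhi iPhi PhiF DPhi surj]] := coning cD cD' cF cG FG GF FD.
have [q1 Dq1 Pq1] := surj _ (hz ord0).1; have [q2 Dq2 Pq2] := surj _ (hz (lift ord0 ord0)).1.
have clD : closed D by have [h [ch ih ->]] := cD; exact: disc_closed.
have oD : open (~` D) by rewrite openC.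
have nDi p : ~ D p -> (~` D°) p by move=> nD /(@interior_subset _ D).
have FG' p : (~` D) p -> (~` D') (F p) /\ G (F p) = p.
  by move=> nD; split; [rewrite -FD; exists p|exact: (FG p (nDi p nD)).2].
have cF' p : (~` D) p -> wc (~` D) F p.
  move=> nD U nU; move: cF => /wcP/(_ p (nDi p nD) U nU).
  by apply: filterS => q hq nDq; apply: hq; exact: nDi.
rewrite eE in hc.
apply: (@flat_contradiction R k e N1 N2 X X' xi xi' (rs_chart i z0) i T S r rho r0 Lam D D' F Phi G
  (z ord0) (z (lift ord0 ord0)) (tnth alpha ord0) (tnth alpha (lift ord0 ord0)) q1 q2) => //.
- by move=> w /hin[].
- by move=> q /DV[h1 [h2 h3]].
- by rewrite rs_chartK.
- by apply/eqP => /iz'.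
- by have [] := hz ord0.
- by have [] := hz (lift ord0 ord0).
- move=> q Dq /(sD' q Dq)[j ->].
  by case: (unliftP ord0 j) => [j' ->|->]; [right; rewrite (ord1 j')|left].
Qed.

(** * Binomial series and the choice of the nodes *)


Section LowCoef.
Context {F : fieldType}.
Implicit Types (p q : {poly F}).

Definition low n p := forall j, (j < n)%N -> p`_j = 0.

Lemma lowM n p q : low n p -> low n (p * q).
Proof.
move=> h j jn; rewrite coefM big1// => i _; rewrite h ?mul0r//.
by apply: leq_ltn_trans jn; rewrite -ltnS.
Qed.

Lemma lowD n p q : low n p -> low n q -> low n (p + q).
Proof. by move=> h1 h2 j jn; rewrite coefD h1// h2// addr0. Qed.

Lemma low_prod n (I : finType) (p q : I -> {poly F}) : (forall i, low n (p i - q i)) ->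
  low n (\prod_i p i - \prod_i q i).
Proof.
move=> h; elim/big_rec2: _ => [|i x y _ ih]; first by move=> j _; rewrite subrr coef0.
rewrite (_ : p i * y - q i * x = (p i - q i) * y + (y - x) * q i); last by ring.
by apply: lowD; [exact: lowM (h i)|exact: lowM].
Qed.
End LowCoef.

(** The computation behind [binp_pow]: the left side is the differential operator applied to the
    difference [P^k L2 - L1]. *)
Lemma ode_alg (A : comPzRingType) (L P Pk1 dP1 dPk dL2 dL1 L2 L1 k n1 n2 b x : A) :
  L * dPk = k * Pk1 * (L * dP1) -> L * dL2 = - (n2 * x * L2) -> L * dL1 = - (n1 * x * L1) ->
  k * b = n1 - n2 ->
  L * (dPk * L2 + P * Pk1 * dL2 - dL1) + n1 * x * (P * Pk1 * L2 - L1) =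
  (L * dP1 + b * x * P) * (k * Pk1 * L2).
Proof.
move=> e1 e2 e3 e4; have -> : n1 = k * b + n2 by rewrite e4 subrK.
transitivity ((L * dPk) * L2 + P * Pk1 * (L * dL2) - L * dL1 + (k * b + n2) * x * (P * Pk1 * L2 - L1)); first by ring.
rewrite e1 e2 e3 (_ : n1 = k * b + n2); [by ring|by rewrite e4 subrK].
Qed.

Section Binomial.
Context {F : numFieldType}.

Definition gbin (b : F) (j : nat) : F := (\prod_(i < j) (b - i%:R)) / j`!%:R.

Lemma gbin0 b : gbin b 0 = 1.
Proof. by rewrite /gbin big_ord0 fact0 divr1. Qed.

Lemma gbinS b j : j.+1%:R * gbin b j.+1 = (b - j%:R) * gbin b j.
Proof.
rewrite /gbin big_ord_recr /= factS natrM invfM.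
have j0 : j.+1%:R != 0 :> F by rewrite pnatr_eq0.
have f0 : j`!%:R != 0 :> F by rewrite pnatr_eq0 -lt0n fact_gt0.
move: (\prod_(i < j) _) (j.+1%:R : F) (j`!%:R : F) (j%:R : F) j0 f0 => P u v w j0 f0.
by field; rewrite f0 j0.
Qed.

Lemma gbin_neq0 b j : (forall i : nat, b != i%:R) -> gbin b j != 0.
Proof.
move=> h; rewrite mulf_neq0 ?invr_neq0// ?pnatr_eq0 -?lt0n ?fact_gt0//.
by apply/prodf_neq0 => i _; rewrite subr_eq0.
Qed.

Lemma gbin_nat n j : (n < j)%N -> gbin n%:R j = 0.
Proof. by move=> nj; rewrite /gbin (bigD1 (Ordinal nj)) //= subrr !mul0r. Qed.

Variable M : nat.

(* (1 - x u)^b modulo u^(M+1) *)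
Definition binp (b x : F) : {poly F} := \poly_(j < M.+1) (gbin b j * (- x) ^+ j).

Lemma coef_binp b x j : (j <= M)%N -> (binp b x)`_j = gbin b j * (- x) ^+ j.
Proof. by move=> jM; rewrite coef_poly ltnS jM. Qed.

Lemma binp_at0 b x : (binp b x)`_0 = 1.
Proof. by rewrite coef_binp// gbin0 mul1r. Qed.

Definition lin (x : F) : {poly F} := 1 - x *: 'X.

Lemma lin_deriv x : (lin x)^`() = - x%:P.
Proof. by rewrite /lin derivB derivZ derivX -polyC1 derivC sub0r alg_polyC. Qed.

Lemma coef_lin x (p : {poly F}) j : (lin x * p)`_j = p`_j - (if j == 0%N then 0 else x * p`_j.-1).
Proof. by rewrite /lin mulrBl mul1r coefB -scalerAl coefZ coefXM; case: j => [|j]; rewrite ?mulr0. Qed.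

Lemma coefD1 (p : {poly F}) j : p^`()`_j = j.+1%:R * p`_j.+1.
Proof. by rewrite coef_deriv mulr_natl. Qed.

Lemma binp_ode b x : low M (lin x * (binp b x)^`() + (b * x) *: binp b x).
Proof.
move=> j jM; rewrite coefD coef_lin coefZ !coefD1.
have jM' := ltnW jM.
case: j jM jM' => [|j] jM jM' /=.
  by rewrite mul1r !coef_binp// gbin0 expr1 !mulr1 subr0 -[gbin b 1]mul1r (gbinS b 0) gbin0; ring.
rewrite !coef_binp//.
rewrite exprS; move: (gbinS b j.+1); move: (gbin b j.+2) (gbin b j.+1) ((- x) ^+ j.+1) => g2 g1 X E.
rewrite [j.+2%:R * _]mulrA E; move: (j.+1%:R : F) => v; ring.
Qed.

(** The equation is a recursion for the coefficients of [D], so that the constant term determines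
    all of them up to index [M]. *)
Lemma ode_low (g x : F) (D : {poly F}) : low M (lin x * D^`() + (g * x) *: D) -> D`_0 = 0 -> low M.+1 D.
Proof.
move=> h D0; elim=> [|j IH] // jM.
have := h j jM; rewrite coefD coef_lin coefZ !coefD1 IH 1?ltnW// mulr0 addr0.
have -> : (if j == 0%N then 0 else x * (j.-1.+1%:R * D`_j.-1.+1)) = 0.
  by case: j jM IH => [|j] jM IH //=; rewrite IH 1?ltnW// !mulr0.
by rewrite subr0 => /eqP; rewrite mulf_eq0 pnatr_eq0 /= => /eqP.
Qed.

(** Both sides of [(1 - x u)^(k b) (1 - x u)^n2 = (1 - x u)^n1] solve the same differential equation
    and have constant term 1. The exponent [k b] is written as [n1 - n2] to stay among
    polynomials. *)
Lemma binp_pow k (n1 n2 : nat) b x : k%:R * b = n1%:R - n2%:R ->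
  low M.+1 (binp b x ^+ k * lin x ^+ n2 - lin x ^+ n1).
Proof.
move=> kb; set P := binp b x; set L := lin x.
have dL : L^`() = - x%:P by exact: lin_deriv.
have kbP : k%:R * b%:P = n1%:R - n2%:R :> {poly F} by rewrite -!(rmorph_nat (polyC)) -polyCM kb polyCB.
have dn n : L * (L ^+ n)^`() = - (n%:R * x%:P * L ^+ n).
  rewrite deriv_exp dL; case: n => [|n]; first by rewrite mulr0n mulr0 !mul0r oppr0.
  by rewrite /= -mulr_natl exprS; ring.
have dP : L * (P ^+ k)^`() = k%:R * P ^+ k.-1 * (L * P^`()).
  by rewrite deriv_exp -mulr_natl; ring.
have ode : low M (L * P^`() + (b * x) *: P) by exact: binp_ode.
apply: (ode_low (g := n1%:R) (x := x)); last first.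
  have c0 (p : {poly F}) n : p`_0 = 1 -> (p ^+ n)`_0 = 1.
    by move=> h; rewrite -!horner_coef0 horner_exp horner_coef0 h expr1n.
  have L0 : L`_0 = 1 by rewrite /L /lin coefB coefZ coefX mulr0 subr0 coef1.
  by rewrite coefB coef0M !c0 ?mulr1 ?subrr//; exact: binp_at0.
case: (posnP k) => [k0|k0].
  have n12 : n1 = n2 by apply/eqP; move/eqP: kb; rewrite k0 mul0r eq_sym subr_eq0 eqr_nat.
  by rewrite k0 n12 expr0 mul1r subrr derivC mulr0 scaler0 addr0 => j _; rewrite coef0.
rewrite (_ : _ + _ = (L * P^`() + (b * x) *: P) * (k%:R * P ^+ k.-1 * L ^+ n2)); first exact: lowM.
have Pk : P ^+ k = P * P ^+ k.-1 by rewrite -exprS prednK.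
rewrite -!mul_polyC !polyCM rmorph_nat derivB derivM Pk in dP *.
exact: ode_alg.
Qed.

End Binomial.

Section Choice.
Context {F : numClosedFieldType}.
Implicit Types (p q G : {poly F}).

Definition polyfun (f : F -> F) := exists p : {poly F}, forall x, f x = p.[x].

Lemma polyfun_cst c : polyfun (fun=> c).
Proof. by exists c%:P => x; rewrite hornerC. Qed.

Lemma polyfunM f g : polyfun f -> polyfun g -> polyfun (fun x => f x * g x).
Proof. by move=> [p hp] [q hq]; exists (p * q) => x; rewrite hornerM hp hq. Qed.

Lemma polyfun_sum (I : Type) (r : seq I) (f : I -> F -> F) : (forall i, polyfun (f i)) ->
  polyfun (fun x => \sum_(i <- r) f i x).
Proof.
move=> h; elim: r => [|i r [p hp]]; first by exists 0 => x; rewrite big_nil horner0.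
by have [q hq] := h i; exists (q + p) => x; rewrite big_cons hornerD hp hq.
Qed.

Lemma poly_avoid (ps : seq {poly F}) (s : seq F) : (forall p, p \in ps -> p != 0) ->
  exists x, x \notin s /\ forall p, p \in ps -> p.[x] != 0.
Proof.
move=> h; pose P := \prod_(p <- ps) p * \prod_(a <- s) ('X - a%:P).
have P0 : P != 0.
  apply: mulf_neq0; last exact/monic_neq0/monic_prod_XsubC.
  by rewrite prodf_seq_neq0; apply/allP => p /h.
pose r := [seq (i%:R : F) | i <- iota 0 (size P)].
have [x xr Px] : exists2 x, x \in r & P.[x] != 0.
  apply/hasP; rewrite -[has _ _]negbK -all_predC; apply/negP => /allP al.
  have : (size r < size P)%N.
    apply: max_poly_roots => //; last by rewrite map_inj_uniq ?iota_uniq// => i j /eqP; rewrite eqr_nat => /eqP.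
    by apply/allP => x /al /=; rewrite negbK.
  by rewrite size_map size_iota ltnn.
move: Px; rewrite hornerM mulf_eq0 negb_or => /andP[P1 P2]; exists x; split.
  apply: contra P2 => xs; rewrite -/(root _ x) root_prod_XsubC//.
by move: P1; rewrite horner_prod prodf_seq_neq0 => /allP H p /H.
Qed.

Variable M : nat.
Local Notation binp := (binp M).

Lemma polyfun_binp b j : polyfun (fun x => (binp b x)`_j).
Proof.
have [jM|jM] := leqP j M; last first.
  by exists 0 => x; rewrite horner0 nth_default// (leq_trans (size_poly _ _)).
by exists ((gbin b j * (-1) ^+ j) *: 'X^j) => x; rewrite coef_binp// hornerZ hornerXn (exprNn x) mulrA.
Qed.

Lemma polyfun_coefM (p q : F -> {poly F}) n : (forall j, polyfun (fun x => (p x)`_j)) ->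
  (forall j, polyfun (fun x => (q x)`_j)) -> polyfun (fun x => (p x * q x)`_n).
Proof.
move=> hp hq; have [P hP] := @polyfun_sum _ (index_enum 'I_n.+1)
  (fun i x => (p x)`_i * (q x)`_(n - i)) (fun i => polyfunM (hp i) (hq _)).
by exists P => x; rewrite coefM hP.
Qed.

(* The coefficient of u^n in (1 - x u)^b G, as a polynomial in x. *)
Definition lead_fun b G n : {poly F} := \poly_(j < n.+1) (gbin b j * (-1) ^+ j * G`_(n - j)).

Lemma lead_funE b G n x : (n <= M)%N -> (binp b x * G)`_n = (lead_fun b G n).[x].
Proof.
move=> nM; rewrite horner_poly coefM; apply: eq_bigr => i _.
rewrite coef_binp; last by rewrite (leq_trans _ nM)// -ltnS.
rewrite (exprNn x); ring.
Qed.

(** Its coefficient of degree [n] is, up to sign, the binomial coefficient [gbin b n], which is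
    nonzero unless [b] is a natural number. *)
Lemma lead_fun_neq0 b G n : G`_0 = 1 -> (forall i : nat, b != i%:R) -> lead_fun b G n != 0.
Proof.
move=> G0 hb; apply: contra_neq (gbin_neq0 n hb) => /(congr1 (fun p : {poly F} => p`_n)).
rewrite coef_poly ltnSn subnn G0 mulr1 coef0 => /eqP.
by rewrite mulf_eq0 signr_eq0 orbF => /eqP.
Qed.

(** Regard the coefficient as a polynomial [Q] in the node of index [c]. It is not constant if
    [be c] and the coefficient of index [M - 1] of the other factors are nonzero, and a root of [Q]
    is a new node if [Q] does not vanish at the old ones. The nodes of [a] and [b], whose exponents
    are not natural numbers, are chosen generically to ensure both. *)
Lemma generic_nodes (t : nat) (be : 'I_t -> F) (a b c : 'I_t) : (0 < M)%N ->
  a != b -> a != c -> b != c -> (forall i : nat, be a != i%:R) -> (forall i : nat, be b != i%:R) ->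
  be c != 0 -> exists y : 'I_t -> F, injective y /\ (\prod_i binp (be i) (y i))`_M = 0.
Proof.
move=> M0 ab ac bc ha hb hc.
pose y0 (i : 'I_t) : F := i%:R.
have y0i : injective y0 by move=> i j /eqP; rewrite eqr_nat => /eqP/val_inj.
pose s0 := [seq y0 i | i <- enum 'I_t].
have y0s i : y0 i \in s0 by rewrite map_f// mem_enum.
pose Go := \prod_(i | [&& i != c, i != b & i != a]) binp (be i) (y0 i).
have c0 p q : p`_0 = 1 -> q`_0 = 1 -> (p * q)`_0 = 1 by move=> h1 h2; rewrite coef0M h1 h2 mulr1.
have Go0 : Go`_0 = 1.
  by rewrite /Go; elim/big_rec: _ => [|i p _ h]; [rewrite coef1|apply: c0 => //; exact: binp_at0].
have [ya [yas Ra]] : exists ya, ya \notin s0 /\ (binp (be a) ya * Go)`_M != 0.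
  have [x [xs hx]] := @poly_avoid [:: lead_fun (be a) Go M] s0 (fun p pp => ltac:(by move: pp; rewrite inE => /eqP ->; exact: lead_fun_neq0)).
  by exists x; split => //; rewrite lead_funE//; apply: hx; rewrite inE.
pose Ga := binp (be a) ya * Go; rewrite -/Ga in Ra.
have Ga0 : Ga`_0 = 1 by apply: c0 => //; exact: binp_at0.
(* [D] excludes that the root equals the node of [b]: there both nodes vary together. [D] does not
   vanish at 0, by the choice of [ya]. *)
have [D hD] : polyfun (fun x => (binp (be c) x * (binp (be b) x * Ga))`_M).
  apply: polyfun_coefM => j; first exact: polyfun_binp.
  apply: (@polyfun_coefM _ (fun=> Ga)) => i; first exact: polyfun_binp.
  exact: polyfun_cst.
have D0 : D != 0.
  apply: contra_neq Ra => D0; have := hD 0; rewrite D0 horner0.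
  have b0 e : forall p, (binp e 0 * p)`_M = p`_M.
    move=> p; rewrite coefM big_ord_recl /= binp_at0 mul1r subn0 big1 ?addr0// => i _.
    by rewrite coef_binp 1?ltn_ord// oppr0 expr0n mulr0 mul0r.
  by rewrite !b0.
have [vs vsE] : exists vs, vs = ya :: s0 by exists (ya :: s0).
have [yb [ybs Rb]] : exists x, x \notin vs /\ forall p, p \in
    D :: lead_fun (be b) Ga M.-1 :: [seq lead_fun (be b) (binp (be c) v * Ga) M | v <- vs] -> p.[x] != 0.
  apply: poly_avoid => p; rewrite !inE => /or3P[/eqP ->//|/eqP ->|/mapP[v _ ->]]; apply: lead_fun_neq0 => //.
  by apply: c0 => //; exact: binp_at0.
pose Gb := binp (be b) yb * Ga.
have Q1 : Gb`_M.-1 != 0 by rewrite lead_funE ?leq_pred//; apply: Rb; rewrite !inE eqxx orbT.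
pose Q := lead_fun (be c) Gb M.
(* The linear coefficient of [Q] is minus [be c] times the coefficient of index [M - 1] of [Gb]. *)
have Qs : size Q != 1%N.
  apply/eqP => sQ; have : Q`_1 = 0 by rewrite nth_default// sQ.
  rewrite coef_poly ltnS M0 -[gbin _ 1]mul1r (gbinS (be c) 0) gbin0 subr0 mulr1 subn1 => /eqP.
  by rewrite !mulf_eq0 signr_eq0 (negPf hc) (negPf Q1).
have [yc /rootP Qyc] := closed_rootP Q Qs.
have Qv v : v \in yb :: vs -> Q.[v] != 0.
  rewrite -lead_funE// inE => /orP[/eqP ->|vv].
    by rewrite hD; apply: Rb; rewrite !inE eqxx.
  rewrite mulrCA lead_funE//; apply: Rb; rewrite !inE; apply/or3P/Or33.
  by apply: (map_f (fun v => lead_fun (be b) (binp (be c) v * Ga) M)).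
have yc_ne v : v \in yb :: vs -> v != yc by move=> /Qv; apply: contraNneq => ->; rewrite Qyc.
pose y i := if i == c then yc else if i == b then yb else if i == a then ya else y0 i.
have yrest i : i != c -> i != b -> i != a -> y i = y0 i by rewrite /y => /negPf -> /negPf -> /negPf ->.
have [ya_ yb_ yc_] : [/\ y a = ya, y b = yb & y c = yc].
  by rewrite /y !eqxx (negPf ac) (negPf ab) (negPf bc).
exists y; split; last first.
  rewrite (bigD1 c) //= (bigD1 b) //= (bigD1 a) /=; last by rewrite ac ab.
  rewrite ya_ yb_ yc_ (_ : \prod_(i | _) _ = Go); last first.
    rewrite /Go; apply: eq_big => [i|i /andP[/andP[ic ib] ia]]; first by rewrite andbA.
    by rewrite yrest.
  by rewrite lead_funE.
have in_vs i : i != c -> i != b -> y i \in vs.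
  move=> ic ib; have [->|ia] := eqVneq i a; first by rewrite ya_ vsE mem_head.
  by rewrite yrest// vsE inE y0s orbT.
have in_all i : i != c -> y i \in yb :: vs.
  move=> ic; have [->|ib] := eqVneq i b; first by rewrite yb_ mem_head.
  by rewrite inE in_vs ?orbT.
move=> i j E; apply/eqP/contraT => ij; exfalso; move: E.
wlog [jc hij] : i j ij / j != c /\ (i = c \/ i != c /\ (i = b /\ j != b \/ i != b /\ j != b /\ (i = a /\ j != a \/ i != a /\ j != a))).
  move=> hw; have [jc|jc] := eqVneq j c.
    move/esym; apply: hw; first by rewrite eq_sym.
    by rewrite -jc; split => //; left.
  have [ic|ic] := eqVneq i c; first by apply: hw => //; split => //; left.
  have [jb|jb] := eqVneq j b.
    move/esym; apply: hw; first by rewrite eq_sym.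
    by split => //; right; split => //; left; split => //; rewrite -jb.
  have [ib|ib] := eqVneq i b; first by apply: hw => //; split => //; right; split => //; left.
  have [ja|ja] := eqVneq j a.
    move/esym; apply: hw; first by rewrite eq_sym.
    by split => //; right; split => //; right; do 2!split => //; left; split => //; rewrite -ja.
  by apply: hw => //; split => //; right; split => //; right; do 2!split => //; have [ia|ia] := eqVneq i a; [left|right].
case: hij => [->|[ic [[-> jb]|[ib [jb [[-> ja]|[ia ja]]]]]]].
- by rewrite yc_ => E; have := yc_ne _ (in_all _ jc); rewrite E eqxx.
- by rewrite yb_ => E; have := in_vs _ jc jb; rewrite -E (negPf ybs).
- by rewrite ya_ yrest// => E; have := yas; rewrite E y0s.
- by rewrite !yrest// => /y0i E; rewrite E eqxx in ij.
Qed.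

Lemma binp_size (n : nat) (x : F) : (size (binp n%:R x) <= n.+1)%N.
Proof.
apply/leq_sizeP => j nj; rewrite coef_poly; case: ifP => // _.
by rewrite gbin_nat ?mul0r.
Qed.

Lemma integral_nodes (t : nat) (n : 'I_t -> nat) (y : 'I_t -> F) : (\sum_i n i < M)%N ->
  (\prod_i binp (n i)%:R (y i))`_M = 0.
Proof.
move=> nM; apply: nth_default; apply: leq_trans nM.
suff : (size (\prod_i binp (n i)%:R (y i))%R <= (\sum_i n i).+1)%N by [].
elim/big_rec2: _ => [|i p m _ ih]; first by rewrite size_poly1.
apply: leq_trans (size_polyMleq _ _) _.
by have := binp_size (n i) (y i); lia.
Qed.

End Choice.

(* Nodes for which the only possible obstruction, the coefficient of u^mu when
   mu = a0 / k + 1 is an integer, vanishes. *)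
Lemma choose_nodes (F : numClosedFieldType) (k t : nat) (al : 'I_t -> int) (a0 : int) : (0 < k)%N ->
  (forall i, al i != 0) -> (forall i, - k%:Z < al i) -> a0 = \sum_i al i -> a0 != 0 -> - k%:Z < a0 ->
  (k%:Z %| a0)%Z -> (t = 2%N -> forall i, (k%:Z %| al i)%Z) ->
  forall M : nat, (k * M)%:Z = a0 + k%:Z ->
  exists y : 'I_t -> F, injective y /\ (\prod_i binp M ((al i)%:~R / k%:R) (y i))`_M = 0.
Proof.
move=> k0 al0 alk a0E a00 a0k ka0 h2 M ME.
have kC : (k%:R : F) != 0 by rewrite pnatr_eq0 -lt0n.
have [/forallP alldiv|] := boolP [forall i, (k%:Z %| al i)%Z].
  have hn i : exists n : nat, al i == (k * n)%:Z.
    have /dvdzP[q qE] := alldiv i; have := alk i; rewrite qE => h.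
    exists `|q|%N; rewrite PoszM gez0_abs 1?mulrC//.
    by rewrite leNgt; apply/negP => q0; have : q * k%:Z <= - k%:Z by [rewrite -mulN1r ler_wpM2r//; lia]; lia.
  pose n i := xchoose (hn i); have nE i : al i = (k * n i)%:Z by apply/eqP; exact: (xchooseP (hn i)).
  exists (fun i => i%:R); split; first by move=> i j /eqP; rewrite eqr_nat => /eqP/val_inj.
  rewrite (eq_bigr (fun i : 'I_t => binp M (n i)%:R i%:R)) => [|i _]; last first.
    by rewrite nE -pmulrn natrM mulrAC divff// mul1r.
  apply: integral_nodes; move: ME; rewrite a0E (eq_bigr (fun i => (k * n i)%:Z)) => [|i _]; last exact: nE.
  rewrite -(big_morph Posz PoszD (erefl _)) -big_distrr /= => /eqP; rewrite -PoszD eqz_nat => /eqP E.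
  by rewrite -(ltn_pmul2l k0) E -[ltnLHS]addn0 ltn_add2l.
rewrite negb_forall => /existsP[a ka].
(* As [k] divides the sum, it cannot fail to divide exactly one of the orders. *)
have [b ba kb] : exists2 b, b != a & ~~ (k%:Z %| al b)%Z.
  apply/exists_inP; rewrite -[X in is_true X]negbK negb_exists_in; apply/negP => /forall_inP H.
  case/negP: ka; rewrite (_ : al a = a0 - \sum_(i | i != a) al i); last by rewrite a0E (bigD1 a) //= addrK.
  by rewrite rpredB// rpred_sum// => i ia; rewrite -[_ \in _]negbK; exact: H.
(* With two orders all of them are divisible by hypothesis, so there is a third index. *)
have [c ca cb] : exists2 c, c != a & c != b.
  have t2 : t != 2%N by apply/eqP => /h2/(_ a); rewrite (negPf ka).
  have : (2 < t)%N.
    have : (#|[set a; b]%SET| <= #|'I_t|)%N by exact: max_card.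
    by rewrite cards2 eq_sym ba card_ord; lia.
  move=> t3; have : (0 < #|~: [set a; b]%SET|)%N.
    by have := cardsC [set a; b]%SET; rewrite cards2 eq_sym ba card_ord; lia.
  by case/card_gt0P => c; rewrite !inE negb_or => /andP[]; exists c.
have M0 : (0 < M)%N by case: M ME => // ; rewrite muln0; lia.
have nonint i : ~~ (k%:Z %| al i)%Z -> forall j : nat, (al i)%:~R / k%:R != j%:R :> F.
  move=> ki j; apply: contra ki => /eqP E; apply/dvdzP; exists j%:Z.
  apply: (@intr_inj F); rewrite intrM -!pmulrn -E divfK//.
apply: (@generic_nodes F M t (fun i => (al i)%:~R / k%:R) a b c) => //; try by rewrite eq_sym.
- exact: nonint.
- exact: nonint.
- by rewrite mulf_neq0 ?invr_neq0// intr_eq0.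
Qed.

(** * The model splitting in the plane *)


Lemma exprzMl_eq (F : fieldType) (x y z : F) (a : int) : x * y = z -> x ^ a * y ^ a = z ^ a.
Proof. by move=> <-; rewrite expfzMl. Qed.

Lemma exprzMl_mul (F : fieldType) (z q : F) (a : int) x : (z * q) ^ a * x = z ^ a * (q ^ a * x).
Proof. by rewrite expfzMl mulrA. Qed.

(** [C] stands for [Q (1/z)] and [c] for the derivative of [z Q (1/z)]. The equation is proved after
    multiplication by a power of [C], which keeps the exponents integral. *)
Lemma dev_alg (F : fieldType) (C c A B g : F) (k N : nat) (a0 : int) : (0 < k)%N -> (0 < N)%N ->
  C != 0 -> A != 0 -> C ^+ N = A ^+ k -> C ^+ N.-1 * c = A ^+ k.-1 * B -> B ^+ k = g ->
  N%:Z = a0 + k%:Z -> C ^ a0 * c ^+ k = g.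
Proof.
move=> k0 N0 C0 A0 CA Cc Bg NE.
have h1 : C ^+ (N.-1 * k) * c ^+ k = C ^+ (N * k.-1) * g.
  by rewrite !exprM -exprMn Cc exprMn CA Bg -!exprM mulnC.
apply: (mulfI (expf_neq0 (N * k.-1) C0)); rewrite -h1 mulrA; congr (_ * _).
rewrite -[C ^+ (N * _)]/(C ^ (N * k.-1)%:Z) -[RHS]/(C ^ (N.-1 * k)%:Z) -expfzDr//; congr (_ ^ _).
have -> : a0 = N%:Z - k%:Z by rewrite NE addrK.
case: k N k0 N0 {CA Cc NE h1 Bg} => [|k] [|N] //= _ _; rewrite !PoszM; lia.
Qed.

Lemma dev_deriv (F : numFieldType) (C dC A dA B u : F) (k N : nat) : (0 < k)%N -> (0 < N)%N ->
  C ^+ N = A ^+ k -> N%:R * C ^+ N.-1 * dC = k%:R * A ^+ k.-1 * dA ->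
  A + - (k%:R / N%:R) * u * dA = B -> C ^+ N.-1 * (C - u * dC) = A ^+ k.-1 * B.
Proof.
move=> k0 N0 CA CdA <-.
have N0C : (N%:R : F) != 0 by rewrite pnatr_eq0 -lt0n.
apply: (mulfI N0C).
transitivity (N%:R * C ^+ N - u * (N%:R * C ^+ N.-1 * dC)).
  have -> : C ^+ N = C * C ^+ N.-1 by rewrite -exprS prednK.
  ring.
rewrite CdA CA; have -> : A ^+ k = A * A ^+ k.-1 by rewrite -exprS prednK.
by field.
Qed.

Section Dev.
Context {R : realType}.
Local Notation C := (Cplx R).

Lemma hol_horner (p : {poly C}) z : hol (fun u => p.[u]) z.
Proof.
elim/poly_ind: p => [|p c ih].
  by apply: hol_eq (hol_cst 0 z); apply: nearCT => w; rewrite horner0.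
have h := holD (holM ih (hol_id z)) (hol_cst c z).
by apply: hol_eq h; apply: nearCT => w; rewrite hornerMXaddC.
Qed.

Lemma hol_prod (I : finType) (f : I -> C -> C) z : (forall i, hol (f i) z) -> hol (fun u => \prod_i f i u) z.
Proof.
move=> h; have H (r : seq I) : hol (fun u => \prod_(i <- r) f i u) z.
  elim: r => [|i r ih]; first by apply: hol_eq (hol_cst 1 z); apply: nearCT => w; rewrite big_nil.
  by apply: hol_eq (holM (h i) ih); apply: nearCT => w; rewrite big_cons.
exact: H.
Qed.

Lemma hol_sum (I : finType) (f : I -> C -> C) z : (forall i, hol (f i) z) -> hol (fun u => \sum_i f i u) z.
Proof.
move=> h; have H (r : seq I) : hol (fun u => \sum_(i <- r) f i u) z.
  elim: r => [|i r ih]; first by apply: hol_eq (hol_cst 0 z); apply: nearCT => w; rewrite big_nil.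
  by apply: hol_eq (holD (h i) ih); apply: nearCT => w; rewrite big_cons.
exact: H.
Qed.

Lemma nearC_all (I : finType) z (P : I -> C -> Prop) : (forall i, nearC z (P i)) -> nearC z (fun w => forall i, P i w).
Proof.
move=> h; have H (r : seq I) : nearC z (fun w => forall i, i \in r -> P i w).
  elim: r => [|i r ih]; first exact: nearCT.
  apply: nearCW (nearCI (h i) ih) => w [h1 h2] j; rewrite inE => /orP[/eqP ->//|]; exact: h2.
by apply: nearCW (H (enum I)) => w hw i; apply: hw; rewrite mem_enum.
Qed.

Lemma hol_bound (f : C -> C) z : hol f z -> exists K : R, 0 <= K /\ nearC z (fun w => md (f w) <= K).
Proof.
move=> /hol_cder[c /cder_nearC h]; exists (md (f z) + 1); split; first by rewrite addr_ge0 ?md_ge0.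
apply: nearCW (h 1 ltr01) => w hw; have := mdD (f w - f z) (f z); rewrite subrK; lra.
Qed.

Lemma poly_small (n : nat) (p : {poly C}) (K : R) : 0 <= K ->
  nearC 0 (fun u => u != 0 -> md p.[u] <= K * md u ^+ n) -> low n p.
Proof.
move=> K0; elim: n p => [|n IH] p [e e0 he] // .
have p0 : p`_0 = 0.
  apply: md_small_eq0 => d d0; rewrite -horner_coef0.
  have d20 : 0 < d / 2 by rewrite divr_gt0.
  have [e1 e10 h1] := cder_nearC (dCP (hol_cder (hol_horner p 0))) d20.
  pose r := Num.min (Num.min e e1) (Num.min 1 (d / (2 * (K + 1)))) / 2.
  have K1 : 0 < K + 1 by lra.
  have m0 : 0 < Num.min (Num.min e e1) (Num.min 1 (d / (2 * (K + 1)))).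
    by rewrite !lt_min e0 e10 ltr01 divr_gt0// mulr_gt0.
  have r0 : 0 < r by rewrite divr_gt0.
  have : r < Num.min (Num.min e e1) (Num.min 1 (d / (2 * (K + 1)))) by rewrite /r; move: m0; move: (Num.min _ _) => m; lra.
  rewrite !lt_min => /andP[/andP[re re1] /andP[r1 rd]].
  have mr : md (r%:C%C : C) = r by rewrite md_real gtr0_norm.
  have rn0 : (r%:C%C : C) != 0 by rewrite -md_gt0 mr.
  have A1 := he r%:C%C; rewrite subr0 mr in A1; have {}A1 := A1 re rn0.
  have A2 := h1 r%:C%C; rewrite subr0 mr in A2; have {}A2 := A2 re1.
  have A3 : K * r ^+ n.+1 <= d / 2.
    have : r ^+ n.+1 <= r by rewrite -[leRHS]expr1 ler_wiXn2l// ltW.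
    move: rd; rewrite ltr_pdivlMr ?mulr_gt0//; move: K0 r0; move: (r ^+ _) => q; nra.
  have := mdD (p.[0] - p.[r%:C%C]) p.[r%:C%C]; rewrite subrK mdB; lra.
have [q pq] : exists q, p = q * 'X.
  exists (drop_poly 1 p); rewrite -{1}(poly_take_drop 1 p) expr1 -[RHS]add0r; congr (_ + _).
  by apply/polyP => j; rewrite coef_take_poly coef0; case: j => [|j] //=; rewrite p0.
have lq : low n q.
  apply: IH; exists e => // u ue u0; have mu0 : 0 < md u by rewrite md_gt0.
  have := he u ue u0; rewrite pq hornerMX mdM exprSr mulrA ler_pM2r//.
by move=> [|j] jn; rewrite pq coefMX//=; exact: lq.
Qed.

Lemma low_horner n (p : {poly C}) : low n p -> exists q : {poly C}, forall u, p.[u] = u ^+ n * q.[u].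
Proof.
move=> h; exists (drop_poly n p) => u; rewrite -{1}(poly_take_drop n p) hornerD hornerM hornerXn.
rewrite (_ : take_poly n p = 0) ?horner0 ?add0r 1?mulrC//.
by apply/polyP => j; rewrite coef_take_poly coef0; case: ifP => // /h.
Qed.

Lemma psum_horner b n (u : C) : psum b n u = (\poly_(j < n) b j).[u].
Proof. by rewrite horner_poly. Qed.

(* A holomorphic k-th root has the expected Taylor coefficients. *)
Lemma root_coef (k M : nat) (B : C -> C) (P L1 L2 : {poly C}) b (Mb rho : R) : (0 < k)%N -> 0 < rho -> 0 <= Mb ->
  expands B b Mb rho -> hol B 0 -> B 0 = 1 -> P.[0] = 1 -> L2.[0] = 1 ->
  nearC 0 (fun u => B u ^+ k * L2.[u] = L1.[u]) -> low M.+1 (P ^+ k * L2 - L1) -> b M = P`_M.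
Proof.
move=> k0 rho0 Mb0 hb hB B0 P0 L20 BL /low_horner[q hq].
(* [(B - P) E = (B^k - P^k) L2] and [E 0 = k], so [B - P] vanishes at 0 to the same order as the
   difference of the k-th powers. *)
pose E u := (\sum_(i < k) B u ^+ (k.-1 - i) * P.[u] ^+ i) * L2.[u].
have hE : hol E 0.
  apply: holM; last exact: hol_horner.
  apply: hol_sum => i; apply: holM; apply: holX => //; exact: hol_horner.
have E0 : E 0 = k%:R.
  rewrite /E L20 mulr1 (eq_bigr (fun=> 1)) => [|i _]; first by rewrite sumr_const card_ord.
  by rewrite B0 P0 !expr1n mulr1.
have EE : nearC 0 (fun u => (B u - P.[u]) * E u = - (u ^+ M.+1 * q.[u])).
  apply: nearCW BL => u hu; rewrite /E mulrA -[X in X * _]/(_ * _) -hq hornerD hornerM horner_exp hornerN -hu.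
  have -> : (B u - P.[u]) * (\sum_(i < k) B u ^+ (k.-1 - i) * P.[u] ^+ i) = B u ^+ k - P.[u] ^+ k.
    by apply/esym; exact: subrXX.
  ring.
have [Kq [Kq0 hKq]] := hol_bound (hol_horner q 0).
have [c hc] := hol_cder hE; have half0 : (0 : R) < 1 / 2 by rewrite divr_gt0.
have nE := cder_nearC hc half0.
have nB : nearC 0 (fun u => md u < rho) by exists rho => // u; rewrite subr0.
suff lw : low M.+1 (\poly_(j < M.+1) b j - P).
  by have := lw M (ltnSn M); rewrite coefB coef_poly ltnSn => /eqP; rewrite subr_eq0 => /eqP.
pose K := 2 * Kq + Mb / rho ^+ M.+1.
have K0 : 0 <= K by apply: addr_ge0; [exact: mulr_ge0|apply: divr_ge0 => //; exact/exprn_ge0/ltW].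
apply: (poly_small K0); apply: nearCW (nearCI (nearCI EE hKq) (nearCI nE nB)) => u [[h1 h2] [h3 h4]] _.
rewrite hornerD hornerN -psum_horner.
have A1 := hb u h4 M.+1.
have A2 : 1 / 2 <= md (E u).
  have := md_sub (E 0) (E u); rewrite mdB E0 md_nat; rewrite E0 in h3.
  have : (1 : R) <= k%:R by rewrite ler1n.
  lra.
have A3 : md (B u - P.[u]) * md (E u) = md u ^+ M.+1 * md q.[u] by rewrite -mdM h1 mdN mdM mdX.
have u0 : 0 <= md u ^+ M.+1 by rewrite exprn_ge0 ?md_ge0.
have A4 : md (B u - P.[u]) <= 2 * Kq * md u ^+ M.+1.
  have X0 := md_ge0 (B u - P.[u]); have := ler_wpM2l u0 h2; move: A3 A2 X0 u0.
  move: (md _) (md (E u)) (md u ^+ _) (md q.[u]) => x e v qq; nra.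
rewrite (_ : psum b M.+1 u - P.[u] = (B u - P.[u]) - (B u - psum b M.+1 u)); last by ring.
apply: le_trans (md_subD _ _) _; rewrite /K mulrDl; apply: lerD => //.
by apply: le_trans A1 _; rewrite expr_div_n mulrA mulrAC.
Qed.

Lemma lin_at (x u : C) : (lin x).[u] = 1 - x * u.
Proof. by rewrite /lin !hornerE. Qed.

Lemma split_exp (x : C) (a : int) (n1 n2 : nat) : x != 0 -> a = n1%:Z - n2%:Z -> x ^ a * x ^+ n2 = x ^+ n1.
Proof.
move=> x0 ->; rewrite -[x ^+ n2]/(x ^ n2%:Z) -[RHS]/(x ^ n1%:Z) -expfzDr//.
by rewrite subrK.
Qed.

Lemma hol_root1 (A : C -> C) n : (0 < n)%N -> hol A 0 -> A 0 = 1 ->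
  exists B, [/\ hol B 0, B 0 = 1 & nearC 0 (fun z => B z ^+ n = A z)].
Proof.
move=> n0 hA A0; have An0 : A 0 != 0 by rewrite A0 oner_neq0.
have [B [hB B0 E]] := hol_root n0 hA An0.
exists (fun z => B z / B 0); split; [by apply: holM => //; exact: hol_cst|by rewrite divff|].
have E0 := nearC_self E.
by apply: nearCW E => z Ez; rewrite expr_div_n Ez E0 A0 divr1.
Qed.

(** With [u = 1/z] a k-th root of the product is [z^(a0/k) B(u)]; its primitive is a multiple of
    [z^(N/k) A(u)] with [A - (k/N) u A' = B], and the gluing map is [z Q(u)] with [Q ^+ N = A ^+ k].
    The logarithm sits at the index [n] with [k n = N], where the factor [1 - (k/N) n] is 0. *)
Lemma dev_map (k t N : nat) (al : 'I_t -> int) (a0 : int) (y : 'I_t -> C) : (0 < k)%N -> (0 < N)%N ->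
  N%:Z = a0 + k%:Z -> a0 = \sum_i al i ->
  (forall M : nat, (k * M)%:Z = a0 + k%:Z -> (\prod_i binp M ((al i)%:~R / k%:R) (y i))`_M = 0) ->
  exists Q : C -> C, [/\ hol Q 0, Q 0 = 1 & exists2 m : R, 0 < m & forall z, m <= md z ->
     hol (fun z => z * Q z^-1) z /\ z * Q z^-1 != 0 /\
     (z * Q z^-1) ^ a0 * dC (fun z => z * Q z^-1) z ^+ k = \prod_i (z - y i) ^ al i].
Proof.
move=> k0 N0 NE a0E hM.
pose n1 i : nat := if 0 <= al i then `|al i|%N else 0%N.
pose n2 i : nat := if 0 <= al i then 0%N else `|al i|%N.
have alE i : al i = (n1 i)%:Z - (n2 i)%:Z by rewrite /n1 /n2; case: ifP => h; lia.
pose g u := \prod_i (1 - y i * u) ^ al i.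
have lin0 i : 1 - y i * 0 != 0 by rewrite mulr0 subr0 oner_neq0.
have hlin i : hol (fun u => 1 - y i * u) 0.
  by apply: holB; [exact: hol_cst|apply: holM; [exact: hol_cst|exact: hol_id]].
have hg : hol g 0 by apply: hol_prod => i; exact: holXz.
have g0 : g 0 = 1 by rewrite /g big1// => i _; rewrite mulr0 subr0 exp1rz.
have nlin : nearC 0 (fun u => forall i, 1 - y i * u != 0).
  by apply: nearC_all => i; exact: hol_neq0.
have [B [hB B0 EB]] := hol_root1 k0 hg g0.
have [b [Mb [rho [rho0 Mb0 hb]]]] := hol_expands0 hB.
have b0 : b 0%N = 1.
  have := hb 0; rewrite md0 => /(_ rho0 1%N); rewrite mul0r expr1 mulr0 B0 /psum big_ord1 expr0 mulr1 => h.
  apply/eqP; rewrite eq_sym -subr_eq0 -md_eq0 eq_le md_ge0 andbT; exact: h.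
(* By [root_coef], this is the Taylor coefficient of [B] that the nodes were chosen to
   annihilate. *)
have bM M : (k * M = N)%N -> b M = 0.
  move=> kM; rewrite -(hM M); last by rewrite kM.
  pose L1 : {poly C} := \prod_i lin (y i) ^+ n1 i; pose L2 : {poly C} := \prod_i lin (y i) ^+ n2 i.
  apply: (root_coef (k := k) (L1 := L1) (L2 := L2) k0 rho0 Mb0 hb hB B0).
  - by rewrite horner_prod big1// => i _; rewrite horner_coef0 binp_at0.
  - by rewrite horner_prod big1// => i _; rewrite horner_exp lin_at mulr0 subr0 expr1n.
  - apply: nearCW (nearCI EB nlin) => u [-> hu]; rewrite /g !horner_prod -big_split; apply: eq_bigr => i _.
    by rewrite !horner_exp !lin_at; apply: split_exp.
  - have -> : (\prod_i binp M ((al i)%:~R / k%:R) (y i)) ^+ k * L2 =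
        \prod_i (binp M ((al i)%:~R / k%:R) (y i) ^+ k * lin (y i) ^+ n2 i).
      by rewrite big_split /= prodrXl.
    apply: low_prod => i; apply: binp_pow.
    rewrite mulrC divfK ?pnatr_eq0 -?lt0n// alE rmorphB /=; exact: erefl.
have NC : (N%:R : C) != 0 by rewrite pnatr_eq0 -lt0n.
pose lam : C := - (k%:R / N%:R).
(* At the resonance any value solves the equation; 0 also satisfies the bound [hD]. *)
pose a n : C := if (k * n == N)%N then 0 else b n / (1 + lam * n%:R).
have lamE n : 1 + lam * n%:R = (N%:R - (k * n)%:R) / N%:R by rewrite /lam natrM; field.
(* The numerator [N - k n] is a nonzero integer, so the factor is at least [1 / N] in modulus. *)
have den n : (k * n == N)%N = false -> 1 + lam * n%:R != 0 /\ md (1 + lam * n%:R)^-1 <= N%:R.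
  move=> kn; have d1 : 1 <= md (N%:R - (k * n)%:R : C).
    have [h|h] := leqP (k * n) N.
      by rewrite -natrB// md_nat ler1n subn_gt0 ltn_neqAle kn.
    by rewrite mdB -natrB 1?ltnW// md_nat ler1n subn_gt0.
  have d0 : (N%:R - (k * n)%:R : C) != 0 by rewrite -md_gt0; lra.
  rewrite lamE; split; first by rewrite mulf_neq0 ?invr_neq0.
  rewrite invf_div mdM md_nat mdV ler_piMr ?ler0n// invf_le1 ?(lt_le_trans ltr01)//.
have hab n : (1 + lam * n%:R) * a n = b n.
  rewrite /a; case: ifP => kn; first by rewrite mulr0 bM//; exact/eqP.
  by rewrite mulrC divfK//; exact: (den n kn).1.
have hD n : md (a n) <= N%:R * md (b n).
  rewrite /a; case: ifP => kn; first by rewrite md0 mulr_ge0 ?ler0n ?md_ge0.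
  by rewrite mdM mulrC ler_wpM2r ?md_ge0//; exact: (den n kn).2.
have [A [A' [r [r_0 A0 hA hAB]]]] := expands_ode rho0 (ler0n R N) hb hab hD.
have a0E1 : a 0%N = 1.
  by rewrite /a muln0 eq_sym -[_ == _]negbK -lt0n N0 /= mulr0 addr0 b0 divr1.
have holA : hol A 0 by exists r => // w; rewrite subr0 => /hA h; exists (A' w).
have holAk : hol (fun u => A u ^+ k) 0 by exact: holX.
have Ak0 : A 0 ^+ k = 1 by rewrite A0 a0E1 expr1n.
have [Q [hQ Q0 EQ]] := hol_root1 N0 holAk Ak0.
have An0 : A 0 != 0 by rewrite A0 a0E1 oner_neq0.
have Qn0 : Q 0 != 0 by rewrite Q0 oner_neq0.
have nr : nearC 0 (fun u : C => md u < r) by exists r => // u; rewrite subr0.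
have [e e0 he] := nearCI (nearCI (nearCI EB nlin) (nearCI (nearC_nearC EQ) nr))
  (nearCI (nearCI (hol_neq0 holA An0) (hol_neq0 hQ Qn0)) (hol_near hQ)).
exists Q; split => //; exists (2 / e); first by rewrite divr_gt0.
move=> z hz.
have e20 : 0 < 2 / e by rewrite divr_gt0.
have mz0 : 0 < md z by exact: lt_le_trans hz.
have z0 : z != 0 by rewrite -md_gt0.
have ue : md (z^-1 - 0) < e.
  rewrite subr0 mdV; apply: le_lt_trans (_ : (2 / e)^-1 < _); first by rewrite lef_pV2// posrE.
  by rewrite invf_div; move: e0; lra.
have [[[EBu nu] [EQu ur]] [[Au Qu] hQu]] := he _ ue.
have hw : hol (fun z => z * Q z^-1) z.
  apply: holM; first exact: hol_id.
  by apply: (hol_comp (f := fun z => z^-1)) => //; apply: holV => //; exact: hol_id.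
have dw : dC (fun z => z * Q z^-1) z = Q z^-1 - z^-1 * dC Q z^-1.
  apply: cder_dC; have hcQ := dCP (hol_cder hQu).
  have := cderM (cder_id z) (cder_comp (f := fun z => z^-1) (cder_inv z0) hcQ).
  by move=> h; apply: cder_eqd h _; rewrite /=; move: (Q _) (dC Q _) => q d; field.
split => //; split; first by rewrite mulf_neq0.
have NkE : N%:R * Q z^-1 ^+ N.-1 * dC Q z^-1 = k%:R * A z^-1 ^+ k.-1 * A' z^-1.
  have e1 : dC (fun u => Q u ^+ N) z^-1 = N%:R * Q z^-1 ^+ N.-1 * dC Q z^-1.
    by apply: cder_dC; apply: cderX; exact: dCP (hol_cder hQu).
  have e2 : dC (fun u => A u ^+ k) z^-1 = k%:R * A z^-1 ^+ k.-1 * A' z^-1.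
    by apply: cder_dC; apply: cderX; exact: hA.
  by rewrite -e1 -e2; apply: dC_eq EQu _; exact: hol_cder (holX N hQu).
have ode := hAB _ ur.
have dd := dev_deriv k0 N0 (nearC_self EQu) NkE ode.
have key := dev_alg k0 N0 Qu Au (nearC_self EQu) dd EBu NE.
rewrite dw; apply: etrans (exprzMl_mul z (Q z^-1) a0 _) _; rewrite key /g a0E.
have -> : z ^ (\sum_i al i) = \prod_i z ^ al i.
  by elim/big_rec2: _ => [|i p q _ ih]; [rewrite expr0z|rewrite expfzDr// ih].
rewrite -big_split; apply: eq_bigr => i _ /=.
by apply: exprzMl_eq; rewrite mulrBr mulr1 mulrCA divff// mulr1.
Qed.

End Dev.

Lemma clamp_lip (R : realDomainType) (x y : R) :
  `|Num.min 1 (Num.max 0 x) - Num.min 1 (Num.max 0 y)| <= `|x - y|.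
Proof.
by rewrite !(minC 1) (le_trans (minr_lip 1 (Num.max 0 x) (Num.max 0 y)) (maxr_lip 0 x y)).
Qed.

(** * The gluing map as a homeomorphism of the plane *)

Section Psi.
Context {R : realType}.
Local Notation C := (Cplx R).

Lemma hol_div0 (f : C -> C) : hol f 0 -> f 0 = 0 -> exists g, hol g 0 /\ nearC 0 (fun u => f u = u * g u).
Proof.
move=> hf f0; have [z|[[|n] [g [hg g0 E]]]] := hol_order hf.
- by exists (fun=> 0); split; [exact: hol_cst|apply: nearCW z => u ->; rewrite mulr0].
- by have := nearC_self E; rewrite f0 expr0 mul1r => /esym/eqP; rewrite (negPf g0).
- exists (fun u => u ^+ n * g u); split; first by apply: holM => //; apply: holX; exact: hol_id.
  by apply: nearCW E => u ->; rewrite subr0 exprS mulrA.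
Qed.

Lemma hol_lip (f : C -> C) : hol f 0 -> exists (L e : R), [/\ 0 <= L, 0 < e &
  forall z w, md z < e -> md w < e -> md (f z - f w) <= L * md (z - w)].
Proof.
move=> /hol_taylor[g [rho [K [rho0 K0 hg ht]]]]; have [G [G0 [e e0 he]]] := hol_bound hg.
exists (G + K * (2 * rho)), (Num.min e rho); split; [by rewrite addr_ge0// !mulr_ge0// ltW|by rewrite lt_min e0|].
move=> z w; rewrite !lt_min => /andP[z1 z2] /andP[w1 w2].
have A1 := ht w z w2 z2; have A2 := he w; rewrite subr0 in A2; have {}A2 := A2 w1.
have A3 := mdD (f z - f w - g w * (z - w)) (g w * (z - w)); rewrite subrK mdM in A3.
have A4 := md_subD z w; have A5 := md_ge0 (z - w).
have A6 : md (g w) * md (z - w) <= G * md (z - w) by exact: ler_wpM2r.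
have A7 : K * md (z - w) ^+ 2 <= K * (2 * rho) * md (z - w).
  by rewrite expr2 mulrA ler_wpM2r// ler_wpM2l//; lra.
by rewrite mulrDl; lra.
Qed.

Lemma damped_lip (K : C -> C) (M Kb L : R) : 1 <= M -> 0 <= Kb -> 0 <= L -> 4 * Kb <= M -> 4 * L <= M ->
  (forall z, M <= md z -> md (K z^-1) <= Kb) ->
  (forall z w, M <= md z -> M <= md w -> md (K z^-1 - K w^-1) <= L * md (z^-1 - w^-1)) ->
  let ch (z : C) : C := (Num.min 1 (Num.max 0 (md z / M - 1)))%:C%C in
  forall z w, md (ch z * K z^-1 - ch w * K w^-1) <= 1 / 2 * md (z - w).
Proof.
move=> M1 Kb0 L0 KM LM hK hL ch z w.
wlog zw : z w / md w <= md z.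
  move=> h; case/orP: (le_total (md w) (md z)) => [|zw]; first exact: h.
  by rewrite (mdB (ch z * K z^-1)) (mdB z w); exact: h.
have M0 : 0 < M by lra.
have chE0 x : md x <= M -> ch x = 0.
  move=> xM; rewrite /ch max_l; first by rewrite min_r ?ler01.
  by rewrite subr_le0 ler_pdivrMr// mul1r.
have chl x y : md (ch x - ch y) <= md (x - y) / M.
  rewrite /ch -rmorphB /= md_real; apply: le_trans (clamp_lip _ _) _.
  rewrite opprB addrA subrK -mulrBl normrM (gtr0_norm (_ : 0 < M^-1)) ?invr_gt0//.
  rewrite ler_pM2r ?invr_gt0// ler_norml.
  by have := md_sub x y; have := md_sub y x; rewrite (mdB y x); lra.
have m0 := md_ge0 (z - w).
have KbM : Kb / M <= 1 / 4 by rewrite ler_pdivrMr//; lra.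
have [zM|zM] := leP (md z) M.
  by rewrite !chE0 ?mul0r ?subrr ?md0 ?mulr_ge0//; lra.
have [wM|wM] := leP (md w) M.
  have -> : ch z * K z^-1 - ch w * K w^-1 = (ch z - ch w) * K z^-1 by rewrite (chE0 w wM); ring.
  rewrite mdM; have h1 := chl z w; have h2 := hK z (ltW zM).
  have : md (ch z - ch w) * md (K z^-1) <= md (z - w) / M * Kb by apply: ler_pM; rewrite ?md_ge0.
  have -> : md (z - w) / M * Kb = md (z - w) * (Kb / M) by ring.
  move: m0 KbM; move: (Kb / M) (md (z - w)) (md _ * _) => x y q *; nra.
have -> : ch z * K z^-1 - ch w * K w^-1 = (ch z - ch w) * K z^-1 + ch w * (K z^-1 - K w^-1) by ring.
apply: le_trans (mdD _ _) _; rewrite !mdM.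
have c1 : md (ch w) <= 1.
  by rewrite /ch md_real ger0_norm ?ge_min ?lexx// le_min ler01 le_max lexx.
have h3 : md (ch z - ch w) * md (K z^-1) <= md (z - w) / M * Kb.
  by apply: ler_pM; rewrite ?md_ge0//; exact: hK (ltW zM).
have h4 : md (ch w) * md (K z^-1 - K w^-1) <= L * md (z^-1 - w^-1).
  rewrite -[leRHS]mul1r; apply: ler_pM; rewrite ?md_ge0//; exact: hL (ltW zM) (ltW wM).
have h5 : md (z^-1 - w^-1) <= md (z - w) / M.
  have z0 : z != 0 by rewrite -md_gt0; lra.
  have w0 : w != 0 by rewrite -md_gt0; lra.
  have -> : z^-1 - w^-1 = (w - z) / (z * w) by field; rewrite w0 z0.
  rewrite !mdM mdV mdM mdB; apply: ler_wpM2l => //.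
  have zw0 : 0 < md z * md w by rewrite mulr_gt0 ?md_gt0.
  rewrite lef_pV2 ?posrE//; move: zM wM M1; move: (md z) (md w) => a b; nra.
have h6 : L * md (z^-1 - w^-1) <= 1 / 4 * md (z - w).
  have : L / M <= 1 / 4 by rewrite ler_pdivrMr//; lra.
  have : L * md (z^-1 - w^-1) <= md (z - w) * (L / M).
    by rewrite [leRHS]mulrCA; exact: ler_wpM2l.
  move: m0; move: (L / M) (md (z - w)) (L * _) => x y q *; nra.
have h7 : md (z - w) / M * Kb <= 1 / 4 * md (z - w).
  have -> : md (z - w) / M * Kb = md (z - w) * (Kb / M) by ring.
  by rewrite mulrC ler_wpM2r.
lra.
Qed.

(** The term [K (1/z)] in [z Q (1/z) = z + K (1/z)] is switched off between the radii [2 M] and [M].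
    What results is the identity plus a 1/2-Lipschitz map, hence a homeomorphism of the plane by
    [half_lip_bij]. *)
Lemma psi_exists (Q : C -> C) (m : R) : hol Q 0 -> Q 0 = 1 -> exists (M : R) (psi : C -> C),
  [/\ m <= M, 1 <= M, forall z, md z <= M -> psi z = z,
   forall z, 2 * M <= md z -> psi z = z * Q z^-1 &
   forall z w, md (psi z - psi w - (z - w)) <= 1 / 2 * md (z - w)].
Proof.
move=> hQ Q0; have [K [hK [e1 e10 E]]] : exists g, hol g 0 /\ nearC 0 (fun u => Q u - 1 = u * g u).
  by apply: hol_div0; [apply: holB => //; exact: hol_cst|rewrite Q0 subrr].
have [L [e2 [L0 e20 hL]]] := hol_lip hK.
have [Kb [Kb0 [e3 e30 hKb]]] := hol_bound hK.
(* At least as large as every bound needed; [m ^+ 2 + 1] replaces [m], whose sign is unknown. *)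
pose M := m ^+ 2 + 1 + 4 * Kb + 4 * L + 2 / e1 + 2 / e2 + 2 / e3.
have q0 : 0 <= m ^+ 2 by exact: sqr_ge0.
have mq : m <= m ^+ 2 + 1 by nra.
have [f1 f2 f3] : [/\ 0 < 2 / e1, 0 < 2 / e2 & 0 < 2 / e3] by split; rewrite divr_gt0.
have M1 : 1 <= M by rewrite /M; lra.
have inv_lt (e : R) z : 0 < e -> 2 / e <= M -> M <= md z -> md z^-1 < e.
  move=> e0 eM Mz; rewrite mdV; have M0 : 0 < 2 / e by rewrite divr_gt0.
  apply: le_lt_trans (_ : (2 / e)^-1 < _); first by rewrite lef_pV2 ?posrE//; lra.
  by rewrite invf_div; lra.
have [g1 g2 g3] : [/\ 2 / e1 <= M, 2 / e2 <= M & 2 / e3 <= M] by rewrite /M; split; lra.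
pose ch (z : C) : C := (Num.min 1 (Num.max 0 (md z / M - 1)))%:C%C.
have lip : forall z w, md (ch z * K z^-1 - ch w * K w^-1) <= 1 / 2 * md (z - w).
  apply: (@damped_lip K M Kb L) => //.
  - by rewrite /M; lra.
  - by rewrite /M; lra.
  - by move=> z zM; apply: hKb; rewrite subr0; exact: inv_lt.
  - by move=> z w zM wM; apply: hL; exact: inv_lt.
have M0 : 0 < M by lra.
exists M, (fun z => z + ch z * K z^-1); split => //.
- by rewrite /M; lra.
- move=> z zM; rewrite /ch max_l; first by rewrite min_r ?ler01// mul0r addr0.
  by rewrite subr_le0 ler_pdivrMr// mul1r.
- move=> z zM; have z0 : z != 0 by rewrite -md_gt0; lra.
  have -> : ch z = 1.
    rewrite /ch min_l//; rewrite le_max; apply/orP; right.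
    by rewrite lerBrDr ler_pdivlMr//; lra.
  have h : Q z^-1 - 1 = z^-1 * K z^-1 by apply: E; rewrite subr0; apply: inv_lt => //; lra.
  rewrite (_ : Q z^-1 = 1 + z^-1 * K z^-1); last by rewrite -h addrC subrK.
  by rewrite mul1r mulrDr mulr1 mulrA divff// mul1r.
- move=> z w; rewrite (_ : _ - _ - _ = ch z * K z^-1 - ch w * K w^-1); last by ring.
  exact: lip.
Qed.

Lemma half_lip_bij (psi : C -> C) : psi 0 = 0 ->
  (forall z w, md (psi z - psi w - (z - w)) <= 1 / 2 * md (z - w)) ->
  exists phi : C -> C, [/\ cancel psi phi, cancel phi psi, forall z, cat setT psi z & forall z, cat setT phi z].
Proof.
move=> p0 lip.
have low_ z w : 1 / 2 * md (z - w) <= md (psi z - psi w).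
  have := md_subr (z - w) (psi z - psi w - (z - w)); rewrite [z - w + _]addrC subrK.
  by have := lip z w; lra.
have sur v : exists z, psi z = v.
  have r0 : 0 < 4 * (md v + 1) by rewrite mulr_gt0// ltr_wpDl ?md_ge0.
  have [|z _ zv] := @near_identity_surj R psi _ v r0 (fun z w _ _ => lip z w); last by exists z.
  by rewrite p0 subr0; lra.
have /choice[phi hphi] := sur.
have inj z w : psi z = psi w -> z = w.
  move=> E; have := low_ z w; rewrite E subrr md0 => h; apply/eqP; rewrite -subr_eq0 -md_eq0 eq_le md_ge0 andbT; lra.
exists phi; split.
- by move=> z; apply: inj; rewrite hphi.
- exact: hphi.
- move=> z e e0; exists (e / 2); first by rewrite divr_gt0.
  move=> w _ wz; have := mdD (psi w - psi z - (w - z)) (w - z); rewrite subrK.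
  by have := lip w z; lra.
- move=> v e e0; exists (e / 2); first by rewrite divr_gt0.
  by move=> w _ wv; have := low_ (phi w) (phi v); rewrite !hphi; lra.
Qed.

(** The equation is homogeneous, because [a0] is the sum of the orders: it persists when [z], the
    nodes and the map are scaled by the same [l]. A small [l] brings the modification into the disc
    of radius [r0]. *)
Lemma model_map (k t N : nat) (al : 'I_t -> int) (a0 : int) (y : 'I_t -> C) (r0 : R) : (0 < k)%N -> (0 < N)%N ->
  N%:Z = a0 + k%:Z -> a0 = \sum_i al i -> injective y -> 0 < r0 ->
  (forall M : nat, (k * M)%:Z = a0 + k%:Z -> (\prod_i binp M ((al i)%:~R / k%:R) (y i))`_M = 0) ->
  exists (yl : 'I_t -> C) (psi phi : C -> C),
  [/\ injective yl, [/\ cancel psi phi, cancel phi psi, forall z, cat setT psi z & forall z, cat setT phi z],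
     psi 0 = 0, forall i, md (psi (yl i)) < r0 &
     forall z, r0 <= md (psi z) -> [/\ hol psi z, dC psi z != 0 &
        psi z ^ a0 * dC psi z ^+ k = \prod_i (z - yl i) ^ al i]].
Proof.
move=> k0 N0 NE a0E iy r00 hM.
have [Q [hQ Q0 [m m0 hw]]] := dev_map k0 N0 NE a0E hM.
pose m1 := m + \sum_i md (y i).
have ym i : md (y i) < m1.
  rewrite /m1 (bigD1 i) //= addrCA ltrDl ltr_wpDr// sumr_ge0// => j _; exact: md_ge0.
have [M [ps [mM M1 ps1 ps2 lip]]] := psi_exists m1 hQ Q0.
have M0 : 0 < M by lra.
(* As [|psi z| <= (3/2) |z|] and [r0 = 4 M la], the condition [r0 <= |psi z|] implies
   [|z| > 2 M la], where [psi] is the exact solution. *)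
pose la := r0 / (4 * M); have la0 : 0 < la by rewrite divr_gt0// mulr_gt0.
have la4 : 4 * M * la = r0 by rewrite /la mulrC divfK// gt_eqF// mulr_gt0.
pose l : C := la%:C%C; have ml : md l = la by rewrite md_real gtr0_norm.
have l0 : l != 0 by rewrite -md_gt0 ml.
pose psi z := l * ps (z / l).
have p00 : psi 0 = 0 by rewrite /psi mul0r ps1 ?md0 ?mulr0//; lra.
have plip z w : md (psi z - psi w - (z - w)) <= 1 / 2 * md (z - w).
  rewrite /psi (_ : _ - _ - _ = l * (ps (z / l) - ps (w / l) - (z / l - w / l))); last by field.
  rewrite mdM ml; have := lip (z / l) (w / l); rewrite -mulrBl mdM mdV ml => h.
  have : la * (md (z - w) / la) = md (z - w) by rewrite mulrCA divff ?mulr1// gt_eqF.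
  by have := ler_wpM2l (ltW la0) h; rewrite mulrCA => *; lra.
have [phi [c1 c2 c3 c4]] := half_lip_bij p00 plip.
have psy i : psi (l * y i) = l * y i.
  by rewrite /psi [l * y i / l]mulrAC divff// mul1r ps1// ltW// (lt_le_trans (ym i)).
exists (fun i => l * y i), psi, phi; split => //.
- by move=> i j /(mulfI l0)/iy.
- move=> i; rewrite psy mdM ml -la4; have := ym i; have := mM; have := md_ge0 (y i).
  move: (md (y i)) => x *; nra.
move=> z zr.
have zM : 2 * M < md (z / l).
  rewrite mdM mdV ml ltr_pdivlMr//.
  have := plip z 0; rewrite p00 !subr0 => h; have := md_sub (psi z) z.
  move: zr h; rewrite -la4; move: M0 la0 (md (psi z)) (md _) => M0 la0 x v; nra.
have zm : m <= md (z / l).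
  have : m <= m1 by rewrite /m1 lerDl sumr_ge0// => j _; exact: md_ge0.
  lra.
have [hwz [w0 wE]] := hw _ zm.
pose w (z : C) := z * Q z^-1.
have cl c : cder (fun z : C => z / l) c (l^-1).
  by have := cderM (cder_id c) (cder_cst l^-1 c); rewrite mul1r mulr0 addr0.
have hl c : hol (fun z : C => z / l) c by exists 1 => // v _; exists l^-1; exact: cl.
have nE : nearC z (fun v => l * w (v / l) = psi v).
  have [d d0 hd] : nearC (z / l) (fun v => 2 * M < md v).
    exists (md (z / l) - 2 * M); first by rewrite subr_gt0.
    by move=> v hv; have := md_sub (z / l) v; rewrite mdB; lra.
  have : nearC z (fun v => 2 * M < md (v / l)).
    by apply: (nearC_comp (f := fun z => z / l) (P := fun v => 2 * M < md v)); [exists l^-1; exact: cl|exists d].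
  by apply: nearCW => v hv; rewrite /psi ps2// ltW.
have hw' : hol (fun v => l * w (v / l)) z.
  by apply: holM; [exact: hol_cst|exact: (hol_comp (hl z) hwz)].
have dpsi : dC psi z = dC w (z / l).
  rewrite -(dC_eq nE (hol_cder hw')); apply: cder_dC.
  have := cderZ l (cder_comp (cl z) (dCP (hol_cder hwz))).
  by move=> h; apply: cder_eqd h _; rewrite mulrC divfK.
have psz : psi z = l * w (z / l) by rewrite (nearC_self nE).
have zy i : z / l - y i != 0.
  rewrite subr_eq0; apply: contraTneq zM => ->; rewrite -leNgt.
  by have := ym i; lra.
have wE' : w (z / l) ^ a0 * dC w (z / l) ^+ k = \prod_i (z / l - y i) ^ al i by exact: wE.
have d0 : dC w (z / l) != 0.
  have : \prod_i (z / l - y i) ^ al i != 0 by apply/prodf_neq0 => i _; exact: expfz_neq0.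
  by rewrite -wE'; apply: contraNneq => ->; rewrite expr0n gtn_eqF// mulr0.
split; [exact: hol_eq nE hw'|by rewrite dpsi|].
rewrite psz dpsi; apply: etrans (exprzMl_mul l (w (z / l)) a0 _) _; rewrite wE' {1}a0E.
have -> : l ^ (\sum_i al i) = \prod_i l ^ al i.
  by elim/big_rec2: _ => [|i p q _ ih]; [rewrite expr0z|rewrite expfzDr// ih].
rewrite -big_split; apply: eq_bigr => i _ /=.
by apply: exprzMl_eq; rewrite mulrBr mulrCA divff// mulr1.
Qed.

End Psi.

(** * Surgery *)


Section Inverse.
Context {R : realType}.
Local Notation C := (Cplx R).

Lemma inv_cder (psi phi : C -> C) (v c : C) : cancel phi psi -> cat setT phi v ->
  cder psi (phi v) c -> c != 0 -> cder phi v c^-1.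
Proof.
move=> K cphi hc c0 e e0; have mc : 0 < md c by rewrite md_gt0.
pose e' := Num.min (md c / 2) (e * md c ^+ 2 / 2).
have e'0 : 0 < e' by rewrite lt_min !divr_gt0// mulr_gt0// exprn_gt0.
have [d d0 hd] := hc e' e'0; have [d' d'0 hd'] := cphi d d0.
exists d' => // w wv; have := hd _ (hd' w I wv); rewrite !K => h.
have m0 := md_ge0 (phi w - phi v).
have h1 : e' <= md c / 2 by rewrite ge_min lexx.
have h2 : e' <= e * md c ^+ 2 / 2 by rewrite ge_min lexx orbT.
have h3 : md (phi w - phi v) * md c <= 2 * md (w - v).
  have := md_sub (c * (phi w - phi v)) (w - v); rewrite mdM [md (_ - (w - v))]mdB => A.
  have : e' * md (phi w - phi v) <= md c / 2 * md (phi w - phi v) by exact: ler_wpM2r.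
  lra.
rewrite (_ : phi w - phi v - c^-1 * (w - v) = - (c^-1 * (w - v - c * (phi w - phi v)))); last by field.
rewrite mdN mdM mdV mulrC ler_pdivrMr//; apply: le_trans h _.
have : e' * md (phi w - phi v) <= e * md c ^+ 2 / 2 * md (phi w - phi v) by exact: ler_wpM2r.
have : e * md c * (md (phi w - phi v) * md c) <= e * md c * (2 * md (w - v)).
  by apply: ler_wpM2l => //; rewrite mulr_ge0// ltW.
rewrite expr2; move: (md _) (md c) (md (w - v)) => x y z; lra.
Qed.

End Inverse.

Lemma mul_pow_id (F : fieldType) (a b x y : F) k : a = b * y ^+ k -> y * x = 1 -> b = a * x ^+ k.
Proof. by move=> -> h; rewrite -mulrA -exprMn h expr1n mulr1. Qed.

Lemma pow_chain3 (F : fieldType) (a b t u tu x : F) k : a = x * u ^+ k -> b * t ^+ k = x -> tu = t * u ->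
  a = b * tu ^+ k.
Proof. by move=> -> <- ->; rewrite exprMn mulrA. Qed.

Lemma pow_chain4 (F : fieldType) (a b d t s x : F) k : b = x * d ^+ k -> b = a * t ^+ k -> d * s = 1 ->
  a * (t * s) ^+ k = x.
Proof. by move=> h1 h2 h3; rewrite exprMn mulrA -h2 h1 -mulrA -exprMn h3 expr1n mulr1. Qed.

Section Surgery.
Context {R : realType} {k : nat} {X : riemannSurface R} (xi : kDifferential k X).
Local Notation C := (Cplx R).
Variables (c0 : C) (i0 : rs_index X) (T S : C -> C) (r rho : R) (a0 : int).
Hypothesis bh : biholo T S c0 r rho.
Hypothesis hin : forall w, md (w - c0) < r -> rs_dom i0 (rs_inv i0 w) /\ rs_chart i0 (rs_inv i0 w) = w.
Hypothesis hc : forall w, md (w - c0) < r -> w != c0 -> kd_coef xi i0 w = T w ^ a0 * dC T w ^+ k.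

(** [vq] is the coordinate in which [xi = v^a0 dv^k], and [kap] is its inverse over the disc of
    radius [rho]. *)
Definition kap (v : C) : X := rs_inv i0 (S v).
Definition vq (q : X) : C := T (rs_chart i0 q).
Definition cdom (s : R) : set X := [set q | [/\ rs_dom i0 q, md (rs_chart i0 q - c0) < r & md (vq q) < s]].

Lemma kapP v : md v < rho -> [/\ rs_dom i0 (kap v), md (rs_chart i0 (kap v) - c0) < r,
  rs_chart i0 (kap v) = S v & vq (kap v) = v].
Proof.
have [_ _ _ _ hS] := bh.
by move=> /hS[h1 h2 _]; have [i1 i2] := hin h1; rewrite /vq /kap i2; split.
Qed.

Lemma kap_dom v s : s <= rho -> md v < s -> cdom s (kap v).
Proof. by move=> sr vs; have [k1 k2 k3 k4] := kapP (lt_le_trans vs sr); split => //; rewrite k4. Qed.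

Lemma kapV q : cdom rho q -> kap (vq q) = q.
Proof.
have [_ _ _ [_ injT] hS] := bh.
move=> [iq qr /hS[h1 h2 _]]; rewrite /kap (_ : S _ = rs_chart i0 q) ?rs_chartK//.
exact: injT.
Qed.

Lemma S_hol v : md v < rho -> hol S v.
Proof.
have [_ _ _ _ hS] := bh => vr; exists (rho - md v); first by rewrite subr_gt0.
move=> w wv; have wr := md_lt_ball wv.
by have [_ _ [d _ hd]] := hS w wr; exists d.
Qed.

Lemma kap_cont v U : md v < rho -> nbhs (kap v) U -> nearC v (fun w => U (kap w)).
Proof.
move=> vr nU; have [h1 h2 h3 h4] := kapP vr.
have hn := iffLR (chart_nbhs _ h1) nU; rewrite h3 in hn.
exact: nearC_comp (hol_cder (S_hol vr)) hn.
Qed.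

Lemma vq_near q P : cdom rho q -> nearC (vq q) P -> nbhs q [set q' | cdom rho q' /\ P (vq q')].
Proof.
move=> [iq qr qv] hP; have [hT _] := biholo_hol bh qr.
have n1 : nearC (rs_chart i0 q) (fun w => md (w - c0) < r).
  by exists (r - md (rs_chart i0 q - c0)); [rewrite subr_gt0|move=> w; have := md_tri w (rs_chart i0 q) c0; lra].
have n2 : nearC (vq q) (fun w => md w < rho).
  exact: near_md_lt.
have n3 := nearC_comp (hol_cder hT) (nearCI n2 hP).
apply: filterS (chart_near iq (nearCI n1 n3)) => q' [iq' [h1 [h2 h3]]].
by split.
Qed.

Lemma cdom_open s : s <= rho -> open (cdom s).
Proof.
move=> sr; rewrite openE => q [q1 q2 q3].
have n2 : nearC (vq q) (fun w => md w < s).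
  exact: near_md_lt.
have qd : cdom rho q by split => //; exact: lt_le_trans sr.
by apply: filterS (vq_near qd n2) => q' [[h1 h2 h3] h4]; split.
Qed.

Definition cdisc (s : R) : set X := [set q | cdom rho q /\ md (vq q) <= s].

Lemma cdisc_closed_disc s : 0 < s -> s < rho -> closed_disc (cdisc s) /\ closed (cdisc s).
Proof.
move=> s0 sr.
have ms (z : C) : md (s%:C%C * z) = s * md z by rewrite mdM md_real gtr0_norm.
have szr (z : C) : md z <= 1 -> md (s%:C%C * z) < rho.
  by move=> z1; rewrite ms; apply: le_lt_trans sr; rewrite ger_pMr.
have s0C : (s%:C%C : C) != 0 by rewrite -md_gt0 md_real gtr0_norm.
have hcont : {within [set z : C | `|z| <= 1], continuous (fun z : C => kap (s%:C%C * z))}.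
  apply/wcP; rewrite -E2E => z z1 U nU.
  have n1 := kap_cont (szr z z1) nU.
  have hs : exists c, cder (fun z : C => s%:C%C * z) z c by eexists; exact: cderZ (cder_id z).
  apply/nbhsC; apply: nearCW (nearC_comp hs n1) => w hw _; exact: hw.
have hinj : set_inj [set z : C | `|z| <= 1] (fun z : C => kap (s%:C%C * z)).
  rewrite -E2E => z w; rewrite !inE => z1 w1 E.
  have [_ _ _ e1] := kapP (szr z z1); have [_ _ _ e2] := kapP (szr w w1).
  by apply: (mulfI s0C); rewrite -e1 -e2 E.
have hD : cdisc s = (fun z : C => kap (s%:C%C * z)) @` [set z : C | `|z| <= 1].
  rewrite -E2E; apply/seteqP; split=> q.
    move=> [qd qs]; exists (vq q / s%:C%C).
      by rewrite /E2 /= mdM mdV md_real gtr0_norm// ler_pdivrMr// mul1r.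
    by rewrite mulrC divfK// kapV.
  move=> [z z1 <-]; split; first by apply: kap_dom => //; exact: szr.
  by have [_ _ _ ->] := kapP (szr z z1); rewrite ms ler_piMr// ltW.
split; first by exists (fun z : C => kap (s%:C%C * z)).
by rewrite hD; exact: disc_closed.
Qed.

Lemma vq_trans j q : cdom rho q -> rs_dom j q -> hol (vq \o rs_inv j) (rs_chart j q).
Proof.
move=> [iq qr _] jq; have [hT _] := biholo_hol bh qr.
have h : hol (T \o trans j i0) (rs_chart j q).
  by apply: hol_comp; [exact: trans_hol|rewrite trans_at].
by apply: hol_eq h; exact: nearCT.
Qed.

Lemma kap_trans j q : cdom rho q -> rs_dom j q -> hol (rs_chart j \o kap) (vq q).
Proof.
move=> qd jq; have [iq qr qv] := qd.
have E : S (vq q) = rs_chart i0 q by have [_ _ <- _] := kapP qv; rewrite kapV.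
have h : hol (trans i0 j \o S) (vq q) by apply: hol_comp; [exact: S_hol|rewrite E; exact: trans_hol].
by apply: hol_eq h; exact: nearCT.
Qed.

(* xi = v^a0 dv^k in the coordinate v *)
Lemma kap_coef j q : cdom rho q -> rs_dom j q -> dnearC (vq q) (fun v =>
  kd_coef xi j ((rs_chart j \o kap) v) * dC (rs_chart j \o kap) v ^+ k = v ^ a0).
Proof.
move=> qd jq; have [iq qr qv] := qd; have [_ _ _ [_ injT] hS] := bh.
have E : S (vq q) = rs_chart i0 q by have [_ _ <- _] := kapP qv; rewrite kapV.
have nv : nearC (vq q) (fun v => md v < rho).
  exact: near_md_lt.
have Sne : dnearC (vq q) (fun v => S v != S (vq q)).
  apply: nearCW nv => v vr; apply: contraNneq => SE.
  by have [_ <- _] := hS v vr; have [_ <- _] := hS _ qv; rewrite SE.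
have ht := trans_hol iq jq; rewrite -E in ht.
have n1 : dnearC (S (vq q)) (fun w => md (w - c0) < r /\ (w != c0 -> kd_coef xi i0 w = T w ^ a0 * dC T w ^+ k)).
  rewrite E; apply: (dnear_at (z := c0) (r := r)) qr => w wr wz; split => // _; exact: hc.
have n0 : dnearC (vq q) (fun v => S v != c0).
  have [E0|E0] := eqVneq (S (vq q)) c0; first by rewrite -E0.
  apply: dnearC_near'; have := hol_neq0 (holB (S_hol qv) (hol_cst c0 _)).
  by rewrite subr_eq0 => /(_ E0); apply: nearCW => v; rewrite subr_eq0.
have n2 := dnear_comp (P := fun w => md (w - c0) < r /\ (w != c0 -> kd_coef xi i0 w = T w ^ a0 * dC T w ^+ k)) (hol_cder (S_hol qv)) Sne n1.
have kt := kd_trans xi iq jq; rewrite -E in kt.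
have n3 := dnear_comp (P := fun w => kd_coef xi i0 w = kd_coef xi j (trans i0 j w) * dC (trans i0 j) w ^+ k) (hol_cder (S_hol qv)) Sne kt.
have n4 := nearC_comp (hol_cder (S_hol qv)) (hol_near ht).
apply: nearCW (nearCI (nearCI n2 n3) (nearCI nv (nearCI n4 n0))) => v [[h1 h2] [vr [h4 h0]]] vz.
have [wr coefT] := h1 vz; have {}coefT := coefT (h0 vz); have {}h2 := h2 vz.
have [_ TS [d d0 hd]] := hS v vr.
have cS : exists c, cder S v c by exists d.
have [hT _] := biholo_hol bh wr.
rewrite TS in coefT.
have dTS : dC T (S v) * dC S v = 1.
  rewrite -(dC_comp cS (hol_cder hT)).
  have nid : nearC v (fun v => v = (T \o S) v).
    have [e e0 he] : nearC v (fun v => md v < rho).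
      exact: near_md_lt.
    by exists e => // w /he wr'; have [_ TSw _] := hS w wr'; rewrite /= TSw.
  by rewrite -(dC_eq nid (ex_intro _ _ (cder_id v))); exact: (cder_dC (cder_id v)).
have -> : dC (rs_chart j \o kap) v = dC (trans i0 j) (S v) * dC S v.
  by rewrite -(dC_comp cS (hol_cder h4)).
exact: pow_chain4 coefT h2 dTS.
Qed.

Variables (r0 : R) (psi phi c : C -> C).
Hypotheses (r00 : 0 < r0) (r0r : r0 < rho).
Hypotheses (psiK : cancel psi phi) (phiK : cancel phi psi).
Hypotheses (cpsi : forall z, cat setT psi z) (cphi : forall z, cat setT phi z).
Hypothesis hpsi : forall z, r0 <= md (psi z) ->
  [/\ hol psi z, dC psi z != 0 & psi z ^ a0 * dC psi z ^+ k = c z].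
Hypothesis cord : forall z, exists n, order_at c z n.

Lemma psi_near z P : nearC (psi z) P -> nearC z (fun w => P (psi w)).
Proof. by move=> [e e0 he]; have [d d0 hd] := cpsi z e0; exists d => // w wz; apply: he; exact: hd. Qed.

Lemma phi_near z P : nearC (phi z) P -> nearC z (fun w => P (phi w)).
Proof. by move=> [e e0 he]; have [d d0 hd] := cphi z e0; exists d => // w wz; apply: he; exact: hd. Qed.

Lemma near_gt (v : C) (s : R) : s < md v -> nearC v (fun w => s < md w).
Proof.
by move=> vs; exists (md v - s); [rewrite subr_gt0|move=> w; have := md_sub v w; rewrite mdB; lra].
Qed.

Lemma phi_hol v : r0 < md v -> hol phi v.
Proof.
move=> vr; apply: nearCW (near_gt vr) => w wr.
have [hp dp _] : [/\ hol psi (phi w), dC psi (phi w) != 0 & psi (phi w) ^ a0 * dC psi (phi w) ^+ k = c (phi w)].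
  by apply: hpsi; rewrite phiK ltW.
by exists (dC psi (phi w))^-1; apply: inv_cder => //; exact: dCP (hol_cder hp).
Qed.

(** The space [X] is kept and only the atlas changes: the old charts are restricted to the
    complement of [cdisc r0], and [None] is the new chart [phi \o vq] over the disc of radius [rho].
    They are compatible because [phi] is holomorphic beyond radius [r0]. *)
Definition sdom (j : option (rs_index X)) : set X :=
  if j is Some j then rs_dom j `&` ~` cdisc r0 else cdom rho.
Definition schart (j : option (rs_index X)) : X -> C :=
  if j is Some j then rs_chart j else phi \o vq.
Definition sinv (j : option (rs_index X)) : C -> X :=
  if j is Some j then rs_inv j else kap \o psi.

Lemma sdom_open j : open (sdom j).
Proof.
case: j => [j|]; last exact: cdom_open.
by apply: openI; [exact: rs_dom_open|rewrite openC; exact: (cdisc_closed_disc r00 r0r).2].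
Qed.

Lemma sdom_cover q : exists j, sdom j q.
Proof.
have [qd|nqd] := pselect (cdisc r0 q); first by exists None; case: qd.
by have [j jq] := rs_cover q; exists (Some j).
Qed.

Lemma schartK j q : sdom j q -> sinv j (schart j q) = q.
Proof.
by case: j => [j [jq _]|qd]; [exact: rs_chartK|rewrite /= phiK kapV].
Qed.

Lemma sim_open j : open (schart j @` sdom j).
Proof.
rewrite openE; case: j => [j|] w [q qd <-] /=.
  have [jq _] := qd; apply/nbhsC.
  have nq : nbhs q (sdom (Some j)) by apply: open_nbhs_nbhs; split => //; exact: sdom_open.
  apply: nearCW (inv_near jq nq) => w' [h1 h2 h3]; by exists (rs_inv j w').
have [_ _ qv] := qd; apply/nbhsC.
have n1 : nearC (phi (vq q)) (fun z => md (psi z) < rho) by apply: (psi_near (P := fun v => md v < rho)); rewrite phiK; exact: near_md_lt.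
apply: nearCW n1 => z zr; exists (kap (psi z)); first exact: kap_dom.
by have [_ _ _ E] := kapP zr; rewrite /= E psiK.
Qed.

Lemma schart_cont j : {within sdom j, continuous (schart j)}.
Proof.
apply/wcP; case: j => [j|] q qd U nU.
  have [jq _] := qd; have /wcP h := @rs_chart_cont _ X j.
  by apply: filterS (h q jq U nU) => q' hq' [jq' _]; exact: hq'.
have := vq_near qd (phi_near (iffLR (nbhsC _ _) nU)).
by apply: filterS => q' [h1 h2] _; exact: h2.
Qed.

Lemma sinv_cont j : {within schart j @` sdom j, continuous (sinv j)}.
Proof.
case: j => [j|].
  by apply: continuous_subspaceW (@rs_inv_cont _ X j) => w [q [jq _] <-]; exists q.
apply/wcP => z [q qd <-] U; rewrite /= phiK => nU; have [_ _ qv] := qd.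
have n1 : nearC (psi (phi (vq q))) (fun v => U (kap v)) by rewrite phiK; exact: kap_cont.
by apply/nbhsC; apply: nearCW (psi_near n1) => w hw _; exact: hw.
Qed.

Lemma far_vq q : cdom rho q -> ~ cdisc r0 q -> r0 < md (vq q).
Proof. by move=> qd nq; rewrite ltNge; apply/negP => h; apply: nq; split. Qed.

Lemma strans_NS j q : cdom rho q -> rs_dom j q -> ~ cdisc r0 q ->
  hol (rs_chart j \o sinv None) (phi (vq q)).
Proof.
move=> qd jq nq; have vr := far_vq qd nq.
have [hp _ _] : [/\ hol psi (phi (vq q)), dC psi (phi (vq q)) != 0 & psi (phi (vq q)) ^ a0 * dC psi (phi (vq q)) ^+ k = c (phi (vq q))].
  by apply: hpsi; rewrite phiK ltW.
have h : hol ((rs_chart j \o kap) \o psi) (phi (vq q)).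
  by apply: hol_comp => //; rewrite phiK; exact: kap_trans.
by apply: hol_eq h; exact: nearCT.
Qed.

Lemma strans_SN j q : cdom rho q -> rs_dom j q -> ~ cdisc r0 q ->
  hol (schart None \o rs_inv j) (rs_chart j q).
Proof.
move=> qd jq nq; have vr := far_vq qd nq.
have h : hol (phi \o (vq \o rs_inv j)) (rs_chart j q).
  by apply: hol_comp; [exact: vq_trans|rewrite /= rs_chartK//; exact: phi_hol].
by apply: hol_eq h; exact: nearCT.
Qed.

Lemma NN_id q : cdom rho q -> nearC (phi (vq q)) (fun z => (schart None \o sinv None) z = z).
Proof.
move=> [_ _ qv]; have n1 : nearC (phi (vq q)) (fun z => md (psi z) < rho) by apply: (psi_near (P := fun v => md v < rho)); rewrite phiK; exact: near_md_lt.
by apply: nearCW n1 => z zr; have [_ _ _ E] := kapP zr; rewrite /= E psiK.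
Qed.

Lemma strans i j q : sdom i q -> sdom j q -> holomorphic_at (schart j \o sinv i) (schart i q).
Proof.
case: i j => [i|] [j|].
- by move=> [iq _] [jq _]; exact: rs_transition.
- by move=> [iq nq] qd; apply/holP; exact: strans_SN.
- by move=> qd [jq nq]; apply/holP; exact: strans_NS.
- move=> qd _; apply/holP; apply: hol_eq (hol_id _).
  by apply: nearCW (NN_id qd) => z ->.
Qed.

Definition surg : riemannSurface R :=
  @RiemannSurface R X (option (rs_index X)) sdom schart sinv (@rs_hausdorff R X) (@rs_connected R X)
    sdom_cover sdom_open sim_open schartK schart_cont sinv_cont strans.

Definition scoef (j : option (rs_index X)) : C -> C := if j is Some j then kd_coef xi j else c.

Lemma order_mero (f : C -> C) z n : order_at f z n -> meromorphic_at f z.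
Proof.
move=> /order_atP[g [hg g0 E]]; case: n E => n E.
  exists 0%N, (fun w => (w - z) ^+ n * g w); split.
    apply/holP; apply: holM => //; apply: holX; apply: holB; [exact: hol_id|exact: hol_cst].
  by apply/dnearC_near; apply: nearCW E => w h wz; rewrite expr0 mul1r h.
exists n.+1, g; split; first exact/holP.
apply/dnearC_near; apply: nearCW E => w h wz; rewrite h// NegzE mulrA.
by rewrite -[X in X * _ * _]/((w - z) ^ n.+1%:Z) -expfzDr ?subr_eq0// subrr expr0z mul1r.
Qed.

Lemma smero j q : sdom j q -> meromorphic_at (scoef j) (schart j q).
Proof.
case: j => [j [jq _]|qd]; first exact: kd_mero.
by have [n hn] := cord (phi (vq q)); exact: order_mero hn.
Qed.

Lemma skd_NS j q : cdom rho q -> rs_dom j q -> ~ cdisc r0 q -> dnearC (phi (vq q)) (fun w =>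
  c w = kd_coef xi j ((rs_chart j \o sinv None) w) * dC (rs_chart j \o sinv None) w ^+ k).
Proof.
move=> qd jq nq; have vr := far_vq qd nq.
have [hp _ _] : [/\ hol psi (phi (vq q)), dC psi (phi (vq q)) != 0 & psi (phi (vq q)) ^ a0 * dC psi (phi (vq q)) ^+ k = c (phi (vq q))].
  by apply: hpsi; rewrite phiK ltW.
have pne : dnearC (phi (vq q)) (fun w => psi w != psi (phi (vq q))).
  by exists 1 => // w _; apply: contraNneq => /(can_inj psiK) ->; rewrite eqxx.
have kc := kap_coef qd jq; rewrite -{1}(phiK (vq q)) in kc.
have n1 := dnear_comp (P := fun v => kd_coef xi j ((rs_chart j \o kap) v) * dC (rs_chart j \o kap) v ^+ k = v ^ a0) (hol_cder hp) pne kc.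
have hk := kap_trans qd jq; rewrite -{1}(phiK (vq q)) in hk.
have n2 := nearC_comp (hol_cder hp) (hol_near hk).
have n3 : nearC (phi (vq q)) (fun w => r0 < md (psi w)) by apply: (psi_near (P := fun v => r0 < md v)); rewrite phiK; exact: near_gt.
apply: nearCW (nearCI n1 (nearCI n2 n3)) => w [h1 [h2 h3]] wz.
have [hpw _ cw] := hpsi (ltW h3).
have -> : rs_chart j \o sinv None = (rs_chart j \o kap) \o psi by [].
exact: (pow_chain3 (esym cw) (h1 wz) (dC_comp (hol_cder hpw) (hol_cder h2))).
Qed.

(** The derivatives of a transition map and of its inverse multiply to 1, so that only one of the
    two laws of transformation has to be computed. *)
Lemma skd_inv (a b : C -> C) (tau sig : C -> C) (z x : C) : hol tau z -> hol sig x -> tau z = x -> sig x = z ->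
  nearC x (fun v => tau (sig v) = v) ->
  dnearC z (fun w => a w = b (tau w) * dC tau w ^+ k) -> dnearC x (fun v => b v = a (sig v) * dC sig v ^+ k).
Proof.
move=> ht hs tz sx ts hab.
have sne : dnearC x (fun v => sig v != sig x).
  apply: nearCW ts => v hv; apply: contraNneq => E; rewrite -hv E sx tz; exact: eqxx.
rewrite -sx in hab; have n1 := dnear_comp (P := fun w => a w = b (tau w) * dC tau w ^+ k) (hol_cder hs) sne hab.
rewrite -sx in ht.
have n2 := nearC_comp (hol_cder hs) (hol_near ht).
apply: nearCW (nearCI (nearCI n1 n2) (nearCI (nearC_nearC ts) (hol_near hs))) => v [[h1 h2] [h3 h4]] vx.
have e1 := h1 vx; rewrite (nearC_self h3) in e1.
apply: mul_pow_id e1 _; rewrite -(dC_comp (hol_cder h4) (hol_cder h2)).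
have h5 : nearC v (fun v => v = (tau \o sig) v) by apply: nearCW h3 => u hu; exact: esym hu.
rewrite -(dC_eq h5 (ex_intro _ _ (cder_id v))); exact: (cder_dC (cder_id v)).
Qed.

Lemma skd i j q : sdom i q -> sdom j q -> \forall w \near (schart i q)^',
  scoef i w = scoef j ((schart j \o sinv i) w) * (derive1 (schart j \o sinv i) w) ^+ k.
Proof.
case: i j => [i|] [j|].
- by move=> [iq _] [jq _]; exact: kd_transition.
- move=> [iq nq] qd; apply/dnearC_near.
  apply: (skd_inv (strans_NS qd iq nq) (strans_SN qd iq nq) _ _ _ (skd_NS qd iq nq)).
  + by rewrite /= phiK kapV.
  + by rewrite /= rs_chartK.
  + have nq' : nbhs q (cdom rho) by apply: open_nbhs_nbhs; split => //; exact: cdom_open.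
    apply: nearCW (inv_near iq nq') => w [h1 h2 h3]; by rewrite /= phiK kapV.
- by move=> qd [jq nq]; apply/dnearC_near; exact: skd_NS.
- move=> qd _; apply/dnearC_near; apply: nearCW (nearC_nearC (NN_id qd)) => w h _.
  have e1 : dC (schart None \o sinv None) w = 1.
    have h5 : nearC w (fun v => v = (schart None \o sinv None) v) by apply: nearCW h => u hu; exact: esym hu.
    rewrite -(dC_eq h5 (ex_intro _ _ (cder_id w))); exact: (cder_dC (cder_id w)).
  rewrite (nearC_self h) -[derive1 _ w]/(dC (schart None \o sinv None) w) e1 expr1n mulr1; exact: erefl.
Qed.

Lemma snonzero : exists i q, sdom i q /\ ~ (\forall w \near (schart i q)^', scoef i w = 0).
Proof.
exists None, (kap 0).
have h0 : md (0 : C) < rho by rewrite md0 (lt_trans r00).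
split; first exact: kap_dom.
move=> /dnearC_near hz; have [n /order_atP[g [hg g0 E]]] := cord (phi (vq (kap 0))).
have [e e0 he] := nearCI (nearCI hz E) (hol_neq0 hg g0).
set z := phi (vq (kap 0)) in he.
have md2 : md ((e / 2)%:C%C : C) = e / 2 by rewrite md_real gtr0_norm// divr_gt0.
have [|[h1 h2] h3] := he (z + (e / 2)%:C%C); first by rewrite addrAC subrr add0r md2; move: e0; lra.
have wz : z + (e / 2)%:C%C != z.
  by rewrite -subr_eq0 addrAC subrr add0r -md_gt0 md2 divr_gt0.
have := h2 wz; rewrite [LHS](h1 wz) => /esym/eqP; rewrite mulf_eq0 (negPf h3) orbF.
by apply/negP; apply: expfz_neq0; rewrite subr_eq0.
Qed.

Definition surgXi : kDifferential k surg := @KDifferential R k surg scoef smero skd snonzero.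

(** The isomorphism is the identity, since all old charts remain available outside [cdisc r0]. *)
Lemma surg_iso rD : r0 <= rD -> rD < rho ->
  isomorphic_outside (cdisc rD) (cdisc rD : set surg) xi surgXi.
Proof.
move=> rr rD'.
have out p : (~` cdisc rD) p -> ~ cdisc r0 p by move=> np [pd pr]; apply: np; split => //; exact: le_trans rr.
exists (id : X -> surg), (id : surg -> X); split.
- split => //.
  + apply/wcP => p _ U nU; have nU' : nbhs (p : X) (U : set X) := nU.
    by apply: (filterS _ nU') => q Uq _.
  + apply/wcP => p _ U nU; have nU' : nbhs (p : X) (U : set X) := nU.
    by apply: (filterS _ nU') => q Uq _.
- by rewrite image_id.
- move=> p i j np ip jp; exact: (@rs_transition R surg (Some i) j p (conj ip (out p np)) jp).
- move=> p j i np jp ip; exact: (@rs_transition R surg j (Some i) p jp (conj ip (out p np))).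
- move=> p i j np ip jp; exact: (@kd_transition R k surg surgXi (Some i) j p (conj ip (out p np)) jp).
Qed.

End Surgery.

Section ProdOrder.
Context {R : realType}.
Local Notation C := (Cplx R).
Variables (t : nat) (al : 'I_t -> int) (y : 'I_t -> C).
Hypothesis iy : injective y.

Lemma hol_sub (a z : C) : hol (fun w => w - a) z.
Proof. by apply: holB; [exact: hol_id|exact: hol_cst]. Qed.

Lemma prod_order0 z : (forall i, y i != z) -> order_at (fun z => \prod_i (z - y i) ^ al i) z 0.
Proof.
move=> h; have hz i : z - y i != 0 by rewrite subr_eq0 eq_sym.
apply/order_atP; exists (fun z => \prod_i (z - y i) ^ al i); split.
- by apply: hol_prod => i; apply: holXz => //; exact: hol_sub.
- by apply/prodf_neq0 => i _; exact: expfz_neq0.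
- by apply: nearCT => w _; rewrite expr0z mul1r.
Qed.

Lemma prod_order i : order_at (fun z => \prod_i (z - y i) ^ al i) (y i) (al i).
Proof.
apply/order_atP; exists (fun z => \prod_(j | j != i) (z - y j) ^ al j); split.
- have -> : (fun z => \prod_(j | j != i) (z - y j) ^ al j) = (fun z => \prod_j (if j != i then (z - y j) ^ al j else 1)).
    by apply/funext => z; rewrite big_mkcond.
  apply: hol_prod => j; case: eqVneq => [_|ji] /=; first exact: hol_cst.
  by apply: holXz; [exact: hol_sub|rewrite subr_eq0 (inj_eq iy) eq_sym].
- by apply/prodf_neq0 => j ji; apply: expfz_neq0; rewrite subr_eq0 (inj_eq iy) eq_sym.
- by apply: nearCT => w _; rewrite (bigD1 i).
Qed.

Lemma prod_order_ex z : exists n, order_at (fun z => \prod_i (z - y i) ^ al i) z n.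
Proof.
have [[i <-]|h] := pselect (exists i, y i = z); first by exists (al i); exact: prod_order.
by exists 0; apply: prod_order0 => i; apply/eqP => E; apply: h; exists i.
Qed.

End ProdOrder.

Theorem splitting (R : realType) (k : nat) (X : riemannSurface R) (xi : kDifferential k X)
    (z0 : X) (a0 : int) (t : nat) (alpha : t.-tuple int) : (0 < k)%N ->
  has_order xi z0 a0 -> a0 != 0 -> - k%:Z < a0 ->
  (forall i, tnth alpha i != 0 /\ - k%:Z < tnth alpha i) -> a0 = \sum_i tnth alpha i ->
  ((k%:Z %| a0)%Z -> t = 2%N -> forall i, (k%:Z %| tnth alpha i)%Z) ->
  splits_locally xi z0 alpha.
Proof.
move=> k0 ho a00 ka halpha hsum hobs V nV.
have [N N0 NE] := int_shift ka.
have [y [iy hy]] : exists y : 'I_t -> Cplx R, injective y /\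
    forall M : nat, (k * M)%:Z = a0 + k%:Z -> (\prod_i binp M ((tnth alpha i)%:~R / k%:R) (y i))`_M = 0.
  have [kd|nkd] := boolP (k%:Z %| a0)%Z; last first.
    (* No [M] satisfies [k M = a0 + k], so any distinct nodes will do. *)
    exists (fun i => i%:R); split; first by move=> i j /eqP; rewrite eqr_nat => /eqP/val_inj.
    move=> M ME; case/negP: nkd; rewrite (_ : a0 = (k * M)%:Z - k%:Z); last by rewrite ME addrK.
    by rewrite rpredB// PoszM dvdz_mulr.
  have [e eE] := int_quotient k0 kd ka.
  have MM : (k * e.+1)%:Z = a0 + k%:Z by rewrite eE mulnS PoszD addrC.
  have [y [iy hy]] := @choose_nodes (Cplx R) k t (fun i => tnth alpha i) a0 k0 (fun i => (halpha i).1)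
    (fun i => (halpha i).2) hsum a00 ka kd (hobs kd) _ MM.
  exists y; split => // M ME; suff -> : M = e.+1 by [].
  by apply/eqP; rewrite -(eqn_pmul2l k0) -eqz_nat MM ME.
have [i [T [S [r [rho [iz bh hin hc]]]]]] := normal_chart k0 ho ka nV.
have [r_0 rho0 Tc0 [dT injT] hS] := bh.
(* The new singularities lie within radius [r0], [D] has radius [rD], and the coordinate reaches
   [rho]: on both sides of the boundary of [D] there is a collar that the surgery leaves alone. *)
pose r0 := rho / 4; pose rD := rho / 2.
have [r00 r0r rr rDr rD0] : [/\ 0 < r0, r0 < rho, r0 <= rD, rD < rho & 0 < rD] by rewrite /r0 /rD; move: rho0; clear; move=> ?; split; lra.
have [yl [psi [phi [iyl [psiK phiK cpsi cphi] p0 hyl hpsi]]]] := model_map k0 N0 NE hsum iy r00 hy.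
pose c z := \prod_i (z - yl i) ^ tnth alpha i.
have hin' w : md (w - rs_chart i z0) < r -> rs_dom i (rs_inv i w) /\ rs_chart i (rs_inv i w) = w by move=> /hin[].
have cord := prod_order_ex (tnth alpha) iyl.
pose X' := surg bh hin' r00 r0r psiK phiK cpsi cphi hpsi.
pose xi' := surgXi bh hin' hc r00 r0r psiK phiK cpsi cphi hpsi cord : kDifferential k X'.
have kP v : md v < rho -> _ := @kapP R X _ _ _ _ _ _ bh hin' v.
exists (cdisc (rs_chart i z0) i T r rho rD).
have [cD _] := cdisc_closed_disc bh hin' rD0 rDr.
split => //.
- by move=> q [[iq qr _] _]; have [_ _] := hin _ qr; rewrite rs_chartK.
- by split; [split => //; rewrite ?subrr ?md0 /vq ?Tc0 ?md0|rewrite /vq Tc0 md0 ltW].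
- move=> q [[iq qr _] _] [n [n0 hn]]; apply/eqP/contraT => qz; case/eqP: n0.
  have h0 : has_order xi q 0.
    apply: (coord_order bh hc iq qr); rewrite -Tc0; apply: contraNneq qz => E.
    by apply/eqP; rewrite -(rs_chartK iq) (injT _ _ qr _ E) ?rs_chartK// subrr md0.
  exact: has_order_uniq hn h0.
exists X', xi', (cdisc (rs_chart i z0) i T r rho rD : set X'); split => //.
  exact: surg_iso.
have ylr j : md (psi (yl j)) < rho := lt_trans (hyl j) r0r.
have vk j : vq i T (kap i S (psi (yl j))) = psi (yl j) by have [] := kP _ (ylr j).
have dk j : cdom (rs_chart i z0) i T r rho (kap i S (psi (yl j))) := kap_dom bh hin' (lexx rho) (ylr j).
exists (fun j => kap i S (psi (yl j)) : X'); split.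
- move=> j l E; apply: iyl; apply: (can_inj psiK); rewrite -vk -(vk l); congr (vq _ _ _); exact: E.
- move=> j; split.
    by split => //; rewrite vk; apply: le_trans (ltW (hyl j)) rr.
  apply: (@has_order_of R k X' xi' None); first exact: dk.
  have -> : rs_chart (None : rs_index X') (kap i S (psi (yl j)) : X') = yl j by rewrite /= vk psiK.
  exact: prod_order.
- move=> q [qd _] [n [n0 hn]]; have hq := hn None qd.
  have [[j E]|h] := pselect (exists j, yl j = phi (vq i T q)).
    by exists j; rewrite E phiK; exact: esym (kapV bh qd).
  have h0 : order_at c (phi (vq i T q)) 0.
    by apply: prod_order0 => j; apply/eqP => E; apply: h; exists j.
  by case/eqP: n0; exact: order_at_uniq hq h0.
Qed.

Local Close Scope classical_set_scope.

Theorem proposition1p16 (R : realType) (k : nat) (hk : (1 <= k)%N)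
    (X : riemannSurface R) (xi : kDifferential k X)
    (z0 : X) (hz0 : singularity xi z0)
    (a0 : int) (ha0 : has_order xi z0 a0) (ha0k : - k%:Z < a0)
    (t : nat) (alpha : t.-tuple int)
    (halpha : forall i : 'I_t, tnth alpha i != 0 /\ - k%:Z < tnth alpha i)
    (hsum : a0 = \sum_(i < t) tnth alpha i) :
  ~ splits_locally xi z0 alpha <->
  [/\ (2 <= k)%N, t = 2%N, (k%:Z %| a0)%Z
    & ~~ (k%:Z %| gcdz (nth 0 alpha 0%N) (nth 0 alpha 1%N))%Z].
Proof.
have a00 : a0 != 0.
  by have [n [n0 hn]] := hz0; rewrite (has_order_uniq ha0 hn).
split=> [ns|[k2 t2 kd kg]]; last first.
  subst t; apply: (obstruction hk ha0 ha0k (fun i => (halpha i).2) _ kd).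
    by rewrite hsum big_ord_recl big_ord1.
  (* [obstruction] asks that [k] does not divide the first order; if it did, it would divide the
     second one too, as it divides [a0]. *)
  move: kg; rewrite dvdz_gcd !(tnth_nth 0); apply: contra => k1; rewrite k1 /=.
  rewrite (_ : nth 0 alpha 1 = a0 - nth 0 alpha 0); first by rewrite rpredB.
  by rewrite hsum big_ord_recl big_ord1 !(tnth_nth 0) /= addrAC subrr add0r.
have [h|h] := pselect ((k%:Z %| a0)%Z -> t = 2%N -> forall i, (k%:Z %| tnth alpha i)%Z).
  by exfalso; exact: ns (splitting hk ha0 a00 ha0k halpha hsum h).
have [kd [t2 [i ki]]] : (k%:Z %| a0)%Z /\ t = 2%N /\ exists i, ~~ (k%:Z %| tnth alpha i)%Z.
  have [kd|nkd] := boolP (k%:Z %| a0)%Z; last by exfalso; apply: h => kd; case/negP: nkd.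
  have [t2|nt2] := eqVneq t 2%N; last by exfalso; apply: h => _ /eqP; rewrite (negPf nt2).
  split => //; split => //; apply: contrapT => ne; apply: h => _ _ i.
  by apply: contrapT => /negP ki; apply: ne; exists i.
split => //.
  (* For [k = 1] every order would be divisible, against [ki]. *)
  by case: k hk ki {ns h kd xi hz0 ha0 ha0k halpha} => [|[|k]] // _; rewrite dvd1z.
subst t; rewrite dvdz_gcd; apply: contra ki => /andP[k1 k2].
by rewrite (tnth_nth 0); case: i => -[|[|j]].
Qed.
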